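(* Let $\ell\in\{2,3,5,7,11,13,23\}$, let $a,b,c,d,g,K\in\mathbb{Q}[x]$ be the polynomials listed for $\ell$ below, and let $F_\ell$ and $F_1$ be the power series defined in the context. Put $$y^+=\frac{2x^\ell}{c+d\sqrt g},\qquad y^-=\frac{2x^\ell}{c-d\sqrt g}.$$ Then in a neighborhood of $x=0$ $$y^+=x^\ell+O(x^{\ell+1}),\qquad y^-=x+O(x^2),$$ and $$F_\ell(x)=\frac{\ell}{(a+b\sqrt g)^{1/2}}\,F_1(y^+)=\frac{1}{(a-b\sqrt g)^{1/2}}\,F_1(y^-).$$ Moreover, $$\frac{c^2-d^2g}{4x^{\ell-1}}=\left(\frac{a^2-b^2g}{\ell^2}\right)^3=K^3 .$$ The polynomials are: $\ell=2$: $a=5/2$, $b=3/2$, $c=1-207x+3456x^2$, $d=1-81x$, $g=1-256x$, $K=1+144x$. $\ell=3$: $a=5$, $b=4$, $c=1-126x+2944x^2$, $d=(1-8x)(1-64x)$, $g=1-108x$, $K=1+192x$. $\ell=5$: $a=13-36x$, $b=12$, $c=1-80x+1890x^2-12600x^3+7776x^4+3456x^5$, $d=(1-4x)(1-18x)(1-36x)$, $g=1-44x-16x^2$, $K=1+216x+144x^2$. $\ell=7$: $a=25-80x$, $b=24$, $c=(1-21x+8x^2)(1-42x+454x^2-1008x^3-1280x^4)$, $d=(1-2x)(1-8x)(1-24x)(1-16x-8x^2)$, $g=(1+x)(1-27x)$, $K=1+224x+448x^2$. $\ell=11$: $a=61-368x+352x^2$, $b=60$, $c=1-66x+1793x^2-26048x^3+221056x^4-1132670x^5+3535840x^6-6683072x^7+7418752x^8-4460544x^9+1183744x^{10}-65536x^{11}$,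 $d=(1-x)(1-2x)(1-4x)(1-7x)(1-16x)(1-12x+16x^2)(1-14x+4x^2)$, $g=1-20x+56x^2-44x^3$, $K=1+224x-192x^2-832x^3+1024x^4$. $\ell=13$: $a=85-135x-280x^2$, $b=84+48x$, $c=1-39x+546x^2-2938x^3+117x^4+42861x^5-36998x^6-255294x^7+15366x^8+519610x^9+342576x^{10}-14976x^{11}-35840x^{12}$, $d=(1+2x)(1+x)(1-x)(1-3x)(1-8x)(1-11x-8x^2)(1-4x-8x^2)(1-10x-2x^2)$, $g=1-10x-27x^2$, $K=1+234x+1417x^2+1872x^3+832x^4$. $\ell=23$: $a=265-940x+310x^2-60x^3-135x^4$, $b=264-120x$, $c=1-46x+920x^2-10465x^3+74221x^4-336927x^5+953856x^6-1470068x^7+336674x^8+3209696x^9-6447728x^{10}+5423124x^{11}+302266x^{12}-6612454x^{13}+8362616x^{14}-4877702x^{15}-116403x^{16}+2732814x^{17}-2492280x^{18}+1115109x^{19}-170775x^{20}-83835x^{21}+48600x^{22}-6750x^{23}$, $d=(1+x)(1-x)(1-2x)(1-3x)(1-5x)(1-8x+3x^2)(1-6x-9x^2)(1-7x+3x^2-5x^3)(1-7x+7x^2-3x^3)(1-4x-x^4)$, $g=(1-x^2+x^3)(1-8x+3x^2-7x^3)$, $K=1+232x+732x^2-968x^3+1894x^4-2280x^5+2268x^6-1080x^7+225x^8$.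
   Context: Here $q=e^{2\pi i\tau}$ with $\operatorname{Im}\tau>0$, $\eta_m=q^{m/24}\prod_{j\ge1}(1-q^{mj})$, and $Q(q)=1+240\sum_{j\ge1}\frac{j^3q^j}{1-q^j}$. Sums over $j,k$ below run over all integers. All roots are taken with the branch equal to $1$ (respectively, with the positive value) at $x=0$, and fractional powers of $q$-series are taken with leading coefficient $1$. For $\ell\in\{1,2,3,5,7,11,13,23\}$ define $q$-series $X_\ell=q+O(q^2)$ and $Z_\ell=1+O(q)$ by: $X_1=\eta_1^{24}/Q(q)^3$, $Z_1=Q(q)^{1/2}$; $X_2=w/(1+64w)^2$ with $w=\eta_2^{24}/\eta_1^{24}$, $Z_2=\eta_1^2\eta_2^2/X_2^{1/4}$; $X_3=w/(1+27w)^2$ with $w=\eta_3^{12}/\eta_1^{12}$, $Z_3=\eta_1^2\eta_3^2/X_3^{1/3}$; $X_5=w/(1+22w+125w^2)$ with $w=\eta_5^6/\eta_1^6$, $Z_5=\eta_1^2\eta_5^2/X_5^{1/2}$; $X_7=w/(1+13w+49w^2)$ with $w=\eta_7^4/\eta_1^4$, $Z_7=\eta_1^2\eta_7^2/X_7^{2/3}$; $X_{11}=(\eta_1\eta_{11}/\sigma)^2$ with $\sigma=\sum_{j,k}q^{j^2+jk+3k^2}$, $Z_{11}=\eta_1^2\eta_{11}^2/X_{11}$; $X_{13}=w/(1+5w+13w^2)$ with $w=\eta_{13}^2/\eta_1^2$, $Z_{13}=\eta_1^2\eta_{13}^2/X_{13}^{7/6}$; $X_{23}=2\eta_1\eta_{23}/(\sigma_A+\sigma_B)$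 with $\sigma_A=\sum_{j,k}q^{j^2+jk+6k^2}$, $\sigma_B=\sum_{j,k}q^{2j^2+jk+3k^2}$, $Z_{23}=\eta_1^2\eta_{23}^2/X_{23}^2$. The coefficients $T_\ell(n)$ are defined by the expansion $Z_\ell=\sum_{n\ge0}T_\ell(n)X_\ell^n$ near $q=0$, and $F_\ell(x)=\sum_{n\ge0}T_\ell(n)x^n$. In particular $F_1(x)=\sum_{n\ge0}\binom{6n}{3n}\binom{3n}{n}\binom{2n}{n}x^n$. Equivalently, $T_\ell(0)=1$ and, for $n\ge 0$, $(n+1)^3T_\ell(n+1)=\sum_{j\ge1}(n+1-\tfrac j2)\{h_j-(n+1)(n+1-j)g_j\}T_\ell(n+1-j)$ (with $T_\ell(m)=0$ for $m<0$), where $g_j,h_j$ are the coefficients of $x^j$ in $G_\ell,H_\ell$: $G_1=1-1728x$, $H_1=240x$; $G_2=1-256x$, $H_2=48x$; $G_3=1-108x$, $H_3=24x$; $G_5=1-44x-16x^2$, $H_5=12x(1+x)$; $G_7=(1+x)(1-27x)$, $H_7=8x(1+3x)$; $G_{11}=1-20x+56x^2-44x^3$, $H_{11}=8x(1-8x+11x^2)$; $G_{13}=(1+x)(1-10x-27x^2)$, $H_{13}=\frac x4(12+175x+231x^2)$; $G_{23}=(1-x^2+x^3)(1-8x+3x^2-7x^3)$, $H_{23}=4x(1-x-x^2+12x^3-15x^4+14x^5)$. (So $g=G_\ell$ in the claim, except for $\ell=13$.) *)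

(* Defs.v *)
From Stdlib Require Import BinInt.
From HB Require Import structures.
From mathcomp Require Import all_boot all_order all_algebra.
From mathcomp Require Import all_classical all_reals all_analysis.
From mathcomp Require Import complex fraction archimedean.
From mathcomp Require Import zify ssrZ ring lra.

Set Implicit Arguments.
Unset Strict Implicit.
Unset Printing Implicit Defensive.

Import Order.TTheory GRing.Theory Num.Theory.
Import numFieldNormedType.Exports.

Local Open Scope classical_set_scope.
Local Open Scope ring_scope.

(* Formal power series in q over the rationals, given by their coefficients.
   The pointwise product of functions is not the product of series: that is
   fps_mul. *)
Definition fps := nat -> rat.

Definition fps_const (c : rat) : fps := fun n => if n == 0%N then c else 0.

Definition fps_add (f g : fps) : fps := fun n => f n + g n.

Definition fps_scale (c : rat) (f : fps) : fps := fun n => c * f n.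

Definition fps_mul (f g : fps) : fps :=
  fun n => \sum_(i < n.+1) f i * g (n - i)%N.

Definition fps_exp (f : fps) (k : nat) : fps :=
  iter k (fps_mul f) (fps_const 1).

Definition fps_horner (p : {poly rat}) (f : fps) : fps :=
  fun n => \sum_(i < size p) p`_i * fps_exp f i n.

Definition gbinomial (r : rat) (k : nat) : rat :=
  \prod_(i < k) ((r - i%:R) / i.+1%:R).

(* u ^ r for u = 1 + O(q), normalised to have constant term 1: the binomial
   series sum_k binomial(r, k) (u - 1)^k, whose k-th term is O(q^k).  Only
   meaningful when the constant term of u is 1. *)
Definition fps_powr (u : fps) (r : rat) : fps :=
  fun n => \sum_(k < n.+1)
    gbinomial r k * fps_exp (fps_add u (fps_const (-1))) k n.

(* QSer e u stands for q^e * u, where e is rational and u = 1 + O(q). *)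
Record qser := QSer { qord : rat; qunit : fps }.

Definition qmul (f g : qser) : qser :=
  QSer (qord f + qord g) (fps_mul (qunit f) (qunit g)).

Definition qpow (f : qser) (r : rat) : qser :=
  QSer (r * qord f) (fps_powr (qunit f) r).

Definition qdiv (f g : qser) : qser := qmul f (qpow g (-1)).

Definition qser_of (u : fps) : qser := QSer 0 u.

(* The coefficients of q^n, n a natural number, in q^e * u; this is all of
   q^e * u when e is itself a natural number. *)
Definition fps_of (f : qser) : fps := fun n =>
  if n%:R - qord f \is a Num.nat then qunit f (Num.truncn (n%:R - qord f))
  else 0.

Declare Scope qser_scope.
Delimit Scope qser_scope with qser.
Bind Scope qser_scope with qser.
Notation "f * g" := (qmul f g) : qser_scope.
Notation "f / g" := (qdiv f g) : qser_scope.
Notation "f ^ r" := (qpow f r%R) : qser_scope.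

(* The factors with j > n do not contribute to the coefficient of q^n
   (m is positive). *)
Definition euler_prod (m : nat) : fps := fun n =>
  (\prod_(1 <= j < n.+1) (1 - 'X^(m * j)) : {poly rat})`_n.

Definition etaq (m : nat) : qser := QSer (m%:R / 24) (euler_prod m).

(* j^3 q^j / (1 - q^j) contributes j^3 to the coefficients of q^j, q^2j, ... *)
Definition Qser : fps := fun n =>
  if n == 0%N then 1
  else 240 * \sum_(1 <= j < n.+1 | (j %| n)%N) j%:R ^+ 3.

Definition qform (a c : nat) (j k : int) : int :=
  a%:Z * j ^+ 2 + j * k + c%:Z * k ^+ 2.

Lemma theta_box (a c n : nat) (j k : int) :
  (0 < a)%N -> (1 < c)%N -> qform a c j k = n%:Z ->
  `|j| <= n%:Z /\ `|k| <= n%:Z.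
Proof.
rewrite /qform => a0 c0 h.
have {}h : 4 * n%:Z >= 4 * j ^+ 2 + 4 * (j * k) + 8 * k ^+ 2.
  have := sqr_ge0 j; have := sqr_ge0 k; nia.
have hk : k ^+ 2 <= n%:Z by have := sqr_ge0 (2 * j + k); nia.
have hj : 7 * j ^+ 2 <= 8 * n%:Z by have := sqr_ge0 (4 * k + j); nia.
by split; nia.
Qed.

(* The sum of q^(a j^2 + j k + c k^2) over all integers j, k.  By theta_box the
   pairs with a j^2 + j k + c k^2 = n all lie in the box |j|, |k| <= n. *)
Definition theta (a c : nat) : fps := fun n =>
  \sum_(j < (2 * n).+1) \sum_(k < (2 * n).+1)
    (qform a c (j%:Z - n%:Z) (k%:Z - n%:Z) == n%:Z)%:R.

Section Parametrizations.
Local Open Scope qser_scope.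

(* The polynomial with coefficients s, constant term first, evaluated at w. *)
Definition wpoly (s : seq rat) (w : qser) : qser :=
  qser_of (fps_horner (Poly s) (fps_of w)).

Definition Xser (l : nat) : qser :=
  match l with
  | 1 => etaq 1 ^ 24 / qser_of Qser ^ 3
  | 2 => let w := etaq 2 ^ 24 / etaq 1 ^ 24 in w / wpoly [:: 1; 64]%R w ^ 2
  | 3 => let w := etaq 3 ^ 12 / etaq 1 ^ 12 in w / wpoly [:: 1; 27]%R w ^ 2
  | 5 => let w := etaq 5 ^ 6 / etaq 1 ^ 6 in w / wpoly [:: 1; 22; 125]%R w
  | 7 => let w := etaq 7 ^ 4 / etaq 1 ^ 4 in w / wpoly [:: 1; 13; 49]%R w
  | 11 => (etaq 1 * etaq 11 / qser_of (theta 1 3)) ^ 2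
  | 13 => let w := etaq 13 ^ 2 / etaq 1 ^ 2 in w / wpoly [:: 1; 5; 13]%R w
  | 23 => etaq 1 * etaq 23
          / qser_of (fps_scale (1 / 2)%R (fps_add (theta 1 6) (theta 2 3)))
  | _ => etaq 1
  end.

Definition Zser (l : nat) : qser :=
  match l with
  | 1 => qser_of Qser ^ (1 / 2)
  | 2 => etaq 1 ^ 2 * etaq 2 ^ 2 / Xser 2 ^ (1 / 4)
  | 3 => etaq 1 ^ 2 * etaq 3 ^ 2 / Xser 3 ^ (1 / 3)
  | 5 => etaq 1 ^ 2 * etaq 5 ^ 2 / Xser 5 ^ (1 / 2)
  | 7 => etaq 1 ^ 2 * etaq 7 ^ 2 / Xser 7 ^ (2 / 3)
  | 11 => etaq 1 ^ 2 * etaq 11 ^ 2 / Xser 11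
  | 13 => etaq 1 ^ 2 * etaq 13 ^ 2 / Xser 13 ^ (7 / 6)
  | 23 => etaq 1 ^ 2 * etaq 23 ^ 2 / Xser 23 ^ 2
  | _ => etaq 1
  end.
End Parametrizations.

(* Given Z and X = q + O(q^2), the coefficients T of the expansion
   Z = sum_n T n * X^n; see expandP. *)
Fixpoint expand_seq (Z X : fps) (n : nat) : seq rat :=
  if n is m.+1 then
    let s := expand_seq Z X m in
    rcons s (Z m - \sum_(i < m) s`_i * fps_exp X i m)
  else [::].

Definition expand (Z X : fps) (n : nat) : rat := (expand_seq Z X n.+1)`_n.

Lemma size_expand_seq (Z X : fps) n : size (expand_seq Z X n) = n.
Proof. by elim: n => //= n IH; rewrite size_rcons IH. Qed.

Lemma nth_expand_seq (Z X : fps) n i :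
  (i < n)%N -> (expand_seq Z X n)`_i = expand Z X i.
Proof.
elim: n => // n IH; rewrite ltnS leq_eqVlt => /orP[/eqP -> //|lt_in] /=.
by rewrite nth_rcons size_expand_seq lt_in IH.
Qed.

Lemma expand_rec (Z X : fps) m :
  expand Z X m = Z m - \sum_(i < m) expand Z X i * fps_exp X i m.
Proof.
rewrite {1}/expand /= nth_rcons size_expand_seq ltnn eqxx.
by congr (_ - _); apply: eq_bigr => i _; rewrite nth_expand_seq.
Qed.

Lemma fps_exp_diag (X : fps) : X 0%N = 0 -> X 1%N = 1 ->
  forall n, (forall m, (m < n)%N -> fps_exp X n m = 0) /\ fps_exp X n n = 1.
Proof.
move=> X0 X1; elim=> [|n [IH0 IH1]]; first by [].
split=> [m lt_mn|]; rewrite /fps_exp iterS -/(fps_exp X n) /fps_mul.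
  rewrite big1 // => -[[|i] /= lt_i] _; first by rewrite X0 mul0r.
  by rewrite IH0 ?mulr0 //; lia.
rewrite big_ord_recl X0 mul0r add0r big_ord_recl /= X1 mul1r subSS subn0 IH1.
rewrite big1 ?addr0 // => i _; rewrite IH0 ?mulr0 // /bump /=.
by have := ltn_ord i; lia.
Qed.

Lemma expandP (Z X : fps) (T : nat -> rat) : X 0%N = 0 -> X 1%N = 1 ->
  (forall m, Z m = \sum_(n < m.+1) T n * fps_exp X n m) <-> T =1 expand Z X.
Proof.
move=> X0 X1; split=> [ZE n|TE m].
  elim/ltn_ind: n => n IH; rewrite expand_rec ZE big_ord_recr /=.
  have [_ ->] := fps_exp_diag X0 X1 n; rewrite mulr1.
  under [X in _ - X]eq_bigr => i _ do rewrite -IH //.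
  by rewrite addrC addrK.
rewrite big_ord_recr /=; have [_ ->] := fps_exp_diag X0 X1 m.
rewrite mulr1 TE expand_rec; under eq_bigr => i _ do rewrite TE.
by rewrite addrC subrK.
Qed.

Lemma fps_powr0 (u : fps) r : fps_powr u r 0 = 1.
Proof.
by rewrite /fps_powr big_ord1 /gbinomial big_ord0 mul1r /fps_exp /fps_const.
Qed.

Lemma fps_mul0 (f g : fps) : fps_mul f g 0 = f 0%N * g 0%N.
Proof. by rewrite /fps_mul big_ord1. Qed.

Lemma euler_prod0 m : euler_prod m 0 = 1.
Proof. by rewrite /euler_prod big_geq // coef1. Qed.

(* The normalisations X = q + O(q^2) and Z = 1 + O(q). *)
Lemma XZser_lead l : l \in [:: 1; 2; 3; 5; 7; 11; 13; 23]%N ->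
  [/\ fps_of (Xser l) 0%N = 0, fps_of (Xser l) 1%N = 1 &
      fps_of (Zser l) 0%N = 1].
Proof.
move=> hl.
have [[X1 XU] [Z0 ZU]] : (qord (Xser l) = 1 /\ qunit (Xser l) 0%N = 1) /\
    (qord (Zser l) = 0 /\ qunit (Zser l) 0%N = 1).
  move: hl; rewrite !inE; do ![case/orP] => /eqP -> /=;
  by split; split; rewrite ?fps_mul0 ?fps_powr0 ?euler_prod0 ?mulr1 //; field.
have N1 : ((-1 : rat) \is a Num.nat) = false by apply/negbTE/negP=> /natr_ge0.
by rewrite /fps_of X1 Z0 mulr0n mulr1n !subr0 subrr sub0r N1 rpred0 truncn0.
Qed.

Definition Tcoef (l : nat) : nat -> rat :=
  expand (fps_of (Zser l)) (fps_of (Xser l)).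

Section Polynomials.

(* The polynomial with the given integer coefficients, constant term first.
   Literals are binary integers because those of rat and int are unary. *)
Definition zpoly (s : seq BinInt.Z) : {poly rat} :=
  Poly [seq (int_of_Z z)%:~R | z <- s].

Delimit Scope Z_scope with bZ.
Local Notation P s := (zpoly s%bZ).

Definition pol_a (l : nat) : {poly rat} :=
  match l with
  | 2 => Poly [:: 5 / 2]
  | 3 => P [:: 5]
  | 5 => P [:: 13; -36]
  | 7 => P [:: 25; -80]
  | 11 => P [:: 61; -368; 352]
  | 13 => P [:: 85; -135; -280]
  | 23 => P [:: 265; -940; 310; -60; -135]
  | _ => 0
  end.

Definition pol_b (l : nat) : {poly rat} :=
  match l with
  | 2 => Poly [:: 3 / 2]
  | 3 => P [:: 4]
  | 5 => P [:: 12]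
  | 7 => P [:: 24]
  | 11 => P [:: 60]
  | 13 => P [:: 84; 48]
  | 23 => P [:: 264; -120]
  | _ => 0
  end.

Definition pol_c (l : nat) : {poly rat} :=
  match l with
  | 2 => P [:: 1; -207; 3456]
  | 3 => P [:: 1; -126; 2944]
  | 5 => P [:: 1; -80; 1890; -12600; 7776; 3456]
  | 7 => P [:: 1; -21; 8] * P [:: 1; -42; 454; -1008; -1280]
  | 11 => P [:: 1; -66; 1793; -26048; 221056; -1132670; 3535840; -6683072;
      7418752; -4460544; 1183744; -65536]
  | 13 => P [:: 1; -39; 546; -2938; 117; 42861; -36998; -255294; 15366;
      519610; 342576; -14976; -35840]
  | 23 => P [:: 1; -46; 920; -10465; 74221; -336927; 953856; -1470068; 336674;
      3209696; -6447728; 5423124; 302266; -6612454; 8362616; -4877702;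
      -116403; 2732814; -2492280; 1115109; -170775; -83835; 48600; -6750]
  | _ => 0
  end.

Definition pol_d (l : nat) : {poly rat} :=
  match l with
  | 2 => P [:: 1; -81]
  | 3 => P [:: 1; -8] * P [:: 1; -64]
  | 5 => P [:: 1; -4] * P [:: 1; -18] * P [:: 1; -36]
  | 7 => P [:: 1; -2] * P [:: 1; -8] * P [:: 1; -24] * P [:: 1; -16; -8]
  | 11 => P [:: 1; -1] * P [:: 1; -2] * P [:: 1; -4] * P [:: 1; -7]
      * P [:: 1; -16] * P [:: 1; -12; 16] * P [:: 1; -14; 4]
  | 13 => P [:: 1; 2] * P [:: 1; 1] * P [:: 1; -1] * P [:: 1; -3]
      * P [:: 1; -8] * P [:: 1; -11; -8] * P [:: 1; -4; -8]
      * P [:: 1; -10; -2]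
  | 23 => P [:: 1; 1] * P [:: 1; -1] * P [:: 1; -2] * P [:: 1; -3]
      * P [:: 1; -5] * P [:: 1; -8; 3] * P [:: 1; -6; -9]
      * P [:: 1; -7; 3; -5] * P [:: 1; -7; 7; -3] * P [:: 1; -4; 0; 0; -1]
  | _ => 0
  end.

Definition pol_g (l : nat) : {poly rat} :=
  match l with
  | 2 => P [:: 1; -256]
  | 3 => P [:: 1; -108]
  | 5 => P [:: 1; -44; -16]
  | 7 => P [:: 1; 1] * P [:: 1; -27]
  | 11 => P [:: 1; -20; 56; -44]
  | 13 => P [:: 1; -10; -27]
  | 23 => P [:: 1; 0; -1; 1] * P [:: 1; -8; 3; -7]
  | _ => 0
  end.

Definition pol_K (l : nat) : {poly rat} :=
  match l with
  | 2 => P [:: 1; 144]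
  | 3 => P [:: 1; 192]
  | 5 => P [:: 1; 216; 144]
  | 7 => P [:: 1; 224; 448]
  | 11 => P [:: 1; 224; -192; -832; 1024]
  | 13 => P [:: 1; 234; 1417; 1872; 832]
  | 23 => P [:: 1; 232; 732; -968; 1894; -2280; 2268; -1080; 225]
  | _ => 0
  end.

End Polynomials.

(* R[i] as a normed module over itself. *)
HB.instance Definition _ (R : realType) := NormedModule.copy R[i] R[i]^o.

Section Functions.
Context {R : realType}.
Implicit Types x : R[i].

Definition peval (p : {poly rat}) x : R[i] := (map_poly ratr p).[x].

Definition Fpart (l : nat) x : nat -> R[i] :=
  [series ratr (Tcoef l n) * x ^+ n]_n.

Definition F (l : nat) x : R[i] := limn (Fpart l x).

(* sqrtc is the principal square root, with cut along the negative reals.  All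
   radicands below take a positive value at x = 0 (1 for g, l^2 and 1 for
   a + b sqrt g and a - b sqrt g), so near x = 0 this is the branch whose
   value at 0 is positive. *)
Definition sqrt_g (l : nat) x : R[i] := sqrtc (peval (pol_g l) x).

(* At x = 0 the denominator of yminus vanishes; 0 / 0 = 0 there is also the
   value by continuity. *)
Definition yplus (l : nat) x : R[i] :=
  2 * x ^+ l / (peval (pol_c l) x + peval (pol_d l) x * sqrt_g l x).

Definition yminus (l : nat) x : R[i] :=
  2 * x ^+ l / (peval (pol_c l) x - peval (pol_d l) x * sqrt_g l x).

Definition ab_plus (l : nat) x : R[i] :=
  peval (pol_a l) x + peval (pol_b l) x * sqrt_g l x.

Definition ab_minus (l : nat) x : R[i] :=
  peval (pol_a l) x - peval (pol_b l) x * sqrt_g l x.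

End Functions.

Notation "p %:F" := (tofrac p) : ring_scope.

(* Main.v *)
(* Put x = X_l(q).  The proof consists in showing that X_1(q) and X_1(q^l) are
   the values of y^- and y^+ at x, and that Z_l^2 (a - b sqrt g) = Q(q) and
   Z_l^2 (a + b sqrt g) = l^2 Q(q^l); as Z_1 = Q^(1/2) is F_1(X_1), the theorem
   then follows as an identity of power series in x, and its radius of
   convergence is positive because F_1 is the square of a hypergeometric series.

   Ramanujan's differential equations for P, Q, R come from a bijection of
   Skoruppa on the quadruples with a x + b y = n.  For l = 2, 3, 5, 7, 13 the
   series w with X_1 = w / (m(w) p(w)^3) satisfies polynomial identities which
   exhibit a second solution of these equations; solutions being unique, it
   consists of the Eisenstein series in q^l, and w is the eta quotient.  For
   l = 11, 23 the relation between X_1(q) and X_1(q^l) is deduced from the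
   modular equations of theta functions, which are proved by splitting lattice
   sums; the weight is then recovered from the logarithmic derivative of X_l. *)
Require Import Defs.
From Stdlib Require Import BinInt.
From HB Require Import structures.
From mathcomp Require Import all_boot all_order all_algebra.
From mathcomp Require Import all_classical all_reals all_analysis.
From mathcomp Require Import complex fraction archimedean.
From mathcomp Require Import zify ssrZ ring lra.

Set Implicit Arguments.
Unset Strict Implicit.
Unset Printing Implicit Defensive.

Import Order.TTheory GRing.Theory Num.Theory.
Import numFieldNormedType.Exports.

Local Open Scope classical_set_scope.
Local Open Scope ring_scope.

(** No theory of modular forms enters: every identity is one between power series over the
    rationals, and analysis begins only after a relation in q has become one in x. The finite
    dimension of spaces of modular forms is replaced by uniqueness for a differential system and by
    explicit polynomial identities, decided by evaluation on lists of binary integers. Convergence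
    is prepared by bounds C M^n on coefficients, which survive products, binomial powers and
    substitution. The split into two families reflects the genus of X_0(l). For l = 2, 3, 5, 7, 13
    it is 0, everything is rational in one function w, and sqrt g is a function of w that the Fricke
    involution negates. For l = 11, 23 no such w exists: X_l generates only the field fixed by the
    involution, X_1(q) and X_1(q^l) are the two roots of a quadratic equation over it, and sqrt g
    comes from its discriminant. That equation is found through a larger field, generated by roots
    of products of values of the modular lambda function. *)

HB.instance Definition _ := gen_eqMixin fps.
HB.instance Definition _ := gen_choiceMixin fps.

(** * The ring of formal power series in q *)

Lemma fpsP (f g : fps) : (forall n, f n = g n) <-> f = g.
Proof. by split=> [e | ->//]; apply/funext. Qed.

Definition fps_opp (f : fps) : fps := fun n => - f n.

Lemma fps_addA : associative fps_add.
Proof. by move=> f g h; apply/fpsP => n; rewrite /fps_add addrA. Qed.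

Lemma fps_addC : commutative fps_add.
Proof. by move=> f g; apply/fpsP => n; rewrite /fps_add addrC. Qed.

Lemma fps_add0 : left_id (fps_const 0) fps_add.
Proof.
by move=> f; apply/fpsP => n; rewrite /fps_add /fps_const; case: ifP; rewrite add0r.
Qed.

Lemma fps_addN : left_inverse (fps_const 0) fps_opp fps_add.
Proof.
move=> f; apply/fpsP => n; rewrite /fps_add /fps_const /fps_opp addNr.
by case: ifP.
Qed.

HB.instance Definition _ :=
  GRing.isZmodule.Build fps fps_addA fps_addC fps_add0 fps_addN.

Definition fps_trunc (N : nat) (f : fps) : {poly rat} := \poly_(i < N) f i.

(** A coefficient below N only sees the truncations; commutativity and associativity of the product
    are thereby inherited from [{poly rat}]. *)
Lemma fps_mul_trunc N (f g : fps) n : (n < N)%N ->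
  fps_mul f g n = (fps_trunc N f * fps_trunc N g)`_n.
Proof.
move=> ltnN; rewrite coefM; apply: eq_bigr => i _; rewrite !coef_poly.
have := ltn_ord i; rewrite ltnS => lein.
by rewrite (leq_ltn_trans lein ltnN) (leq_ltn_trans (leq_subr _ _) ltnN).
Qed.

Lemma fps_mulC : commutative fps_mul.
Proof. by move=> f g; apply/fpsP => n; rewrite !(fps_mul_trunc _ _ (ltnSn n)) mulrC. Qed.

Lemma fps_mulDl : left_distributive fps_mul fps_add.
Proof.
move=> f g h; apply/fpsP => n; rewrite /fps_mul /fps_add -big_split /=.
by apply: eq_bigr => i _; rewrite mulrDl.
Qed.

Lemma fps_mul1 : left_id (fps_const 1) fps_mul.
Proof.
move=> f; apply/fpsP => n; rewrite /fps_mul big_ord_recl /fps_const /= mul1r subn0.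
by rewrite big1 ?addr0 // => i _; rewrite mul0r.
Qed.

Lemma fps_mulA : associative fps_mul.
Proof.
move=> f g h; apply/fpsP => n.
rewrite /fps_mul.
transitivity ((fps_trunc n.+1 f * (fps_trunc n.+1 g * fps_trunc n.+1 h))`_n).
  rewrite coefM; apply: eq_bigr => i _; rewrite coef_poly ltn_ord.
  by congr (_ * _); apply: fps_mul_trunc; rewrite ltnS leq_subr.
rewrite mulrA coefM; apply: eq_bigr => i _.
rewrite [X in _ * X]coef_poly ltnS leq_subr; congr (_ * _).
by rewrite -fps_mul_trunc.
Qed.

Lemma fps_1_neq0 : fps_const 1 != 0.
Proof. by apply/eqP => /fpsP/(_ 0%N)/eqP; rewrite oner_eq0. Qed.

HB.instance Definition _ := GRing.Zmodule_isComNzRing.Build fps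
  fps_mulA fps_mulC fps_mul1 fps_mulDl fps_1_neq0.

Implicit Types (f g h u v : fps).

Lemma fcoef0 n : (0 : fps) n = 0.
Proof. by rewrite /GRing.zero /= /fps_const; case: ifP. Qed.
Lemma fcoefD f g n : (f + g) n = f n + g n. Proof. by []. Qed.
Lemma fcoefN f n : (- f) n = - f n. Proof. by []. Qed.
Lemma fcoefB f g n : (f - g) n = f n - g n. Proof. by []. Qed.
Lemma fcoef_mul f g n : (f * g) n = \sum_(i < n.+1) f i * g (n - i)%N.
Proof. by []. Qed.
Lemma fcoef_const c n : (fps_const c) n = (if n == 0%N then c else 0).
Proof. by []. Qed.
Lemma fcoef1 n : (1 : fps) n = (n == 0%N)%:R.
Proof. by rewrite /GRing.one /= /fps_const; case: ifP. Qed.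
Lemma fcoefMn f k n : (f *+ k) n = f n *+ k.
Proof. by elim: k => [|k IH]; rewrite ?mulr0n ?fcoef0 // !mulrS fcoefD IH. Qed.
Lemma fcoef_sum (I : Type) (r : seq I) (P : pred I) (F : I -> fps) n :
  (\sum_(i <- r | P i) F i) n = \sum_(i <- r | P i) F i n.
Proof. by elim/big_rec2: _ => [|i y1 y2 _ <-]; rewrite ?fcoef0. Qed.
Lemma fcoef_nat k n : (k%:R : fps) n = (if n == 0%N then k%:R else 0).
Proof. by rewrite fcoefMn fcoef1; case: ifP; rewrite // mul0rn. Qed.
Lemma fps_const_is_zmod_morphism : zmod_morphism fps_const.
Proof.
move=> a b; apply/fpsP => n; rewrite fcoefB !fcoef_const.
by case: ifP; rewrite ?subr0.
Qed.
Lemma fcoef_constM c f n : (fps_const c * f) n = c * f n.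
Proof.
rewrite fcoef_mul big_ord_recl /= subn0 fcoef_const /=.
by rewrite big1 ?addr0 // => i _; rewrite fcoef_const /= mul0r.
Qed.
Lemma fps_const_is_monoid_morphism : monoid_morphism fps_const.
Proof.
split=> // a b; apply/fpsP => n; rewrite fcoef_constM !fcoef_const.
by case: ifP; rewrite ?mulr0.
Qed.
HB.instance Definition _ :=
  GRing.isZmodMorphism.Build rat fps fps_const fps_const_is_zmod_morphism.
HB.instance Definition _ :=
  GRing.isMonoidMorphism.Build rat fps fps_const fps_const_is_monoid_morphism.

Lemma fcoef_mul0 f g : (f * g) 0%N = f 0%N * g 0%N.
Proof. by rewrite fcoef_mul big_ord1. Qed.
Lemma fcoef_exp0 f k : (f ^+ k) 0%N = f 0%N ^+ k.
Proof. by elim: k => [|k IH]; rewrite ?expr0 ?fcoef1 // !exprS fcoef_mul0 IH. Qed.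
Lemma fps_expE f k : fps_exp f k = f ^+ k.
Proof. by elim: k => // k IH; rewrite exprS -IH. Qed.

Lemma coef_low_mul n f g : (forall i, (i < n)%N -> f i = 0) ->
  (f * g) n = f n * g 0%N.
Proof.
move=> f0; rewrite fcoef_mul big_ord_recr /= subnn big1 ?add0r // => i _.
by rewrite f0 ?mul0r.
Qed.

Lemma fps_neq0P f : f != 0 ->
  exists2 n, f n != 0 & forall i, (i < n)%N -> f i = 0.
Proof.
move=> fn0; have ex : exists n, f n != 0.
  apply: contrapT => nex; case/eqP: fn0; apply/fpsP => n; rewrite fcoef0.
  by apply/eqP; apply: contrapT => /negP h; apply: nex; exists n.
exists (ex_minn ex); case: ex_minnP => // m _ min i lt_im.
by apply/eqP; apply: contraLR lt_im => /min; rewrite -leqNgt.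
Qed.

Lemma fps_mulf_eq0 f g : f * g = 0 -> (f == 0) || (g == 0).
Proof.
move=> fg0; apply/orP; case: (eqVneq f 0) => [|/fps_neq0P[n fn lown]]; first by left.
right; apply/negPn/negP => /fps_neq0P[m gm lowm].
have /fpsP/(_ (n + m)%N) := fg0; rewrite fcoef0 fcoef_mul.
have ltn : (n < (n + m).+1)%N by lia.
rewrite (bigD1 (Ordinal ltn)) //= addKn big1 ?addr0.
  by move/eqP; rewrite mulf_eq0 (negPf fn) (negPf gm).
move=> i; rewrite -val_eqE /= => ne.
have [lt|ge] := ltnP i n; first by rewrite lown ?mul0r.
by rewrite lowm ?mulr0 //; have := ltn_ord i; move: ne ge; lia.
Qed.

(** Units and inverses are chosen classically, with [fps_inv f = f] outside the units; this makes
    the series an integral domain, where nonzero factors cancel. Explicit inverses are produced by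
    [fps_inverse]. *)
Definition fps_unit : pred fps := fun f => `[< exists g, g * f = 1 >].
Definition fps_inv f : fps :=
  if pselect (exists g, g * f = 1) is left ex then sval (cid ex) else f.

Lemma fps_mulVr : {in fps_unit, left_inverse 1 fps_inv *%R}.
Proof.
move=> f /asboolP uf; rewrite /fps_inv; case: pselect => // ex.
by case: cid.
Qed.
Lemma fps_unitPl f g : g * f = 1 -> fps_unit f.
Proof. by move=> e; apply/asboolP; exists g. Qed.
Lemma fps_inv_out : {in [predC fps_unit], fps_inv =1 id}.
Proof.
move=> f /negP nu; rewrite /fps_inv; case: pselect => // ex.
by case: nu; apply/asboolP.
Qed.
HB.instance Definition _ := GRing.ComNzRing_hasMulInverse.Build fps
  fps_mulVr fps_unitPl fps_inv_out.
HB.instance Definition _ := GRing.ComUnitRing_isIntegral.Build fps fps_mulf_eq0.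

Lemma fps_neq0 f : f 0%N != 0 -> f != 0.
Proof. by apply: contraNneq => ->; rewrite fcoef0. Qed.

Lemma fps_natf_neq0 k : (k.+1%:R : fps) != 0.
Proof. by apply: fps_neq0; rewrite fcoef_nat /= pnatr_eq0. Qed.

Lemma fps_sqr_inj f g : f 0%N = 1 -> g 0%N = 1 -> f ^+ 2 = g ^+ 2 -> f = g.
Proof.
move=> f0 g0 /eqP; rewrite eqf_sqr => /orP[/eqP // | /eqP/fpsP/(_ 0%N)].
by rewrite fcoefN f0 g0 => /eqP.
Qed.

(** The cofactor of f - g in f^k - g^k has constant term k, so it is nonzero. This uniqueness of
    normalised roots is how fractional powers are compared below. *)
Lemma fps_exp_inj k f g : (0 < k)%N -> f 0%N = 1 -> g 0%N = 1 ->
  f ^+ k = g ^+ k -> f = g.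
Proof.
case: k => // k _ f0 g0 /eqP; rewrite -subr_eq0 subrXX mulf_eq0 subr_eq0.
case/orP => [/eqP // | /eqP/fpsP/(_ 0%N)]; rewrite fcoef_sum fcoef0.
under eq_bigr do rewrite fcoef_mul0 !fcoef_exp0 f0 g0 !expr1n mulr1.
by rewrite sumr_const card_ord => /eqP; rewrite pnatr_eq0.
Qed.

(** * Congruence modulo q^N *)

Definition eqmod N f g := forall n, (n < N)%N -> f n = g n.

Lemma eqmodP f g : (forall N, eqmod N f g) -> f = g.
Proof. by move=> e; apply/fpsP => n; apply: (e n.+1). Qed.
Lemma eqmod_refl N f : eqmod N f f. Proof. by []. Qed.
Lemma eqmod_sym N f g : eqmod N f g -> eqmod N g f.
Proof. by move=> e n /e. Qed.
Lemma eqmod_trans N g f h : eqmod N f g -> eqmod N g h -> eqmod N f h.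
Proof. by move=> e1 e2 n lt; rewrite e1 ?e2. Qed.
Lemma eqmodD N f g u v : eqmod N f g -> eqmod N u v -> eqmod N (f + u) (g + v).
Proof. by move=> e1 e2 n lt; rewrite !fcoefD e1 ?e2. Qed.
Lemma eqmodM N f g u v : eqmod N f g -> eqmod N u v -> eqmod N (f * u) (g * v).
Proof.
move=> e1 e2 n lt; rewrite !fcoef_mul; apply: eq_bigr => i _.
by rewrite e1 ?e2 //; have := ltn_ord i; lia.
Qed.
Lemma eqmodX N f g k : eqmod N f g -> eqmod N (f ^+ k) (g ^+ k).
Proof. by move=> e; elim: k => // k IH; rewrite !exprS; apply: eqmodM. Qed.

Definition pX : fps := fun n => (n == 1%N)%:R.

Lemma coef_pXM f n : (pX * f) n = (if n is m.+1 then f m else 0).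
Proof.
rewrite fcoef_mul; case: n => [|n]; first by rewrite big_ord1 mul0r.
rewrite big_ord_recl mul0r add0r big_ord_recl /= mul1r subSS subn0.
by rewrite big1 ?addr0 // => i _; rewrite mul0r.
Qed.
Lemma coef_pXnM k f n : (pX ^+ k * f) n = (if (k <= n)%N then f (n - k)%N else 0).
Proof.
elim: k n => [|k IH] n; first by rewrite mul1r subn0.
by rewrite exprS -mulrA coef_pXM; case: n => // n; rewrite IH ltnS subSS.
Qed.
Lemma coef_pXn k n : (pX ^+ k) n = (n == k)%:R.
Proof.
rewrite -[pX ^+ k]mulr1 coef_pXnM fcoef1; case: leqP => h; last by rewrite ltn_eqF.
by rewrite subn_eq0 eqn_leq h andbT.
Qed.
Lemma pX_neq0 : pX != 0.
Proof. by apply/eqP => /fpsP/(_ 1%N)/eqP; rewrite fcoef0. Qed.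
Lemma pXn_neq0 k : pX ^+ k != 0. Proof. by rewrite expf_neq0 ?pX_neq0. Qed.

Definition fps_shift f : fps := fun n => f n.+1.

Lemma fps_shiftE f : f 0%N = 0 -> f = pX * fps_shift f.
Proof. by move=> f0; apply/fpsP => -[|n]; rewrite coef_pXM. Qed.

Lemma coef_low_exp f k n : f 0%N = 0 -> (n < k)%N -> (f ^+ k) n = 0.
Proof.
move=> f0 ltnk; rewrite (fps_shiftE f0) exprMn coef_pXnM leqNgt ltnk //.
Qed.

(** * The derivation q d/dq *)

Definition D f : fps := fun n => n%:R * f n.

Lemma D_is_zmod_morphism : zmod_morphism D.
Proof. by move=> f g; apply/fpsP => n; rewrite fcoefB /D fcoefB mulrBr. Qed.
HB.instance Definition _ := GRing.isZmodMorphism.Build fps fps D D_is_zmod_morphism.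

Lemma DM f g : D (f * g) = D f * g + f * D g.
Proof.
apply/fpsP => n; rewrite fcoefD !fcoef_mul /D fcoef_mul mulr_sumr -big_split /=.
apply: eq_bigr => i _; have := ltn_ord i; rewrite ltnS => h.
rewrite -{1}(subnKC h) natrD; ring.
Qed.
Lemma D_const c : D (fps_const c) = 0.
Proof. by apply/fpsP => -[|n]; rewrite fcoef0 /D ?mul0r // fcoef_const mulr0. Qed.
Lemma D1 : D 1 = 0. Proof. exact: D_const. Qed.
Lemma D_nat k : D k%:R = 0. Proof. by rewrite -(rmorph_nat fps_const) D_const. Qed.
Lemma DX f k : D (f ^+ k.+1) = k.+1%:R * f ^+ k * D f.
Proof.
elim: k => [|k IH]; first by rewrite !expr1 expr0 !mul1r.
rewrite exprS DM IH -[k.+2]addn1 natrD exprS; ring.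
Qed.
Definition DE := (DX, DM).
Lemma D_natM k f : D (k%:R * f) = k%:R * D f.
Proof. by rewrite DM D_nat mul0r add0r. Qed.
Lemma D_pX : D pX = pX.
Proof. by apply/fpsP => -[|[|n]]; rewrite /D /pX ?mulr0 ?mulr1. Qed.
Lemma D_pXn k : D (pX ^+ k) = k%:R * pX ^+ k.
Proof. case: k => [|k]; first by rewrite expr0 [LHS]D1 !mul0r.
by rewrite DX D_pX exprSr; ring. Qed.
Lemma coef_D0 f : (D f) 0%N = 0. Proof. by rewrite /D mul0r. Qed.
Lemma eqmodE N f g : eqmod N f g -> eqmod N (D f) (D g).
Proof. by move=> e n lt; rewrite /D e. Qed.

(** * Substitution of one series into another *)

Definition comp f g : fps := fun n => \sum_(k < n.+1) f k * (g ^+ k) n.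

(** As g is O(q), the powers g^k with k > n do not reach q^n, so the cut at n in [comp] loses
    nothing. *)
Lemma comp_wide N f g n : g 0%N = 0 -> (n < N)%N ->
  comp f g n = \sum_(k < N) f k * (g ^+ k) n.
Proof.
move=> g0 ltnN; rewrite /comp -[RHS](big_mkord xpredT (fun k => f k * (g ^+ k) n)).
rewrite (big_cat_nat_idem _ (leq0n n.+1)) //= big_mkord.
rewrite [X in _ + X]big_nat_cond [X in _ + X]big1 ?addr0 // => i /andP[/andP[h _] _].
by rewrite coef_low_exp ?mulr0.
Qed.

Definition fps_of_poly (p : {poly rat}) : fps := fun n => p`_n.

Lemma fps_truncK N f : eqmod N (fps_of_poly (fps_trunc N f)) f.
Proof. by move=> n lt; rewrite /fps_of_poly coef_poly lt. Qed.

Lemma fps_of_polyM p q : fps_of_poly (p * q) = fps_of_poly p * fps_of_poly q.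
Proof. by apply/fpsP => n; rewrite /fps_of_poly coefM. Qed.

Lemma comp_poly p g : g 0%N = 0 ->
  comp (fps_of_poly p) g = (map_poly fps_const p).[g].
Proof.
move=> g0; apply/fpsP => n.
have hN : (n < maxn n.+1 (size p))%N by rewrite leq_max ltnSn.
rewrite (comp_wide _ g0 hN) (horner_coef_wide _ (n := maxn n.+1 (size p))).
  by rewrite fcoef_sum; apply: eq_bigr => i _; rewrite coef_map fcoef_constM.
by rewrite (leq_trans (size_poly _ _)) // leq_maxr.
Qed.

Lemma eqmod_comp N f f' g g' : g 0%N = 0 -> g' 0%N = 0 ->
  eqmod N f f' -> eqmod N g g' -> eqmod N (comp f g) (comp f' g').
Proof.
move=> g0 g0' ef eg n lt; apply: eq_bigr => i _.
by rewrite ef ?(eqmodX _ eg) //; have := ltn_ord i; lia.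
Qed.

Lemma comp_trunc N f g : g 0%N = 0 ->
  eqmod N (comp f g) (map_poly fps_const (fps_trunc N f)).[g].
Proof.
move=> g0; rewrite -comp_poly //; apply: eqmod_comp => //.
exact/eqmod_sym/fps_truncK.
Qed.

Lemma compD f1 f2 g : comp (f1 + f2) g = comp f1 g + comp f2 g.
Proof.
apply/fpsP => n; rewrite fcoefD -big_split /=; apply: eq_bigr => i _.
by rewrite fcoefD mulrDl.
Qed.
Lemma compN f g : comp (- f) g = - comp f g.
Proof.
by apply/fpsP => n; rewrite fcoefN -sumrN; apply: eq_bigr => i _; rewrite fcoefN mulNr.
Qed.
Lemma compB f1 f2 g : comp (f1 - f2) g = comp f1 g - comp f2 g.
Proof. by rewrite compD compN. Qed.

Lemma compM f1 f2 g : g 0%N = 0 -> comp (f1 * f2) g = comp f1 g * comp f2 g.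
Proof.
move=> g0; apply: eqmodP => N.
have e (f : fps) : eqmod N (comp f g) (comp (fps_of_poly (fps_trunc N f)) g).
  by apply: eqmod_comp => //; apply/eqmod_sym/fps_truncK.
apply: (@eqmod_trans _
  (comp (fps_of_poly (fps_trunc N f1) * fps_of_poly (fps_trunc N f2)) g)).
  by apply: eqmod_comp => //; apply: eqmodM; apply/eqmod_sym/fps_truncK.
rewrite -fps_of_polyM comp_poly // rmorphM hornerM -!comp_poly //.
by apply: eqmodM; apply/eqmod_sym.
Qed.
Lemma comp_const c g : comp (fps_const c) g = fps_const c.
Proof.
apply/fpsP => n; rewrite /comp big_ord_recl fcoef_const /= expr0 fcoef1 fcoef_const.
by rewrite big1 => [|i _]; [case: ifP; rewrite ?mulr1 ?mulr0 addr0 | rewrite mul0r].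
Qed.
Lemma comp1 g : comp 1 g = 1. Proof. exact: comp_const. Qed.
Lemma comp_nat k g : comp k%:R g = k%:R.
Proof. by rewrite -(rmorph_nat fps_const) comp_const. Qed.
Lemma compX f g k : g 0%N = 0 -> comp (f ^+ k) g = comp f g ^+ k.
Proof. by move=> g0; elim: k => [|k IH]; rewrite ?comp1 // !exprS compM // IH. Qed.
Lemma comp_pX g : g 0%N = 0 -> comp pX g = g.
Proof.
move=> g0; apply/fpsP => n; rewrite (comp_wide _ g0 (n := n) (N := n.+2)) //.
by rewrite big_ord_recl mul0r add0r big_ord_recl mul1r big1 ?addr0 // => i _; rewrite mul0r.
Qed.
Lemma comp_pXr f : comp f pX = f.
Proof.
apply/fpsP => n; rewrite /comp big_ord_recr /= coef_pXn eqxx mulr1 big1 ?add0r //.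
by move=> i _; rewrite coef_pXn gtn_eqF ?mulr0.
Qed.
Lemma fcoef_comp0 f g : comp f g 0%N = f 0%N.
Proof. by rewrite /comp big_ord1 /= expr0 mulr1. Qed.
Lemma fcoef_comp1 f g : g 0%N = 0 -> comp f g 1%N = f 1%N * g 1%N.
Proof. by move=> g0; rewrite /comp big_ord_recl big_ord1 expr0 fcoef1 mulr0 add0r. Qed.

(** Modulo q^N only finitely many coefficients of f matter, so f may be replaced by a polynomial and
    treated by induction along Horner's rule. The chain rule [D_comp] is proved in the same way. *)
Lemma compA f g h : g 0%N = 0 -> h 0%N = 0 ->
  comp (comp f g) h = comp f (comp g h).
Proof.
move=> g0 h0; have gh0 : comp g h 0%N = 0 by rewrite fcoef_comp0.
apply: eqmodP => N.
apply: (@eqmod_trans _ (comp (map_poly fps_const (fps_trunc N f)).[g] h)).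
  by apply: eqmod_comp => //; apply: comp_trunc.
apply: (eqmod_trans _ (eqmod_sym (comp_trunc f gh0))).
rewrite (_ : comp _ h = (map_poly fps_const (fps_trunc N f)).[comp g h]) //.
elim/poly_ind: (fps_trunc N f) => [|p c IH].
  by rewrite !rmorph0 !horner0 -[0]/(fps_const 0) comp_const.
rewrite !rmorphD !rmorphM /= !map_polyX !map_polyC !hornerE compD compM //.
by rewrite IH comp_const.
Qed.

(** For q d/dq the chain rule reads D(f(g)) = (D f)(g) (D g)/g; multiplication by g avoids the
    quotient. *)
Lemma D_comp f g : g 0%N = 0 -> D (comp f g) * g = comp (D f) g * D g.
Proof.
move=> g0; apply: eqmodP => N.
apply: (@eqmod_trans _ (D (comp (fps_of_poly (fps_trunc N f)) g) * g)).
  apply: eqmodM => //; apply: eqmodE; apply: eqmod_comp => //.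
  exact/eqmod_sym/fps_truncK.
apply: (@eqmod_trans _ (comp (D (fps_of_poly (fps_trunc N f))) g * D g)); last first.
  by apply: eqmodM => //; apply: eqmod_comp => //; apply: eqmodE; apply: fps_truncK.
rewrite (_ : D _ * g = comp (D (fps_of_poly (fps_trunc N f))) g * D g) //.
elim/poly_ind: (fps_trunc N f) => [|p c IH].
  have -> : fps_of_poly 0 = 0 by apply/fpsP => n; rewrite fcoef0 /fps_of_poly coef0.
  by rewrite -[0]/(fps_const 0) comp_const !D_const comp_const rmorph0 !mul0r.
have -> : fps_of_poly (p * 'X + c%:P) = fps_of_poly p * pX + fps_const c.
  apply/fpsP => n; rewrite fcoefD [_ * pX]mulrC coef_pXM fcoef_const /fps_of_poly.
  by rewrite coefD coefMX coefC; case: n.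
rewrite compD compM // comp_const comp_pX // !raddfD /= !D_const !addr0.
rewrite !DM D_pX compD !compM // comp_pX //.
transitivity (D (comp (fps_of_poly p) g) * g * g + comp (fps_of_poly p) g * g * D g).
  by ring.
by rewrite IH; ring.
Qed.

Lemma comp_inj f f' g : g 0%N = 0 -> g 1%N = 1 -> comp f g = comp f' g -> f = f'.
Proof.
move=> g0 g1 e.
have h := expandP (comp f g) _ g0 g1.
have e1 : f =1 Defs.expand (comp f g) g.
  by apply/h => m; apply: eq_bigr => i _; rewrite fps_expE.
have e2 : f' =1 Defs.expand (comp f g) g.
  by apply/h => m; rewrite e; apply: eq_bigr => i _; rewrite fps_expE.
by apply/fpsP => n; rewrite e1 e2.
Qed.

Lemma comp_expand f g : g 0%N = 0 -> g 1%N = 1 -> comp (Defs.expand f g) g = f.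
Proof.
move=> g0 g1; apply/fpsP => n.
have [_ /(_ (frefl _)) ->] := expandP f (Defs.expand f g) g0 g1.
by apply: eq_bigr => i _; rewrite fps_expE.
Qed.

(** [expand] yields an inverse on one side only: h with h(g) = q. Applied to h it gives k with k(h)
    = q, and associativity forces k = g. *)
Lemma reversion g : g 0%N = 0 -> g 1%N = 1 ->
  exists h, [/\ h 0%N = 0, h 1%N = 1 & comp g h = pX].
Proof.
move=> g0 g1; pose h : fps := Defs.expand pX g; pose k : fps := Defs.expand pX h.
have hg : comp h g = pX by exact: comp_expand.
have h0 : h 0%N = 0 by rewrite -(fcoef_comp0 h g) hg.
have h1 : h 1%N = 1 by rewrite -[LHS]mulr1 -g1 -fcoef_comp1 // hg.
have kh : comp k h = pX by exact: comp_expand.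
have <- : k = g by rewrite -[LHS]comp_pXr -hg -compA // kh comp_pX.
by exists h.
Qed.

(** * The binomial series and powers with rational exponents *)

Definition binser (r : rat) : fps := gbinomial r.

Lemma fps_powrE u r : fps_powr u r = comp (binser r) (u - 1).
Proof.
have e : fps_add u (fps_const (-1)) = u - 1 by rewrite rmorphN1.
by apply/fpsP => n; rewrite /fps_powr e; apply: eq_bigr => k _; rewrite fps_expE.
Qed.

Lemma binser_ode r : (1 + pX) * D (binser r) = fps_const r * pX * binser r.
Proof.
apply/fpsP => n; rewrite mulrDl mul1r fcoefD -mulrA fcoef_constM !coef_pXM /D.
case: n => [|n]; first by rewrite mul0r mulr0 addr0.
rewrite /binser /gbinomial big_ord_recr /=.
have : n.+1%:R != 0 :> rat by rewrite pnatr_eq0.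
by move: (n.+1%:R : rat) => m m0; field.
Qed.

Lemma fps_powr_ode u r : u 0%N = 1 ->
  u * D (fps_powr u r) = fps_const r * fps_powr u r * D u.
Proof.
move=> u0; rewrite fps_powrE; set g := u - 1.
have g0 : g 0%N = 0 by rewrite /g fcoefB u0 fcoef1 subrr.
have Dg : D u = D g by rewrite /g raddfB /= [D 1]D1 subr0.
(* The chain rule determines D(f(g)) only after cancellation of g, so u = 1 is treated apart. *)
have [gz|gn0] := eqVneq g 0.
  rewrite Dg gz raddf0 mulr0 (_ : comp _ 0 = fps_const (binser r 0)) ?D_const ?mulr0 //.
  apply/fpsP => n; rewrite /comp big_ord_recl expr0 fcoef1 fcoef_const.
  rewrite big1 => [|i _]; last by rewrite exprS mul0r fcoef0 mulr0.
  by case: eqP; rewrite ?mulr1 ?mulr0 addr0.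
apply: (mulIf gn0); have /(congr1 (comp^~ g)) := binser_ode r.
have ch := D_comp (binser r) g0.
rewrite !compM // compD comp1 comp_pX // comp_const => ode.
rewrite -[LHS]mulrA ch mulrA {1}(_ : u = 1 + g) ?ode ?Dg; last by rewrite /g; ring.
by ring.
Qed.

Lemma fps_ode0 u r f : u 0%N = 1 -> u * D f = fps_const r * f * D u ->
  f 0%N = 0 -> f = 0.
Proof.
move=> u0 ode f0; apply/fpsP => n; rewrite fcoef0.
elim/ltn_ind: n => -[//|n] IH.
have /fpsP/(_ n.+1) := ode; rewrite mulrC -mulrA fcoef_constM.
rewrite !coef_low_mul //; last by move=> i /IH; rewrite /D => ->; rewrite mulr0.
by rewrite u0 coef_D0 mulr0 mulr0 mulr1 /D => /eqP; rewrite mulf_eq0 pnatr_eq0 => /eqP.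
Qed.

(** The equation is linear and its coefficients are determined recursively by the constant term, as
    [fps_ode0] shows for a difference of solutions. The laws of exponents below are proved by
    checking it for the candidate. *)
Lemma fps_powr_uniq u r f : u 0%N = 1 -> f 0%N = 1 ->
  u * D f = fps_const r * f * D u -> f = fps_powr u r.
Proof.
move=> u0 f0 ode; apply/eqP; rewrite -subr_eq0; apply/eqP/(fps_ode0 (r := r) u0).
  by rewrite raddfB /= mulrBr ode fps_powr_ode //; ring.
by rewrite fcoefB f0 fps_powr0 subrr.
Qed.

Lemma fps_powrD u r s : u 0%N = 1 ->
  fps_powr u (r + s) = fps_powr u r * fps_powr u s.
Proof.
move=> u0; apply/esym/fps_powr_uniq => //; first by rewrite fcoef_mul0 !fps_powr0 mulr1.
rewrite DM mulrDr mulrA fps_powr_ode // mulrCA [u * D (fps_powr u s)]fps_powr_ode //.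
by rewrite rmorphD; ring.
Qed.

Lemma fps_powr_powr u r s : u 0%N = 1 ->
  fps_powr (fps_powr u r) s = fps_powr u (r * s).
Proof.
move=> u0; set v := fps_powr u r; have v0 : v 0%N = 1 by exact: fps_powr0.
apply: fps_powr_uniq => //; first exact: fps_powr0.
have vn0 : v != 0 by rewrite fps_neq0 ?v0 ?oner_neq0.
apply: (mulfI vn0); rewrite mulrCA fps_powr_ode // mulrCA fps_powr_ode //.
by rewrite rmorphM -/v; ring.
Qed.

Lemma fps_powr_nat u k : u 0%N = 1 -> fps_powr u k%:R = u ^+ k.
Proof.
move=> u0; apply/esym/fps_powr_uniq => //; first by rewrite fcoef_exp0 u0 expr1n.
case: k => [|k]; first by rewrite expr0 [D 1]D1 rmorph0 mulr0 !mul0r.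
by rewrite DX rmorph_nat exprS; ring.
Qed.

Lemma fps_powrN1 u : u 0%N = 1 -> fps_powr u (-1) * u = 1.
Proof.
move=> u0; rewrite -[X in _ * X](fps_powr_nat 1) // -fps_powrD // addNr.
exact: (fps_powr_nat 0).
Qed.

(** * The substitutions of q^m and of -q for q *)

Definition dil (m : nat) f := comp f (pX ^+ m).

Section Dilation.
Variables (m : nat) (m_gt0 : (0 < m)%N).

Lemma dil_base0 : (pX ^+ m) 0%N = 0.
Proof. by rewrite coef_pXn; case: m m_gt0. Qed.
Let b0 := dil_base0.

Lemma dilD f g : dil m (f + g) = dil m f + dil m g. Proof. exact: compD. Qed.
Lemma dilM f g : dil m (f * g) = dil m f * dil m g. Proof. exact: compM. Qed.
Lemma dilX f k : dil m (f ^+ k) = dil m f ^+ k. Proof. exact: compX. Qed.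
Lemma dil_pX : dil m pX = pX ^+ m. Proof. exact: comp_pX. Qed.
Lemma dil0 f : dil m f 0%N = f 0%N. Proof. exact: fcoef_comp0. Qed.

Lemma D_dil f : D (dil m f) = m%:R * dil m (D f).
Proof.
have := D_comp f b0; rewrite D_pXn => e; apply: (mulIf (pXn_neq0 m)).
by rewrite e /dil; ring.
Qed.

Lemma coef_dil f n : dil m f n = if (m %| n)%N then f (n %/ m)%N else 0.
Proof.
rewrite /dil /comp; under eq_bigr => k _ do rewrite -exprM coef_pXn mulnC.
case: ifPn => [/dvdnP[k ->] | nd].
  have lt : (k < (k * m).+1)%N by rewrite ltnS leq_pmulr.
  rewrite (bigD1 (Ordinal lt)) //= mulnK // eqxx mulr1 big1 ?addr0 // => i ne.
  rewrite eqn_pmul2r // (_ : (k == i) = false) ?mulr0 //.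
  by apply/negbTE; apply: contraNneq ne => ke; apply/eqP/val_inj.
rewrite big1 // => i _; rewrite (_ : (n == _) = false) ?mulr0 //.
by apply/negbTE; apply: contraNneq nd => ->; rewrite dvdn_mull.
Qed.

End Dilation.

Lemma dil_dil m k f : (0 < m)%N -> (0 < k)%N -> dil m (dil k f) = dil (m * k) f.
Proof.
move=> m0 k0; rewrite /dil compA ?dil_base0 // compX ?dil_base0 //.
by rewrite comp_pX ?dil_base0 // -exprM.
Qed.

Lemma dil_1 f : dil 1 f = f. Proof. by rewrite /dil expr1 comp_pXr. Qed.

Definition fps_flip f := comp f (- pX).

Lemma flip_base0 : (- pX) 0%N = 0. Proof. by rewrite fcoefN oppr0. Qed.
Lemma fps_sign n : (-1 : fps) ^+ n = fps_const ((-1) ^+ n).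
Proof. by rewrite rmorphXn rmorphN1. Qed.
Lemma coef_flip f n : fps_flip f n = (-1) ^+ n * f n.
Proof.
rewrite /fps_flip /comp big_ord_recr /= big1 ?add0r => [|i _].
  by rewrite [(- pX) ^+ _]exprNn fps_sign fcoef_constM coef_pXn eqxx mulr1 mulrC.
rewrite [(- pX) ^+ _]exprNn fps_sign fcoef_constM coef_pXn.
by rewrite gtn_eqF ?mulr0.
Qed.
Lemma flipM f g : fps_flip (f * g) = fps_flip f * fps_flip g.
Proof. exact/compM/flip_base0. Qed.
Lemma flipX f k : fps_flip (f ^+ k) = fps_flip f ^+ k.
Proof. exact/compX/flip_base0. Qed.

(** * Integer polynomials as lists *)

Section IntegerPolynomials.

(** Lists of binary integers allow identities with large coefficients to be decided by evaluation
    ([zeqb]); [zev] transports them to every commutative ring. *)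
Fixpoint zadd (s t : seq BinInt.Z) : seq BinInt.Z :=
  match s, t with
  | [::], _ => t
  | _, [::] => s
  | a :: s', b :: t' => BinInt.Z.add a b :: zadd s' t'
  end.
Definition zscale (c : BinInt.Z) (s : seq BinInt.Z) := map (BinInt.Z.mul c) s.
Definition zsub s t := zadd s (zscale (BinNums.Zneg BinNums.xH) t).
Fixpoint zmul (s t : seq BinInt.Z) : seq BinInt.Z :=
  if s is a :: s' then zadd (zscale a t) (BinNums.Z0 :: zmul s' t) else [::].
Definition zexp (s : seq BinInt.Z) (n : nat) := iter n (zmul s) [:: BinNums.Zpos BinNums.xH].
(** The operator x d/dx, by x d/dx (a + x s) = x (s + x ds/dx). *)
Fixpoint ztheta (s : seq BinInt.Z) : seq BinInt.Z :=
  if s is _ :: s' then BinNums.Z0 :: zadd s' (ztheta s') else [::].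
Definition zeqb (s t : seq BinInt.Z) := all (BinInt.Z.eqb BinNums.Z0) (zsub s t).
(* p(x / y) y^n *)
Fixpoint zhom (n : nat) (x y p : seq BinInt.Z) : seq BinInt.Z :=
  if p is c :: p' then zadd (zscale c (zexp y n)) (zmul x (zhom n.-1 x y p')) else [::].

Definition zval (c : BinInt.Z) {A : pzRingType} : A := (int_of_Z c)%:~R.
Definition zev {A : pzRingType} (s : seq BinInt.Z) (x : A) : A :=
  foldr (fun c acc => zval c + x * acc) 0 s.

Variable A : comNzRingType.
Implicit Types (s t : seq BinInt.Z) (x y : A).

Lemma zvalD a b : zval (BinInt.Z.add a b) = zval a + zval b :> A.
Proof. by rewrite /zval (rmorphD int_of_Z) intrD. Qed.
Lemma zvalM a b : zval (BinInt.Z.mul a b) = zval a * zval b :> A.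
Proof. by rewrite /zval (rmorphM int_of_Z) intrM. Qed.

Lemma zev_add s t x : zev (zadd s t) x = zev s x + zev t x.
Proof.
elim: s t => [|a s IH] [|b t] /=; rewrite ?add0r ?addr0 //.
by rewrite IH zvalD; ring.
Qed.
Lemma zev_scale c s x : zev (zscale c s) x = zval c * zev s x.
Proof. by elim: s => [|a s IH] /=; rewrite ?mulr0 // IH zvalM; ring. Qed.
Lemma zev_sub s t x : zev (zsub s t) x = zev s x - zev t x.
Proof. by rewrite zev_add zev_scale /zval mulN1r. Qed.
Lemma zev_mul s t x : zev (zmul s t) x = zev s x * zev t x.
Proof.
elim: s => [|a s IH] /=; first by rewrite mul0r.
by rewrite zev_add zev_scale /= IH /zval rmorph0; ring.
Qed.
Lemma zev_exp s n x : zev (zexp s n) x = zev s x ^+ n.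
Proof.
elim: n => [|n IH]; first by rewrite /= /zval mulr0 addr0.
by rewrite exprS -IH -zev_mul.
Qed.
Lemma zev_eq s t x : zeqb s t -> zev s x = zev t x.
Proof.
move=> h; apply/eqP; rewrite -subr_eq0 -zev_sub; apply/eqP.
move: h; rewrite /zeqb; elim: (zsub s t) => //= -[] //= r IH /IH ->.
by rewrite /zval mulr0 addr0.
Qed.
Lemma zev_hom p n sx sy x y z : (size p <= n.+1)%N -> zev sx x = z * zev sy x ->
  zev (zhom n sx sy p) x = zev p z * zev sy x ^+ n.
Proof.
move=> hp e; elim: p n hp => [|c p IH] n hp /=; first by rewrite mul0r.
rewrite zev_add zev_scale zev_exp zev_mul e.
case: n hp => [|n] hp; first by case: p hp {IH} => //= _; rewrite expr0; ring.
by rewrite IH //= exprS; ring.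
Qed.

Definition zevE := (zev_exp, zev_sub, zev_add, zev_scale, zev_mul).

End IntegerPolynomials.

Lemma zval_morph (A B : pzRingType) (h : {rmorphism A -> B}) c : h (zval c) = zval c.
Proof. exact: rmorph_int. Qed.

Lemma zpolyE s : zpoly s = zev s 'X.
Proof.
rewrite /zpoly; elim: s => [|c s IH] //=.
by rewrite cons_poly_def IH addrC mulrC; congr (_ + _); rewrite rmorph_int.
Qed.

Lemma horner_zpoly (A : comNzRingType) (h : {rmorphism rat -> A}) s (x : A) :
  (map_poly h (zpoly s)).[x] = zev s x.
Proof.
rewrite zpolyE; elim: s => [|c s IH] /=; first by rewrite rmorph0 horner0.
rewrite rmorphD rmorphM /= map_polyX !hornerE IH; congr (_ + _).
by rewrite !zval_morph /zval -(rmorph_int (@polyC A)) hornerC.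
Qed.

Lemma zval_fps c : zval c = fps_const (zval c).
Proof. by rewrite zval_morph. Qed.

Lemma D_zval c : D (zval c) = 0. Proof. by rewrite zval_fps D_const. Qed.

Lemma comp_zev s f g : g 0%N = 0 -> comp (zev s f) g = zev s (comp f g).
Proof.
move=> g0; elim: s => [|c s IH] /=; first by rewrite -[0]/(fps_const 0) comp_const.
by rewrite compD compM // IH zval_fps comp_const.
Qed.

Lemma D_zev s f g : D f = f * g -> D (zev s f) = zev (ztheta s) f * g.
Proof.
move=> Df; elim: s => [|c s IH] /=; first by rewrite raddf0 mul0r.
rewrite raddfD /= [D (zval c)]D_zval DM IH Df zev_add /zval rmorph0; ring.
Qed.

Lemma zev_coef0 s f : f 0%N = 0 -> (zev s f) 0%N = zval (head BinNums.Z0 s).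
Proof.
case: s => [|c s] f0 /=; first by rewrite fcoef0.
by rewrite fcoefD fcoef_mul0 f0 mul0r addr0 zval_fps.
Qed.

(** * Generating series of weighted index sets *)

Section LatticeSums.

(** The series of all w i q^(e i) with i in A. The sum over a fibre of e is 0 by default when
    infinitely many of its terms are nonzero; [fibfin] rules this out. *)
Definition gsum (I : choiceType) (A : set I) (e : I -> nat) (w : I -> rat) : fps :=
  fun n => \sum_(i \in A `&` [set i | e i = n]) w i.

Definition fibfin (I : choiceType) (A : set I) (e : I -> nat) :=
  forall n, finite_set (A `&` [set i | e i = n]).

Lemma gsum_seq (I : choiceType) (A : set I) e w n (r : seq I) :
  uniq r -> (forall i, A i -> e i = n -> i \in r) ->
  gsum A e w n = \sum_(i <- r | (i \in A) && (e i == n)) w i.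
Proof.
move=> ur hr; rewrite /gsum.
rewrite (fsbigE [seq i <- r | (i \in A) && (e i == n)]) ?filter_uniq //.
- rewrite big_filter_cond; apply: eq_bigl => i.
  by apply: andb_idr => /andP[Ai /eqP ei]; rewrite inE; split=> //; exact/set_mem.
- move=> i /=; rewrite mem_filter => /andP[/andP[Ai /eqP ei] _].
  by split=> //; exact/set_mem.
- move=> i [Ai ei]; rewrite mem_filter (hr _ Ai ei) andbT => /negP[].
  by rewrite (mem_set Ai) /= ei.
Qed.

Lemma fibfin_seq (I : choiceType) (A : set I) e n : fibfin A e ->
  exists2 r : seq I, uniq r & forall i, A i -> (e i < n)%N -> i \in r.
Proof.
move=> fin; elim: n => [|n [r ur hr]]; first by exists [::].
exists (undup (r ++ finmap.enum_fset (fset_set (A `&` [set i | e i = n])))); first exact: undup_uniq.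
move=> i Ai; rewrite mem_undup mem_cat ltnS leq_eqVlt => /orP[/eqP ei|/(hr _ Ai) -> //].
by apply/orP; right; rewrite in_fset_set // mem_set.
Qed.

Lemma eq_gsum (I : choiceType) (A : set I) e e' w w' :
  (forall i, A i -> e i = e' i) -> (forall i, A i -> w i = w' i) ->
  gsum A e w = gsum A e' w'.
Proof.
move=> ee ww; apply/fpsP => n; rewrite /gsum.
rewrite (_ : A `&` [set i | e i = n] = A `&` [set i | e' i = n]); last first.
  by apply/seteqP; split=> i [Ai] /= h; split=> //=; rewrite -h ee.
by apply: eq_fsbigr => i; rewrite inE => -[Ai _]; apply: ww.
Qed.

Lemma gsum_reindex (I J : choiceType) (h : J -> I) (B : set J) (A : set I) e w :
  set_bij B A h -> gsum A e w = gsum B (e \o h) (w \o h).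
Proof.
move=> [hf hi hs]; apply/fpsP => n; apply: reindex_fsbig; split.
- by move=> j [Bj /= ej]; split=> //; apply: hf.
- by move=> i j; rewrite !inE => -[Bi _] [Bj _]; apply: hi; rewrite inE.
- by move=> i [/hs[j Bj <-] /= ei]; exists j.
Qed.

Lemma gsumID (I : choiceType) (C A : set I) e w : fibfin A e ->
  gsum A e w = gsum (A `&` C) e w + gsum (A `&` ~` C) e w.
Proof.
move=> fin; apply/fpsP => n; rewrite fcoefD /gsum (fsbigID C) //.
by rewrite [A `&` _ `&` C]setIAC [A `&` _ `&` ~` C]setIAC.
Qed.

Lemma fibfinS (I : choiceType) (A B : set I) e : fibfin A e -> B `<=` A -> fibfin B e.
Proof.
by move=> fin BA n; apply: sub_finite_set (fin n) => i [/BA Ai ei]; split.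
Qed.

Lemma gsumD (I : choiceType) (A : set I) e w w' : fibfin A e ->
  gsum A e (fun i => w i + w' i) = gsum A e w + gsum A e w'.
Proof. by move=> fin; apply/fpsP => n; rewrite fcoefD /gsum fsbig_split. Qed.

Lemma gsumZ (I : choiceType) (A : set I) e w c : fibfin A e ->
  gsum A e (fun i => c * w i) = fps_const c * gsum A e w.
Proof.
move=> fin; apply/fpsP => n; rewrite fcoef_constM /gsum.
by rewrite !fsbig_finite // mulr_sumr.
Qed.

Lemma D_gsum (I : choiceType) (A : set I) e w : fibfin A e ->
  D (gsum A e w) = gsum A e (fun i => (e i)%:R * w i).
Proof.
move=> fin; apply/fpsP => n; rewrite /D /gsum !fsbig_finite // mulr_sumr.
rewrite big_seq [RHS]big_seq; apply: eq_bigr => i.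
by rewrite in_fset_set // inE => -[_ /= ->].
Qed.

Lemma fibfinX (I J : choiceType) (A : set I) (B : set J) e e' :
  fibfin A e -> fibfin B e' -> fibfin (A `*` B) (fun p => e p.1 + e' p.2)%N.
Proof.
move=> fA fB n.
have [r _ hr] := fibfin_seq n.+1 fA; have [s _ hs] := fibfin_seq n.+1 fB.
apply: (@sub_finite_set _ _ [set` [seq (i, j) | i <- r, j <- s]]); last exact: finite_seq.
move=> [i j] [[/= Ai Bj] en] /=; apply/allpairsP; exists (i, j) => /=.
by rewrite hr ?hs //; lia.
Qed.

Lemma gsumM (I J : choiceType) (A : set I) (B : set J) e e' w w' :
  fibfin A e -> fibfin B e' ->
  gsum A e w * gsum B e' w' =
  gsum (A `*` B) (fun p => e p.1 + e' p.2)%N (fun p => w p.1 * w' p.2).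
Proof.
move=> fA fB; apply/fpsP => n.
have [r ur hr] := fibfin_seq n.+1 fA; have [s us hs] := fibfin_seq n.+1 fB.
rewrite (gsum_seq _ (r := [seq (i, j) | i <- r, j <- s])).
- rewrite fcoef_mul [RHS]big_mkcond big_allpairs_dep /=.
  transitivity (\sum_(k < n.+1) \sum_(i <- r) \sum_(j <- s)
     (if [&& i \in A, e i == k, j \in B & e' j == n - k]%N then w i * w' j else 0)).
    apply: eq_bigr => k _; have := ltn_ord k => lk.
    rewrite (gsum_seq _ (r := r)) // => [|i Ai ei]; last by apply: hr => //; lia.
    rewrite (gsum_seq _ (r := s)) // => [|j Bj ej]; last by apply: hs => //; lia.
    rewrite [in LHS]big_mkcond mulr_suml; apply: eq_bigr => i _ /=.
    rewrite [in LHS]big_mkcond mulr_sumr; apply: eq_bigr => j _ /=.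
    rewrite andbA; case: (_ && _); rewrite ?mul0r //=.
    by case: (_ && _); rewrite ?mulr0.
  rewrite exchange_big; apply: eq_bigr => i _; rewrite exchange_big; apply: eq_bigr => j _ /=.
  have -> : ((i, j) \in A `*` B) = (i \in A) && (j \in B).
    by apply/idP/andP; rewrite !inE.
  case: (i \in A) => /=; last by rewrite big1.
  case: (j \in B) => /=; last by rewrite big1 // => k _; rewrite andbF.
  case: eqP => [en | ne].
    have lt : (e i < n.+1)%N by lia.
    rewrite (bigD1 (Ordinal lt)) //= eqxx /= ifT; last by apply/eqP; lia.
    rewrite big1 ?addr0 // => k /eqP ne; rewrite ifF //; apply/negbTE.
    by apply/negP => /andP[/eqP ek _]; apply: ne; apply: val_inj; rewrite /= ek.
  rewrite big1 // => k _; rewrite ifF //; apply/negbTE/negP => /andP[/eqP e1 /eqP e2].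
  by apply: ne; have := ltn_ord k; lia.
- by apply: allpairs_uniq => // -[? ?] [? ?] _ _ /= [-> ->].
- move=> [i j] [/= Ai Bj] en; apply/allpairsP; exists (i, j) => /=.
  by rewrite hr ?hs //; lia.
Qed.

Lemma gsum_sum (I : choiceType) (A : set I) e (N : I -> nat) (w : I * nat -> rat) :
  fibfin A e ->
  gsum [set p | A p.1 /\ (p.2 < N p.1)%N] (fun p => e p.1) w =
  gsum A e (fun i => \sum_(a < N i) w (i, nat_of_ord a)).
Proof.
move=> fA; apply/fpsP => n; have [r ur hr] := fibfin_seq n.+1 fA.
rewrite (gsum_seq _ (r := r)) // => [|i Ai ei]; last by apply: hr => //; lia.
rewrite (gsum_seq _ (r := [seq (i, a) | i <- r, a <- iota 0 (N i)])).
- rewrite big_mkcond big_allpairs_dep /= [RHS]big_mkcond; apply: eq_bigr => i _ /=.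
  transitivity (\sum_(a <- iota 0 (N i))
     (if (i \in A) && (e i == n) then w (i, a) else 0)).
    rewrite big_seq [RHS]big_seq; apply: eq_bigr => a; rewrite mem_iota /= => h.
    suff -> : ((i, a) \in [set p | A p.1 /\ (p.2 < N p.1)%N]) = (i \in A) by [].
    by apply/idP/idP; rewrite !inE /= => // -[].
  case: ifP => _; last by rewrite big1.
  by rewrite -[in LHS](subn0 (N i)) -/(index_iota 0 (N i)) big_mkord.
- by apply: allpairs_uniq_dep => // [i _|[? ?] [? ?] _ _ /= [-> ->]] //; exact: iota_uniq.
- move=> [i a] [/= Ai la] ei; apply/allpairsPdep; exists i, a.
  by rewrite mem_iota /= hr //; lia.
Qed.

End LatticeSums.

(** * Lambert series and Skoruppa's bijection *)

Section Lambert.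

Definition pos2 : set (nat * nat) := [set p | (0 < p.1)%N /\ (0 < p.2)%N].

Lemma fibfin_pos2 : fibfin pos2 (fun p => p.1 * p.2)%N.
Proof.
move=> n; apply: (@sub_finite_set _ _ [set` [seq (i, j) | i <- iota 1 n, j <- iota 1 n]]).
  move=> [i j] [[/= i0 j0] en] /=; apply/allpairsP; exists (i, j) => /=.
  by rewrite !mem_iota !add1n !ltnS i0 j0 -en leq_pmulr ?leq_pmull.
exact: finite_seq.
Qed.

Definition lambert (w : rat -> rat -> rat) : fps :=
  gsum pos2 (fun p => p.1 * p.2)%N (fun p => w p.1%:R p.2%:R).

(** The coefficient of q^n is the divisor sum sigma_k(n). *)
Definition Sig k : fps := lambert (fun d _ => d ^+ k).

Lemma lambertD w w' : lambert (fun d z => w d z + w' d z) = lambert w + lambert w'.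
Proof. exact/gsumD/fibfin_pos2. Qed.
Lemma lambertZ c w : lambert (fun d z => c * w d z) = fps_const c * lambert w.
Proof. exact/gsumZ/fibfin_pos2. Qed.
Lemma D_Sig k : D (Sig k) = lambert (fun d z => z * d ^+ k.+1).
Proof.
rewrite D_gsum; last exact: fibfin_pos2.
by apply: eq_gsum => // -[d z] _ /=; rewrite natrM exprS; ring.
Qed.

Lemma coef_Sig k n :
  Sig k n = \sum_(1 <= j < n.+1 | (0 < n)%N && (j %| n)%N) j%:R ^+ k.
Proof.
have u1 m : uniq (iota 1 m) by exact: iota_uniq.
rewrite /Sig /lambert (gsum_seq _ (r := [seq (i, j) | i <- iota 1 n, j <- iota 1 n])).
- rewrite big_mkcond big_allpairs /= [RHS]big_mkcond /index_iota subSS subn0.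
  rewrite big_seq [RHS]big_seq; apply: eq_bigr => d; rewrite mem_iota add1n ltnS => /andP[d0 dn].
  have -> /= : (0 < n)%N by lia.
  case: ifPn => [/dvdnP[z nz] | nd].
    rewrite (bigD1_seq z) ?mem_iota //=; last by nia.
    have -> /= : ((d, z) \in pos2) by rewrite inE /pos2 /=; nia.
    rewrite nz mulnC eqxx big1 ?addr0 // => i iz; rewrite ifF //.
    apply/negbTE/negP => /andP[_ /eqP]; move/eqP: iz; nia.
  rewrite big1 // => z _; rewrite ifF //; apply/negbTE/negP => /andP[_ /eqP e].
  by case/negP: nd; rewrite -e dvdn_mulr.
- by apply: allpairs_uniq => // -[? ?] [? ?] _ _ /= [-> ->].
- move=> [i j] [/= i0 j0] en; apply/allpairsP; exists (i, j) => /=.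
  by rewrite !mem_iota !add1n !ltnS i0 j0 -en leq_pmulr ?leq_pmull.
Qed.

Definition pos4 : set ((nat * nat) * (nat * nat)) := pos2 `*` pos2.
Definition e4 (p : (nat * nat) * (nat * nat)) := (p.1.1 * p.1.2 + p.2.1 * p.2.2)%N.
Definition w4 (h : rat -> rat -> rat) (p : (nat * nat) * (nat * nat)) := h p.1.1%:R p.2.1%:R.

Lemma fibfin_pos4 : fibfin pos4 e4.
Proof. exact: fibfinX fibfin_pos2 fibfin_pos2. Qed.

Lemma Sig_mul r s : Sig r * Sig s = gsum pos4 e4 (w4 (fun a b => a ^+ r * b ^+ s)).
Proof. exact: gsumM fibfin_pos2 fibfin_pos2. Qed.

Let swap4 (p : (nat * nat) * (nat * nat)) := (p.2, p.1).

Lemma gsum_swap4 (P Q : set ((nat * nat) * (nat * nat))) (h : rat -> rat -> rat) :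
  (forall a b, h a b = h b a) -> (forall p, Q p <-> P (swap4 p)) ->
  gsum (pos4 `&` P) e4 (w4 h) = gsum (pos4 `&` Q) e4 (w4 h).
Proof.
move=> hC PQ; rewrite (@gsum_reindex _ _ swap4 (pos4 `&` Q)).
  by apply: eq_gsum => -[[a x] [b y]] _; rewrite /e4 /w4 /= 1?addnC 1?hC.
split.
- by move=> [[a x] [b y]] [[p1 p2] /PQ Pp]; split.
- by move=> [[a x] [b y]] [[a' x'] [b' y']] _ _ [-> -> -> ->].
- by move=> [[a x] [b y]] [[p1 p2] Pp]; exists ((b, y), (a, x)) => //; split=> //; apply/PQ.
Qed.

(* The substitution (a, x), (b, y) |-> (a + b, x), (b, y - x) maps the solutions
   of a x + b y = n with x < y bijectively onto those with a > b. *)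
Lemma gsum_shear (h : rat -> rat -> rat) :
  gsum (pos4 `&` [set p | (p.1.2 < p.2.2)%N]) e4 (w4 h) =
  gsum (pos4 `&` [set p | (p.2.1 < p.1.1)%N]) e4 (w4 (fun a b => h (a - b) b)).
Proof.
pose sh (p : (nat * nat) * (nat * nat)) :=
  ((p.1.1 - p.2.1, p.1.2), (p.2.1, p.2.2 + p.1.2))%N.
rewrite (@gsum_reindex _ _ sh (pos4 `&` [set p | (p.2.1 < p.1.1)%N])).
  apply: eq_gsum => -[[a x] [b y]] [_ /= lt]; rewrite /e4 /w4 /=; first by nia.
  by rewrite natrB // ltnW.
split.
- by move=> [[a x] [b y]] [[[/= a0 x0] [/= b0 y0]] /= lt]; do !split => /=; lia.
- move=> [[a x] [b y]] [[a' x'] [b' y']]; rewrite !inE /= => -[_ /= l1] [_ /= l2] [].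
  by move=> e1 -> e2 e3; congr ((_, _), (_, _)); lia.
- move=> [[a x] [b y]] [[[/= a0 x0] [/= b0 y0]] /= lt].
  exists ((a + b, x), (b, y - x))%N; first by do !split => /=; lia.
  by rewrite /sh /=; congr ((_, _), (_, _)); lia.
Qed.

Lemma gsum4_trichotomy (c : (nat * nat) * (nat * nat) -> nat * nat) (h : rat -> rat -> rat) :
  (forall a b, h a b = h b a) ->
  (forall p, c (swap4 p) = ((c p).2, (c p).1)) ->
  gsum pos4 e4 (w4 h) = gsum (pos4 `&` [set p | (c p).1 = (c p).2]) e4 (w4 h)
    + 2%:R * gsum (pos4 `&` [set p | ((c p).2 < (c p).1)%N]) e4 (w4 h).
Proof.
move=> hC cC; have fin := fibfin_pos4.
rewrite (gsumID [set p | (c p).1 = (c p).2]) //; congr (_ + _).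
rewrite (gsumID [set p | ((c p).2 < (c p).1)%N]); last exact: fibfinS fin (@subIsetl _ _ _).
rewrite -[pos4 `&` ~` _ `&` [set _ | _]]setIA -[pos4 `&` ~` _ `&` ~` _]setIA.
rewrite (_ : ~` _ `&` [set p | ((c p).2 < (c p).1)%N] =
    [set p | ((c p).2 < (c p).1)%N]); last first.
  by apply/seteqP; split=> [p []// | p /= lt]; split=> //= e; move: lt; rewrite e ltnn.
rewrite -(@gsum_swap4 [set p | ((c p).2 < (c p).1)%N]) //; first by ring.
move=> p; rewrite /= cC /=; split=> [[n1 /negP n2]|lt]; first by lia.
by split; [move=> e; move: lt; rewrite e ltnn | apply/negP; lia].
Qed.

(** The sum S(h) over all quadruples is split twice, by a against b and by x against y. Symmetry
    gives S(h) = S_{a=b}(h) + 2 S_{a>b}(h) and S(h) = S_{x=y}(h) + 2 S_{x<y}(h), and [gsum_shear]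
    turns the last sum into that of h(a - b, b) over a > b. Hence the sum of g over a > b is a
    difference of diagonals, and S(g) = S_{x=y}(h) - S_{a=b}(h(0, b)). Both diagonals are Lambert
    series. *)
Lemma skoruppa (h g : rat -> rat -> rat) :
  (forall a b, h a b = h b a) -> (forall a b, g a b = g b a) ->
  (forall a b, g a b = h a b - h (a - b) b) ->
  gsum pos4 e4 (w4 g) =
  lambert (fun d z => \sum_(a < Num.truncn d) h a%:R (d - a%:R) - h 0 d
                      - (z - 1) * h 0 d).
Proof.
move=> hC gC gE; have fin := fibfin_pos4.
have finS P : fibfin (pos4 `&` P) e4 by exact: fibfinS fin (@subIsetl _ _ _).
have T1 := gsum4_trichotomy (c := fun p => (p.1.1, p.2.1)) hC (fun=> erefl).
have T2 := gsum4_trichotomy (c := fun p => (p.2.2, p.1.2)) hC (fun=> erefl).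
have T3 := gsum4_trichotomy (c := fun p => (p.1.1, p.2.1)) gC (fun=> erefl).
rewrite /= in T1 T2 T3; rewrite gsum_shear in T2.
have T4 : gsum (pos4 `&` [set p | (p.2.1 < p.1.1)%N]) e4 (w4 g) =
    gsum (pos4 `&` [set p | (p.2.1 < p.1.1)%N]) e4 (w4 h)
    - gsum (pos4 `&` [set p | (p.2.1 < p.1.1)%N]) e4 (w4 (fun a b => h (a - b) b)).
  rewrite -[X in _ = _ - X]mul1r -mulNr -(rmorphN1 fps_const) -gsumZ // -gsumD //.
  by apply: eq_gsum => // p _; rewrite /w4 gE mulN1r.
have -> : gsum pos4 e4 (w4 g) =
   gsum (pos4 `&` [set p | p.2.2 = p.1.2]) e4 (w4 h) +
   gsum (pos4 `&` [set p | p.1.1 = p.2.1]) e4 (w4 (fun _ b => - h 0 b)).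
  have -> : gsum (pos4 `&` [set p | p.1.1 = p.2.1]) e4 (w4 (fun _ b => - h 0 b)) =
    gsum (pos4 `&` [set p | p.1.1 = p.2.1]) e4 (w4 g)
    - gsum (pos4 `&` [set p | p.1.1 = p.2.1]) e4 (w4 h).
    rewrite -[X in _ = _ - X]mul1r -mulNr -(rmorphN1 fps_const) -gsumZ // -gsumD //.
    apply: eq_gsum => // -[[a x] [b y]] [_ /= ab]; rewrite /w4 /= gE ab subrr mulN1r; ring.
  rewrite T3 T4.
  apply: (addrI (gsum pos4 e4 (w4 h))); rewrite {1}T2 {1}T1.
  ring.
have -> : gsum (pos4 `&` [set p | p.2.2 = p.1.2]) e4 (w4 h) =
    lambert (fun d z => \sum_(a < Num.truncn d) h a%:R (d - a%:R) - h 0 d).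
  (* On x = y put d = a + b and z = x; the fibre over (d, z) is 0 < a < d, with a = [p.2.+1]
     numbered from 0. *)
  rewrite (@gsum_reindex _ _ (fun p => ((p.2.+1, p.1.2), (p.1.1 - p.2.+1, p.1.2))%N)
    [set p | pos2 p.1 /\ (p.2 < p.1.1.-1)%N]); last first.
    split.
    - by move=> [[d z] a] [[/= d0 z0] /= lt]; do !split => /=; lia.
    - move=> [[d z] a] [[d' z'] a']; rewrite !inE /= => -[[/= _ _] l1] [[/= _ _] l2] [] e1 e2 e3 _.
      by congr ((_, _), _); lia.
    - move=> [[a x] [b y]] [[[/= a0 x0] [/= b0 y0]] /= ee].
      exists ((a + b, x), a.-1)%N; first by do !split => /=; lia.
      by rewrite /=; congr ((_, _), (_, _)); lia.
  pose w (p : (nat * nat) * nat) : rat := h p.2.+1%:R (p.1.1%:R - p.2.+1%:R).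
  transitivity (gsum [set p | pos2 p.1 /\ (p.2 < p.1.1.-1)%N] (fun p => p.1.1 * p.1.2)%N w).
    apply: eq_gsum => -[[d z] a] [[/= d0 z0] /= lt]; rewrite /e4 /w4 /w /=; first by nia.
    by rewrite natrB //; lia.
  rewrite (gsum_sum (fun p => p.1.-1) w fibfin_pos2); apply: eq_gsum => // -[d z] [/= d0 z0].
  rewrite /w /= natrK; case: d d0 => // d _ /=.
  by rewrite big_ord_recl /= mulr0n subr0 [_ + \sum_(_ < _) _]addrC addrK.
have -> : gsum (pos4 `&` [set p | p.1.1 = p.2.1]) e4 (w4 (fun _ b => - h 0 b)) =
    lambert (fun d z => - ((z - 1) * h 0 d)).
  (* On a = b = d put z = x + y, which leaves z - 1 choices of x. *)
  rewrite (@gsum_reindex _ _ (fun p => ((p.1.1, p.2.+1), (p.1.1, p.1.2 - p.2.+1))%N)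
    [set p | pos2 p.1 /\ (p.2 < p.1.2.-1)%N]); last first.
    split.
    - by move=> [[d z] a] [[/= d0 z0] /= lt]; do !split => /=; lia.
    - move=> [[d z] a] [[d' z'] a']; rewrite !inE /= => -[[/= _ _] l1] [[/= _ _] l2] [] e1 e2 _ e3.
      by congr ((_, _), _); lia.
    - move=> [[a x] [b y]] [[[/= a0 x0] [/= b0 y0]] /= ee].
      exists ((a, x + y), x.-1)%N; first by do !split => /=; lia.
      by rewrite /=; congr ((_, _), (_, _)); lia.
  pose w (p : (nat * nat) * nat) : rat := - h 0 p.1.1%:R.
  transitivity (gsum [set p | pos2 p.1 /\ (p.2 < p.1.2.-1)%N] (fun p => p.1.1 * p.1.2)%N w).
    by apply: eq_gsum => -[[d z] a] [[/= d0 z0] /= lt]; rewrite /e4 /w4 /w //=; nia.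
  rewrite (gsum_sum (fun p => p.2.-1) w fibfin_pos2); apply: eq_gsum => // -[d z] [/= d0 z0].
  rewrite /w /= sumr_const card_ord; case: z z0 => // z _ /=.
  by rewrite -mulr_natl -[z.+1%:R]natr1; ring.
by rewrite -lambertD.
Qed.

Lemma conv4D (g g' : rat -> rat -> rat) :
  gsum pos4 e4 (w4 (fun a b => g a b + g' a b)) =
  gsum pos4 e4 (w4 g) + gsum pos4 e4 (w4 g').
Proof. exact/gsumD/fibfin_pos4. Qed.

Lemma conv4Z c r s :
  gsum pos4 e4 (w4 (fun a b => c * (a ^+ r * b ^+ s))) = fps_const c * (Sig r * Sig s).
Proof. by rewrite Sig_mul -gsumZ //; apply: fibfin_pos4. Qed.

Lemma eq_lambert_nat (w w' : rat -> rat -> rat) :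
  (forall d z : nat, w d%:R z%:R = w' d%:R z%:R) -> lambert w = lambert w'.
Proof. by move=> e; apply: eq_gsum => // i _; apply: e. Qed.

End Lambert.

(** * Convolutions of divisor sums and Ramanujan's differential equations *)

Section Ramanujan.

Lemma sum_rec (F : rat -> rat) (G : nat -> rat) : F 0 = 0 ->
  (forall n : nat, F (n%:R + 1) = F n%:R + G n) -> forall n : nat, \sum_(a < n) G a = F n%:R.
Proof.
move=> F0 FS; elim=> [|n IH]; first by rewrite big_ord0 F0.
by rewrite big_ord_recr /= IH -FS natr1.
Qed.

(** Here and in [Sig13], [Sig15] the function h is a multiple of a^n + b^n + (a + b)^n with n = 2,
    4, 6, so that h(a, b) - h(a - b, b) is a multiple of (a + b)^n - (a - b)^n, in which a and b
    occur to odd powers only. The [F] passed to [sum_rec] is the closed form of the sum over a. *)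
Lemma Sig11 : 12%:R * Sig 1 ^+ 2 = 5%:R * Sig 3 + Sig 1 - 6%:R * D (Sig 1).
Proof.
have := @skoruppa (fun a b => 6 * (a ^+ 2 + a * b + b ^+ 2)) (fun a b => 12 * (a ^+ 1 * b ^+ 1)).
rewrite conv4Z => e; rewrite -[Sig 1 ^+ 2]/(Sig 1 * Sig 1) -(rmorph_nat fps_const) e; first last.
- by move=> a b; ring.
- by move=> a b; ring.
- by move=> a b; ring.
rewrite D_Sig -(rmorph_nat fps_const 5) -mulNr -(rmorph_nat fps_const 6) -rmorphN.
rewrite -!lambertZ -!lambertD; apply: eq_lambert_nat => d z; rewrite natrK.
rewrite (sum_rec (G := fun a => 6 * (a%:R ^+ 2 + a%:R * (d%:R - a%:R) + (d%:R - a%:R) ^+ 2))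
  (F := fun n => 2 * n ^+ 3 - 3 * n ^+ 2 + n - 3 * n * (n - 1) * d%:R + 6 * n * d%:R ^+ 2)); last 2 first.
- by ring.
- by move=> n; ring.
by move: (d%:R : rat) (z%:R : rat) => x y; ring.
Qed.

Lemma Sig13 :
  240%:R * (Sig 1 * Sig 3) = 21%:R * Sig 5 + 10%:R * Sig 3 - Sig 1 - 30%:R * D (Sig 3).
Proof.
have := @skoruppa (fun a b => 15 * (a ^+ 4 + b ^+ 4 + (a + b) ^+ 4))
  (fun a b => 120 * (a ^+ 1 * b ^+ 3) + 120 * (a ^+ 3 * b ^+ 1)).
rewrite conv4D 2!conv4Z => e.
have -> : 240%:R * (Sig 1 * Sig 3) =
    fps_const 120 * (Sig 1 * Sig 3) + fps_const 120 * (Sig 3 * Sig 1).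
  by rewrite rmorph_nat; ring.
rewrite e; first last.
- by move=> a b; ring.
- by move=> a b; ring.
- by move=> a b; ring.
rewrite D_Sig -(rmorph_nat fps_const 21) -(rmorph_nat fps_const 10).
rewrite -[- Sig 1]mulN1r -[- (_ * lambert _)]mulNr -(rmorphN1 fps_const).
rewrite -(rmorph_nat fps_const 30) -rmorphN.
rewrite -!lambertZ -!lambertD; apply: eq_lambert_nat => d z; rewrite natrK.
(* P(n) is 15 (1^4 + ... + n^4) in Faulhaber's form. *)
pose P (n : rat) := (6 * n ^+ 5 + 15 * n ^+ 4 + 10 * n ^+ 3 - n) / 2.
rewrite (sum_rec (G := fun a => 15 * (a%:R ^+ 4 + (d%:R - a%:R) ^+ 4 + (a%:R + (d%:R - a%:R)) ^+ 4))
  (F := fun n => P n - 15 * n ^+ 4 + (P d%:R - P (d%:R - n)) + 15 * n * d%:R ^+ 4)); last 2 first.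
- by rewrite /P; field.
- by move=> n; rewrite /P; field.
by rewrite /P; move: (d%:R : rat) (z%:R : rat) => x y; field.
Qed.

(** With h = 30 (a b (a + b))^2 the difference h(a, b) - h(a - b, b) is the single monomial 120 a^3
    b^3. *)
Lemma Sig33 : 120%:R * Sig 3 ^+ 2 = Sig 7 - Sig 3.
Proof.
have := @skoruppa (fun a b => 30 * (a ^+ 2 * b ^+ 2 * (a + b) ^+ 2))
  (fun a b => 120 * (a ^+ 3 * b ^+ 3)).
rewrite conv4Z => e; rewrite -[Sig 3 ^+ 2]/(Sig 3 * Sig 3) -(rmorph_nat fps_const) e; first last.
- by move=> a b; ring.
- by move=> a b; ring.
- by move=> a b; ring.
rewrite -[- Sig 3]mulN1r -(rmorphN1 fps_const).
rewrite -!lambertZ -!lambertD; apply: eq_lambert_nat => d z; rewrite natrK.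
rewrite (sum_rec (G := fun a => 30 * (a%:R ^+ 2 * (d%:R - a%:R) ^+ 2 * (a%:R + (d%:R - a%:R)) ^+ 2))
  (F := fun n => d%:R ^+ 2 * (d%:R ^+ 2 * (10 * n ^+ 3 - 15 * n ^+ 2 + 5 * n)
   - 15 * d%:R * n ^+ 2 * (n - 1) ^+ 2 + (6 * n ^+ 5 - 15 * n ^+ 4 + 10 * n ^+ 3 - n)))); last 2 first.
- by ring.
- by move=> n; ring.
by move: (d%:R : rat) (z%:R : rat) => x y; ring.
Qed.

(** The expansion of (a + b)^6 - (a - b)^6 also contains a^3 b^3, so this convolution comes together
    with that of [Sig33], by which [D_Rser] eliminates it along with [Sig 7]. *)
Lemma Sig15 : 504%:R * (Sig 1 * Sig 5) + 840%:R * Sig 3 ^+ 2 =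
  27%:R * Sig 7 + 21%:R * Sig 5 - 7%:R * Sig 3 + Sig 1 - 42%:R * D (Sig 5).
Proof.
have := @skoruppa (fun a b => 21 * (a ^+ 6 + b ^+ 6 + (a + b) ^+ 6))
  (fun a b => 252 * (a ^+ 1 * b ^+ 5) + 840 * (a ^+ 3 * b ^+ 3) + 252 * (a ^+ 5 * b ^+ 1)).
rewrite 2!conv4D 3!conv4Z => e.
have -> : 504%:R * (Sig 1 * Sig 5) + 840%:R * Sig 3 ^+ 2 =
    fps_const 252 * (Sig 1 * Sig 5) + fps_const 840 * (Sig 3 * Sig 3)
    + fps_const 252 * (Sig 5 * Sig 1).
  by rewrite !rmorph_nat; ring.
rewrite e; first last.
- by move=> a b; ring.
- by move=> a b; ring.
- by move=> a b; ring.
rewrite D_Sig -(rmorph_nat fps_const 27) -(rmorph_nat fps_const 21).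
rewrite -[- (_ * lambert _)]mulNr -[- (_ * Sig 3)]mulNr.
rewrite -(rmorph_nat fps_const 42) -(rmorph_nat fps_const 7) -!rmorphN.
rewrite -!lambertZ -!lambertD; apply: eq_lambert_nat => d z; rewrite natrK.
pose P (n : rat) := (6 * n ^+ 7 + 21 * n ^+ 6 + 21 * n ^+ 5 - 7 * n ^+ 3 + n) / 2.
rewrite (sum_rec (G := fun a => 21 * (a%:R ^+ 6 + (d%:R - a%:R) ^+ 6 + (a%:R + (d%:R - a%:R)) ^+ 6))
  (F := fun n => P n - 21 * n ^+ 6 + (P d%:R - P (d%:R - n)) + 21 * n * d%:R ^+ 6)); last 2 first.
- by rewrite /P; field.
- by move=> n; rewrite /P; field.
by rewrite /P; move: (d%:R : rat) (z%:R : rat) => x y; field.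
Qed.

(** With [Qser] these are Ramanujan's P, Q, R, the Eisenstein series of weights 2, 4 and 6. *)
Definition Pser : fps := 1 - 24%:R * Sig 1.
Definition Rser : fps := 1 - 504%:R * Sig 5.

Lemma Qser_Sig : Qser = 1 + 240%:R * Sig 3.
Proof.
apply/fpsP => n; rewrite fcoefD fcoef1 -(rmorph_nat fps_const) fcoef_constM coef_Sig.
rewrite /Qser; case: n => [|n] /=; first by rewrite big_geq // mulr0 addr0.
by rewrite add0r.
Qed.

Lemma D_Pser : 12%:R * D Pser = Pser ^+ 2 - Qser.
Proof.
rewrite /Pser raddfB /= [D 1]D1 D_natM Qser_Sig.
transitivity (48%:R * (6%:R * D (Sig 1)) * (-1)); first by ring.
by rewrite (_ : 6%:R * D (Sig 1) = 5%:R * Sig 3 + Sig 1 - 12%:R * Sig 1 ^+ 2);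
  [ring | rewrite Sig11; ring].
Qed.

Lemma D_Qser : 3%:R * D Qser = Pser * Qser - Rser.
Proof.
rewrite /Pser /Rser Qser_Sig raddfD /= [D 1]D1 D_natM add0r.
transitivity (24%:R * (30%:R * D (Sig 3))); first by ring.
rewrite (_ : 30%:R * D (Sig 3) = 21%:R * Sig 5 + 10%:R * Sig 3 - Sig 1 - 240%:R * (Sig 1 * Sig 3)).
  by ring.
by rewrite Sig13; ring.
Qed.

Lemma D_Rser : 2%:R * D Rser = Pser * Rser - Qser ^+ 2.
Proof.
rewrite /Pser /Rser Qser_Sig raddfB /= [D 1]D1 D_natM sub0r.
transitivity (- (24%:R * (42%:R * D (Sig 5)))); first by ring.
rewrite (_ : 42%:R * D (Sig 5) = 27%:R * (120%:R * Sig 3 ^+ 2 + Sig 3) + 21%:R * Sig 5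
  - 7%:R * Sig 3 + Sig 1 - (504%:R * (Sig 1 * Sig 5) + 840%:R * Sig 3 ^+ 2)).
  by ring.
by rewrite Sig15 Sig33; ring.
Qed.

End Ramanujan.

(** * The Euler product and the discriminant *)

Definition eul : fps := euler_prod 1.

Definition eulN m N : fps := \prod_(1 <= j < N) (1 - pX ^+ (m * j)).

Lemma fps_of_poly_eulN m N : fps_of_poly (\prod_(1 <= j < N) (1 - 'X^(m * j))) = eulN m N.
Proof.
rewrite /eulN; elim: N => [|N IH].
  by rewrite !big_geq //; apply/fpsP => n; rewrite /fps_of_poly coef1 fcoef1.
case: N IH => [|N] IH.
  by rewrite !big_geq //; apply/fpsP => n; rewrite /fps_of_poly coef1 fcoef1.
rewrite big_nat_recr //= fps_of_polyM IH [RHS]big_nat_recr //=; congr (_ * _).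
apply/fpsP => n; rewrite /fps_of_poly coefB coef1 coefXn fcoefB fcoef1 coef_pXn //.
Qed.

Lemma eulN_stable m n N : (0 < m)%N -> (n < N)%N -> eqmod n.+1 (eulN m N) (eulN m n.+1).
Proof.
move=> m0; elim: N => // N IH; rewrite ltnS leq_eqVlt => /orP[/eqP <- //|lt].
rewrite /eulN big_nat_recr //=; last by apply: leq_trans lt.
rewrite -[X in eqmod _ _ X]mulr1; apply: eqmodM; first exact: IH.
move=> i li; rewrite fcoefB coef_pXn ltn_eqF ?subr0 //.
by apply: leq_trans li (leq_trans lt _); rewrite leq_pmull.
Qed.

Lemma euler_prodE m N : (0 < m)%N -> eqmod N (euler_prod m) (eulN m N).
Proof.
move=> m0 n lt; rewrite (eulN_stable m0 lt) //.
by rewrite -fps_of_poly_eulN.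
Qed.

Lemma euler_prod_dil m : (0 < m)%N -> euler_prod m = dil m eul.
Proof.
move=> m0; apply: eqmodP => N; apply: (eqmod_trans (euler_prodE m0)).
have -> : eulN m N = dil m (eulN 1 N).
  rewrite /eulN; elim: N => [|N IH]; first by rewrite !big_geq // /dil comp1.
  case: N IH => [|N] IH; first by rewrite !big_geq // /dil comp1.
  rewrite !(@big_nat_recr _ _ _ N.+1) //= dilM // IH; congr (_ * _).
  by rewrite /dil compB comp1 compX ?dil_base0 // comp_pX ?dil_base0 // -exprM mul1n.
apply: eqmod_comp; rewrite ?dil_base0 //.
exact/eqmod_sym/euler_prodE.
Qed.

Definition geo j : fps := fun n => ((0 < n)%N && (j %| n)%N)%:R.

Lemma geoE j : (0 < j)%N -> (1 - pX ^+ j) * geo j = pX ^+ j.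
Proof.
move=> j0; apply/fpsP => n; rewrite mulrBl mul1r fcoefB coef_pXnM coef_pXn /geo.
case: (leqP j n) => [le | lt]; last first.
  rewrite ltn_eqF //= subr0; case: posnP => //= n0.
  by apply/eqP; rewrite pnatr_eq0 eqb0; apply: contraL lt => /(dvdn_leq n0); rewrite -leqNgt.
rewrite subn_gt0 dvdn_subl // (leq_trans j0 le) /= ltn_neqAle le andbT eq_sym.
by case: eqP => [->|_]; rewrite ?dvdnn ?subr0 ?subrr.
Qed.

Lemma D_eulN N : D (eulN 1 N) = - (\sum_(1 <= j < N) j%:R * geo j) * eulN 1 N.
Proof.
rewrite /eulN; elim: N => [|N IH]; first by rewrite !big_geq // [LHS]D1 oppr0 mul0r.
case: N IH => [|N] IH; first by rewrite !big_geq // [LHS]D1 oppr0 mul0r.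
rewrite !(@big_nat_recr _ _ _ N.+1) //= DM IH raddfB /= [D 1]D1 D_pXn mul1n.
have := geoE (ltn0Sn N); move: (pX ^+ _) (geo _) (\prod_(_ <= _ < _) _) => x y z e.
transitivity (- (\sum_(1 <= j < N.+1) j%:R * geo j) * z * (1 - x)
  - z * (N.+1%:R * ((1 - x) * y))); first by rewrite e; ring.
by ring.
Qed.

(** The logarithmic derivative of 1 - q^j is -j q^j / (1 - q^j), and these add up to a Lambert
    series. The infinite product is reached through the finite products [eulN] modulo q^N. *)
Lemma D_eul : D eul = - Sig 1 * eul.
Proof.
apply: eqmodP => N; have e := @euler_prodE 1 N isT.
apply: (eqmod_trans (eqmodE e)); rewrite D_eulN.
apply: eqmodM; last exact: eqmod_sym.
move=> n lt; rewrite !fcoefN fcoef_sum coef_Sig; congr (- _).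
under eq_bigr do rewrite -(rmorph_nat fps_const) fcoef_constM /geo.
rewrite (@big_cat_nat _ _ _ n.+1) //=.
rewrite [X in _ + X]big_nat_cond [X in _ + X]big1 ?addr0 => [|i /andP[/andP[ni _] _]]; last first.
  case: posnP => n0 /=; first by rewrite mulr0.
  by rewrite (_ : (i %| n)%N = false) ?mulr0 //; apply/negbTE; rewrite gtnNdvd.
rewrite [RHS]big_mkcond; apply: eq_bigr => i _.
by case: ifP => /= h; rewrite ?expr1 ?mulr1 ?mulr0.
Qed.

Definition Delta : fps := pX * eul ^+ 24.

Lemma eul0 : eul 0%N = 1. Proof. exact: euler_prod0. Qed.

Lemma D_Delta : D Delta = Pser * Delta.
Proof. by rewrite /Delta DM D_pX DX D_eul /Pser exprS; ring. Qed.

Lemma Sig0 k : Sig k 0%N = 0.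
Proof. by rewrite coef_Sig big_geq. Qed.
Lemma Sig1 k : Sig k 1%N = 1.
Proof. by rewrite coef_Sig /index_iota /= big_cons big_nil /= expr1n addr0. Qed.

Lemma Pser0 : Pser 0%N = 1.
Proof. by rewrite /Pser fcoefB fcoef1 fcoef_mul0 Sig0 mulr0 subr0. Qed.
Lemma Qser0 : Qser 0%N = 1. Proof. by []. Qed.
Lemma Rser0 : Rser 0%N = 1.
Proof. by rewrite /Rser fcoefB fcoef1 fcoef_mul0 Sig0 mulr0 subr0. Qed.

Lemma fcoef_M1 f g : (f * g) 1%N = f 0%N * g 1%N + f 1%N * g 0%N.
Proof. by rewrite fcoef_mul big_ord_recl big_ord1. Qed.

Lemma fps_proportional f g k : g 0%N = 1 -> g * D f = f * D g ->
  f 0%N = k%:R -> f = k%:R * g.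
Proof.
move=> g0 e f0; apply/eqP; rewrite -subr_eq0; apply/eqP/(fps_ode0 (r := 1) g0).
  by rewrite raddfB /= D_natM mulrBr e rmorph1; ring.
by rewrite fcoefB fcoef_mul0 g0 fcoef_nat mulr1 f0 subrr.
Qed.

(** By Ramanujan's equations both sides have logarithmic derivative P. They are therefore
    proportional, and the coefficient of q on the left is 3 . 240 + 2 . 504 = 1728. *)
Lemma discriminant : Qser ^+ 3 - Rser ^+ 2 = 1728%:R * Delta.
Proof.
set d := Qser ^+ 3 - Rser ^+ 2.
have Dd : D d = Pser * d.
  apply: (mulfI (fps_natf_neq0 0)).
  rewrite /d raddfB /= !DX; transitivity (Qser ^+ 2 * (3%:R * D Qser) - Rser * (2%:R * D Rser)).
    by ring.
  by rewrite D_Qser D_Rser; ring.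
have d0 : d 0%N = 0 by rewrite /d fcoefB !fcoef_exp0 Qser0 Rser0 !expr1n subrr.
have d1 : d 1%N = 1728%:R.
  have Q1 : Qser 1%N = 240 by rewrite Qser_Sig fcoefD fcoef1 -(rmorph_nat fps_const) fcoef_constM Sig1 mulr1 add0r.
  have R1 : Rser 1%N = - 504 by rewrite /Rser fcoefB fcoef1 -(rmorph_nat fps_const) fcoef_constM Sig1 mulr1 sub0r.
  have -> : (1728%:R : rat) = 3%:R * 240%:R + 2%:R * 504%:R by rewrite -!natrM -natrD; congr (_%:R).
  move: Q1 R1; move: (240%:R : rat) (504%:R : rat) => a b Q1 R1.
  rewrite /d fcoefB !exprS !expr0 !mulr1 !fcoef_M1 !fcoef_mul0 Qser0 Rser0 Q1 R1.
  by ring.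
pose e := fps_shift d; have de : d = pX * e by exact: fps_shiftE.
have De : eul ^+ 24 * D e = e * D (eul ^+ 24).
  apply: (mulfI pX_neq0).
  have : D d = Pser * d by [].
  rewrite de DM D_pX DX D_eul /Pser exprS => /(congr1 (fun z => eul ^+ 24 * z)) h.
  have -> : pX * (eul ^+ 24 * D e) = eul ^+ 24 * (pX * e + pX * D e) - eul ^+ 24 * (pX * e) by ring.
  by rewrite h [eul ^+ 24]exprS; ring.
have E0 : (eul ^+ 24) 0%N = 1 by rewrite fcoef_exp0 eul0; exact: expr1n.
rewrite /Delta.
rewrite de mulrCA; congr (_ * _).
exact: fps_proportional E0 De d1.
Qed.

(** * Certificates for consequences of polynomial equations *)

Section LinearCombination.
Variable A : idomainType.
Implicit Types (n a b c x y z : A).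

(** Ideal membership: in a domain, a = b follows from equations x = y as soon as a nonzero multiple
    of a - b is a combination of the differences x - y. The cofactors are supplied at each use and
    verified by [ring]. *)
Lemma lincomb1 n c x y a b : n != 0 -> x = y -> n * (a - b) = c * (x - y) -> a = b.
Proof.
move=> n0 ->; rewrite subrr mulr0 => /eqP; rewrite mulf_eq0 (negPf n0) subr_eq0.
by move/eqP.
Qed.

Lemma lincomb2 n c1 x1 y1 c2 x2 y2 a b : n != 0 -> x1 = y1 -> x2 = y2 ->
  n * (a - b) = c1 * (x1 - y1) + c2 * (x2 - y2) -> a = b.
Proof. by move=> n0 -> e; rewrite subrr mulr0 add0r; apply: lincomb1. Qed.

Lemma lincomb3 n c1 x1 y1 c2 x2 y2 c3 x3 y3 a b : n != 0 ->
  x1 = y1 -> x2 = y2 -> x3 = y3 ->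
  n * (a - b) = c1 * (x1 - y1) + c2 * (x2 - y2) + c3 * (x3 - y3) -> a = b.
Proof. by move=> n0 -> e e'; rewrite subrr mulr0 add0r; apply: lincomb2. Qed.

Lemma lincomb4 n c1 x1 y1 c2 x2 y2 c3 x3 y3 c4 x4 y4 a b : n != 0 ->
  x1 = y1 -> x2 = y2 -> x3 = y3 -> x4 = y4 ->
  n * (a - b) = c1 * (x1 - y1) + c2 * (x2 - y2) + c3 * (x3 - y3) + c4 * (x4 - y4) ->
  a = b.
Proof. by move=> n0 -> e e' e''; rewrite subrr mulr0 add0r; apply: lincomb3. Qed.

End LinearCombination.

Lemma zval_nat (A : pzRingType) k : zval (BinInt.Z.of_nat k) = k%:R :> A.
Proof.
rewrite /zval (_ : int_of_Z _ = Posz k) //.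
by case: k => //= k; rewrite Pnat.SuccNat2Pos.id_succ.
Qed.

Lemma fcoef_natM k f n : (k%:R * f) n = k%:R * f n.
Proof. by rewrite -(rmorph_nat fps_const) fcoef_constM. Qed.

Lemma fps_inverse f : f 0%N = 1 -> exists2 g : fps, f * g = 1 & g 0%N = 1.
Proof.
move=> f0; exists (fps_powr f (-1)); last exact: fps_powr0.
by rewrite mulrC fps_powrN1.
Qed.

Lemma fps_unit_neq0 f : f 0%N = 1 -> f != 0.
Proof. by move=> f0; rewrite fps_neq0 // f0 oner_neq0. Qed.

Lemma log_derivative f : f 0%N = 0 -> f 1%N = 1 ->
  exists2 L : fps, D f = f * L & L 0%N = 1.
Proof.
move=> f0 f1; have fE := fps_shiftE f0; set g := fps_shift f in fE.
have g0 : g 0%N = 1 by [].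
have [i gi i0] := fps_inverse g0.
exists ((g + D g) * i); last by rewrite fcoef_mul0 fcoefD g0 coef_D0 addr0 i0 mulr1.
by rewrite fE DM D_pX; transitivity (pX * (g * i) * (g + D g)); [rewrite gi|]; ring.
Qed.

Lemma dil_nat m k : dil m k%:R = k%:R. Proof. exact: comp_nat. Qed.

(** * Ramanujan's system: solutions in q^l and uniqueness *)

Definition eisenstein_system (p k r : fps) :=
  [/\ 12%:R * D p = p ^+ 2 - k, 3%:R * D k = p * k - r & 2%:R * D r = p * r - k ^+ 2].

(** The system is homogeneous for weights 1, 2, 3 of p, k, r and weight 1 of D. The factor l that D
    produces on series in q^l is thus absorbed by l, l^2, l^3. *)
Lemma eisenstein_system_dil l : (0 < l)%N ->
  eisenstein_system (l%:R * dil l Pser) (l%:R ^+ 2 * dil l Qser) (l%:R ^+ 3 * dil l Rser).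
Proof.
move=> l0; have dE : [/\ 12%:R * D (dil l Pser) = l%:R * (dil l Pser ^+ 2 - dil l Qser),
    3%:R * D (dil l Qser) = l%:R * (dil l Pser * dil l Qser - dil l Rser) &
    2%:R * D (dil l Rser) = l%:R * (dil l Pser * dil l Rser - dil l Qser ^+ 2)].
  have dn n f : n%:R * D (dil l f) = l%:R * dil l (n%:R * D f).
    by rewrite D_dil // dilM // dil_nat; ring.
  have dB f g : dil l (f - g) = dil l f - dil l g by exact: compB.
  rewrite !dn; move: D_Pser D_Qser D_Rser.
  move: (D Pser) (D Qser) (D Rser) Pser Qser Rser => DP DQ DR P Q R -> -> ->.
  by rewrite !dB !dilX // !dilM.
case: dE => d1 d2 d3; have nz : (1 : fps) != 0 by exact: oner_neq0.
rewrite -!natrX; split; rewrite D_natM natrX ?natrX.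
- by apply: (lincomb1 (n := 1) (c := l%:R) nz d1); ring.
- by apply: (lincomb1 (n := 1) (c := l%:R ^+ 2) nz d2); ring.
- by apply: (lincomb1 (n := 1) (c := l%:R ^+ 3) nz d3); ring.
Qed.

(* The linearised recursion at q^n has determinant proportional to n^2 (n - l),
   so only the coefficient of q^l is not determined by the constant terms. *)
Lemma eisenstein_system_unique l p k r p' k' r' : (0 < l)%N ->
  eisenstein_system p k r -> eisenstein_system p' k' r' ->
  p 0%N = l%:R -> p' 0%N = l%:R -> k 0%N = l%:R ^+ 2 -> k' 0%N = l%:R ^+ 2 ->
  r 0%N = l%:R ^+ 3 -> r' 0%N = l%:R ^+ 3 ->
  (k ^+ 3 - r ^+ 2) l = (k' ^+ 3 - r' ^+ 2) l ->
  [/\ p = p', k = k' & r = r'].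
Proof.
move=> l0 [e1 e2 e3] [e1' e2' e3'] p0 p0' k0 k0' r0 r0' el.
pose d := p - p'; pose x := k - k'; pose y := r - r'.
have E1 : 12%:R * D d = d * (p + p') - x.
  by rewrite /d /x raddfB /= mulrBr e1 e1'; ring.
have E2 : 3%:R * D x = d * k + x * p' - y.
  by rewrite /d /x /y raddfB /= mulrBr e2 e2'; ring.
have E3 : 2%:R * D y = d * r + y * p' - x * (k + k').
  by rewrite /d /x /y raddfB /= mulrBr e3 e3'; ring.
have E4 : (x * (k ^+ 2 + k * k' + k' ^+ 2) - y * (r + r')) l = 0.
  rewrite (_ : _ - _ = (k ^+ 3 - r ^+ 2) - (k' ^+ 3 - r' ^+ 2)).
    by rewrite fcoefB el subrr.
  by rewrite /x /y; ring.
suff H n : [/\ d n = 0, x n = 0 & y n = 0].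
  by split; apply/eqP; rewrite -subr_eq0; apply/eqP/fpsP => n;
    rewrite fcoef0; case: (H n).
elim/ltn_ind: n => n IH.
have ld i : (i < n)%N -> d i = 0 by case/IH.
have lx i : (i < n)%N -> x i = 0 by case/IH.
have ly i : (i < n)%N -> y i = 0 by case/IH.
case: n IH ld lx ly => [_ _ _ _|n IH ld lx ly].
  by rewrite /d /x /y !fcoefB p0 p0' k0 k0' r0 r0' !subrr.
have c1 := congr1 (fun f => f n.+1) E1; have c2 := congr1 (fun f => f n.+1) E2.
have c3 := congr1 (fun f => f n.+1) E3.
rewrite /= -(rmorph_nat fps_const) fcoef_constM fcoefB coef_low_mul // fcoefD p0 p0' /D in c1.
rewrite /= -(rmorph_nat fps_const) fcoef_constM fcoefB fcoefD !coef_low_mul // k0 p0' /D in c2.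
rewrite /= -(rmorph_nat fps_const) fcoef_constM fcoefB fcoefD !coef_low_mul // r0 p0' fcoefD k0 k0' /D in c3.
have L0 : l%:R != 0 :> rat by rewrite pnatr_eq0 -lt0n.
have N0 : n.+1%:R != 0 :> rat by rewrite pnatr_eq0.
have c4 : n.+1%:R = l%:R :> rat -> x n.+1 * (l%:R ^+ 4 * 3) - y n.+1 * (l%:R ^+ 3 * 2) = 0.
  move=> /eqP; rewrite eqr_nat => /eqP nl; rewrite -nl in E4; move: E4.
  rewrite fcoefB !coef_low_mul // !fcoefD !fcoef_exp0 fcoef_mul0 k0 k0' r0 r0' => h.
  by rewrite -[RHS]h; ring.
have nl : n.+1%:R = l%:R :> rat \/ n.+1%:R - l%:R != 0 :> rat.
  case: (eqVneq n.+1 l) => [->|ne]; first by left.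
  by right; rewrite subr_eq0 eqr_nat.
move: c1 c2 c3 c4 nl L0 N0; move: (d _) (x _) (y _) (n.+1%:R : rat) (l%:R : rat).
move=> a b c N L c1 c2 c3 c4 nl L0 N0.
(* At q^N the first two equations express the coefficients b, c of the differences of k and r
   through the coefficient a of that of p; the third then reads 72 N^2 (N - L) a = 0. In the
   resonant case N = L, the coefficient of k^3 - r^2 gives -72 L^5 a = 0 instead. *)
have bE : b = (2 * L - 12 * N) * a by apply/eqP; rewrite -subr_eq0; apply/eqP; lra.
have cE : c = L ^+ 2 * a + (L - 3 * N) * b by apply/eqP; rewrite -subr_eq0; apply/eqP; lra.
have nz (z : rat) : z * a = 0 -> z != 0 -> a = 0.
  by move=> /eqP; rewrite mulf_eq0 => /orP[->//|/eqP].
have a0 : a = 0.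
  case: nl => [e|ne].
    move/c4: (e) => {}c4.
    apply: (nz (- (72 * L ^+ 5))); last first.
      by rewrite oppr_eq0; apply: mulf_neq0; [rewrite pnatr_eq0 | rewrite expf_neq0].
    by rewrite -[RHS]c4 cE bE e; ring.
  apply: (nz (72 * N ^+ 2 * (N - L))); last first.
    apply: mulf_neq0; last by exact: ne.
    by apply: mulf_neq0; [rewrite pnatr_eq0 | rewrite expf_neq0].
  have : 2 * (N * c) - (a * L ^+ 3 + c * L - b * (L ^+ 2 + L ^+ 2)) = 0 by rewrite c3 subrr.
  by rewrite cE bE => <-; ring.
by rewrite cE bE a0 !mulr0 addr0.
Qed.

(** * The series X_1 *)

Definition X1s : fps := Delta * fps_powr Qser (-1) ^+ 3.

Lemma X1sE : X1s * Qser ^+ 3 = Delta.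
Proof. by rewrite -mulrA -exprMn fps_powrN1 // expr1n mulr1. Qed.

Lemma Qser_neq0 : Qser != 0. Proof. exact: fps_unit_neq0. Qed.

Lemma coef_Delta1 : Delta 1%N = 1.
Proof. by rewrite /Delta coef_pXM fcoef_exp0 eul0 expr1n. Qed.
Lemma coef_Delta0 : Delta 0%N = 0.
Proof. by rewrite /Delta coef_pXM. Qed.
Lemma coef_X1s0 : X1s 0%N = 0.
Proof. by rewrite /X1s fcoef_mul0 coef_Delta0 mul0r. Qed.
Lemma coef_X1s1 : X1s 1%N = 1.
Proof.
by rewrite /X1s fcoef_M1 coef_Delta0 coef_Delta1 mul0r add0r mul1r fcoef_exp0 fps_powr0 expr1n.
Qed.
Lemma X1s_neq0 : X1s != 0.
Proof. by apply/eqP => /fpsP/(_ 1%N); rewrite coef_X1s1 fcoef0 => /eqP; rewrite oner_eq0. Qed.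

(** The logarithmic derivative of Delta / Q^3 is P - (PQ - R)/Q = R/Q. *)
Lemma D_X1s : Qser * D X1s = X1s * Rser.
Proof.
have dD : D Delta = D X1s * Qser ^+ 3 + X1s * (3%:R * Qser ^+ 2 * D Qser).
  by rewrite -X1sE DM DX.
apply: (lincomb4 (n := Qser ^+ 2) (c1 := -1) (c2 := - (X1s * Qser ^+ 2)) (c3 := 1) (c4 := Pser)
  _ dD D_Qser D_Delta (esym X1sE)); first by rewrite expf_neq0 ?Qser_neq0.
by ring.
Qed.

Lemma X1s_discriminant : Rser ^+ 2 = Qser ^+ 3 * (1 - 1728%:R * X1s).
Proof.
have := discriminant; rewrite -X1sE; move: (1728%:R : fps) => c e.
by apply: (lincomb1 (n := 1) (c := -1) (oner_neq0 _) e); ring.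
Qed.

Lemma dil_discriminant l : (0 < l)%N ->
  dil l Qser ^+ 3 - dil l Rser ^+ 2 = 1728%:R * dil l Delta.
Proof.
move=> l0; have := congr1 (dil l) discriminant; move: 1728%N Qser Rser Delta => k Q R T.
have dB f g : dil l (f - g) = dil l f - dil l g by exact: compB.
by rewrite dB !dilX // dilM // dil_nat.
Qed.

(** * Genus zero: Eisenstein series in q^l from polynomial identities in w *)

Section GenusZero.

Variables (l : nat) (m pm pp kk : seq BinInt.Z).
Hypothesis l_gt0 : (0 < l)%N.
Let zn (n : nat) := zscale (BinInt.Z.of_nat n).
Let zX (n : nat) := ncons n BinNums.Z0 [:: BinNums.Zpos BinNums.xH].
(** With L = D w / w, the logarithmic derivative of X_1 = w / (m pm^3) is L nm / (m pm), and [np]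
    plays the same role for w^l / (m pp^3), the future X_1(q^l). In terms of j = 1/X_1, the simple
    zeros over j = 0 are those of m and the simple ones over j = 1728 those of kk: the elliptic
    points of orders 3 and 2. *)
Let nm := zsub (zsub (zmul m pm) (zmul (ztheta m) pm)) (zn 3 (zmul m (ztheta pm))).
Let np := zsub (zsub (zn l (zmul m pp)) (zmul (ztheta m) pp)) (zn 3 (zmul m (ztheta pp))).
Let kap := zmul m kk.

Definition genus0_lead :=
  [&& BinInt.Z.eqb (head BinNums.Z0 m) (BinNums.Zpos BinNums.xH), BinInt.Z.eqb (head BinNums.Z0 pm) (BinNums.Zpos BinNums.xH),
      BinInt.Z.eqb (head BinNums.Z0 pp) (BinNums.Zpos BinNums.xH) & BinInt.Z.eqb (head BinNums.Z0 kk) (BinNums.Zpos BinNums.xH)].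
Definition genus0_check1 :=
  zeqb (zsub (zmul m (zexp pm 3)) (zn 1728 (zX 1))) (zmul kk (zexp nm 2)).
Definition genus0_check2 :=
  zeqb (zn (l ^ 2)%N (zsub (zmul m (zexp pp 3)) (zn 1728 (zX l)))) (zmul kk (zexp np 2)).
(** This is the first Ramanujan equation for P + (l - 1) L, with D L, Q and the candidate for l^2
    Q(q^l) expressed through L^2 and w, and L^2 then cancelled. *)
Definition genus0_check3 :=
  zeqb (zn (2 * l.-1) (zsub (zadd (zmul (ztheta m) kap) (zn 3 (zmul m (ztheta kap)))) (zmul kap m)))
       (zadd (zn (l.-1 ^ 2)%N (zmul kap m)) (zmul m (zsub pm (zn (l ^ 2)%N pp)))).
Hypotheses (lead : genus0_lead) (ck1 : genus0_check1) (ck2 : genus0_check2)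
  (ck3 : genus0_check3).

Lemma zev_X n (x : fps) : zev (zX n) x = x ^+ n.
Proof.
rewrite /zX; elim: n => [|n IH] /=; first by rewrite mulr0 addr0.
by rewrite IH exprS /zval add0r.
Qed.

(** The series w is the compositional inverse of x / (m pm^3), evaluated at X_1. That it is an eta
    quotient is a later conclusion. *)
Lemma genus0_param : exists2 w : fps, w 0%N = 0 /\ w 1%N = 1 &
  X1s * zev m w * zev pm w ^+ 3 = w.
Proof.
case/and4P: lead => /BinInt.Z.eqb_spec hm /BinInt.Z.eqb_spec hpm _ _.
have X0 : pX 0%N = 0 by [].
have [i mi i0] : exists2 i, zev m pX * i = 1 & i 0%N = 1.
  by apply: fps_inverse; rewrite zev_coef0 // hm.
have [j pj j0] : exists2 j, zev pm pX * j = 1 & j 0%N = 1.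
  by apply: fps_inverse; rewrite zev_coef0 // hpm.
pose psi := pX * (i * j ^+ 3).
have psi0 : psi 0%N = 0 by rewrite /psi coef_pXM.
have psi1 : psi 1%N = 1 by rewrite /psi coef_pXM fcoef_mul0 fcoef_exp0 i0 j0 expr1n mulr1.
have [h [h0 h1 ph]] := reversion psi0 psi1.
pose w := comp h X1s; have w0 : w 0%N = 0 by rewrite /w fcoef_comp0 h0.
exists w; first by split=> //; rewrite /w fcoef_comp1 ?coef_X1s0 // h1 coef_X1s1 mulr1.
have psiE : psi * zev m pX * zev pm pX ^+ 3 = pX.
  by transitivity (pX * (zev m pX * i) * (zev pm pX * j) ^+ 3);
    [rewrite /psi; ring | rewrite mi pj; ring].
have := congr1 (comp^~ w) psiE; rewrite compM // compM // compX // !comp_zev // comp_pX //.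
have -> : comp psi w = X1s.
  by rewrite /w -(@compA psi h X1s) ?coef_X1s0 // ph comp_pX ?coef_X1s0.
by [].
Qed.

Variables w L : fps.
Hypotheses (w0 : w 0%N = 0) (w1 : w 1%N = 1)
  (wE : X1s * zev m w * zev pm w ^+ 3 = w) (Dw : D w = w * L) (L0 : L 0%N = 1).

Let M : fps := zev m w. Let p : fps := zev pm w. Let q : fps := zev pp w. Let K : fps := zev kk w.
Let M' : fps := zev (ztheta m) w. Let p' : fps := zev (ztheta pm) w. Let q' : fps := zev (ztheta pp) w.
Let kp : fps := zev kap w. Let kp' : fps := zev (ztheta kap) w.

Let wE' : X1s * M * p ^+ 3 = w := wE.

Let M0 : M 0%N = 1.
Proof. by case/and4P: lead => /BinInt.Z.eqb_spec h _ _ _; rewrite /M zev_coef0 // h. Qed.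
Let p0 : p 0%N = 1.
Proof. by case/and4P: lead => _ /BinInt.Z.eqb_spec h _ _; rewrite /p zev_coef0 // h. Qed.
Let q0 : q 0%N = 1.
Proof. by case/and4P: lead => _ _ /BinInt.Z.eqb_spec h _; rewrite /q zev_coef0 // h. Qed.
Let K0 : K 0%N = 1.
Proof. by case/and4P: lead => _ _ _ /BinInt.Z.eqb_spec h; rewrite /K zev_coef0 // h. Qed.
Let kpE : kp = M * K. Proof. exact: zev_mul. Qed.
Let kp0 : kp 0%N = 1. Proof. by rewrite kpE fcoef_mul0 M0 K0 mulr1. Qed.
Let DM' : D M = M' * L. Proof. exact: D_zev. Qed.
Let Dp : D p = p' * L. Proof. exact: D_zev. Qed.
Let Dq : D q = q' * L. Proof. exact: D_zev. Qed.
Let Dk : D kp = kp' * L. Proof. exact: D_zev. Qed.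

Let N1 : fps := M * p - M' * p - 3%:R * M * p'.
Let N2 : fps := l%:R * M * q - M' * q - 3%:R * M * q'.
Variable c : fps.
Hypothesis cE : c = 1728%:R.

Let c1 : M * p ^+ 3 - c * w = K * N1 ^+ 2.
Proof.
have := zev_eq w ck1; rewrite !zevE zev_X.
rewrite !zval_nat -/M -/p -/K -/M' -/p' -cE /N1 expr1 => ->; ring.
Qed.
Let c2 : l%:R ^+ 2 * (M * q ^+ 3 - c * w ^+ l) = K * N2 ^+ 2.
Proof.
have := zev_eq w ck2; rewrite !zevE zev_X.
rewrite !zval_nat -/M -/q -/K -/M' -/q' -cE /N2 natrX => ->; ring.
Qed.
Let c3 : 2%:R * l.-1%:R * (M' * kp + 3%:R * M * kp' - kp * M) =
   l.-1%:R ^+ 2 * kp * M + M * (p - l%:R ^+ 2 * q).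
Proof.
have := zev_eq w ck3; rewrite !zevE.
rewrite !zval_nat -/M -/p -/q -/kp -/kp' -/M' -/K !natrX natrM ?kpE => e; rewrite ?kpE.
by apply: (lincomb1 (n := 1) (c := 1) (oner_neq0 _) e); ring.
Qed.

Let N10 : N1 0%N = 1.
Proof.
rewrite /N1 !fcoefB !fcoef_mul0 M0 p0.
have -> : M' 0%N = 0 by rewrite /M' zev_coef0 //; case: (m).
have -> : p' 0%N = 0 by rewrite /p' zev_coef0 //; case: (pm).
by rewrite mul0r mulr0 !subr0 mulr1.
Qed.
Let N20 : N2 0%N = l%:R.
Proof.
rewrite /N2 !fcoefB !fcoef_mul0 M0 q0 fcoef_nat.
have -> : M' 0%N = 0 by rewrite /M' zev_coef0 //; case: (m).
have -> : q' 0%N = 0 by rewrite /q' zev_coef0 //; case: (pp).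
by rewrite mul0r mulr0 !subr0 !mulr1.
Qed.

Let Mn0 : M != 0 := fps_unit_neq0 M0.
Let pn0 : p != 0 := fps_unit_neq0 p0.
Let qn0 : q != 0 := fps_unit_neq0 q0.
Let N1n0 : N1 != 0 := fps_unit_neq0 N10.
Let kpn0 : kp != 0 := fps_unit_neq0 kp0.

Let DX1M : D X1s * M * p = X1s * L * N1.
Proof.
have := congr1 D wE'; rewrite !DE DM' Dp Dw => e.
by apply: (lincomb2 (n := p ^+ 2) (c1 := 1) (c2 := - L) _ e wE'); rewrite ?expf_neq0 // /N1; ring.
Qed.

Let RE : Rser * M * p = Qser * L * N1.
Proof.
apply: (lincomb2 (n := X1s) (c1 := - (M * p)) (c2 := Qser) X1s_neq0 D_X1s DX1M).
by ring.
Qed.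

(** From D X_1 / X_1 = R/Q = L N1 / (m pm), squaring and comparing with R^2 = Q^3 (1 - 1728 X_1)
    leaves, by the first check, an equation from which N1^2 cancels. *)
Lemma genus0_Q : Qser * kp = L ^+ 2 * p.
Proof.
have R2 := X1s_discriminant; rewrite -cE in R2.
have R3 : Rser ^+ 2 * M ^+ 2 * p ^+ 2 = Qser ^+ 2 * L ^+ 2 * N1 ^+ 2.
  by rewrite -!exprMn RE.
have n0 : Qser ^+ 2 * N1 ^+ 2 != 0 by rewrite mulf_neq0 ?expf_neq0 ?Qser_neq0.
rewrite kpE.
apply: (lincomb4 (n := Qser ^+ 2 * N1 ^+ 2) (c1 := - (Qser ^+ 3 * M)) (c2 := p) (c3 := - (M ^+ 2 * p ^+ 3))
  (c4 := Qser ^+ 3 * M * c) n0 c1 R3 R2 wE').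
by ring.
Qed.

Let jexists : exists2 j, [/\ kp * j.1.1 = 1, M * j.1.2 = 1 & q * j.2 = 1] &
  [/\ j.1.1 0%N = 1, j.1.2 0%N = 1 & j.2 0%N = 1].
Proof.
have [i1 h1 z1] := fps_inverse kp0; have [i2 h2 z2] := fps_inverse M0.
by have [i3 h3 z3] := fps_inverse q0; exists (i1, i2, i3).
Qed.

Lemma genus0_Delta : Delta * M * kp ^+ 3 = w * L ^+ 6.
Proof.
have p3 : p ^+ 3 != 0 by rewrite expf_neq0.
apply: (mulfI p3); rewrite -X1sE.
transitivity ((X1s * M * p ^+ 3) * (Qser * kp) ^+ 3); first by ring.
by rewrite genus0_Q wE'; ring.
Qed.

(** If Delta(q^l) is to be w^(l-1) Delta, its logarithmic derivative must be P + (l - 1) L, which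
    dictates Pu. The candidates Qu and Ru are built from u = w^l / (m pp^3) as Q and R arise from
    X_1. Once the triple is known to solve Ramanujan's system, uniqueness identifies it, and the
    three claims are read off. *)
Lemma genus0_main : [/\ l%:R ^+ 2 * dil l Qser * kp = l%:R ^+ 2 * L ^+ 2 * q,
  dil l Delta = w ^+ l.-1 * Delta & dil l X1s * M * q ^+ 3 = w ^+ l].
Proof.
have [[[ik iM] iq] /= [hk hM hq] [k0 iM0 iq0]] := jexists.
pose Qu := l%:R ^+ 2 * L ^+ 2 * q * ik; pose u := w ^+ l * iM * iq ^+ 3.
pose Ru := Qu * L * N2 * iM * iq; pose Pu := Pser + l.-1%:R * L.
have QuE : Qu * kp = l%:R ^+ 2 * L ^+ 2 * q.
  by rewrite /Qu -mulrA [ik * kp]mulrC hk mulr1.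
have uE : u * M * q ^+ 3 = w ^+ l.
  by transitivity (w ^+ l * (M * iM) * (q * iq) ^+ 3); [rewrite /u | rewrite hM hq]; ring.
have RuE : Ru * M * q = Qu * L * N2.
  by transitivity (Qu * L * N2 * (M * iM) * (q * iq)); [rewrite /Ru | rewrite hM hq]; ring.
have Qu0 : Qu 0%N = l%:R ^+ 2.
  by rewrite /Qu !fcoef_mul0 !fcoef_exp0 L0 q0 k0 fcoef_nat expr1n !mulr1.
have Ru0 : Ru 0%N = l%:R ^+ 3.
  by rewrite /Ru !fcoef_mul0 Qu0 L0 N20 iM0 iq0 !mulr1 -exprSr.
clearbody Qu u Ru; clear ik iM iq hk hM hq k0 iM0 iq0.
have wlE : w ^+ l = w * w ^+ l.-1 by rewrite -exprS prednK.
have Dwl k : D (w ^+ k) = k%:R * w ^+ k * L.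
  case: k => [|k]; first by rewrite [LHS]D1 !mul0r.
  by rewrite DX Dw exprS; ring.
have DeltaE := genus0_Delta.
have uQ : u * Qu ^+ 3 = l%:R ^+ 6 * (w ^+ l.-1 * Delta).
  have n0 : M * q ^+ 3 * kp ^+ 3 != 0 by rewrite !mulf_neq0 ?expf_neq0.
  apply: (mulfI n0).
  transitivity ((u * M * q ^+ 3) * (Qu * kp) ^+ 3); first by ring.
  rewrite QuE uE wlE.
  transitivity (l%:R ^+ 6 * w ^+ l.-1 * q ^+ 3 * (Delta * M * kp ^+ 3)); last by ring.
  by rewrite DeltaE; ring.
have dDisc : dil l Qser ^+ 3 - dil l Rser ^+ 2 = c * dil l Delta.
  by rewrite cE dil_discriminant.
have cn0 : c != 0 by rewrite cE; exact: fps_natf_neq0.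
have wn0 : w != 0 by apply/eqP => /fpsP/(_ 1%N); rewrite w1 fcoef0 => /eqP; rewrite oner_eq0.
have l0 : l%:R != 0 :> fps by rewrite -(prednK l_gt0) fps_natf_neq0.
have un0 : u != 0.
  by apply/eqP => uz; move: uE; rewrite uz !mul0r => /esym/eqP; rewrite expf_eq0 (negPf wn0) andbF.
have Ln0 : L != 0 := fps_unit_neq0 L0.
have Qn0 : Qu != 0.
  apply/eqP => Qz; move: QuE; rewrite Qz mul0r => /esym/eqP; apply/negP.
  by rewrite !mulf_neq0 ?expf_neq0.
have N2n0 : N2 != 0.
  by rewrite fps_neq0 // N20 pnatr_eq0 -lt0n.
have Rn0 : Ru != 0.
  apply/eqP => Rz; move: RuE; rewrite Rz !mul0r => /esym/eqP; apply/negP.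
  by apply: mulf_neq0 N2n0; apply: mulf_neq0.
have DuM : D u * M * q = u * L * N2.
  have := congr1 D uE; rewrite !DE DM' Dq Dwl => e.
  by apply: (lincomb2 (n := q ^+ 2) (c1 := 1) (c2 := - (l%:R * L)) _ e uE); rewrite ?expf_neq0 // /N2; ring.
have DuE : Qu * D u = u * Ru.
  have n0 : M * q != 0 by rewrite mulf_neq0.
  apply: (lincomb2 (n := M * q) (c1 := Qu) (c2 := - u) n0 DuM RuE); ring.
have RQ : Qu ^+ 3 - Ru ^+ 2 = c * (u * Qu ^+ 3).
  have n0 : kp * M ^+ 2 * q ^+ 3 != 0 by rewrite !mulf_neq0 ?expf_neq0.
  have R3 : Ru ^+ 2 * M ^+ 2 * q ^+ 2 = Qu ^+ 2 * L ^+ 2 * N2 ^+ 2.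
    by rewrite -!exprMn RuE.
  have kpE' := kpE.
  apply: (mulfI n0).
  transitivity (Qu ^+ 2 * M * q * ((Qu * kp) * M * q ^+ 2) - kp * q * (Ru ^+ 2 * M ^+ 2 * q ^+ 2)).
    by ring.
  rewrite R3 QuE.
  transitivity (Qu ^+ 2 * L ^+ 2 * q * M * (l%:R ^+ 2 * (M * q ^+ 3 - c * w ^+ l)
     - K * N2 ^+ 2 + l%:R ^+ 2 * c * w ^+ l)); first by rewrite kpE'; ring.
  rewrite c2 subrr add0r.
  transitivity (c * Qu ^+ 2 * M * (u * M * q ^+ 3) * (Qu * kp)); last by ring.
  by rewrite uE QuE; ring.
have DuQ : D (u * Qu ^+ 3) = Pu * (u * Qu ^+ 3).
  rewrite uQ -natrX D_natM DM Dwl D_Delta /Pu; ring.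
(* The derivations are run backwards: the logarithmic derivatives of u Qu^3 and of u give that of
   Qu, and differentiating Qu^3 - Ru^2 = c u Qu^3 then gives that of Ru. *)
have DQu : 3%:R * D Qu = Pu * Qu - Ru.
  have n0 : u * Qu ^+ 2 != 0 by rewrite mulf_neq0 ?expf_neq0.
  move: DuQ; rewrite !DE => e.
  by apply: (lincomb2 (n := u * Qu ^+ 2) (c1 := 1) (c2 := - Qu ^+ 2) n0 e DuE); ring.
have DRu : 2%:R * D Ru = Pu * Ru - Qu ^+ 2.
  have := congr1 D RQ; rewrite [X in _ = D (X * _)]cE D_natM -cE DuQ raddfB /= !DE => e.
  apply: (lincomb3 (n := Ru) (c1 := -1) (c2 := Qu ^+ 2) (c3 := Pu) Rn0 e DQu RQ); ring.
(* Here D L is needed. It is obtained by differentiating [genus0_Delta], and the third check closes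
   the computation. *)
have DPu : 12%:R * D Pu = Pu ^+ 2 - Qu.
  have dD := congr1 D DeltaE; rewrite (DM (Delta * M)) (DM Delta) (DX kp) (DM w) (DX L) DM' Dk Dw D_Delta in dD.
  have DL : 6%:R * D L * M * kp = Pser * L * M * kp + L ^+ 2 * (M' * kp + 3%:R * M * kp' - M * kp).
    have n1 : w * L ^+ 5 != 0 by rewrite mulf_neq0 ?expf_neq0.
    apply: (lincomb2 (n := w * L ^+ 5) (c1 := - (M * kp))
      (c2 := Pser * M * kp + L * (M' * kp + 3%:R * M * kp')) n1 dD DeltaE); ring.
  have n2 : M * kp != 0 by rewrite mulf_neq0.
  rewrite /Pu raddfD /= D_natM mulrDr D_Pser.
  apply: (lincomb4 (n := M * kp) (c1 := 2%:R * l.-1%:R) (c2 := L ^+ 2)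
    (c3 := M) (c4 := - M) n2 DL c3 QuE genus0_Q); ring.
have Pu0 : Pu 0%N = l%:R.
  by rewrite /Pu fcoefD fcoef_mul0 Pser0 L0 fcoef_nat mulr1 -[in RHS](prednK l_gt0) -natr1 addrC.
have [i1 i2 i3] : [/\ Pu = l%:R * dil l Pser, Qu = l%:R ^+ 2 * dil l Qser & Ru = l%:R ^+ 3 * dil l Rser].
  apply: (@eisenstein_system_unique l) => //.
  - exact: eisenstein_system_dil.
  - by rewrite fcoef_mul0 dil0 Pser0 fcoef_nat mulr1.
  - by rewrite fcoef_mul0 dil0 Qser0 fcoef_exp0 fcoef_nat mulr1.
  - by rewrite fcoef_mul0 dil0 Rser0 fcoef_exp0 fcoef_nat mulr1.
  (* Both discriminants are 1728 l^6 q^l + O(q^(l+1)), which settles the resonant coefficient. *)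
  - rewrite RQ uQ.
    have -> : (l%:R ^+ 2 * dil l Qser) ^+ 3 - (l%:R ^+ 3 * dil l Rser) ^+ 2 =
        l%:R ^+ 6 * (c * dil l Delta).
      by rewrite -dDisc; ring.
    have wl1 : (w ^+ l.-1 * Delta) l = 1.
      rewrite /Delta (fps_shiftE w0) exprMn.
      transitivity ((pX ^+ l * (fps_shift w ^+ l.-1 * eul ^+ 24)) l).
        have -> : pX ^+ l = pX * pX ^+ l.-1 by rewrite -exprS prednK.
        have e (x y z : fps) : x * y * (pX * z) = pX * x * (y * z) by ring.
        by rewrite e.
      by rewrite coef_pXnM leqnn subnn fcoef_mul0 !fcoef_exp0 eul0 /fps_shift w1 !expr1n mulr1.
    have dl1 : dil l Delta l = 1 by rewrite coef_dil // dvdnn divnn l_gt0 coef_Delta1.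
    have [k ck] : exists k : nat, c = k%:R by exists 1728%N.
    have cM (f : fps) n : (c * f) n = k%:R * f n by rewrite ck fcoef_natM.
    have lM (f : fps) n : (l%:R ^+ 6 * f) n = (l ^ 6)%:R * f n by rewrite -natrX fcoef_natM.
    by rewrite cM !lM cM wl1 dl1; ring.
have dDl : l%:R ^+ 6 * (w ^+ l.-1 * Delta) = l%:R ^+ 6 * dil l Delta.
  rewrite -uQ; apply: (mulfI cn0); rewrite -RQ i2 i3.
  by transitivity (l%:R ^+ 6 * (c * dil l Delta)); [rewrite -dDisc | ]; ring.
have dDelta : dil l Delta = w ^+ l.-1 * Delta.
  by apply: (mulfI _ (esym dDl)); rewrite expf_neq0.
split.
- by rewrite -i2 QuE.
- exact: dDelta.
- rewrite -uE; congr (_ * _ * _).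
  have dQ : l%:R ^+ 6 * dil l Qser ^+ 3 != 0.
    by rewrite mulf_neq0 ?expf_neq0 // fps_unit_neq0 // dil0.
  apply: (mulfI dQ); transitivity (l%:R ^+ 6 * dil l (X1s * Qser ^+ 3)).
    by rewrite dilM // dilX //; ring.
  by rewrite X1sE -dDl -uQ i2; ring.
Qed.

End GenusZero.

(** * The q-series of the statement as formal power series *)

Section QSeries.

Lemma fps_of_nat (f : qser) k : qord f = k%:R -> fps_of f = pX ^+ k * qunit f.
Proof.
move=> fk; apply/fpsP => n; rewrite /fps_of fk coef_pXnM.
case: leqP => [le | lt]; first by rewrite -natrB // rpred_nat natrK.
rewrite (_ : (_ \is a Num.nat) = false) //.
by apply/negbTE/negP => /natr_ge0; rewrite subr_ge0 ler_nat leqNgt lt.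
Qed.

Lemma fps_hornerE s f :
  fps_horner (Poly s) f = foldr (fun c acc => fps_const c + f * acc) 0 s.
Proof.
have -> : fps_horner (Poly s) f = (map_poly fps_const (Poly s)).[f].
  apply/fpsP => n; rewrite (horner_coef_wide _ (n := size (Poly s))); last exact: size_poly.
  rewrite fcoef_sum; apply: eq_bigr => i _.
  by rewrite coef_map fcoef_constM fps_expE.
elim: s => [|c s IH] /=; first by rewrite rmorph0 horner0.
rewrite cons_poly_def rmorphD rmorphM /= map_polyX map_polyC /= !hornerE IH.
by rewrite mulrC addrC.
Qed.

Definition eulp m : fps := euler_prod m.

Lemma eulp0 m : eulp m 0%N = 1. Proof. exact: euler_prod0. Qed.
Lemma eulpE m : (0 < m)%N -> eulp m = dil m eul. Proof. exact: euler_prod_dil. Qed.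

Lemma dil_Delta l : (0 < l)%N -> dil l Delta = pX ^+ l * eulp l ^+ 24.
Proof. by move=> l0; rewrite /Delta (dilM l0) (dil_pX l0) (dilX l0) (eulpE l0). Qed.

Lemma X1s_xser : fps_of (Xser 1) = X1s.
Proof.
have E0 := eulp0 1; rewrite (@fps_of_nat _ 1) /=; last by field.
rewrite expr1 -[euler_prod 1]/eul /X1s /Delta -mulrA; congr (_ * (_ * _)).
  by rewrite -(fps_powr_nat 24).
rewrite fps_powr_powr // -(fps_powr_nat 3) ?fps_powr0 // fps_powr_powr //.
Qed.

Lemma Z1_zser : fps_of (Zser 1) = fps_powr Qser (1 / 2).
Proof. by rewrite (@fps_of_nat _ 0) /= ?mulr0 // expr0 mul1r. Qed.

Lemma fps_powrX u r k : u 0%N = 1 -> fps_powr u r ^+ k = fps_powr u (r * k%:R).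
Proof. by move=> u0; rewrite -(fps_powr_nat k) ?fps_powr0 // fps_powr_powr. Qed.

Lemma expr_mul3 (A : comNzRingType) (a b c d : A) n :
  c ^+ n * d = 1 -> (a * b * c) ^+ n * d = a ^+ n * b ^+ n.
Proof. by move=> e; rewrite !exprMn -[RHS]mulr1 -e; ring. Qed.

(** The exponent of X_l in Z_l is (l + 1)/12 at every level. With n = 12 and k = l + 1 the
    definition of Z_l becomes Z^12 X^(l+1) = (eta_1 eta_l)^24 on the unit parts, free of fractional
    powers. *)
Lemma zeta_powr (e1 e2 x : fps) r k n : e1 0%N = 1 -> e2 0%N = 1 -> x 0%N = 1 ->
  r * n%:R = k%:R ->
  fps_mul (fps_mul (fps_powr e1 2) (fps_powr e2 2)) (fps_powr (fps_powr x r) (-1)) ^+ n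
    * x ^+ k = e1 ^+ (2 * n) * e2 ^+ (2 * n).
Proof.
move=> e10 e20 x0 rk.
rewrite -[fps_mul (fps_mul _ _) _]/(fps_powr e1 2 * fps_powr e2 2 * fps_powr (fps_powr x r) (-1)).
have hx : fps_powr (fps_powr x r) (-1) ^+ n * x ^+ k = 1.
  rewrite fps_powr_powr // fps_powrX // -[x ^+ k]fps_powr_nat // -fps_powrD //.
  rewrite (_ : r * -1 * n%:R + k%:R = 0%:R); last by rewrite -rk; ring.
  by rewrite (fps_powr_nat 0).
by rewrite (expr_mul3 _ _ hx) (fps_powr_nat 2 e10) (fps_powr_nat 2 e20) -!exprM.
Qed.

Lemma omega_powr (e1 e2 : fps) k : e1 0%N = 1 ->
  e2 0%N = 1 ->
  fps_mul (fps_powr e2 k%:R) (fps_powr (fps_powr e1 k%:R) (-1)) * e1 ^+ k = e2 ^+ k.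
Proof.
move=> e10 e20; rewrite -[fps_mul _ _]/(fps_powr e2 k%:R * fps_powr (fps_powr e1 k%:R) (-1)).
rewrite -mulrA fps_powr_powr // -[e1 ^+ k]fps_powr_nat // -fps_powrD //.
rewrite (_ : k%:R * -1 + k%:R = 0%:R); last by ring.
by rewrite (fps_powr_nat 0) // expr0 mulr1 fps_powr_nat.
Qed.

Lemma mu_powr u r : u 0%N = 1 ->
  fps_mul r (fps_powr (fps_powr u 2) (-1)) * u ^+ 2 = r.
Proof.
move=> u0; rewrite -[fps_mul _ _]/(r * fps_powr (fps_powr u 2) (-1)).
by rewrite -[u ^+ 2](fps_powr_nat 2) // -mulrA fps_powrN1 ?fps_powr0 // mulr1.
Qed.

Lemma mu_powr1 u r : u 0%N = 1 -> fps_mul r (fps_powr u (-1)) * u = r.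
Proof.
move=> u0; rewrite -[fps_mul _ _]/(r * fps_powr u (-1)).
by rewrite -mulrA fps_powrN1 // mulr1.
Qed.

End QSeries.

(** * The polynomials of the theorem and the relations to be proved in q *)

Section ModularData.

Lemma zev_head1 s f : f 0%N = 0 -> head BinNums.Z0 s = BinNums.Zpos BinNums.xH ->
  (zev s f) 0%N = 1.
Proof. by move=> f0 hs; rewrite zev_coef0 // hs. Qed.

Delimit Scope Z_scope with bZ.

Local Notation L s := (s%bZ).

(** The polynomial a is doubled, as is b in [lb], since for l = 2 both have half-integral
    coefficients. *)
Definition la (l : nat) : seq BinInt.Z :=
  match l with
  | 2 => (L [:: 5]) | 3 => (L [:: 10]) | 5 => (L [:: 26; -72]) | 7 => (L [:: 50; -160])
  | 11 => (L [:: 122; -736; 704]) | 13 => (L [:: 170; -270; -560])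
  | 23 => (L [:: 530; -1880; 620; -120; -270])
  | _ => [::] end.
Definition lb (l : nat) : seq BinInt.Z :=
  match l with
  | 2 => (L [:: 3]) | 3 => (L [:: 8]) | 5 => (L [:: 24]) | 7 => (L [:: 48])
  | 11 => (L [:: 120]) | 13 => (L [:: 168; 96]) | 23 => (L [:: 528; -240])
  | _ => [::] end.
Definition lc (l : nat) : seq BinInt.Z :=
  match l with
  | 2 => (L [:: 1; -207; 3456])
  | 3 => (L [:: 1; -126; 2944])
  | 5 => (L [:: 1; -80; 1890; -12600; 7776; 3456])
  | 7 => zmul (L [:: 1; -21; 8]) (L [:: 1; -42; 454; -1008; -1280])
  | 11 => (L [:: 1; -66; 1793; -26048; 221056; -1132670; 3535840; -6683072;
      7418752; -4460544; 1183744; -65536])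
  | 13 => (L [:: 1; -39; 546; -2938; 117; 42861; -36998; -255294; 15366;
      519610; 342576; -14976; -35840])
  | 23 => (L [:: 1; -46; 920; -10465; 74221; -336927; 953856; -1470068; 336674;
      3209696; -6447728; 5423124; 302266; -6612454; 8362616; -4877702;
      -116403; 2732814; -2492280; 1115109; -170775; -83835; 48600; -6750])
  | _ => [::] end.
Definition ld_factors (l : nat) : seq (seq BinInt.Z) :=
  match l with
  | 2 => [:: (L [:: 1; -81])]
  | 3 => [:: (L [:: 1; -8]); (L [:: 1; -64])]
  | 5 => [:: (L [:: 1; -4]); (L [:: 1; -18]); (L [:: 1; -36])]
  | 7 => [:: (L [:: 1; -2]); (L [:: 1; -8]); (L [:: 1; -24]); (L [:: 1; -16; -8])]
  | 11 => [:: (L [:: 1; -1]); (L [:: 1; -2]); (L [:: 1; -4]); (L [:: 1; -7]); (L [:: 1; -16]);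
      (L [:: 1; -12; 16]); (L [:: 1; -14; 4])]
  | 13 => [:: (L [:: 1; 2]); (L [:: 1; 1]); (L [:: 1; -1]); (L [:: 1; -3]); (L [:: 1; -8]);
      (L [:: 1; -11; -8]); (L [:: 1; -4; -8]); (L [:: 1; -10; -2])]
  | 23 => [:: (L [:: 1; 1]); (L [:: 1; -1]); (L [:: 1; -2]); (L [:: 1; -3]); (L [:: 1; -5]);
      (L [:: 1; -8; 3]); (L [:: 1; -6; -9]); (L [:: 1; -7; 3; -5]); (L [:: 1; -7; 7; -3]);
      (L [:: 1; -4; 0; 0; -1])]
  | _ => [::] end.
Definition ld (l : nat) : seq BinInt.Z :=
  if ld_factors l is s :: ss then foldl zmul s ss else [::].
Definition lg (l : nat) : seq BinInt.Z :=
  match l with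
  | 2 => (L [:: 1; -256]) | 3 => (L [:: 1; -108]) | 5 => (L [:: 1; -44; -16])
  | 7 => zmul (L [:: 1; 1]) (L [:: 1; -27]) | 11 => (L [:: 1; -20; 56; -44])
  | 13 => (L [:: 1; -10; -27]) | 23 => zmul (L [:: 1; 0; -1; 1]) (L [:: 1; -8; 3; -7])
  | _ => [::] end.
Definition lK (l : nat) : seq BinInt.Z :=
  match l with
  | 2 => (L [:: 1; 144]) | 3 => (L [:: 1; 192]) | 5 => (L [:: 1; 216; 144])
  | 7 => (L [:: 1; 224; 448]) | 11 => (L [:: 1; 224; -192; -832; 1024])
  | 13 => (L [:: 1; 234; 1417; 1872; 832])
  | 23 => (L [:: 1; 232; 732; -968; 1894; -2280; 2268; -1080; 225])
  | _ => [::] end.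

Definition levels := [:: 2; 3; 5; 7; 11; 13; 23]%N.

Lemma levelsP (P : nat -> Prop) :
  P 2%N -> P 3%N -> P 5%N -> P 7%N -> P 11%N -> P 13%N -> P 23%N ->
  forall l, l \in levels -> P l.
Proof.
move=> p2 p3 p5 p7 p11 p13 p23 l; rewrite /levels !inE.
by do ![case/orP] => /eqP ->.
Qed.

Lemma zpolyM s t : zpoly (zmul s t) = zpoly s * zpoly t.
Proof. by rewrite !zpolyE zev_mul. Qed.
Lemma zpoly_scale c s : zpoly (zscale c s) = zval c * zpoly s.
Proof. by rewrite !zpolyE zev_scale. Qed.

Lemma Poly1_scale (a : rat) (z : BinInt.Z) : 2 * a = (int_of_Z z)%:~R ->
  2%:R *: Poly [:: a] = zpoly [:: z].
Proof.
move=> e; rewrite /zpoly /= !cons_poly_def !mul0r !add0r -e.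
by rewrite -mul_polyC -polyCM.
Qed.

Lemma pol_aE l : l \in levels -> 2%:R *: pol_a l = zpoly (la l).
Proof.
have h s : 2%:R *: zpoly s = zpoly (zscale (BinInt.Z.of_nat 2) s).
  by rewrite zpoly_scale zval_nat scaler_nat mulr_natl.
move: l; apply: levelsP; rewrite /pol_a; try exact: h.
by apply: Poly1_scale; field.
Qed.

Lemma pol_bE l : l \in levels -> 2%:R *: pol_b l = zpoly (lb l).
Proof.
have h s : 2%:R *: zpoly s = zpoly (zscale (BinInt.Z.of_nat 2) s).
  by rewrite zpoly_scale zval_nat scaler_nat mulr_natl.
move: l; apply: levelsP; rewrite /pol_b; try exact: h.
by apply: Poly1_scale; field.
Qed.

Lemma pol_cE l : l \in levels -> pol_c l = zpoly (lc l).
Proof. by move: l; apply: levelsP; rewrite /pol_c /lc ?zpolyM. Qed.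
Lemma pol_dE l : l \in levels -> pol_d l = zpoly (ld l).
Proof. by move: l; apply: levelsP; rewrite /pol_d /ld /ld_factors /foldl ?zpolyM. Qed.
Lemma pol_gE l : l \in levels -> pol_g l = zpoly (lg l).
Proof. by move: l; apply: levelsP; rewrite /pol_g /lg ?zpolyM. Qed.
Lemma pol_KE l : l \in levels -> pol_K l = zpoly (lK l).
Proof. by move: l; apply: levelsP. Qed.

Let zn (n : nat) := zscale (BinInt.Z.of_nat n).
Definition zXn (n : nat) := ncons n BinNums.Z0 [:: BinNums.Zpos BinNums.xH].

Lemma zev_Xn (A : comNzRingType) n (x : A) : zev (zXn n) x = x ^+ n.
Proof.
rewrite /zXn; elim: n => [|n IH] /=; first by rewrite mulr0 addr0.
by rewrite IH exprS /zval add0r.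
Qed.

Lemma cd_check l : l \in levels ->
  zeqb (zsub (zexp (lc l) 2) (zmul (zexp (ld l) 2) (lg l)))
       (zmul (zn 4 (zXn l.-1)) (zexp (lK l) 3)).
Proof. by move: l; apply: levelsP; vm_compute. Qed.
Lemma ab_check l : l \in levels ->
  zeqb (zsub (zexp (la l) 2) (zmul (zexp (lb l) 2) (lg l))) (zn (4 * l ^ 2)%N (lK l)).
Proof. by move: l; apply: levelsP; vm_compute. Qed.

Lemma cd_zev l (A : comNzRingType) (x : A) : l \in levels ->
  zev (lc l) x ^+ 2 - zev (ld l) x ^+ 2 * zev (lg l) x = 4%:R * x ^+ l.-1 * zev (lK l) x ^+ 3.
Proof. by move=> hl; have := zev_eq x (cd_check hl); rewrite !zevE zev_Xn zval_nat. Qed.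
Lemma ab_zev l (A : comNzRingType) (x : A) : l \in levels ->
  zev (la l) x ^+ 2 - zev (lb l) x ^+ 2 * zev (lg l) x = 4%:R * l%:R ^+ 2 * zev (lK l) x.
Proof. by move=> hl; have := zev_eq x (ab_check hl); rewrite !zevE zval_nat natrM natrX. Qed.

Lemma lead_check l : l \in levels ->
  [&& head BinNums.Z0 (lc l) == 1, head BinNums.Z0 (ld l) == 1,
      head BinNums.Z0 (lg l) == 1, head BinNums.Z0 (lK l) == 1,
      BinInt.Z.sub (head BinNums.Z0 (la l)) (head BinNums.Z0 (lb l)) == BinInt.Z.of_nat 2 &
      BinInt.Z.add (head BinNums.Z0 (la l)) (head BinNums.Z0 (lb l)) == BinInt.Z.of_nat (2 * l ^ 2)].
Proof. by move: l; apply: levelsP; vm_compute. Qed.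

(* For X = X_l(q) and Z = Z_l(q): S is the square root of g at X, and X_1(q),
   X_1(q^l) are the values of y^- and y^+; la and lb are 2a and 2b. *)
Definition modular_data l (X Z S : fps) :=
  [/\ S ^+ 2 = zev (lg l) X,
      (zev (lc l) X - zev (ld l) X * S) * X1s = 2%:R * X ^+ l,
      (zev (lc l) X + zev (ld l) X * S) * dil l X1s = 2%:R * X ^+ l,
      Z ^+ 2 * (zev (la l) X - zev (lb l) X * S) = 2%:R * Qser &
      Z ^+ 2 * (zev (la l) X + zev (lb l) X * S) = 2%:R * l%:R ^+ 2 * dil l Qser].

End ModularData.

(** * Jacobi's triple product *)

Section TripleProduct.
Variables (A : comNzRingType) (u v : A).
Let Q := u * v.

(** The terms of index j and -j in Jacobi's sum: u^(j(j+1)/2) v^(j(j-1)/2) and the same with u and v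
    exchanged. *)
Fixpoint theta_term (j : nat) : A * A :=
  if j is i.+1 then
    ((theta_term i).1 * (u * Q ^+ i), (theta_term i).2 * (v * Q ^+ i))
  else (1, 1).
Let T j := (theta_term j).1 + (theta_term j).2.

(** The Gaussian binomial of 2m over m + j in base Q, defined without division by the recursion that
    multiplication by (1 + u Q^m)(1 + v Q^m) imposes; [T_step] says how this moves a term to its
    neighbours. For j = 0 the neighbour -1 is replaced by 1, by symmetry. *)
Fixpoint gauss_bin (m j : nat) : A :=
  if m is m'.+1 then
    if (j <= m)%N then
      (1 + Q ^+ (2 * m').+1) * gauss_bin m' j +
      (if j is i.+1 then Q ^+ (m' - i) * gauss_bin m' i else Q ^+ m * gauss_bin m' 1)
      + Q ^+ (m' + j).+1 * gauss_bin m' j.+1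
    else 0
  else (j == 0%N)%:R.

Arguments gauss_bin : simpl never.

Lemma gauss_binS m j : (j <= m.+1)%N -> gauss_bin m.+1 j =
  (1 + Q ^+ (2 * m).+1) * gauss_bin m j +
  (if j is i.+1 then Q ^+ (m - i) * gauss_bin m i else Q ^+ m.+1 * gauss_bin m 1)
  + Q ^+ (m + j).+1 * gauss_bin m j.+1.
Proof. by move=> jm; rewrite /gauss_bin -/gauss_bin jm. Qed.

Lemma gauss_bin0 m j : (m < j)%N -> gauss_bin m j = 0.
Proof.
by rewrite /gauss_bin; case: m => [|m]; [case: j | rewrite -/gauss_bin ltnNge => /negPf ->].
Qed.

Lemma T_step m i : (i < m)%N ->
  T i.+1 * (u * Q ^+ m + v * Q ^+ m) = Q ^+ (m - i.+1) * T i.+2 + Q ^+ (m + i.+1) * T i.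
Proof.
move=> jm; rewrite /T /=; move: (theta_term i) => [x y] /=.
have e1 : Q ^+ m = Q ^+ (m - i.+1) * Q ^+ i * Q by rewrite -exprD -exprSr; congr (_ ^+ _); lia.
have e2 : Q ^+ (m + i.+1) = Q ^+ (m - i.+1) * Q ^+ i * Q ^+ i * Q ^+ 2.
  by rewrite -!exprD; congr (_ ^+ _); lia.
by rewrite e1 e2 !exprS expr0 /Q; ring.
Qed.

Lemma finite_triple_product m :
  \prod_(j < m) ((1 + u * Q ^+ j) * (1 + v * Q ^+ j)) =
  gauss_bin m 0 + \sum_(1 <= j < m.+1) gauss_bin m j * T j.
Proof.
elim: m => [|m IH]; first by rewrite big_ord0 big_geq // addr0.
rewrite big_ord_recr /= {}IH.
have fE : (1 + u * Q ^+ m) * (1 + v * Q ^+ m) = 1 + Q ^+ (2 * m).+1 + (u * Q ^+ m + v * Q ^+ m).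
  by rewrite exprS mul2n -addnn exprD /Q; ring.
pose H := gauss_bin m.
have S1 : H 0%N * (u * Q ^+ m + v * Q ^+ m) +
    \sum_(1 <= j < m.+1) H j * T j * (u * Q ^+ m + v * Q ^+ m) =
   Q ^+ m.+1 * H 1%N * 2%:R +
   \sum_(1 <= j < m.+2) (Q ^+ (m - j.-1) * H j.-1 + Q ^+ (m + j).+1 * H j.+1) * T j.
  have -> : \sum_(1 <= j < m.+1) H j * T j * (u * Q ^+ m + v * Q ^+ m) =
      \sum_(1 <= j < m.+1) Q ^+ (m - j) * H j * T j.+1 +
      \sum_(1 <= j < m.+1) Q ^+ (m + j) * H j * T j.-1.
    rewrite -big_split /= big_nat [RHS]big_nat; apply: eq_bigr => -[//|i] /andP[_ im].
    by rewrite -mulrA T_step //=; ring.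
  have -> : \sum_(1 <= j < m.+1) Q ^+ (m + j) * H j * T j.-1 =
      \sum_(1 <= j < m.+3) Q ^+ (m + j) * H j * T j.-1.
    rewrite [RHS]big_nat_recr // [X in _ = X + _]big_nat_recr //.
    by rewrite /= /H (gauss_bin0 (ltnSn m)) (gauss_bin0 (leqnSn m.+1)) !mulr0 !mul0r !addr0.
  rewrite [X in _ + (_ + X) = _]big_ltn // [X in _ + (_ + (_ + X)) = _]big_add1 /=.
  under [in RHS]eq_bigr => j _ do rewrite mulrDl.
  rewrite big_split /= [X in _ = _ + (X + _)]big_add1 /= [X in _ = _ + (X + _)]big_ltn //.
  rewrite subn0 addn1.
  under [X in _ + (_ + (_ + X)) = _]eq_bigr => j _ do rewrite addnS.
  by rewrite /T /= expr0; ring.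
rewrite fE mulrDr mulrDl [X in _ + X]mulrDl -/H mulr_suml.
rewrite [X in _ + (_ + X)]mulr_suml S1.
have -> : \sum_(1 <= i < m.+1) H i * T i * (1 + Q ^+ (2 * m).+1) =
    \sum_(1 <= i < m.+2) H i * T i * (1 + Q ^+ (2 * m).+1).
  by rewrite [RHS]big_nat_recr //= /H gauss_bin0 // !mul0r addr0.
have -> : \sum_(1 <= j < m.+2) gauss_bin m.+1 j * T j =
   \sum_(1 <= i < m.+2) H i * T i * (1 + Q ^+ (2 * m).+1) +
   \sum_(1 <= j < m.+2) (Q ^+ (m - j.-1) * H j.-1 + Q ^+ (m + j).+1 * H j.+1) * T j.
  rewrite -big_split /= big_nat [RHS]big_nat; apply: eq_bigr => -[//|j] /andP[_ jm].
  by rewrite gauss_binS // -/H /=; ring.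
by rewrite gauss_binS // -/H addn0; ring.
Qed.

Fixpoint qfact (n : nat) : A := if n is k.+1 then qfact k * (1 - Q ^+ k.+1) else 1.

(** Induction on m: multiplied by the denominators for m + 1, each of the three terms of the
    recursion is an explicit multiple of [qfact (2 * m)]. The boundary j = m + 1 has a single
    term. *)
Lemma gauss_bin_fact m j : (j <= m)%N ->
  gauss_bin m j * (qfact (m + j) * qfact (m - j)) = qfact (2 * m).
Proof.
elim: m j => [|m IH] j.
  by rewrite leqn0 => /eqP ->; rewrite /gauss_bin /= !mulr1.
move=> jm; rewrite gauss_binS //.
have -> : qfact (2 * m.+1) = qfact (2 * m) * (1 - Q ^+ (2 * m).+1) * (1 - Q ^+ (2 * m).+2).
  by rewrite (_ : (2 * m.+1 = (2 * m).+2)%N) //; lia.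
move: jm; rewrite leq_eqVlt => /orP[/eqP ->|].
  rewrite (gauss_bin0 (ltnSn m)) (gauss_bin0 (leqnSn m.+1)) !mulr0 add0r addr0 subnn expr0 mul1r subnn mulr1.
  have -> : (m.+1 + m.+1 = (m + m).+2)%N by lia.
  have := IH m (leqnn m); rewrite subnn /= mulr1 => e.
  by rewrite -[in RHS]e mul2n -addnn; ring.
rewrite ltnS => jm; set F := qfact (2 * m).
have I0 := IH j jm; rewrite -/F in I0.
have -> : qfact (m.+1 + j) = qfact (m + j) * (1 - Q ^+ (m + j).+1) by rewrite addSn.
have -> : qfact (m.+1 - j) = qfact (m - j) * (1 - Q ^+ (m - j).+1) by rewrite subSn.
have I1 : Q ^+ (m + j).+1 * gauss_bin m j.+1 * (qfact (m + j) * (1 - Q ^+ (m + j).+1) * (qfact (m - j) * (1 - Q ^+ (m - j).+1))) =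
    Q ^+ (m + j).+1 * (1 - Q ^+ (m - j)) * (1 - Q ^+ (m - j).+1) * F.
  move: jm; rewrite leq_eqVlt => /orP[/eqP jm|jm].
    by rewrite gauss_bin0 ?jm // subnn expr0 subrr mulr0 !mul0r.
  have := IH j.+1 jm; rewrite -/F addnS /= => <-.
  have -> : qfact (m - j) = qfact (m - j.+1) * (1 - Q ^+ (m - j)).
    by rewrite -[(m - j)%N]prednK ?subn_gt0 //= prednK ?subn_gt0 // subnS.
  by ring.
have I2 : (if j is i.+1 then Q ^+ (m - i) * gauss_bin m i else Q ^+ m.+1 * gauss_bin m 1)
    * (qfact (m + j) * (1 - Q ^+ (m + j).+1) * (qfact (m - j) * (1 - Q ^+ (m - j).+1))) =
    Q ^+ (m - j).+1 * (1 - Q ^+ (m + j)) * (1 - Q ^+ (m + j).+1) * F.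
  case: j jm I0 I1 => [|i] jm I0 I1; first by rewrite subn0 addn0 in I1 *; rewrite I1.
  have := IH i (ltnW jm); rewrite -/F => <-; rewrite addnS /=.
  have -> : qfact (m - i) = qfact (m - i.+1) * (1 - Q ^+ (m - i)).
    by rewrite -[(m - i)%N]prednK ?subn_gt0 //= prednK ?subn_gt0 // subnS.
  by rewrite subnSK // -(subnSK jm) ; ring.
rewrite mulrDl [X in X + _]mulrDl I1 I2 -/F.
have -> : (1 + Q ^+ (2 * m).+1) * gauss_bin m j *
    (qfact (m + j) * (1 - Q ^+ (m + j).+1) * (qfact (m - j) * (1 - Q ^+ (m - j).+1))) =
   (1 + Q ^+ (2 * m).+1) * (1 - Q ^+ (m + j).+1) * (1 - Q ^+ (m - j).+1) * F.
  by rewrite -I0; ring.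
have -> : (2 * m = (m + j) + (m - j))%N by lia.
by rewrite !exprS !exprD; move: (Q ^+ (m + j)) (Q ^+ (m - j)) => a b; ring.
Qed.

End TripleProduct.

Section TripleProductSeries.

Lemma exp_low (Q0 : fps) N : Q0 0%N = 0 -> forall k, (N <= k)%N -> eqmod N (Q0 ^+ k) 0.
Proof.
by move=> q0 k Nk n lt; rewrite fcoef0 coef_low_exp //; apply: leq_trans Nk.
Qed.

(** The finite formula is used with m = 2N. For j <= N both m + j and m - j are at least N, so their
    q-factorials agree with that of m modulo q^N and the Gaussian binomial times [qfact m] is 1; the
    terms with j > N vanish by assumption. *)
Lemma triple_product N (u v : fps) : (u * v) 0%N = 0 ->
  (forall j, (N < j)%N -> eqmod N ((theta_term u v j).1 + (theta_term u v j).2) 0) ->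
  eqmod N (\prod_(j < 2 * N) ((1 + u * (u * v) ^+ j) * (1 + v * (u * v) ^+ j)) * qfact u v (2 * N))
   (1 + \sum_(1 <= j < (2 * N).+1) ((theta_term u v j).1 + (theta_term u v j).2)).
Proof.
move=> uv0 low; set Q := u * v; set m := (2 * N)%N.
have Qlow k : (N <= k)%N -> eqmod N (Q ^+ k) 0 by move=> Nk; apply: exp_low Nk; exact: uv0.
have fact_stable k : (N <= k)%N -> eqmod N (qfact u v k) (qfact u v m).
  have st i : eqmod N (qfact u v (N + i)) (qfact u v N).
    elim: i => [|i IH]; first by rewrite addn0.
    rewrite addnS /= -[X in eqmod _ _ X]mulr1; apply: eqmodM => //.
    move=> n lt; rewrite fcoefB (Qlow (N + i).+1) ?fcoef0 ?subr0 //.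
    by rewrite leqW // leq_addr.
  move=> Nk; rewrite -(subnKC Nk) -(@subnKC N m) ?/m; last by lia.
  exact: eqmod_trans (st _) (eqmod_sym (st _)).
have fact0 k : qfact u v k 0%N = 1.
  elim: k => [|k IH] //=; rewrite fcoef_mul0 IH fcoefB fcoef_exp0 uv0 expr0n /=.
  by rewrite subr0 mulr1.
have [i mi i0] := fps_inverse (fact0 m).
have G1 j : (j <= N)%N -> eqmod N (gauss_bin u v m j * qfact u v m) 1.
  move=> jN; have jm : (j <= m)%N by rewrite /m; lia.
  have e := gauss_bin_fact u v jm.
  have e1 : eqmod N (gauss_bin u v m j * (qfact u v m * qfact u v m)) (qfact u v m).
    apply: (@eqmod_trans _ (gauss_bin u v m j * (qfact u v (m + j) * qfact u v (m - j)))).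
      by apply: eqmodM => //; apply: eqmodM; apply/eqmod_sym/fact_stable; rewrite /m; lia.
    by rewrite e; apply: fact_stable; rewrite /m; lia.
  have := eqmodM e1 (@eqmod_refl N i).
  have assoc (a b c : fps) : a * (b * b) * c = a * b * (b * c) by ring.
  by rewrite mi assoc mi mulr1.
rewrite finite_triple_product mulrDl; apply: eqmodD; first by apply: G1.
rewrite mulr_suml => n lt; rewrite !fcoef_sum big_nat [RHS]big_nat.
apply: eq_bigr => j /andP[j1 _]; have [jN|Nj] := leqP j N.
  rewrite mulrAC -[in RHS]( mul1r (_ + _)).
  by apply: (eqmodM (G1 j jN)) lt.
rewrite (low j Nj) // fcoef0 -[RHS](fcoef0 n) mulrAC.
have := eqmodM (@eqmod_refl N (gauss_bin u v m j * qfact u v m)) (low j Nj).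
by rewrite mulr0; apply.
Qed.

End TripleProductSeries.

(** * Genus zero: X_l, Z_l and sqrt g in terms of w *)

Lemma genus0_algebra (A : idomainType) (c d a b g X w u u1 e n S z M K p q L x1 x1' Q Q' : A) l :
  u != 0 -> e != 0 -> M != 0 -> K != 0 -> p != 0 -> q != 0 ->
  S * e = n -> X ^+ l * u ^+ l = w ^+ l ->
  x1 * M * p ^+ 3 = w -> x1' * M * q ^+ 3 = w ^+ l ->
  Q * (M * K) = L ^+ 2 * p -> l%:R ^+ 2 * Q' * (M * K) = l%:R ^+ 2 * L ^+ 2 * q ->
  z ^+ 2 * (M * K) = L ^+ 2 * u1 ->
  (c * u ^+ l * e - d * u ^+ l * n) * w = 2%:R * (w ^+ l * e) * (M * p ^+ 3) ->
  c * u ^+ l * e + d * u ^+ l * n = 2%:R * e * (M * q ^+ 3) ->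
  (a * u ^+ 2 * e - b * u ^+ 2 * n) * u1 = 2%:R * p * (u ^+ 2 * e) ->
  (a * u ^+ 2 * e + b * u ^+ 2 * n) * u1 = 2%:R * l%:R ^+ 2 * q * (u ^+ 2 * e) ->
  g * u ^+ 2 * e ^+ 2 = n ^+ 2 * u ^+ 2 ->
  [/\ S ^+ 2 = g, (c - d * S) * x1 = 2%:R * X ^+ l, (c + d * S) * x1' = 2%:R * X ^+ l,
    z ^+ 2 * (a - b * S) = 2%:R * Q & z ^+ 2 * (a + b * S) = 2%:R * l%:R ^+ 2 * Q'].
Proof.
move=> u0 e0 M0 K0 p0 q0 <- Xl wE T3 T4 T1 Z2 k2 k3 k4 k5 k6; split.
- have nz : u ^+ 2 * e ^+ 2 != 0 by rewrite mulf_neq0 ?expf_neq0.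
  by apply: (lincomb1 (n := u ^+ 2 * e ^+ 2) (c := -1) nz k6); ring.
- have nz : u ^+ l * e * (M * p ^+ 3) != 0 by rewrite !mulf_neq0 ?expf_neq0.
  move: Xl k2; move: (w ^+ l) (X ^+ l) (u ^+ l) nz => wl xl ul nz Xl k2.
  apply: (lincomb3 (n := ul * e * (M * p ^+ 3)) (c1 := 1) (c2 := - (2%:R * e * M * p ^+ 3))
    (c3 := c * ul * e - d * ul * (S * e)) nz k2 Xl wE).
  ring.
- have nz : u ^+ l * e * (M * q ^+ 3) != 0 by rewrite !mulf_neq0 ?expf_neq0.
  move: Xl k3 T3; move: (w ^+ l) (X ^+ l) (u ^+ l) nz => wl xl ul nz Xl k3 T3.
  apply: (lincomb3 (n := ul * e * (M * q ^+ 3)) (c1 := x1' * (M * q ^+ 3)) (c2 := - (2%:R * e * M * q ^+ 3))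
     (c3 := 2%:R * e * (M * q ^+ 3)) nz k3 Xl T3).
  ring.
- have nz : M * K * u ^+ 2 * e != 0 by rewrite !mulf_neq0 ?expf_neq0.
  apply: (lincomb3 (n := M * K * u ^+ 2 * e) (c1 := L ^+ 2) (c2 := (a * u ^+ 2 * e - b * u ^+ 2 * (S * e)))
    (c3 := - (2%:R * u ^+ 2 * e)) nz k4 Z2 T4).
  ring.
- have nz : M * K * u ^+ 2 * e != 0 by rewrite !mulf_neq0 ?expf_neq0.
  apply: (lincomb3 (n := M * K * u ^+ 2 * e) (c1 := L ^+ 2) (c2 := (a * u ^+ 2 * e + b * u ^+ 2 * (S * e)))
    (c3 := - (2%:R * u ^+ 2 * e)) nz k5 Z2 T1).
  ring.
Qed.

Section GenusZeroLevels.

Variables (l : nat) (m pm pp kk mu mu1 de nu : seq BinInt.Z).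
Let zn (n : nat) := zscale (BinInt.Z.of_nat n).
Let hom n s := zhom n (zXn 1) mu s.

(** Here X_l = w / mu and sqrt g = nu / de, while mu1 is a sixth root of mu^(l+1) / m^2, so that
    Z_l^2 m kk = L^2 mu1. The remaining five conditions are the relations of [modular_data] at X = w
    / mu, made polynomial by homogenisation. *)
Definition genus0_check4 :=
  [&& zeqb (zmul (zexp mu1 6) (zexp m 2)) (zexp mu l.+1),
    zeqb (zmul (zsub (zmul (hom l (lc l)) de) (zmul (hom l (ld l)) nu)) (zXn 1))
      (zmul (zn 2 (zmul (zXn l) de)) (zmul m (zexp pm 3))),
    zeqb (zadd (zmul (hom l (lc l)) de) (zmul (hom l (ld l)) nu))
      (zmul (zn 2 de) (zmul m (zexp pp 3))),
    zeqb (zmul (zsub (zmul (hom 2 (la l)) de) (zmul (hom 2 (lb l)) nu)) mu1)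
      (zmul (zn 2 pm) (zmul (zexp mu 2) de)),
    zeqb (zmul (zadd (zmul (hom 2 (la l)) de) (zmul (hom 2 (lb l)) nu)) mu1)
      (zmul (zn (2 * l ^ 2) pp) (zmul (zexp mu 2) de)) &
    zeqb (zmul (hom 2 (lg l)) (zexp de 2)) (zmul (zexp nu 2) (zexp mu 2))].
Definition genus0_check5 :=
  [&& size (lc l) <= l.+1, size (ld l) <= l.+1, size (la l) <= 3,
    size (lb l) <= 3, size (lg l) <= 3, head BinNums.Z0 mu == BinNums.Zpos BinNums.xH,
    head BinNums.Z0 mu1 == BinNums.Zpos BinNums.xH,
    head BinNums.Z0 de == BinNums.Zpos BinNums.xH &
    head BinNums.Z0 nu == BinNums.Zpos BinNums.xH]%N.

Lemma genus0_check4P (w X : fps) : X * zev mu w = w ->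
  genus0_check4 -> genus0_check5 ->
  let u := zev mu w in let d := zev de w in let n := zev nu w in
  let c s k := zev s X * u ^+ k in
  [/\ zev mu1 w ^+ 6 * zev m w ^+ 2 = u ^+ l.+1,
    (c (lc l) l * d - c (ld l) l * n) * w = 2%:R * (w ^+ l * d) * (zev m w * zev pm w ^+ 3) &
    c (lc l) l * d + c (ld l) l * n = 2%:R * d * (zev m w * zev pp w ^+ 3)] /\
  [/\ (c (la l) 2 * d - c (lb l) 2 * n) * zev mu1 w = 2%:R * zev pm w * (u ^+ 2 * d),
    (c (la l) 2 * d + c (lb l) 2 * n) * zev mu1 w = 2%:R * l%:R ^+ 2 * zev pp w * (u ^+ 2 * d) &
    c (lg l) 2 * d ^+ 2 = n ^+ 2 * u ^+ 2].
Proof.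
move=> Xmu /and5P[h1 h2 h3 h4 /andP[h5 h6]] /and5P[sc sd sa sb /and5P[sg _ _ _ _]] u d n c.
have hX : zev (zXn 1) w = X * zev mu w by rewrite zev_Xn expr1 Xmu.
have homE k s : (size s <= k.+1)%N -> zev (hom k s) w = c s k.
  by move=> ss; apply: zev_hom.
have e1 := zev_eq w h1; have e2 := zev_eq w h2; have e3 := zev_eq w h3.
have e4 := zev_eq w h4; have e5 := zev_eq w h5; have e6 := zev_eq w h6.
clear h1 h2 h3 h4 h5 h6.
rewrite zev_mul !zev_exp in e1.
rewrite zev_mul zev_sub zev_mul [zev (zmul (hom _ (ld l)) _) w]zev_mul in e2.
rewrite (homE _ _ sc) (homE _ _ sd) zev_Xn expr1 zev_mul zev_scale zval_nat in e2.
rewrite zev_mul zev_Xn zev_mul zev_exp in e2.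
rewrite zev_add zev_mul [zev (zmul (hom _ (ld l)) _) w]zev_mul in e3.
rewrite (homE _ _ sc) (homE _ _ sd) zev_mul zev_scale zval_nat zev_mul zev_exp in e3.
rewrite zev_mul zev_sub zev_mul [zev (zmul (hom _ (lb l)) _) w]zev_mul in e4.
rewrite (homE _ _ sa) (homE _ _ sb) zev_mul zev_scale zval_nat zev_mul zev_exp in e4.
rewrite zev_mul zev_add zev_mul [zev (zmul (hom _ (lb l)) _) w]zev_mul in e5.
rewrite (homE _ _ sa) (homE _ _ sb) zev_mul zev_scale zval_nat zev_mul zev_exp natrM natrX in e5.
rewrite zev_mul (homE _ _ sg) zev_exp zev_mul !zev_exp in e6.
by split; split.
Qed.

Hypothesis l_gt1 : (1 < l)%N.
Hypotheses (lead : genus0_lead m pm pp kk) (ck1 : genus0_check1 m pm kk)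
  (ck2 : genus0_check2 l m pp kk) (ck3 : genus0_check3 l m pm pp kk)
  (ck4 : genus0_check4) (ck5 : genus0_check5).

(** [genus0_main] gives w^(l-1) = Delta(q^l) / Delta, and normalised roots are unique, so w is the
    eta quotient q om. In the same way Z^12 X^(l+1) = Delta Delta(q^l), together with
    [genus0_Delta], yields the sixth power of Z^2 m kk = L^2 mu1. *)
Lemma genus0_modular (om x z : fps) :
  om 0%N = 1 -> x 0%N = 1 -> z 0%N = 1 -> om ^+ l.-1 * eul ^+ 24 = eulp l ^+ 24 ->
  x * zev mu (pX * om) = om -> z ^+ 12 * x ^+ l.+1 = eul ^+ 24 * eulp l ^+ 24 ->
  exists2 S : fps, S 0%N = 1 & modular_data l (pX * x) z S.
Proof.
move=> om0 x0 z0 omE xE zE; have l0 : (0 < l)%N by apply: ltn_trans l_gt1.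
have [w [w0 w1] wE] := genus0_param lead.
have [L Dw L0] := log_derivative w0 w1.
have [T1 T2 T3] := genus0_main l0 lead ck1 ck2 ck3 w0 w1 wE Dw L0 (erefl _).
have T4 := genus0_Q lead ck1 w0 wE Dw (erefl _).
have T5 := genus0_Delta lead ck1 w0 wE Dw (erefl _).
have wom : w = pX * om.
  rewrite (fps_shiftE w0); congr (_ * _).
  apply: (@fps_exp_inj l.-1); [by rewrite -ltnS prednK | exact: w1 | exact: om0 |].
  have e24 : eul ^+ 24 != 0 by apply: expf_neq0; apply: fps_unit_neq0 eul0.
  apply: (mulIf e24); rewrite omE; apply: (mulfI (pXn_neq0 l)).
  transitivity (w ^+ l.-1 * Delta).
    have -> : w ^+ l.-1 = pX ^+ l.-1 * fps_shift w ^+ l.-1 by rewrite -exprMn -(fps_shiftE w0).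
    have -> : pX ^+ l = pX * pX ^+ l.-1 by rewrite -exprS prednK.
    have e (a b c : fps) : pX * a * (b * c) = a * b * (pX * c) by ring.
    exact: e.
  exact: (etrans (esym T2) (dil_Delta l0)).
move: T1 T2 T3 T4 T5 wE Dw; rewrite zev_mul.
set M := zev m w; set p := zev pm w; set q := zev pp w; set K := zev kk w.
move=> T1 T2 T3 T4 T5 wE Dw.
pose X : fps := pX * x.
have Xmu : X * zev mu w = w by rewrite /X -mulrA wom xE.
case/and5P: ck5 => sc sd sa sb /and5P[sg /eqP hmu /eqP hmu1 /eqP hde /eqP hnu].
have [id dE id0] := fps_inverse (zev_head1 w0 hde).
pose S : fps := zev nu w * id.
have SE : S * zev de w = zev nu w by rewrite /S -mulrA [id * _]mulrC dE mulr1.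
have [[k1 k2 k3] [k4 k5 k6]] := genus0_check4P Xmu ck4 ck5.
rewrite -/M -/p -/q in k1 k2 k3 k4 k5 k6.
move: k1 k2 k3 k4 k5 k6 Xmu SE.
have mu0 : zev mu w != 0 by exact: fps_unit_neq0 (zev_head1 w0 hmu).
have mu10 : zev mu1 w 0%N = 1 by exact: zev_head1 w0 hmu1.
have den0 : zev de w != 0 by exact: fps_unit_neq0 (zev_head1 w0 hde).
have S0 : S 0%N = 1 by rewrite /S fcoef_mul0 (zev_head1 w0 hnu) id0 mulr1.
have wn0 : w != 0 by rewrite wom; apply: mulf_neq0 pX_neq0 (fps_unit_neq0 om0).
have [hm [hpm [hpp hkk]]] : M 0%N = 1 /\ p 0%N = 1 /\ q 0%N = 1 /\ K 0%N = 1.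
  case/and4P: lead => /BinInt.Z.eqb_spec h1 /BinInt.Z.eqb_spec h2 /BinInt.Z.eqb_spec h3 /BinInt.Z.eqb_spec h4.
  by split; [|split; [|split]]; apply: zev_head1 w0 _.
have Mn0 := fps_unit_neq0 hm; have pn0 := fps_unit_neq0 hpm.
have qn0 := fps_unit_neq0 hpp; have Kn0 := fps_unit_neq0 hkk.
have Ln0 := fps_unit_neq0 L0.
clearbody S; move: (zev mu w) (zev mu1 w) (zev de w) (zev nu w) mu0 mu10 den0.
move=> u u1 d n u0 u10 d0 k1 k2 k3 k4 k5 k6 Xmu SE.
have Xl : X ^+ l * u ^+ l = w ^+ l by rewrite -exprMn Xmu.
have Z12 : z ^+ 12 * X ^+ l.+1 = w ^+ l.-1 * Delta ^+ 2.
  have -> : w ^+ l.-1 * Delta ^+ 2 = Delta * dil l Delta by rewrite T2; ring.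
  rewrite (dil_Delta l0) /X exprMn mulrCA zE exprS.
  rewrite /Delta.
  by move: (eul ^+ 24) (eulp l ^+ 24) (pX ^+ l) => a b c; ring.
have Z2 : z ^+ 2 * (M * K) = L ^+ 2 * u1.
  have MK0 : (M * K) 0%N = 1 by rewrite fcoef_mul0 hm hkk mulr1.
  apply: (@fps_exp_inj 6); first by [].
  - by rewrite fcoef_mul0 fcoef_exp0 z0 expr1n mul1r.
  - by rewrite fcoef_mul0 fcoef_exp0 L0 u10 expr1n mul1r.
  have nz : w ^+ l.+1 * M ^+ 2 != 0 by apply: mulf_neq0; apply: expf_neq0.
  apply: (mulfI nz).
  have wl : w ^+ l.+1 = w ^+ l.-1 * w ^+ 2 by rewrite -exprD addn2 prednK.
  transitivity (z ^+ 12 * X ^+ l.+1 * u ^+ l.+1 * M ^+ 2 * (M * K) ^+ 6).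
    by rewrite -[in LHS]Xmu exprMn; ring.
  rewrite Z12 -k1.
  transitivity (w ^+ l.-1 * (Delta * M * (M * K) ^+ 3) ^+ 2 * u1 ^+ 6 * M ^+ 2); first by ring.
  by rewrite T5 wl; ring.
exists S; first exact: S0.
exact: (genus0_algebra u0 d0 Mn0 Kn0 pn0 qn0 SE Xl wE T3 T4 T1 Z2 k2 k3 k4 k5 k6).
Qed.

End GenusZeroLevels.

(** * The levels 2, 3, 5, 7 and 13 *)

Section GenusZeroInstances.

Definition has_modular_data l := exists2 S : fps, S 0%N = 1 &
  modular_data l (fps_of (Xser l)) (fps_of (Zser l)) S.

Lemma zev_wpoly (s : seq BinInt.Z) (r : seq rat) (w : qser) :
  r = [seq zval z | z <- s] -> qunit (wpoly r w) = zev s (fps_of w).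
Proof.
move=> ->; rewrite /wpoly /= fps_hornerE; elim: s => //= z s ->.
by rewrite zval_fps.
Qed.

Delimit Scope Z_scope with bZ.
Local Notation L s := (s%bZ).

Lemma omega_pX (l k : nat) (e1 e2 : fps) : (l.-1 * k = 24)%N -> e1 0%N = 1 -> e2 0%N = 1 ->
  fps_mul (fps_powr e2 k%:R) (fps_powr (fps_powr e1 k%:R) (-1)) ^+ l.-1 * e1 ^+ 24 = e2 ^+ 24.
Proof.
move=> lk e10 e20; rewrite -lk mulnC !exprM -exprMn.
by rewrite (omega_powr k e10 e20).
Qed.

Definition genus0_checks (l k : nat) (m pm pp kk mu mu1 de nu : seq BinInt.Z) :=
  [&& (1 < l)%N, (l.-1 * k == 24)%N, genus0_lead m pm pp kk, genus0_check1 m pm kk,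
    genus0_check2 l m pp kk, genus0_check3 l m pm pp kk,
    genus0_check4 l m pm pp mu mu1 de nu & genus0_check5 l mu mu1 de nu].

Lemma genus0_data (l k : nat) (m pm pp kk mu mu1 de nu : seq BinInt.Z) (X Z : qser) (om : fps) :
  genus0_checks l k m pm pp kk mu mu1 de nu ->
  qord X = 1%:R -> qord Z = 0%:R ->
  om = fps_mul (fps_powr (euler_prod l) k%:R) (fps_powr (fps_powr (euler_prod 1) k%:R) (-1)) ->
  qunit X 0%N = 1 -> qunit X * zev mu (pX * om) = om ->
  forall r : rat, r * 12%:R = l.+1%:R ->
  qunit Z = fps_mul (fps_mul (fps_powr (euler_prod 1) 2) (fps_powr (euler_prod l) 2))
     (fps_powr (fps_powr (qunit X) r) (-1)) ->
  exists2 S : fps, S 0%N = 1 & modular_data l (fps_of X) (fps_of Z) S.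
Proof.
move=> /and5P[l1 /eqP lk h1 h2 /and4P[h3 h4 h5 h6]] X1 Z0 omE x0 xE r rE ZE.
have E1 := eulp0 1; have El := eulp0 l.
have Xof := fps_of_nat X1; have Zof := fps_of_nat Z0.
rewrite expr1 in Xof; rewrite expr0 mul1r in Zof; rewrite Xof Zof.
have om0 : om 0%N = 1.
  by rewrite omE -[fps_mul _ _]/(fps_powr (euler_prod l) k%:R * fps_powr (fps_powr (euler_prod 1) k%:R) (-1))
    fcoef_mul0 !fps_powr0 mulr1.
apply: (genus0_modular l1 h1 h2 h3 h4 h5 h6 om0 x0).
- rewrite ZE -[fps_mul _ _]/(fps_mul (fps_powr (euler_prod 1) 2) (fps_powr (euler_prod l) 2) *
     fps_powr (fps_powr (qunit X) r) (-1)) fcoef_mul0 fps_powr0 mulr1.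
  by rewrite fps_mul0 !fps_powr0 mulr1.
- by rewrite omE; apply: omega_pX.
- exact: xE.
- by rewrite ZE; apply: (zeta_powr E1 El x0 rE).
Qed.

(** The data are the classical formulas 1/X_1(q) = (1 + 256 w)^3 / w and 1/X_1(q^2) = (1 + 16 w)^3 /
    w^2, exchanged by the Fricke involution w -> 1/(4096 w). X_2 is invariant under it, and sqrt g =
    (1 - 64 w)/(1 + 64 w) changes sign. The other genus zero levels have the same shape. *)
Lemma has_modular_data2 : has_modular_data 2.
Proof.
have ck : genus0_checks 2 24 (L [:: 1]) (L [:: 1; 256]) (L [:: 1; 16]) (L [:: 1; 64])
  (zexp (L [:: 1; 64]) 2) (L [:: 1; 64]) (L [:: 1; 64]) (L [:: 1; -64]).
  by vm_compute.
have om1 : qord (etaq 2 ^ 24 / etaq 1 ^ 24)%qser = 1%:R by rewrite /=; field.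
pose om : fps := qunit (etaq 2 ^ 24 / etaq 1 ^ 24)%qser.
have w0 : (pX * om) 0%N = 0 by rewrite coef_pXM.
have rs : [:: 1; 64]%R = [seq zval z | z <- L [:: 1; 64]] :> seq rat.
  by congr [:: _; _].
have uE : qunit (wpoly [:: 1; 64]%R (etaq 2 ^ 24 / etaq 1 ^ 24)%qser) = zev (L [:: 1; 64]) (pX * om).
  by rewrite (zev_wpoly _ rs) (fps_of_nat om1) expr1.
have X1 : qord (Xser 2) = 1%:R by rewrite /=; field.
have Z0 : qord (Zser 2) = 0%:R by rewrite /=; field.
have u0 : (zev (L [:: 1; 64]) (pX * om) : fps) 0%N = 1 := zev_head1 (s := L [:: 1; 64]) w0 (erefl _).
have xE : qunit (Xser 2) * zev (zexp (L [:: 1; 64]) 2) (pX * om) = om.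
  rewrite zev_exp -uE; apply: mu_powr; rewrite uE; exact: u0.
have x0 : qunit (Xser 2) 0%N = 1 by rewrite /= !(fps_mul0, fps_powr0) !mulr1.
have rE : (1 / 4) * 12%:R = 3%:R :> rat by field.
exact: (genus0_data ck X1 Z0 (erefl om) x0 xE rE (erefl _)).
Qed.

Lemma has_modular_data3 : has_modular_data 3.
Proof.
have ck : genus0_checks 3 12 (L [:: 1; 27]) (L [:: 1; 243]) (L [:: 1; 3]) (L [:: 1])
  (zexp (L [:: 1; 27]) 2) (L [:: 1; 27]) (L [:: 1; 27]) (L [:: 1; -27]).
  by vm_compute.
have om1 : qord (etaq 3 ^ 12 / etaq 1 ^ 12)%qser = 1%:R by rewrite /=; field.
pose om : fps := qunit (etaq 3 ^ 12 / etaq 1 ^ 12)%qser.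
have w0 : (pX * om) 0%N = 0 by rewrite coef_pXM.
have rs : [:: 1; 27]%R = [seq zval z | z <- L [:: 1; 27]] :> seq rat.
  by congr [:: _; _].
have uE : qunit (wpoly [:: 1; 27]%R (etaq 3 ^ 12 / etaq 1 ^ 12)%qser) = zev (L [:: 1; 27]) (pX * om).
  by rewrite (zev_wpoly _ rs) (fps_of_nat om1) expr1.
have X1 : qord (Xser 3) = 1%:R by rewrite /=; field.
have Z0 : qord (Zser 3) = 0%:R by rewrite /=; field.
have u0 : (zev (L [:: 1; 27]) (pX * om) : fps) 0%N = 1 := zev_head1 (s := L [:: 1; 27]) w0 (erefl _).
have xE : qunit (Xser 3) * zev (zexp (L [:: 1; 27]) 2) (pX * om) = om.
  rewrite zev_exp -uE; apply: mu_powr; rewrite uE; exact: u0.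
have x0 : qunit (Xser 3) 0%N = 1 by rewrite /= !(fps_mul0, fps_powr0) !mulr1.
have rE : (1 / 3) * 12%:R = 4%:R :> rat by field.
exact: (genus0_data ck X1 Z0 (erefl om) x0 xE rE (erefl _)).
Qed.

Lemma has_modular_data5 : has_modular_data 5.
Proof.
have ck : genus0_checks 5 6 (L [:: 1]) (L [:: 1; 250; 3125]) (L [:: 1; 10; 5]) (L [:: 1; 22; 125])
  (L [:: 1; 22; 125]) (L [:: 1; 22; 125]) (L [:: 1; 22; 125]) (L [:: 1; 0; -125]).
  by vm_compute.
have om1 : qord (etaq 5 ^ 6 / etaq 1 ^ 6)%qser = 1%:R by rewrite /=; field.
pose om : fps := qunit (etaq 5 ^ 6 / etaq 1 ^ 6)%qser.
have w0 : (pX * om) 0%N = 0 by rewrite coef_pXM.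
have rs : [:: 1; 22; 125]%R = [seq zval z | z <- L [:: 1; 22; 125]] :> seq rat.
  by congr [:: _; _; _].
have uE : qunit (wpoly [:: 1; 22; 125]%R (etaq 5 ^ 6 / etaq 1 ^ 6)%qser) = zev (L [:: 1; 22; 125]) (pX * om).
  by rewrite (zev_wpoly _ rs) (fps_of_nat om1) expr1.
have X1 : qord (Xser 5) = 1%:R by rewrite /=; field.
have Z0 : qord (Zser 5) = 0%:R by rewrite /=; field.
have u0 : (zev (L [:: 1; 22; 125]) (pX * om) : fps) 0%N = 1 := zev_head1 (s := L [:: 1; 22; 125]) w0 (erefl _).
have xE : qunit (Xser 5) * zev (L [:: 1; 22; 125]) (pX * om) = om.
  rewrite -uE; apply: mu_powr1; rewrite uE; exact: u0.
have x0 : qunit (Xser 5) 0%N = 1 by rewrite /= !(fps_mul0, fps_powr0) !mulr1.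
have rE : (1 / 2) * 12%:R = 6%:R :> rat by field.
exact: (genus0_data ck X1 Z0 (erefl om) x0 xE rE (erefl _)).
Qed.

Lemma has_modular_data7 : has_modular_data 7.
Proof.
have ck : genus0_checks 7 4 (L [:: 1; 13; 49]) (L [:: 1; 245; 2401]) (L [:: 1; 5; 1]) (L [:: 1])
  (L [:: 1; 13; 49]) (L [:: 1; 13; 49]) (L [:: 1; 13; 49]) (L [:: 1; 0; -49]).
  by vm_compute.
have om1 : qord (etaq 7 ^ 4 / etaq 1 ^ 4)%qser = 1%:R by rewrite /=; field.
pose om : fps := qunit (etaq 7 ^ 4 / etaq 1 ^ 4)%qser.
have w0 : (pX * om) 0%N = 0 by rewrite coef_pXM.
have rs : [:: 1; 13; 49]%R = [seq zval z | z <- L [:: 1; 13; 49]] :> seq rat.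
  by congr [:: _; _; _].
have uE : qunit (wpoly [:: 1; 13; 49]%R (etaq 7 ^ 4 / etaq 1 ^ 4)%qser) = zev (L [:: 1; 13; 49]) (pX * om).
  by rewrite (zev_wpoly _ rs) (fps_of_nat om1) expr1.
have X1 : qord (Xser 7) = 1%:R by rewrite /=; field.
have Z0 : qord (Zser 7) = 0%:R by rewrite /=; field.
have u0 : (zev (L [:: 1; 13; 49]) (pX * om) : fps) 0%N = 1 := zev_head1 (s := L [:: 1; 13; 49]) w0 (erefl _).
have xE : qunit (Xser 7) * zev (L [:: 1; 13; 49]) (pX * om) = om.
  rewrite -uE; apply: mu_powr1; rewrite uE; exact: u0.
have x0 : qunit (Xser 7) 0%N = 1 by rewrite /= !(fps_mul0, fps_powr0) !mulr1.
have rE : (2 / 3) * 12%:R = 8%:R :> rat by field.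
exact: (genus0_data ck X1 Z0 (erefl om) x0 xE rE (erefl _)).
Qed.

Lemma has_modular_data13 : has_modular_data 13.
Proof.
have ck : genus0_checks 13 2 (L [:: 1; 5; 13]) (L [:: 1; 247; 3380; 15379; 28561]) (L [:: 1; 7; 20; 19; 1]) (L [:: 1; 6; 13])
  (L [:: 1; 5; 13]) (zexp (L [:: 1; 5; 13]) 2) (L [:: 1; 5; 13]) (L [:: 1; 0; -13]).
  by vm_compute.
have om1 : qord (etaq 13 ^ 2 / etaq 1 ^ 2)%qser = 1%:R by rewrite /=; field.
pose om : fps := qunit (etaq 13 ^ 2 / etaq 1 ^ 2)%qser.
have w0 : (pX * om) 0%N = 0 by rewrite coef_pXM.
have rs : [:: 1; 5; 13]%R = [seq zval z | z <- L [:: 1; 5; 13]] :> seq rat.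
  by congr [:: _; _; _].
have uE : qunit (wpoly [:: 1; 5; 13]%R (etaq 13 ^ 2 / etaq 1 ^ 2)%qser) = zev (L [:: 1; 5; 13]) (pX * om).
  by rewrite (zev_wpoly _ rs) (fps_of_nat om1) expr1.
have X1 : qord (Xser 13) = 1%:R by rewrite /=; field.
have Z0 : qord (Zser 13) = 0%:R by rewrite /=; field.
have u0 : (zev (L [:: 1; 5; 13]) (pX * om) : fps) 0%N = 1 := zev_head1 (s := L [:: 1; 5; 13]) w0 (erefl _).
have xE : qunit (Xser 13) * zev (L [:: 1; 5; 13]) (pX * om) = om.
  rewrite -uE; apply: mu_powr1; rewrite uE; exact: u0.
have x0 : qunit (Xser 13) 0%N = 1 by rewrite /= !(fps_mul0, fps_powr0) !mulr1.
have rE : (7 / 6) * 12%:R = 14%:R :> rat by field.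
exact: (genus0_data ck X1 Z0 (erefl om) x0 xE rE (erefl _)).
Qed.

End GenusZeroInstances.

(** * Theta series in one variable as eta quotients *)

Section OneDimensionalTheta.

Definition Zsum (E : int -> int) (w : int -> rat) : fps :=
  gsum [set: int] (fun n => `|E n|%N) w.

Lemma eqmod_Zsum N M (E : int -> int) (w : int -> rat) :
  (forall j : nat, (M <= j)%N -> (N <= `|E j%:Z|)%N /\ (N <= `|E (- j%:Z)|)%N) ->
  eqmod N (Zsum E w) (fps_const (w 0) * pX ^+ `|E 0|%N +
    \sum_(1 <= j < M) (fps_const (w j%:Z) * pX ^+ `|E j%:Z|%N +
                       fps_const (w (- j%:Z)) * pX ^+ `|E (- j%:Z)|%N)).
Proof.
move=> low n ltnN.
pose r : seq int := 0 :: ([seq j%:Z | j <- iota 1 M.-1] ++ [seq - j%:Z | j <- iota 1 M.-1]).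
have mon c k : (fps_const c * pX ^+ k) n = if k == n then c else 0.
  by rewrite fcoef_constM coef_pXn eq_sym; case: eqP; rewrite ?mulr1 ?mulr0.
rewrite /Zsum (gsum_seq _ (r := r)).
- rewrite big_mkcond big_cons big_cat !big_map /= fcoefD mon fcoef_sum -big_split /=.
  rewrite in_setT /=; congr (_ + _); rewrite /index_iota subn1; apply: eq_bigr => j _.
  by rewrite fcoefD !mon !in_setT.
- rewrite /r /= cat_uniq !map_inj_uniq ?iota_uniq //=.
  + rewrite mem_cat negb_or andbT; apply/andP; split.
    * by apply/andP; split; apply/mapP => -[j]; rewrite mem_iota => /andP[j1 _]; lia.
    * apply/hasPn => x /mapP[j]; rewrite mem_iota => /andP[j1 _] ->.
      by apply/mapP=> -[k]; rewrite mem_iota => /andP[k1 _]; lia.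
  + by move=> i j /eqP; rewrite eqr_opp => /eqP[].
  + by move=> i j [].
- move=> i _ ei; rewrite /r inE mem_cat.
  have : (`|i| < M)%N.
    rewrite ltnNge; apply/negP => Mi; have [l1 l2] := low _ Mi.
    have : i = `|i|%N%:Z \/ i = - (`|i|%N%:Z) by lia.
    by case=> e; move: l1 l2 ei; rewrite -e; lia.
  move=> iM; have : i = 0 \/ (0 < `|i|)%N /\ (i = `|i|%N%:Z \/ i = - (`|i|%N%:Z)) by lia.
  case=> [->|[i0 [e|e]]]; first by rewrite eqxx.
  + by apply/or3P; apply: Or32; apply/mapP; exists `|i|%N => //; rewrite mem_iota; lia.
  + by apply/or3P; apply: Or33; apply/mapP; exists `|i|%N => //; rewrite mem_iota; lia.
Qed.

Lemma bin2_double j : (2 * 'C(j.+1, 2) = j.+1 * j)%N.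
Proof. by elim: j => // j IH; rewrite binS mulnDr IH bin1; lia. Qed.

Lemma theta_term_bin (u v : fps) j : theta_term u v j =
  (u ^+ 'C(j.+1, 2) * v ^+ 'C(j, 2), v ^+ 'C(j.+1, 2) * u ^+ 'C(j, 2)).
Proof.
elim: j => [|j IH]; first by rewrite /= !bin_small // !expr0 !mulr1.
rewrite [theta_term _ _ _]/= IH /=; congr (_, _).
- have b1 : 'C(j.+2, 2) = ('C(j.+1, 2) + j.+1)%N by rewrite binS bin1.
  have b2 : 'C(j.+1, 2) = ('C(j, 2) + j)%N by rewrite binS bin1.
  rewrite b1 [in RHS]exprD [X in _ = _ * v ^+ X]b2 [in RHS]exprD exprMn exprS -!mulrA; ring.
- have b1 : 'C(j.+2, 2) = ('C(j.+1, 2) + j.+1)%N by rewrite binS bin1.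
  have b2 : 'C(j.+1, 2) = ('C(j, 2) + j)%N by rewrite binS bin1.
  rewrite b1 [in RHS]exprD [X in _ = _ * u ^+ X]b2 [in RHS]exprD exprMn exprS -!mulrA; ring.
Qed.

Definition theta3 : fps := Zsum (fun n => n ^+ 2) (fun=> 1).
Definition theta4 : fps := Zsum (fun n => n ^+ 2) (fun n => (-1) ^+ `|n|%N).
(** Twice Ramanujan's psi(q^2), since n and -1 - n contribute equally; q^(1/4) times it is Jacobi's
    theta_2. *)
Definition psi2 : fps := Zsum (fun n => n ^+ 2 + n) (fun=> 1).
Definition pent (n : int) : int := ((n * (3 * n + 1)) %/ 2)%Z.
Definition pentsum : fps := Zsum pent (fun n => (-1) ^+ `|n|%N).

Lemma pent2 n : 2 * pent n = n * (3 * n + 1).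
Proof.
rewrite /pent mulrC divzK //; apply/dvdzP.
have [k [->|->]] : exists k : int, n = 2 * k \/ n = 2 * k + 1.
  by exists (n %/ 2)%Z; lia.
- by exists (k * (3 * (2 * k) + 1)); ring.
- by exists ((2 * k + 1) * (3 * k + 2)); ring.
Qed.

Lemma eulN_rec m N : eulN m N.+2 = eulN m N.+1 * (1 - pX ^+ (m * N.+1)).
Proof. by rewrite /eulN big_nat_recr. Qed.
Lemma eulN_1 m : eulN m 1 = 1. Proof. by rewrite /eulN big_geq. Qed.

Lemma eqmod_eulN m N k : (0 < m)%N -> (N <= k)%N -> eqmod N (eulN m k) (eulp m).
Proof.
move=> m0 Nk n lt; rewrite /eulp (euler_prodE (N := k) m0) //; exact: leq_trans lt Nk.
Qed.

Lemma pXn_low N k : (N <= k)%N -> eqmod N (pX ^+ k) 0.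
Proof. by move=> Nk n lt; rewrite fcoef0 coef_pXn ltn_eqF // (leq_trans lt). Qed.

Lemma signed_pX a b i j : (- pX ^+ a) ^+ i * (- pX ^+ b) ^+ j =
  fps_const ((-1) ^+ (i + j)) * pX ^+ (a * i + b * j).
Proof.
rewrite -fps_sign exprD (exprD pX) [(- pX ^+ a) ^+ i]exprNn [(- pX ^+ b) ^+ j]exprNn -!exprM.
by rewrite mulrACA.
Qed.

Lemma binS2 j : ('C(j.+1, 2) + 'C(j, 2) = j ^ 2)%N.
Proof. by have := bin2_double j; case: j => [|j] //; have := bin2_double j; lia. Qed.

Lemma sgn_sq j : (-1) ^+ (j ^ 2) = (-1) ^+ j :> rat.
Proof. by rewrite -signr_odd oddX /= signr_odd. Qed.

Lemma coef0_pXn (a : nat) : (0 < a)%N -> (pX ^+ a) 0%N = 0.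
Proof. by move=> a0; rewrite coef_pXn; case: a a0. Qed.

(** Take u = v = -q in the triple product, with base q^2. A further Euler product in q^2 completes
    the odd factors to the square of the full Euler product. *)
Lemma theta4_eta : theta4 * eulp 2 = eulp 1 ^+ 2.
Proof.
apply: eqmodP => N; pose u : fps := - pX ^+ 1.
have TE j : theta_term u u j = (fps_const ((-1) ^+ j) * pX ^+ (j ^ 2), fps_const ((-1) ^+ j) * pX ^+ (j ^ 2)).
  by rewrite theta_term_bin /u !signed_pX !mul1n binS2 sgn_sq.
have uu : u * u = pX ^+ 2 by rewrite /u mulrNN expr1 expr2.
have low j : (N < j)%N -> eqmod N ((theta_term u u j).1 + (theta_term u u j).2) 0.
  move=> Nj; rewrite TE /= -mulrDr -[X in eqmod _ _ X](mulr0 (fps_const ((-1) ^+ j))).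
  apply: eqmodM => //; rewrite -[X in eqmod _ _ X](addr0 0).
  by apply: eqmodD; apply: pXn_low; rewrite -mulnn; nia.
have tp := triple_product (N := N) (u := u) (v := u).
rewrite uu in tp; have {}tp := tp (coef0_pXn (isT : (0 < 2)%N)) low.
have fE k : qfact u u k = eulN 2 k.+1.
  elim: k => [|k IH]; first by rewrite eulN_1.
  by rewrite eulN_rec /= IH uu -exprM.
have pE k : \prod_(j < k) ((1 + u * (pX ^+ 2) ^+ j) * (1 + u * (pX ^+ 2) ^+ j)) * eulN 2 k.+1 * eulN 2 k.+1 = eulN 1 (2 * k).+1 ^+ 2.
  elim: k => [|k IH]; first by rewrite big_ord0 !eulN_1; ring.
  rewrite big_ord_recr /= (_ : (2 * k.+1).+1 = (2 * k).+3); last by lia.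
  rewrite !eulN_rec.
  transitivity (eulN 1 (2 * k).+1 ^+ 2 * ((1 + u * (pX ^+ 2) ^+ k) * (1 - pX ^+ (2 * k.+1))) ^+ 2).
    by rewrite -IH; ring.
  have -> : 1 + u * (pX ^+ 2) ^+ k = 1 - pX ^+ (1 * (2 * k).+1).
    by rewrite /u mul1n expr1 -exprM exprS; ring.
  by rewrite (_ : 1 * (2 * k).+2 = 2 * k.+1)%N; [ring | lia].
rewrite fE in tp.
have eZ : eqmod N theta4 (1 + \sum_(1 <= j < (2 * N).+1) ((theta_term u u j).1 + (theta_term u u j).2)).
  apply: (eqmod_trans (eqmod_Zsum (M := (2 * N).+1) _ _)).
    move=> j jN; rewrite sqrrN abszX /=; split; rewrite -mulnn; nia.
  rewrite expr0 rmorph1 expr0n /= expr0 mulr1.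
  apply: eqmodD => // n lt; rewrite !fcoef_sum; apply: eq_bigr => j _.
  by rewrite TE /= sqrrN abszX abszN /=.
have tN : (N <= (2 * N).+1)%N by lia.
have tN2 : (N <= (2 * (2 * N)).+1)%N by lia.
apply: (@eqmod_trans _ (\prod_(j < 2 * N) ((1 + u * (pX ^+ 2) ^+ j) * (1 + u * (pX ^+ 2) ^+ j)) * eulN 2 (2 * N).+1 * eulN 2 (2 * N).+1)).
  apply: eqmodM; first exact: (eqmod_trans eZ (eqmod_sym tp)).
  exact/eqmod_sym/(eqmod_eulN (isT : (0 < 2)%N) tN).
rewrite pE; exact/eqmodX/(eqmod_eulN (isT : (0 < 1)%N) tN2).
Qed.

(** Take u = -q^2 and v = -q, with base q^3: the three kinds of factors run through the residues 2,
    1 and 0 modulo 3. *)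
Lemma pentagonal : pentsum = eulp 1.
Proof.
apply: eqmodP => N; pose u : fps := - pX ^+ 2; pose v : fps := - pX ^+ 1.
have TE j : theta_term u v j = (fps_const ((-1) ^+ j) * pX ^+ (2 * 'C(j.+1, 2) + 'C(j, 2)),
    fps_const ((-1) ^+ j) * pX ^+ ('C(j.+1, 2) + 2 * 'C(j, 2))).
  by rewrite theta_term_bin /u /v !signed_pX !mul1n !binS2 sgn_sq.
have uv : u * v = pX ^+ 3 by rewrite /u /v mulrNN -exprD.
have bj j : (N < j)%N -> (N <= 'C(j.+1, 2))%N by move=> h; have := bin2_double j; nia.
have low j : (N < j)%N -> eqmod N ((theta_term u v j).1 + (theta_term u v j).2) 0.
  move=> Nj; rewrite TE /= -mulrDr -[X in eqmod _ _ X](mulr0 (fps_const ((-1) ^+ j))).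
  apply: eqmodM => //; rewrite -[X in eqmod _ _ X](addr0 0).
  by apply: eqmodD; apply: pXn_low; have := bj j Nj; lia.
have tp := triple_product (N := N) (u := u) (v := v).
rewrite uv in tp; have {}tp := tp (coef0_pXn (isT : (0 < 3)%N)) low.
have pE k : \prod_(j < k) ((1 + u * (pX ^+ 3) ^+ j) * (1 + v * (pX ^+ 3) ^+ j)) * qfact u v k = eulN 1 (3 * k).+1.
  elim: k => [|k IH]; first by rewrite big_ord0 eulN_1 mulr1.
  rewrite big_ord_recr /= (_ : (3 * k.+1).+1 = (3 * k).+4); last by lia.
  rewrite !eulN_rec -IH uv -!exprM !mul1n.
  have -> : u * pX ^+ (3 * k) = - pX ^+ (3 * k).+2 by rewrite /u mulNr -exprD.
  have -> : v * pX ^+ (3 * k) = - pX ^+ (3 * k).+1 by rewrite /v mulNr -exprD.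
  by rewrite (_ : 3 * k.+1 = (3 * k).+3)%N; [ring | lia].
rewrite pE in tp.
have E1 j : `|pent j%:Z|%N = (2 * 'C(j.+1, 2) + 'C(j, 2))%N.
  by have := pent2 j%:Z; have := bin2_double j; case: j => [|j] //; have := bin2_double j; nia.
have E2 j : `|pent (- j%:Z)|%N = ('C(j.+1, 2) + 2 * 'C(j, 2))%N.
  by have := pent2 (- j%:Z); have := bin2_double j; case: j => [|j] //; have := bin2_double j; nia.
apply: (@eqmod_trans _ (1 + \sum_(1 <= j < (2 * N).+1) ((theta_term u v j).1 + (theta_term u v j).2))).
  apply: (eqmod_trans (eqmod_Zsum (M := (2 * N).+1) _ _)).
    move=> j jN; rewrite E1 E2; case: N jN {tp bj low} => [|N] jN; first by [].
    by have := bin2_double j; nia.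
  rewrite expr0 rmorph1 (E1 0%N) expr0 mulr1.
  apply: eqmodD => // n lt; rewrite !fcoef_sum; apply: eq_bigr => j _.
  by rewrite TE E1 E2 abszN /=.
apply: (eqmod_trans (eqmod_sym tp)); apply: (eqmod_eulN (isT : (0 < 1)%N)); lia.
Qed.

(** Take u = q^2 and v = 1, with base q^2; the first factor 1 + v is the 2 on the right. *)
Lemma psi2_eta : psi2 * eulp 2 = 2%:R * eulp 4 ^+ 2.
Proof.
apply: eqmodP => N; pose u : fps := pX ^+ 2; pose v : fps := 1.
have TE j : theta_term u v j = (pX ^+ (2 * 'C(j.+1, 2)), pX ^+ (2 * 'C(j, 2))).
  by rewrite theta_term_bin /u /v !expr1n mulr1 mul1r -!exprM.
have uv : u * v = pX ^+ 2 by rewrite /v mulr1.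
have bj j : (N < j)%N -> (N <= 2 * 'C(j, 2))%N.
  by case: j => // j h; have := bin2_double j; nia.
have bj' j : (N < j)%N -> (N <= 2 * 'C(j.+1, 2))%N.
  by move=> h; have := bin2_double j; nia.
have low j : (N < j)%N -> eqmod N ((theta_term u v j).1 + (theta_term u v j).2) 0.
  move=> Nj; rewrite TE /= -[X in eqmod _ _ X](addr0 0).
  by apply: eqmodD; apply: pXn_low; [exact: bj' | exact: bj].
have tp := triple_product (N := N) (u := u) (v := v).
rewrite uv in tp; have {}tp := tp (coef0_pXn (isT : (0 < 2)%N)) low.
have fE k : qfact u v k = eulN 2 k.+1.
  elim: k => [|k IH]; first by rewrite eulN_1.
  by rewrite eulN_rec /= IH uv -exprM.
pose P k : fps := \prod_(j < k) (1 + pX ^+ (2 * j.+1)).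
have P1 k : P k * eulN 2 k.+1 = eulN 4 k.+1.
  elim: k => [|k IH]; first by rewrite /P big_ord0 !eulN_1 mulr1.
  rewrite /P big_ord_recr /= -/(P k) !eulN_rec -IH.
  rewrite (_ : 4 * k.+1 = 2 * k.+1 + 2 * k.+1)%N; last by lia.
  by rewrite exprD; ring.
(* The two products are shifted against each other by one factor; what is left over, 1 + q^(2k), is
   1 modulo q^N. *)
have P2 k : \prod_(j < k) ((1 + u * (pX ^+ 2) ^+ j) * (1 + v * (pX ^+ 2) ^+ j)) * (1 + pX ^+ (2 * k)) = 2%:R * P k ^+ 2.
  elim: k => [|k IH]; first by rewrite /P !big_ord0 muln0 expr0; ring.
  rewrite big_ord_recr /= /P big_ord_recr /= -/(P k).
  transitivity (2%:R * P k ^+ 2 * (1 + u * pX ^+ (2 * k)) * (1 + pX ^+ (2 * k.+1))).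
    have vk : v * (pX ^+ 2) ^+ k = pX ^+ (2 * k) by rewrite mul1r -exprM.
    rewrite -IH vk -exprM; move: (\prod_(j < k) _) => a.
    move: (pX ^+ (2 * k)) (pX ^+ (2 * k.+1)) => b c; clear; ring.
  by rewrite /u -exprD (_ : 2 + 2 * k = 2 * k.+1)%N; [ring | lia].
rewrite fE in tp.
have E1 j : absz (j%:Z ^+ 2 + j%:Z) = (2 * 'C(j.+1, 2))%N by have := bin2_double j; nia.
have E2 j : absz ((- j%:Z) ^+ 2 + - j%:Z) = (2 * 'C(j, 2))%N.
  by case: j => // j; have := bin2_double j; nia.
have eZ : eqmod N psi2 (1 + \sum_(1 <= j < (2 * N).+2) ((theta_term u v j).1 + (theta_term u v j).2)).
  apply: (eqmod_trans (eqmod_Zsum (M := (2 * N).+2) _ _)).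
    by move=> j jN; rewrite E1 E2; split; [apply: bj' | apply: bj]; lia.
  rewrite rmorph1 (E1 0%N) expr0 mulr1.
  apply: eqmodD => // n lt; rewrite !fcoef_sum; apply: eq_bigr => j _.
  by rewrite TE E1 E2 ?mul1r.
have eZ' : eqmod N psi2 (1 + \sum_(1 <= j < (2 * N).+1) ((theta_term u v j).1 + (theta_term u v j).2)).
  apply: (eqmod_trans eZ); rewrite big_nat_recr; last by [].
  rewrite -[X in eqmod _ _ (1 + X)]addr0; apply: eqmodD => //; apply: eqmodD => //.
  by apply: low; lia.
have tN : (N <= (2 * N).+1)%N by lia.
have e1 : eqmod N (1 + pX ^+ (2 * (2 * N))) 1.
  by rewrite -[X in eqmod _ _ X]addr0; apply: eqmodD => //; apply: pXn_low; lia.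
set PP := \prod_(j < 2 * N) _ in tp.
have h2 := eqmod_eulN (isT : (0 < 2)%N) tN.
have h4 := eqmod_eulN (isT : (0 < 4)%N) tN.
apply: (@eqmod_trans _ (PP * eulN 2 (2 * N).+1 * eulN 2 (2 * N).+1)).
  by apply: eqmodM; [exact: (eqmod_trans eZ' (eqmod_sym tp)) | exact: eqmod_sym].
apply: (@eqmod_trans _ (PP * eulN 2 (2 * N).+1 * eulN 2 (2 * N).+1 * (1 + pX ^+ (2 * (2 * N))))).
  by rewrite -[X in eqmod _ X]mulr1; apply: eqmodM => //; exact: eqmod_sym.
have -> : PP * eulN 2 (2 * N).+1 * eulN 2 (2 * N).+1 * (1 + pX ^+ (2 * (2 * N))) =
    2%:R * eulN 4 (2 * N).+1 ^+ 2.
  by rewrite -P1 exprMn mulrA -P2 -/PP; ring.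
by apply: eqmodM => //; apply: eqmodX.
Qed.

End OneDimensionalTheta.

(** * Sums over the plane lattice *)

Section PlaneLatticeSums.

(** The bound is e n + 1 rather than e n because n^2 + n vanishes at n = -1. *)
Lemma fibfin_int (A : set int) e :
  (forall n, A n -> (`|n| <= (e n).+1)%N) -> fibfin A e.
Proof.
move=> h n.
apply: (@sub_finite_set _ _ [set` [seq i%:Z - n.+1%:Z | i <- iota 0 (2 * n + 3)]]); last exact: finite_seq.
move=> k [/h kn /= ek]; apply/mapP; move: (k : int) kn ek => {}k kn ek.
by exists (absz (k + n.+1%:Z)); [rewrite mem_iota; lia | lia].
Qed.

Lemma fibfin_int2 (A : set (int * int)) e :
  (forall p, A p -> (`|p.1| <= (e p).+1)%N /\ (`|p.2| <= (e p).+1)%N) -> fibfin A e.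
Proof.
move=> h n; pose s : seq int := [seq i%:Z - n.+1%:Z | i <- iota 0 (2 * n + 3)].
apply: (@sub_finite_set _ _ [set` [seq (i, j) | i <- s, j <- s]]); last exact: finite_seq.
move=> [i j] [/h /= [h1 h2] /= ek]; apply/allpairsP; exists (i, j) => /=.
move: (i : int) (j : int) h1 h2 ek => {}i {}j h1 h2 ek.
by split=> //; apply/mapP; [exists (absz (i + n.+1%:Z)) | exists (absz (j + n.+1%:Z))];
  rewrite ?mem_iota; lia.
Qed.

Lemma dil_gsum (I : choiceType) (A : set I) e w m : (0 < m)%N ->
  dil m (gsum A e w) = gsum A (fun i => m * e i)%N w.
Proof.
move=> m0; apply/fpsP => n; rewrite coef_dil // /gsum; case: ifPn => [/dvdnP[k ->]|nd].
  rewrite mulnK //; congr (\sum_(i \in _ `&` _) _); apply/seteqP; split=> i /=; first by move=> ->; rewrite mulnC.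
  by move=> /eqP; rewrite mulnC eqn_pmul2r // => /eqP.
rewrite (_ : A `&` _ = set0) ?fsbig_set0 //; apply/seteqP; split=> i //= [_ ei].
by case/negP: nd; rewrite -ei dvdn_mulr.
Qed.

Lemma flip_gsum (I : choiceType) (A : set I) e w : fibfin A e ->
  fps_flip (gsum A e w) = gsum A e (fun i => (-1) ^+ e i * w i).
Proof.
move=> fin; apply/fpsP => n; rewrite coef_flip /gsum !fsbig_finite // mulr_sumr.
rewrite big_seq [RHS]big_seq; apply: eq_bigr => i.
by rewrite in_fset_set // inE => -[_ /= ->].
Qed.

Definition Lsum (A : set (int * int)) (Q : int * int -> int) : fps :=
  gsum A (fun p => `|Q p|%N) (fun=> 1).

Definition defin (A : set (int * int)) (Q : int * int -> int) :=
  forall p, A p -> (`|p.1| <= `|Q p|.+1)%N /\ (`|p.2| <= `|Q p|.+1)%N.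

Lemma defin_fib A Q : defin A Q -> fibfin A (fun p => `|Q p|%N).
Proof. by move=> h; apply: fibfin_int2. Qed.

(** Giving the inverse k explicitly reduces each change of variables below to linear integer
    arithmetic with congruences and one polynomial identity between quadratic forms. *)
Lemma Lsum_reindex (h k : int * int -> int * int) A B Q Q' :
  (forall p, B p -> A (h p)) -> (forall p, A p -> B (k p)) ->
  (forall p, A p -> h (k p) = p) -> (forall p, B p -> k (h p) = p) ->
  (forall p, B p -> Q (h p) = Q' p) -> Lsum A Q = Lsum B Q'.
Proof.
move=> BA AB hk kh QQ; rewrite /Lsum (@gsum_reindex _ _ h B A); last first.
  split=> //.
  - by move=> i j; rewrite !inE => Bi Bj e; rewrite -(kh i Bi) e kh.
  - by move=> i Ai; exists (k i); [exact: AB | exact: hk].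
by apply: eq_gsum => p Bp //=; rewrite QQ.
Qed.

Lemma LsumID C A Q : defin A Q ->
  Lsum A Q = Lsum (A `&` C) Q + Lsum (A `&` ~` C) Q.
Proof. by move=> /defin_fib fin; apply: gsumID. Qed.

Lemma Lsum_scale A Q m : (0 < m)%N ->
  dil m (Lsum A Q) = Lsum A (fun p => m%:Z * Q p).
Proof. by move=> m0; rewrite /Lsum dil_gsum //; apply: eq_gsum => // p _; rewrite abszM. Qed.

Lemma pXn_gsum (I : choiceType) (A : set I) e w m :
  pX ^+ m * gsum A e w = gsum A (fun i => m + e i)%N w.
Proof.
apply/fpsP => n; rewrite coef_pXnM /gsum; case: ltnP => mn.
  rewrite (_ : A `&` _ = set0) ?fsbig_set0 //; apply/seteqP; split=> i //= [_ ei].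
  by move: mn; rewrite -ei; lia.
by congr (\sum_(i \in _ `&` _) _); apply/seteqP; split=> i /=; lia.
Qed.

Lemma Zsum_mul E1 E2 (w1 w2 : int -> rat) m k : (0 < k)%N ->
  (forall n, 0 <= E1 n /\ (`|n| <= `|E1 n|.+1)%N) ->
  (forall n, 0 <= E2 n /\ (`|n| <= `|E2 n|.+1)%N) ->
  pX ^+ m * (Zsum E1 w1 * dil k (Zsum E2 w2)) =
  gsum [set: int * int] (fun p => `|(m%:Z + (E1 p.1 + k%:Z * E2 p.2))%R|%N)
    (fun p => w1 p.1 * w2 p.2).
Proof.
move=> k0 h1 h2; have kk n : (`|n| <= (k * `|E2 n|).+1)%N.
  by have [_ h] := h2 n; apply: leq_trans h _; rewrite ltnS leq_pmull.
rewrite /Zsum dil_gsum // gsumM; first last.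
- by apply: fibfin_int => n _.
- by apply: fibfin_int => n _; case: (h1 n).
rewrite setXTT pXn_gsum; apply: eq_gsum => // -[i j] _ /=.
have [e1 _] := h1 i; have [e2 _] := h2 j.
have : (0 <= k%:Z * E2 j)%R by apply: mulr_ge0.
have -> : (k * `|E2 j|)%N = `|(k%:Z * E2 j)%R|%N by rewrite abszM.
by move: e1; move: (E1 i) (k%:Z * E2 j) => a b; lia.
Qed.

Lemma theta_Lsum a c : (0 < a)%N -> (1 < c)%N ->
  theta a c = Lsum setT (fun p => qform a c p.1 p.2).
Proof.
move=> a0 c1; apply/fpsP => n; have pos j k : 0 <= qform a c j k.
  by rewrite /qform; have := sqr_ge0 (2 * j + k); have := sqr_ge0 k; have := sqr_ge0 j; nia.
pose s := [seq i%:Z - n%:Z | i <- iota 0 (2 * n).+1].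
have us : uniq s by rewrite map_inj_uniq ?iota_uniq // => i j /addIr [].
rewrite /Lsum (gsum_seq _ (r := [seq (i, j) | i <- s, j <- s])).
- rewrite big_mkcond big_allpairs_dep /theta /s big_map.
  rewrite -[iota 0 _]/(index_iota 0 (2 * n).+1) big_mkord; apply: eq_bigr => j _.
  rewrite big_map big_mkord; apply: eq_bigr => k _ /=.
  rewrite in_setT /=; move: (pos (j%:Z - n%:Z) (k%:Z - n%:Z)); move: (qform _ _ _ _) => q q0.
  have -> : (q == n%:Z) = (`|q|%N == n) by lia.
  by case: eqP.
- by apply: allpairs_uniq => // -[? ?] [? ?] _ _ /= [-> ->].
- move=> [i j] _ qn; have qE : qform a c i j = n%:Z by move: qn (pos i j) => /=; lia.
  have [h1 h2] := theta_box a0 c1 qE; apply/allpairsP; exists (i, j) => /=.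
  move: (i : int) (j : int) h1 h2 => {qn qE}{}i {}j h1 h2.
  by split=> //; apply/mapP; [exists (absz (i + n%:Z)) | exists (absz (j + n%:Z))];
    rewrite ?mem_iota; lia.
Qed.

Lemma defin_form a c (A : set (int * int)) : (0 < a)%N -> (1 < c)%N ->
  defin A (fun p => qform a c p.1 p.2).
Proof.
move=> a0 c1 [j k] _ /=; have pos : 0 <= qform a c j k.
  by rewrite /qform; have := sqr_ge0 (2 * j + k); have := sqr_ge0 k; have := sqr_ge0 j; nia.
have : qform a c j k = `|qform a c j k|%N%:Z by lia.
by case/(theta_box a0 c1) => h1 h2; lia.
Qed.

End PlaneLatticeSums.

(** * Products of theta series *)

Section ThetaIdentities.

Lemma sqr_box (n : int) : 0 <= n ^+ 2 /\ (`|n| <= `|(n ^+ 2)%R|.+1)%N.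
Proof. by have := sqr_ge0 n; split; nia. Qed.
Lemma tri_box (n : int) : 0 <= n ^+ 2 + n /\ (`|n| <= `|(n ^+ 2 + n)%R|.+1)%N.
Proof. by have := sqr_ge0 n; split; nia. Qed.
Lemma pent_box (n : int) : 0 <= pent n /\ (`|n| <= `|pent n|.+1)%N.
Proof. by have := pent2 n; split; nia. Qed.

Lemma sgn_absD (i j : int) : (-1) ^+ `|i|%N * (-1) ^+ `|j|%N = (-1) ^+ absz (i + j) :> rat.
Proof.
rewrite -exprD -signr_odd -[RHS]signr_odd (_ : odd (`|i| + `|j|) = odd (absz (i + j))) //.
by lia.
Qed.

Lemma theta3_mul k : (0 < k)%N -> theta3 * dil k theta3 =
  Lsum setT (fun p => p.1 ^+ 2 + k%:Z * p.2 ^+ 2).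
Proof.
move=> k0; have := Zsum_mul (fun=> 1) (fun=> 1) 0 k0 sqr_box sqr_box.
rewrite expr0 mul1r => ->; apply: eq_gsum => p _; rewrite ?mulr1 //.
by rewrite add0r.
Qed.

Lemma theta4_mul k : (0 < k)%N -> theta4 * dil k theta4 =
  gsum setT (fun p => `|(p.1 ^+ 2 + k%:Z * p.2 ^+ 2)%R|%N) (fun p => (-1) ^+ `|(p.1 + p.2)%R|%N).
Proof.
move=> k0; have := Zsum_mul (fun n => (-1) ^+ `|n|%N) (fun n => (-1) ^+ `|n|%N) 0 k0 sqr_box sqr_box.
rewrite expr0 mul1r => ->; apply: eq_gsum => p _; first by rewrite add0r.
exact: sgn_absD.
Qed.

Lemma psi2_mul m k : (0 < k)%N -> pX ^+ m * (psi2 * dil k psi2) =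
  Lsum setT (fun p => m%:Z + (p.1 ^+ 2 + p.1 + k%:Z * (p.2 ^+ 2 + p.2))).
Proof.
move=> k0; rewrite (Zsum_mul (fun=> 1) (fun=> 1) m k0 tri_box tri_box).
by apply: eq_gsum => p _; rewrite ?mulr1.
Qed.

Lemma gsum_const (I : choiceType) (A : set I) e (w : I -> rat) c : fibfin A e ->
  (forall i, A i -> w i = c) -> gsum A e w = fps_const c * gsum A e (fun=> 1).
Proof. by move=> fin wc; rewrite -gsumZ //; apply: eq_gsum => // i Ai; rewrite wc // mulr1. Qed.

Definition oddsum := [set p : int * int | ((p.1 + p.2) %% 2)%Z = 1].

(* Only the terms with p.1 + p.2 odd survive in the difference. *)
Lemma theta34_diff k : (0 < k)%N -> theta3 * dil k theta3 - theta4 * dil k theta4 =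
  2%:R * Lsum oddsum (fun p => p.1 ^+ 2 + k%:Z * p.2 ^+ 2).
Proof.
move=> k0; rewrite theta3_mul // theta4_mul //; set Q := (fun p : int * int => p.1 ^+ 2 + _).
have box : defin setT Q.
  by move=> [i j] _; rewrite /Q /=; have := sqr_ge0 i; have := sqr_ge0 j; split; nia.
have fin := defin_fib box.
rewrite (LsumID oddsum box) (gsumID oddsum _ fin) /Lsum -/Q.
rewrite (gsum_const (w := fun p => _ ^+ _) (c := -1)); first last.
- move=> [i j] [_]; rewrite /oddsum /= => h; rewrite -signr_odd (_ : odd _ = true) ?expr1 //; lia.
- exact: fibfinS fin _.
rewrite [X in _ - (_ + X)](gsum_const (w := fun p => _ ^+ _) (c := 1)); first last.
- move=> [i j] [_]; rewrite /oddsum /= => h; rewrite -signr_odd (_ : odd _ = false) ?expr0 //.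
  by apply/negbTE/negP => o; apply: h; lia.
- exact: fibfinS fin _.
rewrite setTI rmorphN rmorph1.
have alg (a b : fps) : a + b - (-1 * a + 1 * b) = 2%:R * a by ring.
exact: alg.
Qed.

(** Only pairs with even sum survive on the left; they are i = s + t, j = s - t, where i^2 + j^2 = 2
    (s^2 + t^2). *)
Lemma theta34_sum : theta3 ^+ 2 + theta4 ^+ 2 = 2%:R * dil 2 theta3 ^+ 2.
Proof.
have E : dil 2 theta3 ^+ 2 = dil 2 (theta3 * dil 1 theta3) by rewrite dil_1 dilM.
rewrite E theta3_mul // Lsum_scale //.
have D34 := theta34_diff (isT : (0 < 1)%N); rewrite !dil_1 -!expr2 in D34.
have S3 := theta3_mul (isT : (0 < 1)%N); rewrite dil_1 -expr2 in S3.
set Q := (fun p : int * int => _) in D34 S3 *.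
have box : defin setT Q.
  by move=> [i j] _; rewrite /Q /=; have := sqr_ge0 i; have := sqr_ge0 j; split; nia.
have D' : theta4 ^+ 2 = theta3 ^+ 2 - 2%:R * Lsum oddsum Q.
  by rewrite -D34; move: (theta3 ^+ 2) (theta4 ^+ 2) => a b; ring.
rewrite D' S3 (LsumID oddsum box) setTI.
have -> : Lsum setT (fun p => 2%:Z * Q p) = Lsum (setT `&` ~` oddsum) Q.
  apply: (@Lsum_reindex (fun p => (((p.1 + p.2) %/ 2)%Z, ((p.1 - p.2) %/ 2)%Z))
    (fun p => (p.1 + p.2, p.1 - p.2))).
  - by [].
  - by move=> [i j] _ /=; split=> //; rewrite /oddsum /=; lia.
  - by move=> [i j] _ /=; congr pair; lia.
  - by move=> [i j] [_]; rewrite /oddsum /= => h; congr pair; lia.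
  - move=> [i j] [_]; rewrite /oddsum /= => h.
    have [s [t [-> ->]]] : exists s t : int, i = s + t /\ j = s - t.
      by exists ((i + j) %/ 2)%Z, ((i - j) %/ 2)%Z; lia.
    rewrite /Q /= (_ : s + t + (s - t) = s * 2) ?mulzK //; last by ring.
    rewrite (_ : s + t - (s - t) = t * 2) ?mulzK //; ring.
have alg (a b : fps) : a + b + (a + b - 2%:R * a) = 2%:R * b by ring.
exact: alg.
Qed.

(** Pairs with odd sum are i = s + t + 1, j = s - t, where i^2 + j^2 = 1 + 2 (s^2 + s + t^2 + t). *)
Lemma theta34_diff1 : theta3 ^+ 2 - theta4 ^+ 2 = 2%:R * (pX * dil 2 psi2 ^+ 2).
Proof.
have E : pX * dil 2 psi2 ^+ 2 = pX * dil 2 (pX ^+ 0 * (psi2 * dil 1 psi2)).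
  by rewrite dil_1 expr0 mul1r dilM.
have D34 := theta34_diff (isT : (0 < 1)%N); rewrite !dil_1 -!expr2 in D34.
rewrite D34 E psi2_mul // Lsum_scale //; congr (_ * _).
rewrite -[pX in RHS]expr1 [in RHS]/Lsum pXn_gsum.
pose Q' (p : int * int) : int := 1 + 2%:Z * (p.1 ^+ 2 + p.1 + (p.2 ^+ 2 + p.2)).
transitivity (Lsum setT Q').
  apply: (@Lsum_reindex (fun p => (p.1 + p.2 + 1, p.1 - p.2))
    (fun p => (((p.1 + p.2 - 1) %/ 2)%Z, ((p.1 - p.2 - 1) %/ 2)%Z))).
  - by move=> [i j] _ /=; rewrite /oddsum /=; lia.
  - by [].
  - by move=> [i j]; rewrite /oddsum /= => h; congr pair; lia.
  - by move=> [i j] _ /=; congr pair; lia.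
  - by move=> [i j] _; rewrite /Q' /=; ring.
apply: eq_gsum => // -[i j] _; rewrite /Q' /=.
have [h1 _] := tri_box i; have [h2 _] := tri_box j.
by move: (i ^+ 2 + i) (j ^+ 2 + j) h1 h2 => a b; lia.
Qed.

(* k even, k = 2b and j = a - b, gives the first product; k odd the second. *)
Lemma theta_1c c : (1 < c)%N -> theta 1 c =
  theta3 * dil (4 * c).-1 theta3 + pX ^+ c * (psi2 * dil (4 * c).-1 psi2).
Proof.
move=> c1; have k0 : (0 < (4 * c).-1)%N by lia.
rewrite theta_Lsum // theta3_mul // psi2_mul //.
rewrite (LsumID [set p | (p.2 %% 2)%Z = 0] (defin_form (A := setT) (isT : (0 < 1)%N) c1)) !setTI.
have -> : (4 * c).-1%:Z = 4 * c%:Z - 1 by lia.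
congr (_ + _).
- apply: (@Lsum_reindex (fun p => (p.1 - p.2, 2 * p.2))
    (fun p => (p.1 + (p.2 %/ 2)%Z, (p.2 %/ 2)%Z))).
  + by move=> [i j] _ /=; lia.
  + by [].
  + by move=> [i j] /= h; congr pair; lia.
  + by move=> [i j] _ /=; congr pair; lia.
  + by move=> [i j] _; rewrite /qform /=; ring.
- apply: (@Lsum_reindex (fun p => (p.1 - p.2, 2 * p.2 + 1))
    (fun p => (p.1 + ((p.2 - 1) %/ 2)%Z, ((p.2 - 1) %/ 2)%Z))).
  + by move=> [i j] _ /=; lia.
  + by [].
  + by move=> [i j] /= h; congr pair; lia.
  + by move=> [i j] _ /=; congr pair; lia.
  + by move=> [i j] _; rewrite /qform /=; ring.
Qed.

End ThetaIdentities.

(** * The modular equation of degree 11 *)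

Section ThetaIdentities11.

Let Q := fun p : int * int => qform 1 3 p.1 p.2.
Let Qbox A : defin A Q := defin_form (isT : (0 < 1)%N) (isT : (1 < 3)%N).

Local Notation eo := [set p : int * int | (p.2 %% 2)%Z = 0 /\ (p.1 %% 2)%Z = 1]%classic.
Local Notation oe := [set p : int * int | (p.2 %% 2)%Z = 1 /\ (p.1 %% 2)%Z = 0]%classic.
Local Notation oo := [set p : int * int | (p.2 %% 2)%Z = 1 /\ (p.1 %% 2)%Z = 1]%classic.

Let Gp : fps := Lsum setT (fun p => Q (1 + 6 * p.1 - 6 * p.2, 2 * p.2)).
Let Gm : fps := Lsum setT (fun p => Q (2 + 6 * p.1 - 4 * p.2, - 1 - 2 * p.2)).

(** The points with j prime to 3 form the classes 1 and 2 modulo 3, exchanged by p -> -p, and [Gp]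
    is the first of them. The other splittings in this section and the next follow the same
    pattern. *)
Lemma eo_split : Lsum eo Q = 2%:R * Gp + Lsum (eo `&` [set p | (p.1 %% 3)%Z = 0]) Q.
Proof.
rewrite (LsumID [set p | (p.1 %% 3)%Z = 0] (@Qbox _)).
rewrite [X in _ + X](LsumID [set p | (p.1 %% 3)%Z = 1] (@Qbox _)).
have alg (a b c d : fps) : b = d -> c = d -> a + (b + c) = 2%:R * d + a by move=> -> ->; ring.
apply: alg.
- apply: (@Lsum_reindex (fun p => (1 + 6 * p.1 - 6 * p.2, 2 * p.2))
    (fun p => (((p.1 - 1) %/ 6)%Z + (p.2 %/ 2)%Z, (p.2 %/ 2)%Z))) => //.
  + by move=> [i j] _ /=; lia.
  + by move=> [i j] [[[/= h1 h2] /= h3] /= h4] /=; congr pair; lia.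
  + by move=> [i j] _ /=; congr pair; lia.
- apply: (@Lsum_reindex (fun p => (- (1 + 6 * p.1 - 6 * p.2), - (2 * p.2)))
    (fun p => (((- p.1 - 1) %/ 6)%Z + (- p.2 %/ 2)%Z, (- p.2 %/ 2)%Z))) => //.
  + by move=> [i j] _ /=; lia.
  + by move=> [i j] [[[/= h1 h2] /= h3] /= h4] /=; congr pair; lia.
  + by move=> [i j] _ /=; congr pair; lia.
  + by move=> [i j] _; rewrite /Q /qform /=; ring.
Qed.

Lemma oe_split : Lsum oe Q = 2%:R * Gm + Lsum (oe `&` [set p | ((p.1 + p.2) %% 3)%Z = 0]) Q.
Proof.
rewrite (LsumID [set p | ((p.1 + p.2) %% 3)%Z = 0] (@Qbox _)).
rewrite [X in _ + X](LsumID [set p | ((p.1 + p.2) %% 3)%Z = 1] (@Qbox _)).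
have alg (a b c d : fps) : b = d -> c = d -> a + (b + c) = 2%:R * d + a by move=> -> ->; ring.
apply: alg.
- apply: (@Lsum_reindex (fun p => (2 + 6 * p.1 - 4 * p.2, - 1 - 2 * p.2))
    (fun p => (((p.1 - 2 + 4 * ((- 1 - p.2) %/ 2)%Z) %/ 6)%Z, ((- 1 - p.2) %/ 2)%Z))) => //.
  + by move=> [i j] _ /=; lia.
  + by move=> [i j] [[[/= h1 h2] /= h3] /= h4] /=; congr pair; lia.
  + by move=> [i j] _ /=; congr pair; lia.
- apply: (@Lsum_reindex (fun p => (- (2 + 6 * p.1 - 4 * p.2), 1 + 2 * p.2))
    (fun p => (((- p.1 - 2 + 4 * ((p.2 - 1) %/ 2)%Z) %/ 6)%Z, ((p.2 - 1) %/ 2)%Z))) => //.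
  + by move=> [i j] _ /=; lia.
  + by move=> [i j] [[[/= h1 h2] /= h3] /= h4] /=; congr pair; lia.
  + by move=> [i j] _ /=; congr pair; lia.
  + by move=> [i j] _; rewrite /Q /qform /=; ring.
Qed.

(** Both are the sum of q^(9a^2 + 6ab + 12b^2) over a odd and b arbitrary. *)
Lemma eo_oe_rest : Lsum (eo `&` [set p | (p.1 %% 3)%Z = 0]) Q =
  Lsum (oe `&` [set p | ((p.1 + p.2) %% 3)%Z = 0]) Q.
Proof.
transitivity (Lsum [set p | (p.1 %% 2)%Z = 1] (fun p : int * int => Q (3 * p.1, 2 * p.2))).
  apply: (@Lsum_reindex (fun p => (3 * p.1, 2 * p.2)) (fun p => ((p.1 %/ 3)%Z, (p.2 %/ 2)%Z))) => //.
  + by move=> [i j] /=; lia.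
  + by move=> [i j] /=; lia.
  + by move=> [i j] [[/= h1 h2] /= h3] /=; congr pair; lia.
  + by move=> [i j] _ /=; congr pair; lia.
apply/esym/(@Lsum_reindex (fun p => (2 * p.1 - 2 * p.2, p.1 + 2 * p.2))
   (fun p => (((p.1 + p.2) %/ 3)%Z, ((2 * p.2 - p.1) %/ 6)%Z))).
+ by move=> [i j] /=; lia.
+ by move=> [i j] /=; lia.
+ by move=> [i j] [[/= h1 h2] /= h3] /=; congr pair; lia.
+ by move=> [i j] _ /=; congr pair; lia.
+ by move=> [i j] _; rewrite /Q /qform /=; ring.
Qed.

(** The form has the automorphism (j, k) -> (-j - k, k). *)
Lemma oo_oe : Lsum oo Q = Lsum oe Q.
Proof.
apply: (@Lsum_reindex (fun p => (- p.1 - p.2, p.2)) (fun p => (- p.1 - p.2, p.2))).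
+ by move=> [i j] /=; lia.
+ by move=> [i j] /=; lia.
+ by move=> [i j] _ /=; congr pair; lia.
+ by move=> [i j] _ /=; congr pair; lia.
+ by move=> [i j] _; rewrite /Q /qform /=; ring.
Qed.

Lemma pent_mul_dil (m a k : nat) (c : int * int -> int) : (0 < a)%N -> (0 < k)%N ->
  c = (fun p => m%:Z + (a%:Z * pent p.1 + k%:Z * (a%:Z * pent p.2))) -> 
  pX ^+ m * dil a (eulp 1 * dil k (eulp 1)) =
  gsum setT (fun p => `|c p|%N) (fun p => (-1) ^+ `|(p.1 + p.2)%R|%N).
Proof.
move=> a0 k0 ->; rewrite -pentagonal.
have := Zsum_mul (fun n => (-1) ^+ `|n|%N) (fun n => (-1) ^+ `|n|%N) 0 k0 pent_box pent_box.
rewrite expr0 mul1r => ->; rewrite dil_gsum // pXn_gsum; apply: eq_gsum => p _ /=.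
  have [e1 _] := pent_box p.1; have [e2 _] := pent_box p.2.
  by move: (pent _) (pent _) e1 e2 => x y; nia.
exact: sgn_absD.
Qed.

(* Split according to the parity of m + n, with (m, n) = (s + t, s - t) or
   (s + t + 1, s - t). *)
Lemma signed_split (c : int * int -> int) (ce co : int * int -> int) :
  fibfin setT (fun p => `|c p|%N) ->
  (forall s t, c (s + t, s - t) = ce (s, t)) ->
  (forall s t, c (s + t + 1, s - t) = co (s, t)) ->
  gsum setT (fun p => `|c p|%N) (fun p => (-1) ^+ `|(p.1 + p.2)%R|%N) =
  Lsum setT ce - Lsum setT co.
Proof.
move=> fin he ho; rewrite (gsumID oddsum _ fin).
rewrite (gsum_const (c := -1)); first last.
- move=> [i j] [_]; rewrite /oddsum /= => h; rewrite -signr_odd (_ : odd _ = true) ?expr1 //; lia.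
- exact: fibfinS fin _.
rewrite [X in _ + X](gsum_const (c := 1)); first last.
- move=> [i j] [_]; rewrite /oddsum /= => h; rewrite -signr_odd (_ : odd _ = false) ?expr0 //.
  by apply/negbTE/negP => o; apply: h; lia.
- exact: fibfinS fin _.
rewrite setTI rmorphN rmorph1 -!/(Lsum _ c).
have -> : Lsum (setT `&` ~` oddsum) c = Lsum setT ce.
  apply: (@Lsum_reindex (fun p => (p.1 + p.2, p.1 - p.2))
    (fun p => (((p.1 + p.2) %/ 2)%Z, ((p.1 - p.2) %/ 2)%Z))) => //.
  + by move=> [i j] _; split=> //; rewrite /oddsum /=; lia.
  + by move=> [i j] [_]; rewrite /oddsum /= => h; congr pair; lia.
  + by move=> [i j] _ /=; congr pair; lia.
  + by move=> [i j] _; apply: he.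
have -> : Lsum oddsum c = Lsum setT co.
  apply: (@Lsum_reindex (fun p => (p.1 + p.2 + 1, p.1 - p.2))
    (fun p => (((p.1 + p.2 - 1) %/ 2)%Z, ((p.1 - p.2 - 1) %/ 2)%Z))) => //.
  + by move=> [i j] _; rewrite /oddsum /=; lia.
  + by move=> [i j]; rewrite /oddsum /= => h; congr pair; lia.
  + by move=> [i j] _ /=; congr pair; lia.
  + by move=> [i j] _; apply: ho.
have alg (a b : fps) : -1 * a + 1 * b = b - a by ring.
exact: alg.
Qed.

Lemma pent_form_fib (m a k : nat) : (0 < a)%N -> (0 < k)%N ->
  fibfin setT (fun p : int * int => absz (m%:Z + (a%:Z * pent p.1 + k%:Z * (a%:Z * pent p.2)))).
Proof.
move=> a0 k0; apply: fibfin_int2 => p _.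
have [e1 f1] := pent_box p.1; have [e2 f2] := pent_box p.2.
move: (pent p.1) (pent p.2) e1 e2 f1 f2 => x y e1 e2 f1 f2.
have hx : x <= a%:Z * x by nia.
have hy : y <= a%:Z * y by nia.
have hz : a%:Z * y <= k%:Z * (a%:Z * y) by nia.
by move: (a%:Z * x) (k%:Z * (a%:Z * y)) hx hy hz => b c hx hy hz; split; lia.
Qed.

(** By the pentagonal number theorem the exponents on the left are 1 + 2 pent(m) + 22 pent(n) = ((6m
    + 1)^2 + 11 (6n + 1)^2)/12, a value of j^2 + jk + 3k^2 at a point that depends on the parity of
    m + n; the sign is that parity. *)
Lemma eta11_split : pX * dil 2 (eulp 1 * dil 11 (eulp 1)) = Gp - Gm.
Proof.
rewrite -[pX]expr1 (pent_mul_dil (m := 1) (isT : (0 < 2)%N) (isT : (0 < 11)%N) (erefl _)).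
rewrite (signed_split (ce := fun p => Q (1 + 6 * p.1 - 6 * p.2, 2 * p.2))
   (co := fun p => Q (2 + 6 * p.1 - 4 * p.2, - 1 - 2 * p.2))) //.
- exact: pent_form_fib.
- move=> s t; rewrite /Q /qform /=.
  have := pent2 (s + t); have := pent2 (s - t).
  by move: (pent _) (pent _) => x y; lia.
- move=> s t; rewrite /Q /qform /=.
  have := pent2 (s + t + 1); have := pent2 (s - t).
  by move: (pent _) (pent _) => x y; lia.
Qed.

(** Divided by theta_3(q) theta_3(q^11) this is the classical modular equation of degree 11. After
    the splittings the points divisible by 3 cancel, and 2 (2 Gp + c) - 2 (2 Gm + c) = 4 (Gp - Gm)
    remains. *)
Lemma theta_relation11 :
  theta3 * dil 11 theta3 - theta4 * dil 11 theta4 - pX ^+ 3 * (psi2 * dil 11 psi2) =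
  4%:R * (pX * dil 2 (eulp 1 * dil 11 (eulp 1))).
Proof.
rewrite theta34_diff // eta11_split.
have -> : Lsum oddsum (fun p => p.1 ^+ 2 + 11%:Z * p.2 ^+ 2) = Lsum eo Q.
  apply: (@Lsum_reindex (fun p => (p.1 + (p.2 %/ 2)%Z, (p.2 %/ 2)%Z)) (fun p => (p.1 - p.2, 2 * p.2))).
  + by move=> [i j] /=; rewrite /oddsum /=; lia.
  + by move=> [i j] /=; rewrite /oddsum /=; lia.
  + by move=> [i j] _ /=; congr pair; lia.
  + by move=> [i j] [/= h1 h2] /=; congr pair; lia.
  + move=> [i j] [/= h1 h2]; have [b ->] : exists b, j = 2 * b by exists (j %/ 2)%Z; lia.
    by rewrite [2 * b]mulrC mulzK // /Q /qform /=; ring.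
have -> : pX ^+ 3 * (psi2 * dil 11 psi2) = Lsum oe Q + Lsum oo Q.
  rewrite psi2_mul //; transitivity (Lsum [set p | (p.2 %% 2)%Z = 1] Q).
    apply/esym/(@Lsum_reindex (fun p => (p.1 - p.2, 2 * p.2 + 1))
      (fun p => (p.1 + ((p.2 - 1) %/ 2)%Z, ((p.2 - 1) %/ 2)%Z))).
    + by move=> [i j] _ /=; lia.
    + by [].
    + by move=> [i j] /= h; congr pair; lia.
    + by move=> [i j] _ /=; congr pair; lia.
    + by move=> [i j] _; rewrite /Q /qform /=; ring.
  rewrite (LsumID [set p | (p.1 %% 2)%Z = 0] (@Qbox _)).
  congr (Lsum _ _ + Lsum _ _); apply/seteqP; split=> -[i j]; rewrite /=; lia.
rewrite oo_oe eo_split oe_split eo_oe_rest.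
have alg (a b c : fps) : 2%:R * (2%:R * a + c) - (2%:R * b + c + (2%:R * b + c)) = 4%:R * (a - b) by ring.
exact: alg.
Qed.

End ThetaIdentities11.

(** * The modular equation of degree 23 *)

Section ThetaIdentities23.

Let A := fun p : int * int => qform 1 6 p.1 p.2.
Let B := fun p : int * int => qform 2 3 p.1 p.2.
Let Abox S : defin S A := defin_form (isT : (0 < 1)%N) (isT : (1 < 6)%N).
Let Bbox S : defin S B := defin_form (isT : (0 < 2)%N) (isT : (1 < 3)%N).

Local Notation je := [set p : int * int | (p.1 %% 2)%Z = 0]%classic.
Local Notation ke := [set p : int * int | (p.2 %% 2)%Z = 0]%classic.
Local Notation se := [set p : int * int | ((p.1 + p.2) %% 2)%Z = 0]%classic.

Let Gp : fps := Lsum setT (fun p => A (1 + 6 * p.1 - 6 * p.2, p.2)).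
Let Gm : fps := Lsum setT (fun p => B (- 3 * p.1 + 4 * p.2, 1 + 3 * p.1 - 2 * p.2)).

Let split3 (a b c d : fps) : b = d -> c = d -> a + (b + c) = 2%:R * d + a.
Proof. by move=> -> ->; ring. Qed.

Lemma je_dil : Lsum je A = dil 2 (Lsum setT B).
Proof.
rewrite Lsum_scale //.
apply: (@Lsum_reindex (fun p => (2 * p.1, p.2)) (fun p => ((p.1 %/ 2)%Z, p.2))) => //.
+ by move=> [i j] _ /=; lia.
+ by move=> [i j] /= h; congr pair; lia.
+ by move=> [i j] _ /=; congr pair; lia.
+ by move=> [i j] _; rewrite /A /B /qform /=; ring.
Qed.

Lemma se_dil : Lsum se B = dil 2 (Lsum setT B).
Proof.
rewrite Lsum_scale //.
apply: (@Lsum_reindex (fun p => (p.1 - p.2, - p.1 - p.2))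
  (fun p => (((p.1 - p.2) %/ 2)%Z, ((- p.1 - p.2) %/ 2)%Z))) => //.
+ by move=> [i j] _ /=; lia.
+ by move=> [i j] /= h; congr pair; lia.
+ by move=> [i j] _ /=; congr pair; lia.
+ by move=> [i j] _; rewrite /B /qform /=; ring.
Qed.

Lemma ke_dil : Lsum ke B = dil 2 (Lsum setT A).
Proof.
rewrite Lsum_scale //.
apply: (@Lsum_reindex (fun p => (p.1, 2 * p.2)) (fun p => (p.1, (p.2 %/ 2)%Z))) => //.
+ by move=> [i j] _ /=; lia.
+ by move=> [i j] /= h; congr pair; lia.
+ by move=> [i j] _ /=; congr pair; lia.
+ by move=> [i j] _; rewrite /A /B /qform /=; ring.
Qed.

Lemma both_even_dil (Q : int * int -> int) : (forall p, Q (2 * p.1, 2 * p.2) = 4 * Q p) ->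
  Lsum (se `&` je) Q = dil 4 (Lsum setT Q).
Proof.
move=> hQ; rewrite Lsum_scale //.
apply: (@Lsum_reindex (fun p => (2 * p.1, 2 * p.2)) (fun p => ((p.1 %/ 2)%Z, (p.2 %/ 2)%Z))) => //.
+ by move=> [i j] _ /=; lia.
+ by move=> [i j] [/= h1 h2]; congr pair; lia.
+ by move=> [i j] _ /=; congr pair; lia.
Qed.

Lemma se_swap : Lsum se A = Lsum je A.
Proof.
apply: (@Lsum_reindex (fun p => (- p.1 - p.2, p.2)) (fun p => (- p.1 - p.2, p.2))).
+ by move=> [i j] /=; lia.
+ by move=> [i j] /=; lia.
+ by move=> [i j] _ /=; congr pair; lia.
+ by move=> [i j] _ /=; congr pair; lia.
+ by move=> [i j] _; rewrite /A /qform /=; ring.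
Qed.

Lemma flip_Lsum S Q : defin setT Q -> (forall p, ((Q p %% 2)%Z = 0) <-> S p) ->
  Lsum setT Q + fps_flip (Lsum setT Q) = 2%:R * Lsum S Q.
Proof.
move=> box hS; have fin := defin_fib box.
rewrite flip_gsum // (LsumID S box) (gsumID S _ fin).
rewrite (gsum_const (c := 1)); first last.
- move=> p [_ /hS h]; rewrite mulr1 -signr_odd (_ : odd _ = false) ?expr0 //; lia.
- exact: fibfinS fin _.
rewrite [X in _ + (_ + X)](gsum_const (c := -1)); first last.
- move=> p [_ h]; rewrite mulr1 -signr_odd (_ : odd _ = true) ?expr1 //.
  by apply/negPn/negP => o; apply: h; apply/hS; lia.
- exact: fibfinS fin _.
rewrite setTI rmorphN rmorph1 -!/(Lsum _ Q).
have alg (a b : fps) : a + b + (1 * a + -1 * b) = 2%:R * a by ring.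
exact: alg.
Qed.

(** Modulo 2 the form is j (j + k), so it is even where j or j + k is. The even part follows by
    inclusion and exclusion, the overlap being the doubled lattice. For [flip_theta23] the form is k
    (j + k) modulo 2. *)
Lemma flip_theta16 : theta 1 6 + fps_flip (theta 1 6) =
  2%:R * (2%:R * dil 2 (theta 2 3) - dil 4 (theta 1 6)).
Proof.
rewrite !theta_Lsum // -/A -/B (flip_Lsum (S := je `|` se) (@Abox _)); last first.
  move=> [j k]; rewrite /A /qform /=.
  have [a [r [-> r2]]] : exists a r : int, j = 2 * a + r /\ (r = 0 \/ r = 1).
    by exists (j %/ 2)%Z, (j %% 2)%Z; lia.
  have [b [s [-> s2]]] : exists b s : int, k = 2 * b + s /\ (s = 0 \/ s = 1).
    by exists (k %/ 2)%Z, (k %% 2)%Z; lia.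
  by case: r2 => ->; case: s2 => ->; lia.
rewrite (LsumID je (@Abox _)) setIUl setIid (_ : (je `|` se `&` je) = je); last first.
  by apply/seteqP; split=> -[i j] /=; lia.
have E := LsumID je (@Abox se); rewrite se_swap both_even_dil in E; last first.
  by move=> p; rewrite /A /qform /=; ring.
rewrite (_ : (je `|` se) `&` ~` je = se `&` ~` je); last first.
  by apply/seteqP; split=> -[i j] /=; lia.
rewrite -je_dil; move: E; move: (Lsum je A) (Lsum (se `&` _) A) (dil 4 _) => a b c E.
by apply: (lincomb1 (n := 1) (c := -2%:R) (oner_neq0 _) E); ring.
Qed.

Lemma flip_theta23 : theta 2 3 + fps_flip (theta 2 3) =
  2%:R * (dil 2 (theta 1 6) + dil 2 (theta 2 3) - dil 4 (theta 2 3)).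
Proof.
rewrite !theta_Lsum // -/A -/B (flip_Lsum (S := ke `|` se) (@Bbox _)); last first.
  move=> [j k]; rewrite /B /qform /=.
  have [a [r [-> r2]]] : exists a r : int, j = 2 * a + r /\ (r = 0 \/ r = 1).
    by exists (j %/ 2)%Z, (j %% 2)%Z; lia.
  have [b [s [-> s2]]] : exists b s : int, k = 2 * b + s /\ (s = 0 \/ s = 1).
    by exists (k %/ 2)%Z, (k %% 2)%Z; lia.
  by case: r2 => ->; case: s2 => ->; lia.
rewrite (LsumID ke (@Bbox _)) (_ : (ke `|` se) `&` ke = ke); last first.
  by apply/seteqP; split=> -[i j] /=; lia.
have E := LsumID je (@Bbox se); rewrite both_even_dil in E; last first.
  by move=> p; rewrite /B /qform /=; ring.
rewrite (_ : (ke `|` se) `&` ~` ke = se `&` ~` je); last first.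
  by apply/seteqP; split=> -[i j] /=; lia.
rewrite -ke_dil -se_dil; move: E.
move: (Lsum ke B) (Lsum se B) (Lsum (se `&` _) B) (dil 4 _) => a b c d E.
by apply: (lincomb1 (n := 1) (c := -2%:R) (oner_neq0 _) E); ring.
Qed.

Lemma theta16_split : Lsum setT A = 2%:R * Gp +
  (Lsum je A + Lsum (~` je `&` [set p | (p.1 %% 3)%Z = 0]) A).
Proof.
rewrite (LsumID je (@Abox _)) !setTI (LsumID [set p | (p.1 %% 3)%Z = 0] (@Abox (~` je))).
rewrite [X in _ + (_ + X)](LsumID [set p | (p.1 %% 3)%Z = 1] (@Abox _)).
rewrite [in LHS]addrA; apply: split3.
- apply: (@Lsum_reindex (fun p => (1 + 6 * p.1 - 6 * p.2, p.2))
    (fun p => (((p.1 - 1) %/ 6)%Z + p.2, p.2))) => //.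
  + by move=> [i j] _ /=; lia.
  + by move=> [i j] [[/= h1 /= h3] /= h4] /=; congr pair; lia.
  + by move=> [i j] _ /=; congr pair; lia.
- apply: (@Lsum_reindex (fun p => (- (1 + 6 * p.1 - 6 * p.2), - p.2))
    (fun p => (((- p.1 - 1) %/ 6)%Z - p.2, - p.2))) => //.
  + by move=> [i j] _ /=; lia.
  + by move=> [i j] [[/= h1 /= h3] /= h4] /=; congr pair; lia.
  + by move=> [i j] _ /=; congr pair; lia.
  + by move=> [i j] _; rewrite /A /qform /=; ring.
Qed.

Lemma theta23_split : Lsum setT B = 2%:R * Gm +
  (Lsum se B + Lsum (~` se `&` [set p | ((p.1 - p.2) %% 3)%Z = 0]) B).
Proof.
rewrite (LsumID se (@Bbox _)) !setTI (LsumID [set p | ((p.1 - p.2) %% 3)%Z = 0] (@Bbox (~` se))).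
rewrite [X in _ + (_ + X)](LsumID [set p | ((p.1 - p.2) %% 3)%Z = 2] (@Bbox _)).
rewrite [in LHS]addrA; apply: split3.
- apply: (@Lsum_reindex (fun p => (- 3 * p.1 + 4 * p.2, 1 + 3 * p.1 - 2 * p.2))
    (fun p => (((2 * (p.1 + p.2 - 1) - p.1) %/ 3)%Z, ((p.1 + p.2 - 1) %/ 2)%Z))) => //.
  + by move=> [i j] _ /=; lia.
  + by move=> [i j] [[/= h1 /= h3] /= h4] /=; congr pair; lia.
  + by move=> [i j] _ /=; congr pair; lia.
- apply: (@Lsum_reindex (fun p => (- (- 3 * p.1 + 4 * p.2), - (1 + 3 * p.1 - 2 * p.2)))
    (fun p => (((2 * (- p.1 - p.2 - 1) + p.1) %/ 3)%Z, ((- p.1 - p.2 - 1) %/ 2)%Z))) => //.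
  + by move=> [i j] _ /=; lia.
  + by move=> [i j] [[/= h1 /= h3] /= h4] /=; congr pair; lia.
  + by move=> [i j] _ /=; congr pair; lia.
  + by move=> [i j] _; rewrite /B /qform /=; ring.
Qed.

(** Both are the sum of q^(6a^2 + 3ab + 9b^2) over a arbitrary and b odd. *)
Lemma theta_rest : Lsum (~` je `&` [set p | (p.1 %% 3)%Z = 0]) A =
  Lsum (~` se `&` [set p | ((p.1 - p.2) %% 3)%Z = 0]) B.
Proof.
transitivity (Lsum (~` ke) (fun p : int * int => A (3 * p.2, p.1))).
  apply: (@Lsum_reindex (fun p => (3 * p.2, p.1)) (fun p => (p.2, (p.1 %/ 3)%Z))) => //.
  + by move=> [i j] /=; lia.
  + by move=> [i j] /=; lia.
  + by move=> [i j] [/= h1 /= h3] /=; congr pair; lia.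
  + by move=> [i j] _ /=; congr pair; lia.
apply/esym/(@Lsum_reindex (fun p => (p.1 + 2 * p.2, p.1 - p.2))
   (fun p => (((p.1 + 2 * p.2) %/ 3)%Z, ((p.1 - p.2) %/ 3)%Z))).
+ by move=> [i j] /=; lia.
+ by move=> [i j] /=; lia.
+ by move=> [i j] [/= h1 /= h3] /=; congr pair; lia.
+ by move=> [i j] _ /=; congr pair; lia.
+ by move=> [i j] _; rewrite /A /B /qform /=; ring.
Qed.

Lemma eta23_split : pX * (eulp 1 * dil 23 (eulp 1)) = Gp - Gm.
Proof.
rewrite -[_ * dil 23 _]dil_1 -[pX]expr1.
rewrite (pent_mul_dil (m := 1) (isT : (0 < 1)%N) (isT : (0 < 23)%N) (erefl _)).
rewrite (signed_split (ce := fun p => A (1 + 6 * p.1 - 6 * p.2, p.2))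
   (co := fun p => B (- 3 * p.1 + 4 * p.2, 1 + 3 * p.1 - 2 * p.2))) //.
- exact: pent_form_fib.
- move=> s t; rewrite /A /qform /=.
  have := pent2 (s + t); have := pent2 (s - t).
  by move: (pent _) (pent _) => x y; lia.
- move=> s t; rewrite /B /qform /=.
  have := pent2 (s + t + 1); have := pent2 (s - t).
  by move: (pent _) (pent _) => x y; lia.
Qed.

Definition h23 : fps := pX * (eulp 1 * dil 23 (eulp 1)).

Lemma theta_relation23 : theta 1 6 - theta 2 3 = 2%:R * h23.
Proof.
rewrite !theta_Lsum // theta16_split theta23_split /h23 eta23_split je_dil se_dil theta_rest.
have alg (a b c : fps) : 2%:R * a + c - (2%:R * b + c) = 2%:R * (a - b) by ring.
exact: alg.
Qed.

Lemma fcoef2_neq0 : (2%:R : fps) != 0. Proof. exact: fps_natf_neq0. Qed.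

(** In terms of coefficients this is the Hecke relation at 2 for eta_1 eta_23, a form of weight one
    with eigenvalue -1. It follows from the even parts of the two theta series, whose difference is
    2 h23, and becomes the modular equation of degree 23 once h23(-q) is written as an eta
    quotient. *)
Lemma flip_h23 : - fps_flip h23 = h23 + 2%:R * dil 2 h23 + 2%:R * dil 4 h23.
Proof.
have e := theta_relation23; have eA := flip_theta16; have eB := flip_theta23.
have flipN f : fps_flip (- f) = - fps_flip f by exact: compN.
have flipD f g : fps_flip (f + g) = fps_flip f + fps_flip g by exact: compD.
have ef : fps_flip (theta 1 6) - fps_flip (theta 2 3) = 2%:R * fps_flip h23.
  by rewrite -flipN -flipD e flipM; congr (_ * _); rewrite /fps_flip comp_nat.
have ed m : (0 < m)%N -> dil m (theta 1 6) - dil m (theta 2 3) = 2%:R * dil m h23.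
  move=> m0; have -> : - dil m (theta 2 3) = dil m (- theta 2 3) by apply/esym; exact: compN.
  by rewrite -dilD // e dilM // dil_nat.
have e2 := ed 2 isT; have e4 := ed 4 isT; move: e eA eB ef e2 e4.
move: (dil 2 (theta 1 6)) (dil 2 (theta 2 3)) (dil 2 h23) (dil 4 (theta 1 6)) (dil 4 (theta 2 3)) (dil 4 h23).
move: (theta 1 6) (theta 2 3) h23 (fps_flip (theta 1 6)) (fps_flip (theta 2 3)) (fps_flip h23).
move=> a b h fa fb fh a2 b2 h2 a4 b4 h4 e eA eB ef e2 e4.
have n0 : (2%:R : fps) != 0 := fcoef2_neq0.
have E : fa - fb + (a - b) = - 2%:R * ((a2 - b2) + (a4 - b4)).
  by apply: (lincomb2 (n := 1) (c1 := 1) (c2 := -1) (oner_neq0 _) eA eB); ring.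
rewrite ef e e2 e4 in E.
by apply: (lincomb1 (n := 2%:R) (c := -1) n0 E); ring.
Qed.

End ThetaIdentities23.

(** * Eta quotients and Jacobi's identity for fourth powers *)

Section EtaForms.

Lemma eqmod_flip N f g : eqmod N f g -> eqmod N (fps_flip f) (fps_flip g).
Proof. by move=> e n lt; rewrite !coef_flip e. Qed.

Lemma flip_dil_even m f : (0 < m)%N -> fps_flip (dil (2 * m) f) = dil (2 * m) f.
Proof.
move=> m0; have m2 : (0 < 2 * m)%N by lia.
apply/fpsP => n; rewrite coef_flip coef_dil //; case: ifP => [/dvdnP[k ->]|_]; last by rewrite mulr0.
by rewrite -signr_odd (_ : odd _ = false) ?mul1r //; lia.
Qed.

Lemma flip_dil_odd m f : odd m -> fps_flip (dil m f) = dil m (fps_flip f).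
Proof.
move=> mo; have m0 : (0 < m)%N by lia.
apply/fpsP => n; rewrite coef_flip !coef_dil //; case: ifP => [/dvdnP[k ->]|_]; last by rewrite mulr0.
by rewrite mulnK // coef_flip -signr_odd oddM mo andbT signr_odd.
Qed.

(** Under q -> -q the factors with odd exponent become 1 + q^j = (1 - q^(2j))/(1 - q^j). The finite
    identity [fin] carries this out with matching ranges. *)
Lemma flip_eul : fps_flip (eulp 1) * eulp 1 * eulp 4 = eulp 2 ^+ 3.
Proof.
have flip_odd k : fps_flip (pX ^+ k) = (-1) ^+ k * pX ^+ k.
  rewrite flipX (_ : fps_flip pX = -1 * pX) ?exprMn //.
  by rewrite mulN1r /fps_flip comp_pX // flip_base0.
have flipB k : fps_flip (1 - pX ^+ k) = 1 - (-1) ^+ k * pX ^+ k.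
  rewrite -flip_odd /fps_flip compD ?flip_base0 // compN ?flip_base0 //; congr (_ - _).
  exact: comp1.
have flr m : fps_flip (eulN 1 m.+2) = fps_flip (eulN 1 m.+1) * (1 - (-1) ^+ m.+1 * pX ^+ m.+1).
  by rewrite eulN_rec flipM mul1n flipB.
have fin k : fps_flip (eulN 1 (2 * k).+1) * eulN 1 (2 * k).+1 * eulN 4 k.+1 =
   eulN 2 (2 * k).+1 * eulN 2 k.+1 ^+ 2.
  elim: k => [|k IH].
    by rewrite muln0 !eulN_1 /fps_flip comp1; ring.
  have so : (-1) ^+ (2 * k).+1 = -1 :> fps by rewrite exprS exprM sqrrN !expr1n mulr1.
  have se : (-1) ^+ (2 * k).+2 = 1 :> fps by rewrite exprS so mulN1r opprK.
  rewrite (_ : (2 * k.+1).+1 = (2 * k).+3); last by lia.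
  rewrite (flr (2 * k).+1) (flr (2 * k)%N) so se.
  rewrite (eulN_rec 1 (2 * k).+1) (eulN_rec 1 (2 * k)) (eulN_rec 4 k) (eulN_rec 2 k).
  rewrite (eulN_rec 2 (2 * k).+1) (eulN_rec 2 (2 * k)) !mul1n.
  rewrite (_ : 2 * (2 * k).+1 = (2 * k).+1 + (2 * k).+1)%N; last by lia.
  rewrite (_ : 2 * k.+1 = (2 * k).+2)%N; last by lia.
  rewrite (_ : 4 * k.+1 = 2 * (2 * k).+2)%N; last by lia.
  rewrite exprD.
  move: IH; move: (eulN 1 _) (eulN 4 _) (eulN 2 (2 * k).+1) (eulN 2 k.+1) (fps_flip (eulN 1 _)).
  move: (pX ^+ (2 * k).+1) (pX ^+ (2 * k).+2) (pX ^+ (2 * (2 * k).+2)) => x y z b c d f a e.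
  transitivity (a * b * c * ((1 - x * x) * (1 - y) ^+ 2 * (1 - z))); first by ring.
  by rewrite e; ring.
apply: eqmodP => N.
have h1 := eqmod_eulN (isT : (0 < 1)%N) (_ : N <= (2 * N).+1)%N.
have h2 := eqmod_eulN (isT : (0 < 2)%N) (_ : N <= (2 * N).+1)%N.
have h2' := eqmod_eulN (isT : (0 < 2)%N) (leqnSn N).
have h4 := eqmod_eulN (isT : (0 < 4)%N) (leqnSn N).
have le : (N <= (2 * N).+1)%N by lia.
apply: (@eqmod_trans _ (fps_flip (eulN 1 (2 * N).+1) * eulN 1 (2 * N).+1 * eulN 4 N.+1)).
  apply: eqmodM; last exact: eqmod_sym.
  by apply: eqmodM; [apply: eqmod_flip |]; apply: eqmod_sym; apply: h1.
rewrite fin (_ : eulp 2 ^+ 3 = eulp 2 * eulp 2 ^+ 2); last by ring.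
by apply: eqmodM; [apply: h2 | apply: eqmodX].
Qed.

Lemma flip_theta4 : fps_flip theta4 = theta3.
Proof.
rewrite /theta4 /Zsum flip_gsum; last by apply: fibfin_int => n _; case: (sqr_box n).
apply: eq_gsum => // n _; rewrite -exprD -signr_odd (_ : odd _ = false) //.
have o : odd (absz (n ^+ 2)) = odd `|n|%N by rewrite abszX oddX.
by lia.
Qed.

Lemma theta3_eta : theta3 * (eulp 1 ^+ 2 * eulp 4 ^+ 2) = eulp 2 ^+ 5.
Proof.
have t := congr1 fps_flip theta4_eta; rewrite flipM flipX flip_theta4 in t.
rewrite [eulp 2]eulpE // in t; have e2 := flip_dil_even eul (isT : (0 < 1)%N).
rewrite muln1 in e2; rewrite e2 -eulpE // in t.
have f := flip_eul; have n2 : eulp 2 != 0 := fps_unit_neq0 (eulp0 2).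
move: t f n2; move: (eulp 1) (eulp 2) (eulp 4) theta3 (fps_flip (eulp 1)) => b c d x a t f n2.
apply: (mulfI n2); transitivity (x * c * (b ^+ 2 * d ^+ 2)); first by ring.
rewrite t; transitivity ((a * b * d) ^+ 2); first by ring.
by rewrite f; ring.
Qed.

Lemma dil_eulp m k : (0 < m)%N -> (0 < k)%N -> dil m (eulp k) = eulp (m * k).
Proof.
by move=> m0 k0; rewrite [eulp k]eulpE // dil_dil // -eulpE // muln_gt0 m0.
Qed.

(** Both sides are the eta quotient 4 eta_4^4 / eta_2^2 without its power of q. *)
Lemma psi2_duplication : psi2 ^+ 2 = 2%:R * (dil 2 theta3 * dil 2 psi2).
Proof.
have n m : (0 < m)%N -> eulp m != 0 by move=> _; apply: fps_unit_neq0 (eulp0 m).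
have p := psi2_eta.
have t2 := congr1 (dil 2) theta3_eta; have p2 := congr1 (dil 2) psi2_eta.
rewrite !(dilM (isT : (0 < 2)%N), dilX (isT : (0 < 2)%N)) !dil_eulp // in t2.
rewrite !(dilM (isT : (0 < 2)%N), dilX (isT : (0 < 2)%N)) !dil_eulp // dil_nat // in p2.
have n2 := n 2 isT; have n4 := n 4 isT; have n8 := n 8 isT.
move: t2 p2 p n2 n4 n8; rewrite /=.
move: psi2 (eulp 2) (eulp 4) (eulp 8) (dil 2 theta3) (dil 2 psi2) => z a b c x y t p2 p a0 b0 c0.
have nz : a ^+ 2 * c ^+ 2 * b != 0 by rewrite !mulf_neq0 ?expf_neq0.
apply: (mulfI nz); transitivity ((z * a) ^+ 2 * c ^+ 2 * b); first by ring.
rewrite p; transitivity (2%:R * (x * (a ^+ 2 * c ^+ 2)) * (y * b)); last by ring.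
by rewrite t p2; ring.
Qed.

(** Factor theta_3^4 - theta_4^4 as a difference of squares: [theta34_sum] and [theta34_diff1]
    evaluate the factors at q^2, and [psi2_duplication] brings their product back to q. *)
Lemma jacobi_abstruse : theta3 ^+ 4 = theta4 ^+ 4 + pX * psi2 ^+ 4.
Proof.
have s := theta34_sum; have d := theta34_diff1; have p := psi2_duplication.
move: s d p; move: theta3 theta4 psi2 (dil 2 theta3) (dil 2 psi2) pX => a b c x y q s d p.
transitivity (b ^+ 4 + (a ^+ 2 - b ^+ 2) * (a ^+ 2 + b ^+ 2)); first by ring.
rewrite s d; transitivity (b ^+ 4 + q * (2%:R * (x * y)) ^+ 2); first by ring.
by rewrite -p; ring.
Qed.

End EtaForms.

(** * Arithmetic in a quadratic extension of a polynomial ring *)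

Section QuadraticExtension.

(* Elements x.1(d) + x.2(d) b of A, where b ^+ 2 = P(d) b + Q(d). *)
Definition quad := (seq BinInt.Z * seq BinInt.Z)%type.
Definition qd_add (x y : quad) : quad := (zadd x.1 y.1, zadd x.2 y.2).
Definition qd_scale (c : BinInt.Z) (x : quad) : quad := (zscale c x.1, zscale c x.2).
Definition qd_sub (x y : quad) : quad := (zsub x.1 y.1, zsub x.2 y.2).
Definition qd_mul (P Q : seq BinInt.Z) (x y : quad) : quad :=
  let z := zmul x.2 y.2 in
  (zadd (zmul x.1 y.1) (zmul Q z), zadd (zadd (zmul x.1 y.2) (zmul x.2 y.1)) (zmul P z)).
Definition qd_one : quad := ([:: BinNums.Zpos BinNums.xH], [::]).
Definition qd_exp P Q (x : quad) n : quad := iter n (qd_mul P Q x) qd_one.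
Fixpoint qd_hom P Q (n : nat) (x y : quad) (p : seq BinInt.Z) : quad :=
  if p is c :: p' then
    qd_add (qd_scale c (qd_exp P Q y n)) (qd_mul P Q x (qd_hom P Q n.-1 x y p'))
  else ([::], [::]).
Definition qd_eqb (x y : quad) := zeqb x.1 y.1 && zeqb x.2 y.2.

Variables (P Q : seq BinInt.Z) (A : comNzRingType) (d b : A).
Hypothesis bE : b ^+ 2 = zev P d * b + zev Q d.

Definition qd_ev (x : quad) : A := zev x.1 d + zev x.2 d * b.

Lemma qd_evD x y : qd_ev (qd_add x y) = qd_ev x + qd_ev y.
Proof. by rewrite /qd_ev !zev_add; ring. Qed.
Lemma qd_evB x y : qd_ev (qd_sub x y) = qd_ev x - qd_ev y.
Proof. by rewrite /qd_ev !zev_sub; ring. Qed.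
Lemma qd_evZ c x : qd_ev (qd_scale c x) = zval c * qd_ev x.
Proof. by rewrite /qd_ev !zev_scale; ring. Qed.
Lemma qd_evM x y : qd_ev (qd_mul P Q x y) = qd_ev x * qd_ev y.
Proof.
rewrite /qd_ev /= !zev_add !zev_mul.
transitivity (zev x.1 d * zev y.1 d + (zev x.1 d * zev y.2 d + zev x.2 d * zev y.1 d) * b
   + zev x.2 d * zev y.2 d * (zev P d * b + zev Q d)); first by ring.
by rewrite -bE; ring.
Qed.
Lemma qd_ev1 : qd_ev qd_one = 1.
Proof. by rewrite /qd_ev /= /zval mulr0 addr0 mul0r addr0. Qed.
Lemma qd_evX x n : qd_ev (qd_exp P Q x n) = qd_ev x ^+ n.
Proof. by elim: n => [|n IH]; [exact: qd_ev1 | rewrite /qd_exp iterS qd_evM exprS -IH]. Qed.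
Lemma qd_ev_hom n x y p z : (size p <= n.+1)%N -> qd_ev x = z * qd_ev y ->
  qd_ev (qd_hom P Q n x y p) = zev p z * qd_ev y ^+ n.
Proof.
move=> hp e; elim: p n hp => [|c p IH] n hp /=; first by rewrite /qd_ev /=; ring.
rewrite qd_evD qd_evZ qd_evX qd_evM e.
case: n hp => [|n] hp; first by case: p hp {IH} => //= _; rewrite /qd_ev /= expr0; ring.
by rewrite IH //= exprS; ring.
Qed.
Lemma qd_eq x y : qd_eqb x y -> qd_ev x = qd_ev y.
Proof. by case/andP => /(zev_eq d) h1 /(zev_eq d) h2; rewrite /qd_ev h1 h2. Qed.

End QuadraticExtension.

(** * X_1 as a function of the modular lambda function *)

Section QuarticModel.

Delimit Scope Z_scope with bZ.
Local Notation L s := (s%bZ).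
Local Notation N := (eulp 2 ^+ 24).
Local Notation al := (16%:R * pX * eulp 1 ^+ 8 * eulp 4 ^+ 16).
Local Notation be := (eulp 1 ^+ 16 * eulp 4 ^+ 8).

(** This is X_1 = w / (1 + 256 w)^3 of level 2, rewritten in eta products of level 4. Divided by
    powers of N it reads 1/X_1 = 16 (1 + 14 lam + lam^2)^3 / (lam (1 - lam)^4). *)
Lemma X1s_level2 : 16%:R * (be ^+ 2 + 16%:R * al * N) ^+ 3 * X1s = al * be ^+ 4 * N.
Proof.
pose m := L [:: 1]; pose pm := L [:: 1; 256]; pose pp := L [:: 1; 16]; pose kk := L [:: 1; 64].
have lead : genus0_lead m pm pp kk by vm_compute.
have ck1 : genus0_check1 m pm kk by vm_compute.
have ck2 : genus0_check2 2 m pp kk by vm_compute.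
have ck3 : genus0_check3 2 m pm pp kk by vm_compute.
have [w [w0 w1] wE] := genus0_param lead.
have [Lw Dw L0] := log_derivative w0 w1.
have [_ T2 _] := genus0_main (isT : (0 < 2)%N) lead ck1 ck2 ck3 w0 w1 wE Dw L0 (erefl _).
have k256 : zval (L 256) = 16%:R * 16%:R :> fps by rewrite -natrM -zval_nat.
have z1 : zval (L 1) = 1 :> fps by [].
have mE : zev m w = 1 by rewrite /m /= z1 mulr0 addr0.
have pE : zev pm w = 1 + 16%:R * 16%:R * w by rewrite /pm /= z1 k256 mulr0 addr0 [w * _]mulrC.
have T : pX * eulp 2 ^+ 24 = w * eulp 1 ^+ 24.
  have T : w ^+ 1 * Delta = pX ^+ 2 * eulp 2 ^+ 24 := etrans (esym T2) (dil_Delta (isT : (0 < 2)%N)).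
  have DE' : Delta = pX * eulp 1 ^+ 24 := erefl.
  rewrite DE' expr1 in T; clear T2 wE Dw DE'; apply: (mulfI pX_neq0); move: T.
  move: (eulp 2 ^+ 24) (eulp 1 ^+ 24) => a b T.
  by transitivity (pX ^+ 2 * a); [ring | rewrite -T; ring].
clear T2 Dw.
rewrite mE mulr1 pE in wE.
move: wE T; move: (16%:R : fps) (eulp 2 ^+ 24) (eulp 1) (eulp 4) X1s pX => c n a d X q wE T.
have alg1 : c * ((a ^+ 16 * d ^+ 8) ^+ 2 + c * (c * q * a ^+ 8 * d ^+ 16) * n) ^+ 3 * X =
    c * (a ^+ 8 * d ^+ 16) ^+ 3 * (X * (a ^+ 24 + c * c * (q * n)) ^+ 3) by clear; ring.
have alg2 : X * (a ^+ 24 + c * c * (w * a ^+ 24)) ^+ 3 = (a ^+ 24) ^+ 3 * (X * (1 + c * c * w) ^+ 3) by clear; ring.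
have alg3 : c * q * a ^+ 8 * d ^+ 16 * (a ^+ 16 * d ^+ 8) ^+ 4 * n = c * a ^+ 72 * d ^+ 48 * (q * n) by clear; ring.
have alg4 : c * (a ^+ 8 * d ^+ 16) ^+ 3 * ((a ^+ 24) ^+ 3 * w) = c * a ^+ 72 * d ^+ 48 * (w * a ^+ 24) by clear; ring.
have e1 := congr1 (fun z => X * (a ^+ 24 + c * c * z) ^+ 3) T.
have e2 := congr1 (fun z => c * (a ^+ 8 * d ^+ 16) ^+ 3 * z) (etrans e1 alg2).
have e3 := congr1 (fun z => c * (a ^+ 8 * d ^+ 16) ^+ 3 * ((a ^+ 24) ^+ 3 * z)) wE.
have e4 := congr1 (fun z => c * a ^+ 72 * d ^+ 48 * z) T.
exact: (etrans alg1 (etrans e2 (etrans e3 (etrans alg4 (etrans (esym e4) (esym alg3)))))).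
Qed.

Lemma eta_jacobi : N = be + al.
Proof.
have j := jacobi_abstruse; have t3 := theta3_eta; have t4 := theta4_eta; have p := psi2_eta.
have n2 : eulp 2 != 0 := fps_unit_neq0 (eulp0 2).
move: j t3 t4 p n2.
move: theta3 theta4 psi2 (eulp 1) (eulp 2) (eulp 4) pX => x y z a b d q j t3 t4 p n2.
have c16 : (16%:R : fps) = 2%:R ^+ 4 by rewrite -natrX.
rewrite c16; transitivity (b ^+ 4 * (b ^+ 5) ^+ 4); first by ring.
rewrite -t3; transitivity (x ^+ 4 * (b ^+ 4 * a ^+ 8 * d ^+ 8)); first by ring.
rewrite j; transitivity ((y * b) ^+ 4 * (a ^+ 8 * d ^+ 8) + q * (z * b) ^+ 4 * (a ^+ 8 * d ^+ 8)); first by ring.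
by rewrite t4 p; ring.
Qed.

Lemma eulp_unit_exp m k : (eulp m ^+ k) 0%N = 1.
Proof. by rewrite fcoef_exp0 eulp0 expr1n. Qed.

(* The modular lambda function at 2 tau. *)
Definition lam : fps := al * fps_powr N (-1).

Lemma lamE : lam * N = al.
Proof. exact: (mu_powr1 al (eulp_unit_exp 2 24)). Qed.

Lemma lam0 : lam 0%N = 0.
Proof. by rewrite /lam -!mulrA mulrCA coef_pXM. Qed.

Lemma lamCE : (1 - lam) * N = be.
Proof. by rewrite mulrBl mul1r lamE eta_jacobi addrK. Qed.

Lemma quartic_dehomogenize (A : idomainType) (n a X c x y : A) : n != 0 ->
  a * n = x -> (1 - a) * n = y -> c * (y ^+ 2 + c * x * n) ^+ 3 * X = x * y ^+ 4 * n ->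
  c * ((1 - a) ^+ 2 + c * a) ^+ 3 * X = a * (1 - a) ^+ 4.
Proof.
move=> n0 <- <- h; apply: (mulfI (expf_neq0 6 n0)).
transitivity (c * (((1 - a) * n) ^+ 2 + c * (a * n) * n) ^+ 3 * X); first by ring.
by rewrite h; ring.
Qed.

Lemma X1s_lam : 16%:R * ((1 - lam) ^+ 2 + 16%:R * lam) ^+ 3 * X1s = lam * (1 - lam) ^+ 4.
Proof.
exact: (quartic_dehomogenize (fps_unit_neq0 (eulp_unit_exp 2 24)) lamE lamCE X1s_level2).
Qed.

End QuarticModel.

(** * Symmetric functions of two values of lambda *)

Section SymmetricFunctions.
Variable A : idomainType.

Lemma quartic_norm (c a b p r m : A) : a * b = p -> (1 - a) * (1 - b) = r ->
  a * (1 - b) ^+ 2 + b * (1 - a) ^+ 2 = m ->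
  ((1 - a) ^+ 2 + c * a) * ((1 - b) ^+ 2 + c * b) = r ^+ 2 + c * m + c ^+ 2 * p.
Proof. by move=> <- <- <-; ring. Qed.

Lemma quartic_trace (c a b p r m : A) : a * b = p -> (1 - a) * (1 - b) = r ->
  a * (1 - b) ^+ 2 + b * (1 - a) ^+ 2 = m ->
  a * (1 - a) ^+ 4 * ((1 - b) ^+ 2 + c * b) ^+ 3 + b * (1 - b) ^+ 4 * ((1 - a) ^+ 2 + c * a) ^+ 3 =
  r ^+ 4 * m + 6%:R * c * p * r ^+ 4 + 3%:R * c ^+ 2 * p * r ^+ 2 * m
  + c ^+ 3 * p * (m ^+ 2 - 2%:R * p * r ^+ 2).
Proof. by move=> <- <- <-; ring. Qed.

Lemma quartic_sum (a b p r : A) : a * b = p -> (1 - a) * (1 - b) = r ->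
  a * (1 - b) ^+ 2 + b * (1 - a) ^+ 2 = 1 - r - 3%:R * p + p * (1 + p - r).
Proof. by move=> <- <-; ring. Qed.

(** Here t and u are the same rational function of a and of b. Up to the cubed norm [nn] of the
    denominators, their product and sum are symmetric polynomials in a, b, hence polynomials in p =
    ab and r = (1 - a)(1 - b), because a + b = 1 + p - r. *)
Lemma quartic_pair (c a b t u p r m nn tr : A) :
  c * ((1 - a) ^+ 2 + c * a) ^+ 3 * t = a * (1 - a) ^+ 4 ->
  c * ((1 - b) ^+ 2 + c * b) ^+ 3 * u = b * (1 - b) ^+ 4 ->
  a * b = p -> (1 - a) * (1 - b) = r -> m = 1 - r - 3%:R * p + p * (1 + p - r) ->
  nn = r ^+ 2 + c * m + c ^+ 2 * p ->
  tr = r ^+ 4 * m + 6%:R * c * p * r ^+ 4 + 3%:R * c ^+ 2 * p * r ^+ 2 * m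
     + c ^+ 3 * p * (m ^+ 2 - 2%:R * p * r ^+ 2) ->
  c ^+ 2 * nn ^+ 3 * (t * u) = p * r ^+ 4 /\ c * nn ^+ 3 * (t + u) = tr.
Proof.
move=> ht hu hp hr mE nnE trE; have m' : a * (1 - b) ^+ 2 + b * (1 - a) ^+ 2 = m.
  by rewrite mE; apply: quartic_sum.
rewrite trE -(quartic_trace c hp hr m') nnE -(quartic_norm c hp hr m') -ht -hu -hp -hr.
move: ht hu; set n1 := (1 - a) ^+ 2 + c * a; set n2 := (1 - b) ^+ 2 + c * b => ht hu.
split; last by ring.
transitivity ((c * n1 ^+ 3 * t) * (c * n2 ^+ 3 * u)); first by ring.
by rewrite ht hu; ring.
Qed.

End SymmetricFunctions.

(** * The polynomial identities for levels 11 and 23 *)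

Section HigherLevelCheck.

Delimit Scope Z_scope with bZ.
Local Notation L s := (s%bZ).

(* The level 11 and 23 data: b = B and d = D satisfy b ^+ 2 = (1 + m d) b + m d ^+ 3,
   C = 1 - b + m d, p = b ^+ k, r = C ^+ k and X = C d / den. *)
Definition higher_check (l k : nat) (m : BinInt.Z) (den : quad) : bool :=
  let P := [:: BinInt.Z.of_nat 1; m] in
  let Q := [:: BinNums.Z0; BinNums.Z0; BinNums.Z0; m] in
  let mul := qd_mul P Q in let exp := qd_exp P Q in
  let z n := qd_scale (BinInt.Z.of_nat n) in
  let B : quad := ([::], [:: BinInt.Z.of_nat 1]) in
  let C : quad := ([:: BinInt.Z.of_nat 1; m], [:: BinInt.Z.opp (BinInt.Z.of_nat 1)]) in
  let CD := mul C ([:: BinNums.Z0; BinInt.Z.of_nat 1], [::]) in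
  let p := exp B k in let r := exp C k in
  let mm := qd_add (qd_sub (qd_sub qd_one r) (z 3 p)) (mul p (qd_sub (qd_add qd_one p) r)) in
  let r2 := mul r r in let r4 := mul r2 r2 in
  let nn := qd_add (qd_add r2 (z 16 mm)) (z (16 ^ 2)%N p) in
  let tr := qd_add (qd_add (qd_add (mul r4 mm) (z 6 (z 16 (mul p r4)))) (z 3 (z (16 ^ 2)%N (mul (mul p r2) mm))))
     (z (16 ^ 3)%N (mul p (qd_sub (mul mm mm) (z 2 (mul p r2))))) in
  let pr4 := mul p r4 in
  [&& qd_eqb (z (16 ^ 2)%N (mul (exp CD l.+1) (exp nn 3))) (mul (exp (qd_hom P Q (l.+1 %/ 3) CD den (lK l)) 3) pr4),
      qd_eqb (z 16 (mul (exp CD l) tr)) (mul (qd_hom P Q l CD den (lc l)) pr4),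
      (size (lK l) <= (l.+1 %/ 3).+1)%N, (size (lc l) <= l.+1)%N & (3 %| l.+1)%N].

(** The denominator is (1 + B)^2, with B^2 replaced by means of the equation of B. *)
Lemma higher_check11 : higher_check 11 4 (L (-4)) (L [:: 1; 0; 0; -4], L [:: 3; -4]).
Proof. by vm_compute. Qed.
(* den = 1 + B ^+ 2 - C D, reduced modulo the equation of B *)
Lemma higher_check23 : higher_check 23 8 (L (-2)) (L [:: 1; -1; 2; -2], L [:: 1; -1]).
Proof. by vm_compute. Qed.

End HigherLevelCheck.

(** * The quadratic equation for X_1(q) and X_1(q^l) *)

Section HigherLevels.

Delimit Scope Z_scope with bZ.
Local Notation L s := (s%bZ).

(** The goal is the product and the sum of reciprocals of y^+ and y^-, namely x^(l+1)/K^3 and c/x^l,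
    freed of denominators. Both are symmetric, so they are accessible through p = B^k and r = C^k
    without any choice between the two roots. *)
Lemma higher_pair (l k : nat) (mz : BinInt.Z) (den : quad) (mv t u a b B C D0 X : fps) :
  higher_check l k mz den -> l \in levels -> zval mz = - mv ->
  16%:R * ((1 - a) ^+ 2 + 16%:R * a) ^+ 3 * t = a * (1 - a) ^+ 4 ->
  16%:R * ((1 - b) ^+ 2 + 16%:R * b) ^+ 3 * u = b * (1 - b) ^+ 4 ->
  a 0%N = 0 -> b 0%N = 0 -> a * b = B ^+ k -> (1 - a) * (1 - b) = C ^+ k ->
  C = 1 - B - mv * D0 -> B ^+ 2 = (1 - mv * D0) * B - mv * D0 ^+ 3 ->
  X * (qd_ev D0 B den) = C * D0 -> (qd_ev D0 B den) 0%N = 1 ->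
  X ^+ l.+1 = zev (lK l) X ^+ 3 * (t * u) /\ X ^+ l * (t + u) = zev (lc l) X * (t * u).
Proof.
move=> /and5P[c1 c2 sK sc dv] hl mE ht hu a0 b0 hp hr CE BE XE den0.
have z1 : zval (L 1) = 1 :> fps by [].
have z_1 : zval (L (-1)) = -1 :> fps by [].
have zn n : zval (BinInt.Z.of_nat n) = n%:R :> fps by exact: zval_nat.
pose P := [:: BinInt.Z.of_nat 1; mz].
pose Q := [:: BinNums.Z0; BinNums.Z0; BinNums.Z0; mz].
have BE' : B ^+ 2 = zev P D0 * B + zev Q D0.
  rewrite BE /P /Q /= mE z1 /zval /=; ring.
have n1 : (((1 - a) ^+ 2 + 16%:R * a) * ((1 - b) ^+ 2 + 16%:R * b)) 0%N = 1.
  have h (f : fps) : f 0%N = 0 -> ((1 - f) ^+ 2 + 16%:R * f) 0%N = 1.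
    by move=> f0; rewrite fcoefD fcoef_exp0 fcoefB fcoef_natM f0 fcoef1 mulr0 addr0 subr0 expr1n.
  by rewrite fcoef_mul0 (h a a0) (h b b0) mulr1.
have m' := quartic_sum hp hr.
rewrite (quartic_norm 16%:R hp hr m') in n1.
have [e1 e2] := quartic_pair ht hu hp hr (erefl _) (erefl _) (erefl _).
have denn := fps_unit_neq0 den0.
have {c1} c1 := qd_eq D0 B c1; have {c2} c2 := qd_eq D0 B c2.
have Bev : qd_ev D0 B ([::], [:: BinInt.Z.of_nat 1]) = B.
  by rewrite /qd_ev /= z1 mulr0 addr0 mul1r add0r.
have Cev : qd_ev D0 B ([:: BinInt.Z.of_nat 1; mz], [:: BinInt.Z.opp (BinInt.Z.of_nat 1)]) = C.
  rewrite /qd_ev /= z1 z_1 mE CE; ring.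
have Dev : qd_ev D0 B ([:: BinNums.Z0; BinInt.Z.of_nat 1], [::]) = D0.
  rewrite /qd_ev /= z1 /zval /=; ring.
have CDev : qd_ev D0 B (qd_mul P Q ([:: BinInt.Z.of_nat 1; mz], [:: BinInt.Z.opp (BinInt.Z.of_nat 1)])
    ([:: BinNums.Z0; BinInt.Z.of_nat 1], [::])) = X * qd_ev D0 B den.
  by rewrite (qd_evM BE') Cev Dev XE.
move: c1 c2.
rewrite !(qd_evX BE', qd_evM BE', qd_evZ, qd_evD, qd_evB, qd_ev1) -/P -/Q.
rewrite (qd_ev_hom BE' sK CDev) (qd_ev_hom BE' sc CDev) Cev Dev Bev !zn -XE.
rewrite !natrX.
move: e1 e2 n1 den0 denn; rewrite -!expr2.
set nn := C ^+ k ^+ 2 + _ + _; set tr := _ + 16%:R ^+ 3 * _ * _.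
set tr2 := _ + 16%:R ^+ 3 * (_ * _).
have -> : tr2 = tr by rewrite /tr2 /tr; move: (16%:R : fps) (B ^+ k) (C ^+ k) => c p r; ring.
have -> : C ^+ k ^+ 2 ^+ 2 = C ^+ k ^+ 4 by rewrite -!exprM.
set v := qd_ev D0 B den; move: (B ^+ k * C ^+ k ^+ 4) => pr4.
have c0 : (16%:R : fps) != 0 by exact: fps_natf_neq0.
move: c0; move: (16%:R : fps) => c c0 e1 e2 /fps_unit_neq0 nn0 _ vn0 c1 c2.
have kl : (l.+1 %/ 3 * 3 = l.+1)%N by rewrite divnK.
split.
- have nz : c ^+ 2 * nn ^+ 3 * v ^+ l.+1 != 0 by rewrite !mulf_neq0 ?expf_neq0.
  apply: (mulfI nz); transitivity (c ^+ 2 * ((X * v) ^+ l.+1 * nn ^+ 3)).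
    by rewrite exprMn; ring.
  rewrite c1 -e1 [(zev _ X * _) ^+ 3]exprMn -exprM kl; ring.
- have nz : c ^+ 2 * nn ^+ 3 * v ^+ l != 0 by rewrite !mulf_neq0 ?expf_neq0.
  apply: (mulfI nz); transitivity (c * ((X * v) ^+ l * tr)).
    by rewrite exprMn -e2; ring.
  by rewrite c2 -e1; ring.
Qed.

End HigherLevels.

(** * Eisenstein series from the derivative of X_l *)

Section Schwarzian.

(** With Y = D X / X and T = X N / (2 K^3), N = c + d S, the quantity M is defined by 4 S K^4 D T =
    X Y M ([schwarz_deriv]). The tested identity is what turns (D T)^2 = T^2 q (1 - 1728 T) into g q
    = Y^2 (a - b S); the factor 864 is 1728 / 2. *)
Definition eis_check (l : nat) : bool :=
  let g := lg l in let mul := qd_mul [::] g in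
  let p s : quad := (s, [::]) in let z n := qd_scale (BinInt.Z.of_nat n) in
  let one := [:: BinInt.Z.of_nat 1] in let S : quad := ([::], one) in
  let X := p [:: BinNums.Z0; BinInt.Z.of_nat 1] in
  let th s := p (ztheta s) in
  let N := qd_add (p (lc l)) (mul (p (ld l)) S) in let K := p (lK l) in
  let M := qd_sub (qd_add (z 2 (mul (mul S N) K))
      (mul K (qd_add (qd_add (z 2 (mul (th (lc l)) S)) (z 2 (mul (th (ld l)) (p g)))) (mul (th g) (p (ld l))))))
    (z 6 (mul (mul S N) (th (lK l)))) in
  qd_eqb (mul (mul M M) K)
    (z 2 (mul (mul N N) (mul (qd_sub (mul K (mul K K)) (z 864 (mul X N)))
       (qd_sub (p (la l)) (mul (p (lb l)) S))))).

Lemma eis_check_levels l : l \in [:: 11; 23]%N -> eis_check l.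
Proof. by rewrite !inE => /orP[] /eqP ->; vm_compute. Qed.

Section Algebra.
Variable A : idomainType.
Variables (X Y S N K kc cc dd gg tc td tg tK T : A).
Variables (DT DS : A) (c la lb q : A).

Lemma schwarz_deriv :
  S ^+ 2 = gg -> 2%:R * (S * DS) = tg * Y ->
  T * (2%:R * K ^+ 3) = X * (cc + dd * S) ->
  2%:R * (3%:R * K ^+ 2 * (tK * Y) * T + K ^+ 3 * DT) =
    X * Y * (cc + dd * S) + X * (tc * Y + (td * Y * S + dd * DS)) ->
  4%:R * S * K ^+ 4 * DT = X * Y * (2%:R * (S * (cc + dd * S) * K)
    + K * (2%:R * (tc * S) + 2%:R * (td * gg) + tg * dd) - 6%:R * (S * (cc + dd * S) * tK)).
Proof.
move=> e1 e2 e3 e4.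
apply: (lincomb4 (n := 1) (c1 := 2%:R * S * K) (c2 := - 6%:R * S * tK * Y) (c3 := 2%:R * X * K * Y * td)
  (c4 := X * K * dd) (oner_neq0 _) e4 e3 e1 e2).
by ring.
Qed.

Lemma schwarz_final M : 2%:R != 0 :> A -> X != 0 -> T != 0 -> K != 0 -> 1 - 2%:R * c * T != 0 ->
  S ^+ 2 = gg -> T * (2%:R * K ^+ 3) = X * N ->
  4%:R * S * K ^+ 4 * DT = X * Y * M ->
  M * M * K = 2%:R * (N * N * ((K * (K * K) - c * (X * N)) * (la - lb * S))) ->
  DT ^+ 2 = T ^+ 2 * q * (1 - 2%:R * c * T) ->
  2%:R * gg * q = Y ^+ 2 * (la - lb * S).
Proof.
move=> two X0 T0 K0 c0 e1 e3 e4 e5 e6.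
have N0 : N != 0.
  apply/eqP => N0; have := mulf_neq0 T0 (mulf_neq0 two (expf_neq0 3 K0)).
  by rewrite e3 N0 mulr0 eqxx.
have e7 : 2%:R * (S * K * N * DT) = T * Y * M.
  apply: (lincomb2 (n := 2%:R * K ^+ 3) (c1 := N) (c2 := - (Y * M)) _ e4 e3); last by ring.
  by rewrite mulf_neq0 ?expf_neq0.
apply: (mulfI (x := 2%:R * K ^+ 3 * N ^+ 2 * (1 - 2%:R * c * T) * T ^+ 2)).
  by rewrite !mulf_neq0 ?expf_neq0.
have e8 : (2%:R * (S * K * N * DT)) ^+ 2 * K = T ^+ 2 * Y ^+ 2 * (M * M * K) by rewrite e7; ring.
rewrite e5 -e3 in e8.
transitivity ((2%:R * (S * K * N)) ^+ 2 * (T ^+ 2 * q * (1 - 2%:R * c * T)) * K).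
  by rewrite -e1; ring.
rewrite -e6; transitivity ((2%:R * (S * K * N * DT)) ^+ 2 * K); first by ring.
by rewrite e8; ring.
Qed.

End Algebra.

(** It is applied twice: to T = X_1(q) with q = Q, and with -S in place of S to T = X_1(q^l) with q
    = l^2 Q(q^l). *)
Lemma hauptmodul_eisenstein l (X S T Y q : fps) : eis_check l ->
  D X = X * Y -> X 0%N = 0 -> X != 0 -> T != 0 -> T 0%N = 0 -> (zev (lK l) X) 0%N = 1 ->
  S ^+ 2 = zev (lg l) X ->
  T * (2%:R * zev (lK l) X ^+ 3) = X * (zev (lc l) X + zev (ld l) X * S) ->
  D T ^+ 2 = T ^+ 2 * q * (1 - 1728%:R * T) ->
  2%:R * zev (lg l) X * q = Y ^+ 2 * (zev (la l) X - zev (lb l) X * S).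
Proof.
move=> ck DX0 X0 Xn0 Tn0 T0 K0 e1 e3 e6.
have c1728 : 1728%:R = 2%:R * 864%:R :> fps by rewrite -natrM.
have two : (2%:R : fps) != 0 by exact: fps_natf_neq0.
have c0 : 1 - 1728%:R * T != 0.
  by apply: fps_unit_neq0; rewrite fcoefB fcoef_mul0 T0 mulr0 fcoef1 subr0.
have z1 : zval (BinInt.Z.of_nat 1) = 1 :> fps by [].
have zn n : zval (BinInt.Z.of_nat n) = n%:R :> fps by exact: zval_nat.
have SE : S ^+ 2 = zev [::] X * S + zev (lg l) X by rewrite mul0r add0r.
have pE s : qd_ev X S (s, [::]) = zev s X by rewrite /qd_ev mul0r addr0.
have SSE : qd_ev X S ([::], [:: BinInt.Z.of_nat 1]) = S.
  by rewrite /qd_ev /= z1 mulr0 addr0 mul1r add0r.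
have xE : zev [:: BinNums.Z0; BinInt.Z.of_nat 1] X = X.
  by rewrite /= z1 /zval /= mulr0 addr0 mulr1 add0r.
have := qd_eq X S ck; rewrite !(qd_evZ, qd_evM SE, qd_evD, qd_evB) !pE SSE xE !zn => {ck} ck.
have Dk := D_zev (lK l) DX0; have Dc := D_zev (lc l) DX0.
have Dd := D_zev (ld l) DX0; have Dg := D_zev (lg l) DX0.
have e2 : 2%:R * (S * D S) = zev (ztheta (lg l)) X * Y.
  by rewrite -Dg -e1 DX; move: (D S) => d; rewrite expr1; ring.
have e4 := congr1 D e3.
have {}e4 : 2%:R * (3%:R * zev (lK l) X ^+ 2 * (zev (ztheta (lK l)) X * Y) * T + zev (lK l) X ^+ 3 * D T) =
    X * Y * (zev (lc l) X + zev (ld l) X * S)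
    + X * (zev (ztheta (lc l)) X * Y + (zev (ztheta (ld l)) X * Y * S + zev (ld l) X * D S)).
  move: e4; rewrite (DM T) D_natM (DX (zev (lK l) X) 2) (DM X) raddfD /= (DM (zev (ld l) X)) Dk Dc Dd DX0.
  move: (D T) (D S) => x y e4; rewrite -e4; ring.
have e5 := schwarz_deriv e1 e2 e3 e4.
have ck' := schwarz_final two Xn0 Tn0 (fps_unit_neq0 K0) _ e1 e3 e5 ck.
by apply: ck'; rewrite -c1728.
Qed.

End Schwarzian.

(** * Levels 11 and 23: from the quadratic equation to all relations *)

Section HigherModularData.

Lemma D_X1s_sq : D X1s ^+ 2 = X1s ^+ 2 * Qser * (1 - 1728%:R * X1s).
Proof.
have d := D_X1s; have r := X1s_discriminant; have q0 := Qser_neq0.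
move: d r q0; move: (1728%:R : fps) X1s Qser Rser (D X1s) => c t q r dt d r2 q0.
apply: (mulfI (expf_neq0 2 q0)); transitivity ((q * dt) ^+ 2); first by ring.
by rewrite d exprMn r2; ring.
Qed.

Lemma D_dil_X1s_sq l : (0 < l)%N ->
  D (dil l X1s) ^+ 2 = dil l X1s ^+ 2 * (l%:R ^+ 2 * dil l Qser) * (1 - 1728%:R * dil l X1s).
Proof.
move=> l0; rewrite D_dil // exprMn -(dilX l0 (D X1s) 2) D_X1s_sq (dilM l0 _ (1 - _)) (dilM l0 _ Qser) (dilX l0 X1s 2).
have -> : dil l (1 - 1728%:R * X1s) = 1 - 1728%:R * dil l X1s.
  rewrite /dil compD ?dil_base0 // compN ?dil_base0 // compM ?dil_base0 // comp1.
  by rewrite comp_nat.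
by move: (1 - _) => a; ring.
Qed.

Section HauptmodulRoots.
Variable A : idomainType.
Variables (K c d g S X t u : A) (l : nat).
Hypotheses (two : 2%:R != 0 :> A) (X0 : X != 0) (K0 : K != 0) (l0 : (0 < l)%N).
Hypotheses (SE : S ^+ 2 = g) (cd : c ^+ 2 - d ^+ 2 * g = 4%:R * X ^+ l.-1 * K ^+ 3).
Hypotheses (e1 : X ^+ l.+1 = K ^+ 3 * (t * u)) (e2 : X ^+ l * (t + u) = c * (t * u)).

Let XX : X ^+ l = X * X ^+ l.-1.
Proof. by rewrite -exprS prednK. Qed.

(** By e1 and e2, t and u are the roots of K^3 T^2 - c X T + X^(l+1), whose discriminant is X^2 d^2
    g by [cd]; completing the square at t gives the claim. *)
Lemma hauptmodul_square : (2%:R * K ^+ 3 * t - c * X) ^+ 2 = (X * (d * S)) ^+ 2.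
Proof.
have q : K ^+ 3 * t ^+ 2 + X ^+ l.+1 = c * X * t.
  apply: (mulfI (expf_neq0 l X0)).
  apply: (lincomb2 (n := 1) (c1 := X ^+ l - c * t) (c2 := K ^+ 3 * t) (oner_neq0 _) e1 e2).
  by rewrite (exprS X l); ring.
have q2 : 4%:R * K ^+ 3 * X ^+ l.+1 = X ^+ 2 * (c ^+ 2 - d ^+ 2 * g).
  by rewrite cd (exprS X l) XX; ring.
apply: (lincomb3 (n := 1) (c1 := 4%:R * K ^+ 3) (c2 := -1) (c3 := - X ^+ 2 * d ^+ 2) (oner_neq0 _) q q2 SE).
by ring.
Qed.

Hypothesis tE : 2%:R * K ^+ 3 * t = X * (c + d * S).

Lemma hauptmodul_minus : (c - d * S) * t = 2%:R * X ^+ l.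
Proof.
apply: (mulfI (mulf_neq0 two (expf_neq0 3 K0))).
transitivity ((c - d * S) * (2%:R * K ^+ 3 * t)); first by ring.
rewrite tE; transitivity (X * (c ^+ 2 - d ^+ 2 * S ^+ 2)); first by ring.
by rewrite SE cd XX; ring.
Qed.

Lemma hauptmodul_plus : (c + d * S) * u = 2%:R * X ^+ l.
Proof.
apply: (mulfI X0); transitivity (X * (c + d * S) * u); first by ring.
rewrite -tE; transitivity (2%:R * (K ^+ 3 * (t * u))); first by ring.
by rewrite -e1 (exprS X l); ring.
Qed.

Lemma hauptmodul_conj : u * (2%:R * K ^+ 3) = X * (c + d * - S).
Proof.
have p := hauptmodul_plus.
have n0 : c + d * S != 0.
  apply/eqP => z; move: p; rewrite z mul0r => /esym/eqP.
  by rewrite mulf_eq0 (negPf two) /= (negPf (expf_neq0 _ X0)).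
apply: (mulfI n0); transitivity (2%:R * K ^+ 3 * ((c + d * S) * u)); first by ring.
rewrite p; transitivity (X * (c ^+ 2 - d ^+ 2 * S ^+ 2)); last by ring.
by rewrite SE cd XX; ring.
Qed.

End HauptmodulRoots.

Section Weight.
Variable A : idomainType.

Lemma weight_quartic (g q qu Y la lb S K ll : A) : 4%:R * ll != 0 -> S ^+ 2 = g ->
  2%:R * g * q = Y ^+ 2 * (la - lb * S) ->
  2%:R * g * (ll * qu) = Y ^+ 2 * (la + lb * S) ->
  la ^+ 2 - lb ^+ 2 * g = 4%:R * ll * K ->
  g ^+ 2 * (q * qu) = Y ^+ 4 * K.
Proof.
move=> n0 sg h1 h2 ab; apply: (mulfI n0).
transitivity ((2%:R * g * q) * (2%:R * g * (ll * qu))); first by ring.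
rewrite h1 h2; transitivity (Y ^+ 4 * (la ^+ 2 - lb ^+ 2 * S ^+ 2)); first by ring.
by rewrite sg ab; ring.
Qed.

Lemma weight_transfer (g q Y m z : A) : g != 0 -> z ^+ 2 * g = Y ^+ 2 ->
  2%:R * g * q = Y ^+ 2 * m -> z ^+ 2 * m = 2%:R * q.
Proof.
move=> g0 zE h; apply: (mulfI g0); transitivity (z ^+ 2 * g * m); first by ring.
by rewrite zE -h; ring.
Qed.

Lemma weight_cube (z K t u q qu X dl : A) l : t != 0 -> u != 0 ->
  X ^+ l.+1 = K ^+ 3 * (t * u) -> z ^+ 12 * X ^+ l.+1 = dl ->
  dl = (t * q ^+ 3) * (u * qu ^+ 3) -> (z ^+ 4 * K) ^+ 3 = (q * qu) ^+ 3.
Proof.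
move=> t0 u0 e1 e2 e3; apply: (mulfI (mulf_neq0 t0 u0)).
transitivity (z ^+ 12 * (K ^+ 3 * (t * u))); first by ring.
by rewrite -e1 e2 e3; ring.
Qed.

End Weight.

(** Z must be matched with Y = D X / X. On one side Z^12 X^(l+1) = Delta Delta(q^l) and X^(l+1) =
    K^3 X_1(q) X_1(q^l) give Z^4 K = Q(q) Q(q^l) after a cube root; on the other the product of the
    two Eisenstein relations gives g^2 Q(q) Q(q^l) = Y^4 K. Hence Z^2 g = Y^2, which carries the
    Eisenstein relations over to Z. *)
Lemma higher_modular l (x z : fps) : l \in [:: 11; 23]%N ->
  x 0%N = 1 -> z 0%N = 1 -> z ^+ 12 * x ^+ l.+1 = eul ^+ 24 * eulp l ^+ 24 ->
  (pX * x) ^+ l.+1 = zev (lK l) (pX * x) ^+ 3 * (X1s * dil l X1s) ->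
  (pX * x) ^+ l * (X1s + dil l X1s) = zev (lc l) (pX * x) * (X1s * dil l X1s) ->
  exists2 S : fps, S 0%N = 1 & modular_data l (pX * x) z S.
Proof.
move=> h23 x0 z0 zE e1 e2.
have l0 : (0 < l)%N by move: h23; rewrite !inE => /orP[] /eqP ->.
have l1 : (1 < l)%N by move: h23; rewrite !inE => /orP[] /eqP ->.
have hl : l \in levels by move: h23; rewrite !inE => /orP[] /eqP ->.
have ck := eis_check_levels h23.
case/and5P: (lead_check hl) => /eqP hc /eqP hd /eqP hg /eqP hK _.
move: e1 e2; set X : fps := pX * x => e1 e2.
have X0 : X 0%N = 0 by rewrite /X coef_pXM.
have X1 : X 1%N = 1 by rewrite /X coef_pXM.
have Xn0 : X != 0 by apply: mulf_neq0 pX_neq0 (fps_unit_neq0 x0).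
have [Y DX0 Y0] := log_derivative X0 X1.
have c0 := zev_head1 X0 hc; have d0 := zev_head1 X0 hd.
have g0 := zev_head1 X0 hg; have K0 := zev_head1 X0 hK.
pose S : fps := fps_powr (zev (lg l) X) (1 / 2).
have S0 : S 0%N = 1 by exact: fps_powr0.
have SE : S ^+ 2 = zev (lg l) X.
  rewrite /S fps_powrX // (_ : 1 / 2 * 2%:R = 1%:R); last by field.
  by rewrite (fps_powr_nat 1 g0) expr1.
have two : (2%:R : fps) != 0 by exact: fps_natf_neq0.
have Kn0 := fps_unit_neq0 K0; have gn0 := fps_unit_neq0 g0.
have cd := cd_zev X hl; have ab := ab_zev X hl.
have un0 : dil l X1s != 0.
  apply/eqP => u0; move: e1; rewrite u0 !mulr0 => /eqP.
  by rewrite (negPf (expf_neq0 _ Xn0)).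
have tE : 2%:R * zev (lK l) X ^+ 3 * X1s = X * (zev (lc l) X + zev (ld l) X * S).
  have := hauptmodul_square Xn0 l0 SE cd e1 e2.
  move: c0 d0 S0 K0 => c0 d0 S0 K0; move/eqP; rewrite eqf_sqr => /orP[] /eqP e.
    by rewrite mulrDr -e [X * _]mulrC addrC subrK.
  (* The opposite sign is excluded by the coefficient of q, which would have to be both 2 - 1 and
     -1. *)
  have := congr1 (fun f : fps => f 1%N) e.
  have XM1 (f : fps) : (X * f) 1%N = f 0%N by rewrite /X -mulrA coef_pXM fcoef_mul0 x0 mul1r.
  rewrite fcoefB fcoefN -mulrA fcoef_natM [_ * X]mulrC !XM1 fcoef_mul0 c0 d0 S0 mulr1.
  have -> : (zev (lK l) X ^+ 3 * X1s) 1%N = 1.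
    rewrite [_ * X1s]mulrC /X1s /Delta -!mulrA coef_pXM !fcoef_mul0 !fcoef_exp0 K0 eul0 fps_powr0.
    by rewrite !expr1n !mulr1.
  by move=> /eqP; rewrite (_ : 2%:R * 1 - 1 = 1) //.
have t0 := X1s_neq0.
have em := hauptmodul_minus two Kn0 l0 SE cd tE.
have ep := hauptmodul_plus Xn0 e1 tE.
have uE := hauptmodul_conj two Xn0 l0 SE cd e1 tE.
have ud : (dil l X1s) 0%N = 0 by rewrite dil0 // coef_X1s0.
have tE' : X1s * (2%:R * zev (lK l) X ^+ 3) = X * (zev (lc l) X + zev (ld l) X * S).
  by rewrite mulrC.
have h1 := hauptmodul_eisenstein ck DX0 X0 Xn0 t0 coef_X1s0 K0 SE tE' D_X1s_sq.
have SN : (- S) ^+ 2 = zev (lg l) X by rewrite sqrrN.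
have h2 := hauptmodul_eisenstein ck DX0 X0 Xn0 un0 ud K0 SN uE (D_dil_X1s_sq l0).
rewrite mulrN opprK in h2.
have ln0 : (l%:R : fps) != 0.
  by clear - l0; case: l l0 => // n _; exact: fps_natf_neq0.
have n4 : 4%:R * l%:R ^+ 2 != 0 :> fps := mulf_neq0 (fps_natf_neq0 3) (expf_neq0 2 ln0).
have w4 := weight_quartic n4 SE h1 h2 ab.
have zE' : z ^+ 12 * X ^+ l.+1 = Delta * dil l Delta.
  rewrite (dil_Delta l0) /X exprMn mulrCA zE exprS /Delta.
  by move: (eul ^+ 24) (eulp l ^+ 24) (pX ^+ l) => a b c; ring.
have dE : Delta * dil l Delta = (X1s * Qser ^+ 3) * (dil l X1s * dil l Qser ^+ 3).
  by rewrite -dilX // -dilM // X1sE.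
have w3 := weight_cube t0 un0 e1 zE' dE.
have w : z ^+ 4 * zev (lK l) X = Qser * dil l Qser.
  apply: (@fps_exp_inj 3) w3 => //.
    by rewrite fcoef_mul0 fcoef_exp0 z0 K0 expr1n mulr1.
  by rewrite fcoef_mul0 dil0 // Qser0 mulr1.
have zg : z ^+ 2 * zev (lg l) X = Y ^+ 2.
  apply: fps_sqr_inj.
  - by rewrite fcoef_mul0 fcoef_exp0 z0 g0 expr1n mulr1.
  - by rewrite fcoef_exp0 Y0 expr1n.
  apply: (mulfI Kn0); transitivity (zev (lg l) X ^+ 2 * (z ^+ 4 * zev (lK l) X)); first by ring.
  by rewrite w w4; ring.
exists S; first exact: S0; split=> //.
- exact: weight_transfer gn0 zg h1.
- rewrite (weight_transfer gn0 zg h2); ring.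
Qed.

End HigherModularData.

(** * The field of the modular equation at levels 11 and 23 *)

Section LevelElevenTwentyThree.

Delimit Scope Z_scope with bZ.
Local Notation L s := (s%bZ).

Section Algebra.
Variable A : idomainType.
Variables (q X : A).

Section Eleven.
Variables (ps p4 e T Ti th : A).
Hypotheses (TiE : T * Ti = 1) (r1 : T - p4 - q ^+ 3 * ps = 4%:R * (q * e))
  (r2 : ps * p4 * T = 4%:R * e ^+ 3) (thE : th = T + q ^+ 3 * ps)
  (r3 : X * th ^+ 2 = q * (p4 * e)).
(** For T = theta_3(q) theta_3(q^11), B and C are fourth roots of ab and (1 - a)(1 - b), where a, b
    are the values of lambda at q and q^11. Then [r1] is the modular equation B + C + 4 D0 = 1, and
    B C = 4 D0^3 ties D0 to the other two. *)
Let B := q ^+ 3 * ps * Ti. Let C := p4 * Ti. Let D0 := q * e * Ti.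

Lemma eleven_linear : C = 1 - B - 4%:R * D0.
Proof.
rewrite /B /C /D0.
by apply: (lincomb2 (n := 1) (c1 := - Ti) (c2 := 1) (oner_neq0 _) r1 TiE); ring.
Qed.

Lemma eleven_quadratic : B ^+ 2 = (1 - 4%:R * D0) * B - 4%:R * D0 ^+ 3.
Proof.
have BC : B * C = 4%:R * D0 ^+ 3.
  rewrite /B /C /D0.
  apply: (lincomb2 (n := 1) (c1 := - q ^+ 3 * ps * p4 * Ti ^+ 2) (c2 := q ^+ 3 * Ti ^+ 3) (oner_neq0 _) TiE r2).
  by ring.
by have := eleven_linear => e1; apply: (lincomb2 (n := 1) (c1 := -1) (c2 := B) (oner_neq0 _) BC e1); ring.
Qed.

Lemma eleven_X : X * (1 + B) ^+ 2 = C * D0.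
Proof.
have -> : 1 + B = th * Ti by rewrite thE mulrDl TiE.
by rewrite exprMn mulrA r3 /C /D0; ring.
Qed.
End Eleven.

Section TwentyThree.
Variables (a b M Mi T ps s x : A).
Hypotheses (MiE : M * Mi = 1) (r1 : M ^+ 3 = a ^+ 2 * b + 2%:R * (q * a * b * M) + 2%:R * (q ^+ 3 * a * b ^+ 2)).
(** For a, b, M the products of two eta functions at levels 1, 4, 2 and their multiples by 23, B and
    C are eighth roots of the products of lambda values and of their complements. The modular
    equation is B + C + 2 D0 = 1, with B C = 2 D0^3. *)
Let B := 2%:R * (q ^+ 3 * a * b ^+ 2) * Mi ^+ 3. Let C := a ^+ 2 * b * Mi ^+ 3.
Let D0 := q * a * b * Mi ^+ 2.

Lemma twentythree_linear : C = 1 - B - 2%:R * D0.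
Proof.
have M3 : M ^+ 3 * Mi ^+ 3 = 1 by rewrite -exprMn MiE expr1n.
rewrite /B /C /D0.
apply: (lincomb3 (n := 1) (c1 := - Mi ^+ 3) (c2 := 1) (c3 := - 2%:R * q * a * b * Mi ^+ 2) (oner_neq0 _) r1 M3 MiE).
by ring.
Qed.

Lemma twentythree_quadratic : B ^+ 2 = (1 - 2%:R * D0) * B - 2%:R * D0 ^+ 3.
Proof.
have BC : B * C = 2%:R * D0 ^+ 3 by rewrite /B /C /D0; ring.
by have := twentythree_linear => e1; apply: (lincomb2 (n := 1) (c1 := -1) (c2 := B) (oner_neq0 _) BC e1); ring.
Qed.

Hypotheses (TE : T * (a ^+ 2 * b ^+ 2) = M ^+ 5) (psE : ps * M = 4%:R * b ^+ 2)
  (sE : s = T + q ^+ 6 * ps - q * a) (XE : X * s = q * a).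

Lemma twentythree_X : X * (1 + B ^+ 2 - C * D0) = C * D0.
Proof.
have M6 : M ^+ 6 * Mi ^+ 6 = 1 by rewrite -exprMn MiE expr1n.
have M1 : M * Mi ^+ 6 = Mi ^+ 5.
  by transitivity (M * Mi * Mi ^+ 5); [ring | rewrite MiE mul1r].
have e : X * (M ^+ 6 + 4%:R * q ^+ 6 * a ^+ 2 * b ^+ 4 - q * a ^+ 3 * b ^+ 2 * M) = q * a ^+ 3 * b ^+ 2 * M.
  have XE' := XE; rewrite sE in XE'.
  apply: (lincomb3 (n := 1) (c1 := - X * M) (c2 := - X * q ^+ 6 * a ^+ 2 * b ^+ 2) (c3 := a ^+ 2 * b ^+ 2 * M) (oner_neq0 _) TE psE XE').
  by ring.
have CD : C * D0 = q * a ^+ 3 * b ^+ 2 * M * Mi ^+ 6 by rewrite /C /D0 -[RHS]mulrA M1; ring.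
transitivity (q * a ^+ 3 * b ^+ 2 * M * Mi ^+ 6); last by rewrite CD.
have -> : X * (1 + B ^+ 2 - C * D0) = X * (M ^+ 6 * Mi ^+ 6 + B ^+ 2 - q * a ^+ 3 * b ^+ 2 * M * Mi ^+ 6).
  by rewrite M6 CD.
transitivity (X * (M ^+ 6 + 4%:R * q ^+ 6 * a ^+ 2 * b ^+ 4 - q * a ^+ 3 * b ^+ 2 * M) * Mi ^+ 6); last by rewrite e.
by rewrite /B; ring.
Qed.
End TwentyThree.
End Algebra.

Lemma theta3_0 : theta3 0%N = 1.
Proof.
have := congr1 (fun f : fps => f 0%N) theta3_eta.
by rewrite /= !fcoef_mul0 !fcoef_exp0 !eulp0 !expr1n !mulr1.
Qed.

Lemma theta_1c0 c : (1 < c)%N -> (theta 1 c) 0%N = 1.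
Proof.
move=> c1; rewrite theta_1c // fcoefD coef_pXnM leqn0 (_ : (c == 0)%N = false); last by lia.
by rewrite addr0 fcoef_mul0 dil0 ?theta3_0 ?mulr1 //; lia.
Qed.

Lemma lam_theta : lam * theta3 ^+ 4 = pX * psi2 ^+ 4 /\ (1 - lam) * theta3 ^+ 4 = theta4 ^+ 4.
Proof.
have n m : eulp m != 0 := fps_unit_neq0 (eulp0 m).
have a0 := n 1%N; have b0 := n 2; have d0 := n 4.
have l1 := lamE; have t3 := theta3_eta; have p := psi2_eta; have j := jacobi_abstruse.
have e : lam * theta3 ^+ 4 = pX * psi2 ^+ 4.
  move: l1 t3 p a0 b0 d0; have c16 : (16%:R : fps) = 2%:R ^+ 4 by rewrite -natrX.
  rewrite c16; move: theta3 psi2 lam (eulp 1) (eulp 2) (eulp 4) pX => x z l a b d q l1 t3 p a0 b0 d0.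
  have nz : a ^+ 8 * d ^+ 8 * b ^+ 4 != 0 by rewrite !mulf_neq0 ?expf_neq0.
  apply: (mulfI nz); transitivity (l * (x * (a ^+ 2 * d ^+ 2)) ^+ 4 * b ^+ 4); first by ring.
  rewrite t3; transitivity (l * b ^+ 24); first by ring.
  rewrite l1; transitivity (q * (z * b) ^+ 4 * a ^+ 8 * d ^+ 8); last by ring.
  by rewrite p; ring.
by split; [exact: e | rewrite mulrBl mul1r e j addrK].
Qed.

Lemma psi2_theta4_theta3 : psi2 * theta4 * theta3 = 2%:R * eulp 2 ^+ 3.
Proof.
have n m : eulp m != 0 := fps_unit_neq0 (eulp0 m).
have a0 := n 1%N; have b0 := n 2; have d0 := n 4.
have t4 := theta4_eta; have t3 := theta3_eta; have p := psi2_eta.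
move: t4 t3 p a0 b0 d0; move: theta3 theta4 psi2 (eulp 1) (eulp 2) (eulp 4).
move=> x y z a b d t4 t3 p a0 b0 d0.
have nz : a ^+ 2 * d ^+ 2 * b ^+ 2 != 0 by rewrite !mulf_neq0 ?expf_neq0.
apply: (mulfI nz); transitivity ((z * b) * (y * b) * (x * (a ^+ 2 * d ^+ 2))); first by ring.
by rewrite p t4 t3; ring.
Qed.

Lemma dil_X1s_lam l : (0 < l)%N ->
  16%:R * ((1 - dil l lam) ^+ 2 + 16%:R * dil l lam) ^+ 3 * dil l X1s = dil l lam * (1 - dil l lam) ^+ 4.
Proof.
move=> l0; have h := congr1 (dil l) X1s_lam.
have dB f g : dil l (f - g) = dil l f - dil l g.
  by rewrite dilD //; congr (_ + _); apply: compN; exact: dil_base0.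
have d1 : dil l 1 = 1 by exact: comp1.
have dC : dil l (1 - lam) = 1 - dil l lam by rewrite dB d1.
have dE : dil l ((1 - lam) ^+ 2 + 16%:R * lam) = (1 - dil l lam) ^+ 2 + 16%:R * dil l lam.
  by rewrite dilD (dilX l0 (1 - lam) 2) dC (dilM l0 _ lam) dil_nat.
rewrite (dilM l0 _ X1s) (dilM l0 16%:R) (dilX l0 _ 3) dE dil_nat // (dilM l0 lam) (dilX l0 _ 4) dC in h.
exact: h.
Qed.

Lemma dil_monomial l (c : nat) (a n q u1 u2 n' q' u1' u2' : fps) : (0 < l)%N ->
  dil l n = n' -> dil l q = q' -> dil l u1 = u1' -> dil l u2 = u2' ->
  a * n ^+ 24 = c%:R * q * u1 ^+ 8 * u2 ^+ 16 ->
  (1 - a) * n ^+ 24 = u1 ^+ 16 * u2 ^+ 8 ->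
  dil l a * n' ^+ 24 = c%:R * q' * u1' ^+ 8 * u2' ^+ 16 /\
  (1 - dil l a) * n' ^+ 24 = u1' ^+ 16 * u2' ^+ 8.
Proof.
move=> l0 <- <- <- <- /(congr1 (dil l)) e1 /(congr1 (dil l)) e2.
have dC : dil l (1 - a) = 1 - dil l a.
  rewrite dilD; congr (_ + _); first exact: comp1.
  by apply: compN; exact: dil_base0.
split.
  rewrite -(dilX l0 n 24) -(dilM l0 a) e1 (dilM l0 (c%:R * q * u1 ^+ 8)) (dilM l0 (c%:R * q)).
  by rewrite (dilM l0 c%:R q) (dil_nat l c) (dilX l0 u1 8) (dilX l0 u2 16).
rewrite -dC -(dilX l0 n 24) -(dilM l0 (1 - a)) e2 (dilM l0 (u1 ^+ 16)).
by rewrite (dilX l0 u1 16) (dilX l0 u2 8).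
Qed.

Lemma lam_dil l : (0 < l)%N ->
  dil l lam * eulp (l * 2) ^+ 24 = 16%:R * pX ^+ l * eulp (l * 1) ^+ 8 * eulp (l * 4) ^+ 16 /\
  (1 - dil l lam) * eulp (l * 2) ^+ 24 = eulp (l * 1) ^+ 16 * eulp (l * 4) ^+ 8.
Proof.
move=> l0; have e k : dil l (eulp k.+1) = eulp (l * k.+1) by exact: dil_eulp.
exact: (dil_monomial l0 (e 1%N) (dil_pX l0) (e 0%N) (e 3) lamE lamCE).
Qed.

Lemma flip_pX : fps_flip pX = - pX.
Proof. by rewrite /fps_flip comp_pX // flip_base0. Qed.

Lemma dil_eulpS m k : dil m.+1 (eulp k.+1) = eulp (m.+1 * k.+1).
Proof. exact: dil_eulp. Qed.
Lemma dilMS m f g : dil m.+1 (f * g) = dil m.+1 f * dil m.+1 g. Proof. exact: dilM. Qed.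
Lemma dil_natS m k : dil m.+1 k%:R = k%:R. Proof. exact: dil_nat. Qed.
Lemma dil_pXS m : dil m.+1 pX = pX ^+ m.+1. Proof. exact: dil_pX. Qed.
Lemma dil0S m f : dil m.+1 f 0%N = f 0%N. Proof. exact: dil0. Qed.

(** The theta series of X_11 is T (1 + B) by [theta_1c], and eta_1^2 = theta_4 eta_2 turns its
    numerator into a product of C and D0; so X_11 = C D0 / (1 + B)^2 lies in the field of the
    modular equation. *)
Lemma has_modular_data11 : has_modular_data 11.
Proof.
have l0 : (0 < 11)%N by []. 
have X1 : qord (Xser 11) = 1%:R by rewrite /=; field.
have Z0 : qord (Zser 11) = 0%:R by rewrite /=; field.
have Xof := fps_of_nat X1; have Zof := fps_of_nat Z0.
rewrite expr1 in Xof; rewrite expr0 mul1r in Zof; rewrite /has_modular_data Xof Zof.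
have e1 := eulp0 1; have e11 := eulp0 11; have th0 := theta_1c0 (isT : (1 < 3)%N).
have x0 : qunit (Xser 11) 0%N = 1 by rewrite /= fps_powr0.
have z0 : qunit (Zser 11) 0%N = 1 by rewrite /= !(fps_mul0, fps_powr0) !mulr1.
have u0 : (eulp 1 * eulp 11 * fps_powr (theta 1 3) (-1)) 0%N = 1.
  by rewrite !fcoef_mul0 e1 e11 fps_powr0 !mulr1.
have xE : qunit (Xser 11) = (eulp 1 * eulp 11 * fps_powr (theta 1 3) (-1)) ^+ 2 := fps_powr_nat 2 u0.
have xth : qunit (Xser 11) * theta 1 3 ^+ 2 = (eulp 1 * eulp 11) ^+ 2.
  rewrite xE -exprMn; congr (_ ^+ 2).
  exact: (mu_powr1 (eulp 1 * eulp 11) th0).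
have zE : qunit (Zser 11) ^+ 12 * qunit (Xser 11) ^+ 12 = eul ^+ 24 * eulp 11 ^+ 24.
  have := zeta_powr (r := 1) (k := 12) (n := 12) e1 e11 x0 (mul1r _).
  have -> : fps_powr (qunit (Xser 11)) 1 = qunit (Xser 11) by rewrite (fps_powr_nat 1 x0) expr1.
  exact.
move: x0 z0 xth zE; move: (qunit (Xser 11)) (qunit (Zser 11)) => x z x0 z0 xth zE.
pose T : fps := theta3 * dil 11 theta3.
have T0 : T 0%N = 1 by rewrite /T fcoef_mul0 dil0S theta3_0 mulr1.
have [Ti TiE Ti0] := fps_inverse T0.
pose ps : fps := psi2 * dil 11 psi2; pose p4 : fps := theta4 * dil 11 theta4.
pose e : fps := eulp 2 * eulp 22.
have r1 : T - p4 - pX ^+ 3 * ps = 4%:R * (pX * e).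
  have r := theta_relation11; rewrite (dilMS 1 (eulp 1)) !dil_eulpS in r.
  exact: r.
have r2 : ps * p4 * T = 4%:R * e ^+ 3.
  have t := psi2_theta4_theta3; have t' := congr1 (dil 11) t.
  rewrite (dilM l0 _ theta3) (dilM l0 psi2) (dilM l0 2%:R) (dilX l0 _ 3) dil_eulpS dil_natS in t'.
  rewrite /ps /p4 /T /e; transitivity ((psi2 * theta4 * theta3) * (dil 11 psi2 * dil 11 theta4 * dil 11 theta3)).
    by move: psi2 theta4 theta3 (dil 11 psi2) (dil 11 theta4) (dil 11 theta3) => *; ring.
  by rewrite t t'; move: (eulp 2) (eulp _) => *; ring.
have thE : theta 1 3 = T + pX ^+ 3 * ps := theta_1c (isT : (1 < 3)%N).
have t4' := congr1 (dil 11) theta4_eta.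
rewrite (dilM l0) (dilX l0 _ 2) !dil_eulpS in t4'.
have r3 : pX * x * theta 1 3 ^+ 2 = pX * (p4 * e).
  rewrite -mulrA xth exprMn -theta4_eta -t4' /p4 /e.
  by move: pX theta4 (dil 11 theta4) (eulp _) (eulp _) => *; ring.
pose B : fps := pX ^+ 3 * ps * Ti; pose C : fps := p4 * Ti; pose D0 : fps := pX * e * Ti.
have h1 : C = 1 - B - 4%:R * D0 := eleven_linear TiE r1.
have h2 : B ^+ 2 = (1 - 4%:R * D0) * B - 4%:R * D0 ^+ 3 := eleven_quadratic TiE r1 r2.
have h3 : pX * x * (1 + B) ^+ 2 = C * D0 := eleven_X TiE thE r3.
have [la1 la2] := lam_theta; have lb1 := congr1 (dil 11) la1; have lb2 := congr1 (dil 11) la2.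
rewrite (dilM l0 lam) (dilM l0 pX) (dilX l0 theta3 4) (dilX l0 psi2 4) (dil_pX l0) in lb1.
have dC : dil 11 (1 - lam) = 1 - dil 11 lam.
  rewrite dilD; congr (_ + _); first exact: comp1.
  by apply: compN; exact: dil_base0.
rewrite (dilM l0 _ (theta3 ^+ 4)) dC (dilX l0 theta3 4) (dilX l0 theta4 4) in lb2.
have Ti4 : T ^+ 4 * Ti ^+ 4 = 1 by rewrite -exprMn TiE expr1n.
have hp : lam * dil 11 lam = B ^+ 4.
  rewrite -[LHS]mulr1 -Ti4; transitivity (lam * theta3 ^+ 4 * (dil 11 lam * dil 11 theta3 ^+ 4) * Ti ^+ 4).
    by rewrite /T; move: lam (dil 11 lam) theta3 (dil 11 theta3) => *; ring.
  rewrite la1 lb1 /B /ps; move: psi2 (dil 11 psi2) => s t; ring.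
have hr : (1 - lam) * (1 - dil 11 lam) = C ^+ 4.
  transitivity ((1 - lam) * (1 - dil 11 lam) * (T ^+ 4 * Ti ^+ 4)); first by rewrite Ti4 mulr1.
  transitivity ((1 - lam) * theta3 ^+ 4 * ((1 - dil 11 lam) * dil 11 theta3 ^+ 4) * Ti ^+ 4).
    by rewrite /T; move: (1 - lam) (1 - dil 11 lam) theta3 (dil 11 theta3) => *; ring.
  rewrite la2 lb2 /C /p4; move: theta4 (dil 11 theta4) => s t; ring.
have b0 : dil 11 lam 0%N = 0 by rewrite dil0S lam0.
have B0 : B 0%N = 0 by rewrite /B -mulrA coef_pXnM.
have m4 : zval (L (-4)) = - 4%:R :> fps by [].
have denE : qd_ev D0 B (L [:: 1; 0; 0; -4], L [:: 3; -4]) = (1 + B) ^+ 2.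
  have z3 : zval (L 3) = 3%:R :> fps by [].
  have z1 : zval (L 1) = 1 :> fps by [].
  have z0' : zval (L 0) = 0 :> fps by [].
  transitivity (1 + 2%:R * B + ((1 - 4%:R * D0) * B - 4%:R * D0 ^+ 3)); last by rewrite -h2; ring.
  by rewrite /qd_ev /= z1 z3 z0' m4; ring.
have den0 : qd_ev D0 B (L [:: 1; 0; 0; -4], L [:: 3; -4]) 0%N = 1.
  by rewrite denE fcoef_exp0 fcoefD B0 addr0 fcoef1 expr1n.
have XE : (pX * x) * qd_ev D0 B (L [:: 1; 0; 0; -4], L [:: 3; -4]) = C * D0 by rewrite denE h3.
have [c1 c2] := higher_pair higher_check11 (isT : 11%N \in levels) m4 X1s_lam (dil_X1s_lam l0) lam0 b0 hp hr h1 h2 XE den0.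
exact: (higher_modular (isT : 11%N \in [:: 11; 23]%N) x0 z0 zE c1 c2).
Qed.

(** In terms of eta products the denominator of X_23 has three terms, and division by the common
    power of M gives X_23 = C D0 / (1 + B^2 - C D0). *)
Lemma has_modular_data23 : has_modular_data 23.
Proof.
have l0 : (0 < 23)%N by [].
have X1 : qord (Xser 23) = 1%:R by rewrite /=; field.
have Z0 : qord (Zser 23) = 0%:R by rewrite /=; field.
have Xof := fps_of_nat X1; have Zof := fps_of_nat Z0.
rewrite expr1 in Xof; rewrite expr0 mul1r in Zof; rewrite /has_modular_data Xof Zof.
have e1 := eulp0 1; have e23 := eulp0 23; have th0 := theta_1c0 (isT : (1 < 6)%N).
pose s : fps := fps_scale (1 / 2) (fps_add (theta 1 6) (theta 2 3)).
have sh : s = theta 1 6 - h23.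
  (* The half sum of the two theta series involves only the first of them, since their difference is
     2 h23. *)
  apply/fpsP => n.
  have h : theta 1 6 n - theta 2 3 n = 2%:R * h23 n by rewrite -fcoefB theta_relation23 fcoef_natM.
  rewrite fcoefB; change (1 / 2 * (theta 1 6 n + theta 2 3 n) = theta 1 6 n - h23 n).
  by move: (theta 1 6 n) (theta 2 3 n) (h23 n) h => y1 y2 y3 h; clear - h; lra.
have s0 : s 0%N = 1 by rewrite sh fcoefB th0 /h23 coef_pXM subr0.
have x0 : qunit (Xser 23) 0%N = 1.
  by rewrite /= !(fps_mul0, fps_powr0) /= !euler_prod0 !mulr1.
have z0 : qunit (Zser 23) 0%N = 1 by rewrite /= !(fps_mul0, fps_powr0) !mulr1.
have xs : qunit (Xser 23) * s = eulp 1 * eulp 23 := mu_powr1 (eulp 1 * eulp 23) s0.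
have zE : qunit (Zser 23) ^+ 12 * qunit (Xser 23) ^+ 24 = eul ^+ 24 * eulp 23 ^+ 24.
  have rk : 2 * 12%:R = 24%:R :> rat by [].
  exact: (zeta_powr (r := 2) (k := 24) (n := 12) e1 e23 x0 rk).
move: x0 z0 xs zE; move: (qunit (Xser 23)) (qunit (Zser 23)) => x z x0 z0 xs zE.
pose a : fps := eulp 1 * eulp 23; pose b : fps := eulp 4 * eulp 92; pose M : fps := eulp 2 * eulp 46.
have M0 : M 0%N = 1 by rewrite /M fcoef_mul0 !eulp0 mulr1.
have [Mi MiE Mi0] := fps_inverse M0.
have hE : h23 = pX * a by rewrite /h23 dil_eulp.
have h2E : dil 2 h23 = pX ^+ 2 * M.
  by rewrite hE (dilMS _ pX) dil_pXS /a (dilMS _ (eulp 1)) !dil_eulp.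
have h4E : dil 4 h23 = pX ^+ 4 * b.
  by rewrite hE (dilMS _ pX) dil_pXS /a (dilMS _ (eulp 1)) !dil_eulp.
have fl := flip_eul; have fl' := congr1 (dil 23) fl.
rewrite (dilM l0 _ (eulp 4)) (dilM l0 _ (eulp 1)) (dilX l0 _ 3) !dil_eulpS in fl'.
have fl2 : dil 23 (fps_flip (eulp 1)) * eulp 23 * eulp 92 = eulp 46 ^+ 3 := fl'.
have fh : - fps_flip h23 = pX * (fps_flip (eulp 1) * dil 23 (fps_flip (eulp 1))).
  rewrite /h23 (flipM pX) (flipM (eulp 1)) (flip_dil_odd (eulp 1) (isT : odd 23)) flip_pX.
  by rewrite mulNr opprK.
(* Multiply the Hecke relation by a b and cancel q; [flip_eul], at q and at q^23, identifies the
   left side. *)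
have r1 : M ^+ 3 = a ^+ 2 * b + 2%:R * (pX * a * b * M) + 2%:R * (pX ^+ 3 * a * b ^+ 2).
  have r := flip_h23; rewrite fh h2E h4E hE in r.
  apply: (mulfI pX_neq0).
  have -> : M ^+ 3 = (fps_flip (eulp 1) * dil 23 (fps_flip (eulp 1))) * (a * b).
    rewrite /M exprMn -fl -fl2 /a /b.
    by move: (eulp 1) (eulp 4) (eulp 23) (eulp 92) (fps_flip (eulp 1)) (dil 23 _) => *; ring.
  transitivity (pX * (fps_flip (eulp 1) * dil 23 (fps_flip (eulp 1))) * (a * b)); first exact: mulrA.
  by rewrite r; clear; ring.
pose B : fps := 2%:R * (pX ^+ 3 * a * b ^+ 2) * Mi ^+ 3; pose C : fps := a ^+ 2 * b * Mi ^+ 3.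
pose D0 : fps := pX * a * b * Mi ^+ 2.
have h1 : C = 1 - B - 2%:R * D0 := twentythree_linear MiE r1.
have h2 : B ^+ 2 = (1 - 2%:R * D0) * B - 2%:R * D0 ^+ 3 := twentythree_quadratic MiE r1.
have TE : theta3 * dil 23 theta3 * (a ^+ 2 * b ^+ 2) = M ^+ 5.
  have t := theta3_eta; have t' := congr1 (dil 23) t.
  rewrite (dilM l0 theta3) (dilM l0 (eulp 1 ^+ 2)) (dilX l0 _ 2) (dilX l0 _ 2) (dilX l0 _ 5) !dil_eulpS in t'.
  have t2 : dil 23 theta3 * (eulp 23 ^+ 2 * eulp 92 ^+ 2) = eulp 46 ^+ 5 := t'.
  rewrite /M [RHS]exprMn -t -t2 /a /b.
  by move: (eulp 1) (eulp 4) (eulp 23) (eulp 92) theta3 (dil 23 theta3) => *; ring.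
have psE : psi2 * dil 23 psi2 * M = 4%:R * b ^+ 2.
  have t := psi2_eta; have t' := congr1 (dil 23) t.
  rewrite (dilM l0 psi2) (dilM l0 2%:R) (dilX l0 _ 2) !dil_eulpS dil_natS in t'.
  have t2 : dil 23 psi2 * eulp 46 = 2%:R * eulp 92 ^+ 2 := t'.
  rewrite /M; transitivity ((psi2 * eulp 2) * (dil 23 psi2 * eulp 46)).
    by move: psi2 (dil 23 psi2) (eulp 2) (eulp 46) => *; ring.
  by rewrite t t2 /b; move: (eulp 4) (eulp 92) => *; ring.
have sE : s = theta3 * dil 23 theta3 + pX ^+ 6 * (psi2 * dil 23 psi2) - pX * a.
  by rewrite sh (theta_1c (isT : (1 < 6)%N)) hE.
have XE0 : pX * x * s = pX * a by rewrite -mulrA xs.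
have h3 : pX * x * (1 + B ^+ 2 - C * D0) = C * D0 := twentythree_X MiE TE psE sE XE0.
have la1 := lamE; have la2 := lamCE.
have lc1 : dil 23 lam * eulp 46 ^+ 24 = 16%:R * pX ^+ 23 * eulp 23 ^+ 8 * eulp 92 ^+ 16 := (lam_dil l0).1.
have lc2 : (1 - dil 23 lam) * eulp 46 ^+ 24 = eulp 23 ^+ 16 * eulp 92 ^+ 8 := (lam_dil l0).2.
have Mi24 : M ^+ 24 * Mi ^+ 24 = 1 by rewrite -exprMn MiE expr1n.
have ME : M ^+ 24 = eulp 2 ^+ 24 * eulp 46 ^+ 24 := exprMn 24 (eulp 2) (eulp 46).
have c16 : (16%:R : fps) = 2%:R ^+ 4 by rewrite -natrX.
have hp : lam * dil 23 lam = B ^+ 8.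
  have alg (r1' r2' r3' r4' r5' : fps) : r1' * r2' * (r3' * r4' * r5') = r1' * r3' * (r2' * r4') * r5' by ring.
  transitivity (lam * dil 23 lam * (M ^+ 24 * Mi ^+ 24)); first by rewrite Mi24 mulr1.
  rewrite ME alg la1 lc1 /B /a /b c16; move: (eulp 1) (eulp 4) (eulp 23) (eulp 92) pX => u1 u2 u3 u4 q; ring.
have hr : (1 - lam) * (1 - dil 23 lam) = C ^+ 8.
  transitivity ((1 - lam) * (1 - dil 23 lam) * (M ^+ 24 * Mi ^+ 24)); first by rewrite Mi24 mulr1.
  have alg (r1' r2' r3' r4' r5' : fps) : r1' * r2' * (r3' * r4' * r5') = r1' * r3' * (r2' * r4') * r5' by ring.
  rewrite ME alg la2 lc2 /C /a /b; move: (eulp 1) (eulp 4) (eulp 23) (eulp 92) => u1 u2 u3 u4; ring.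
have b0 : dil 23 lam 0%N = 0 by rewrite dil0S lam0.
have B0 : B 0%N = 0.
  have -> : B = pX ^+ 3 * (2%:R * a * b ^+ 2 * Mi ^+ 3) by rewrite /B; clear; ring.
  by rewrite coef_pXnM.
have D00 : D0 0%N = 0 by rewrite /D0 -!mulrA coef_pXM.
have m2 : zval (L (-2)) = - 2%:R :> fps by [].
have denE : qd_ev D0 B (L [:: 1; -1; 2; -2], L [:: 1; -1]) = 1 + B ^+ 2 - C * D0.
  have z2 : zval (L 2) = 2%:R :> fps by [].
  have z1 : zval (L 1) = 1 :> fps by [].
  have z_1 : zval (L (-1)) = -1 :> fps by [].
  transitivity (1 + ((1 - 2%:R * D0) * B - 2%:R * D0 ^+ 3) - (1 - B - 2%:R * D0) * D0); last by rewrite -h2 -h1.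
  by rewrite /qd_ev /= z1 z2 z_1 m2; ring.
have den0 : qd_ev D0 B (L [:: 1; -1; 2; -2], L [:: 1; -1]) 0%N = 1.
  by rewrite denE fcoefB fcoefD fcoef_exp0 fcoef_mul0 B0 D00 expr0n fcoef1 mulr0 addr0 subr0.
have XE : (pX * x) * qd_ev D0 B (L [:: 1; -1; 2; -2], L [:: 1; -1]) = C * D0 by rewrite denE h3.
have [c1 c2] := higher_pair higher_check23 (isT : 23%N \in levels) m2 X1s_lam (dil_X1s_lam l0) lam0 b0 hp hr h1 h2 XE den0.
exact: (higher_modular (isT : 23%N \in [:: 11; 23]%N) x0 z0 zE c1 c2).
Qed.

Lemma has_modular_dataP l : l \in levels -> has_modular_data l.
Proof.
by move: l; apply: levelsP; [exact: has_modular_data2 | exact: has_modular_data3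
  | exact: has_modular_data5 | exact: has_modular_data7 | exact: has_modular_data11
  | exact: has_modular_data13 | exact: has_modular_data23].
Qed.

End LevelElevenTwentyThree.

(** * The transformation as an identity of power series in x *)

Section FormalTransformation.

Definition Tser (l : nat) : fps := Tcoef l.

Lemma fps_halve f : fps_const (1 / 2) * (2%:R * f) = f.
Proof.
apply/fpsP => n; rewrite fcoef_constM fcoef_natM mulrA.
by rewrite (_ : 1 / 2 * 2%:R = 1 :> rat) ?mul1r.
Qed.

Lemma fps_double f : 2%:R * (fps_const (1 / 2) * f) = f.
Proof. by rewrite mulrCA; exact: fps_halve. Qed.

(** Here y^+ = x^l / n with n = (c + d s)/2, but y^- is written as x n / K^3: the denominator c - d
    s vanishes to order l - 1 at x = 0, and c^2 - d^2 g = 4 x^(l-1) K^3 removes it. The factors wm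
    and wp are the roots of a - b s and of (a + b s)/l^2, both with constant term 1. *)
Lemma formal_transformation l : l \in levels -> exists s n ki wm wp : fps,
  [/\ s = fps_powr (zev (lg l) pX) (1 / 2),
      n = fps_const (1 / 2) * (zev (lc l) pX + zev (ld l) pX * s),
      ki = fps_powr (zev (lK l) pX) (-3),
      wm = fps_powr (fps_const (1 / 2) * (zev (la l) pX - zev (lb l) pX * s)) (1 / 2) &
      wp = fps_powr (fps_const (1 / (2%:R * l%:R ^+ 2)) * (zev (la l) pX + zev (lb l) pX * s)) (1 / 2)] /\
  [/\ s ^+ 2 = zev (lg l) pX, n 0%N = 1,
      2%:R * wm ^+ 2 = zev (la l) pX - zev (lb l) pX * s,
      2%:R * l%:R ^+ 2 * wp ^+ 2 = zev (la l) pX + zev (lb l) pX * s &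
      [/\ zev (lK l) pX ^+ 3 * ki = 1,
        n * fps_powr n (-1) = 1,
        Tser l * wm = comp (Tser 1) (pX * (n * ki)),
        Tser l * wp = comp (Tser 1) (pX ^+ l * fps_powr n (-1)) &
        [/\ (zev (lg l) pX) 0%N = 1, (zev (lK l) pX) 0%N = 1,
         (fps_const (1 / 2) * (zev (la l) pX - zev (lb l) pX * s)) 0%N = 1 &
         (fps_const (1 / (2%:R * l%:R ^+ 2)) * (zev (la l) pX + zev (lb l) pX * s)) 0%N = 1]]].
Proof.
move=> hl; case/and5P: (lead_check hl) => /eqP hc /eqP hd /eqP hg /eqP hK /andP[/eqP hm /eqP hp].
have l0 : (0 < l)%N by move: l hl {hc hd hg hK hm hp}; apply: levelsP.
have p0 : pX 0%N = 0 by [].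
have c0 := zev_head1 p0 hc; have d0 := zev_head1 p0 hd.
have g0 := zev_head1 p0 hg; have K0 := zev_head1 p0 hK.
pose s : fps := fps_powr (zev (lg l) pX) (1 / 2).
have s0 : s 0%N = 1 by exact: fps_powr0.
have half : 1 / 2 * 2%:R = 1%:R :> rat by [].
have sq (f : fps) : f 0%N = 1 -> fps_powr f (1 / 2) ^+ 2 = f.
  by move=> f0; rewrite fps_powrX // half (fps_powr_nat 1 f0) expr1.
have sE : s ^+ 2 = zev (lg l) pX by exact: sq.
pose n : fps := fps_const (1 / 2) * (zev (lc l) pX + zev (ld l) pX * s).
have n2 : 2%:R * n = zev (lc l) pX + zev (ld l) pX * s by exact: fps_double.
have n0 : n 0%N = 1.
  by rewrite /n fcoef_constM fcoefD fcoef_mul0 c0 d0 s0 mulr1; field.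
pose um : fps := fps_const (1 / 2) * (zev (la l) pX - zev (lb l) pX * s).
pose up : fps := fps_const (1 / (2%:R * l%:R ^+ 2)) * (zev (la l) pX + zev (lb l) pX * s).
have um2 : 2%:R * um = zev (la l) pX - zev (lb l) pX * s by exact: fps_double.
have lq : (l%:R : rat) != 0 by rewrite pnatr_eq0 -lt0n.
have up2 : 2%:R * l%:R ^+ 2 * up = zev (la l) pX + zev (lb l) pX * s.
  have -> : 2%:R * l%:R ^+ 2 = fps_const (2%:R * l%:R ^+ 2).
    by rewrite rmorphM rmorphXn !rmorph_nat.
  rewrite /up mulrA -rmorphM (_ : _ * (1 / _) = 1) ?rmorph1 ?mul1r //.
  by field.
have um0 : um 0%N = 1.
  rewrite /um fcoef_constM fcoefB fcoef_mul0 !zev_coef0 // s0 mulr1.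
  have := congr1 (fun z => zval z : rat) hm; rewrite zval_nat /zval.
  have -> : BinInt.Z.sub (head BinNums.Z0 (la l)) (head BinNums.Z0 (lb l)) =
    BinInt.Z.add (head BinNums.Z0 (la l)) (BinInt.Z.opp (head BinNums.Z0 (lb l))) by [].
  rewrite (rmorphD int_of_Z) intrD (rmorphN int_of_Z) intrN => ->.
  by [].
have up0 : up 0%N = 1.
  rewrite /up fcoef_constM fcoefD fcoef_mul0 !zev_coef0 // s0 mulr1.
  have := congr1 (fun z => zval z : rat) hp; rewrite zval_nat.
  rewrite /zval (rmorphD int_of_Z) intrD => ->.
  by rewrite natrM natrX; field.
have uw := sq um um0; have pw := sq up up0.
have K3 : zev (lK l) pX ^+ 3 * fps_powr (zev (lK l) pX) (-3) = 1.
  rewrite -(fps_powr_nat 3 K0) -fps_powrD // (_ : 3%:R + -3 = 0%:R :> rat) //.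
  by rewrite (fps_powr_nat 0 K0) expr0.
have nn : n * fps_powr n (-1) = 1 by rewrite mulrC fps_powrN1.
have [S S0 [d1 d2 d3 d4 d5]] := has_modular_dataP hl.
have [x0 x1 z0] : [/\ fps_of (Xser l) 0%N = 0, fps_of (Xser l) 1%N = 1 & fps_of (Zser l) 0%N = 1].
  by apply: XZser_lead; move: l hl {l0 hc hd hg hK hm hp c0 d0 g0 K0 s s0 sE n n2 n0 um up um2 lq up2 um0 up0 uw pw K3 nn S S0 d1 d2 d3 d4 d5}; apply: levelsP.
have TX : comp (Tser l) (fps_of (Xser l)) = fps_of (Zser l) := comp_expand _ x0 x1.
move: x0 x1 z0 d1 d2 d3 d4 d5 TX; move: (fps_of (Xser l)) (fps_of (Zser l)) => X Z.
move=> x0 x1 z0 d1 d2 d3 d4 d5 TX.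
have Xn0 : X != 0 by apply/eqP => e; move: x1; rewrite e fcoef0 => /eqP; rewrite eq_sym oner_eq0.
have cz t : comp (zev t pX) X = zev t X by rewrite comp_zev // comp_pX.
have cs : comp s X = S.
  apply: fps_sqr_inj S0 _; first by rewrite fcoef_comp0.
  by rewrite -compX // sE cz d1.
have two : (2%:R : fps) != 0 := fps_natf_neq0 1.
have cn : 2%:R * comp n X = zev (lc l) X + zev (ld l) X * S.
  have := congr1 (fun h => comp h X) n2; rewrite (compM 2%:R n x0) comp_nat compD (compM (zev (ld l) pX) s x0) !cz cs.
  exact.
have cN0 : comp n X != 0 by apply: fps_unit_neq0; rewrite fcoef_comp0.
have KX : zev (lK l) X ^+ 3 * comp (fps_powr (zev (lK l) pX) (-3)) X = 1.
  have := congr1 (fun h => comp h X) K3; rewrite (compM _ _ x0) (compX _ 3 x0) cz comp1.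
  exact.
have KXn0 : zev (lK l) X != 0 by apply: fps_unit_neq0 (zev_head1 x0 hK).
have cd := cd_zev X hl.
have ym : comp (pX * (n * fps_powr (zev (lK l) pX) (-3))) X = X1s.
  rewrite (compM _ _ x0) (compM _ _ x0) comp_pX //.
  move: KX; move: (comp (fps_powr _ (-3)) X) => ki KX.
  apply: (mulfI (expf_neq0 3 KXn0)).
  transitivity (X * comp n X * (zev (lK l) X ^+ 3 * ki)); first by ring.
  rewrite KX mulr1; apply: (mulfI (mulf_neq0 two (mulf_neq0 two (expf_neq0 l.-1 Xn0)))).
  transitivity (2%:R * X ^+ l.-1 * X * (2%:R * comp n X)); first by ring.
  have xl : X ^+ l = X ^+ l.-1 * X by rewrite -exprSr prednK.
  rewrite cn; transitivity (2%:R * X ^+ l * (zev (lc l) X + zev (ld l) X * S)).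
    by rewrite xl; ring.
  rewrite -d2.
  transitivity ((zev (lc l) X ^+ 2 - zev (ld l) X ^+ 2 * S ^+ 2) * X1s); first by ring.
  by rewrite d1 cd; ring.
have yp : comp (pX ^+ l * fps_powr n (-1)) X = dil l X1s.
  rewrite (compM _ _ x0) (compX _ l x0) comp_pX //; apply: (mulfI cN0); apply: (mulfI two).
  have nX : comp n X * comp (fps_powr n (-1)) X = 1 by rewrite -compM // nn comp1.
  transitivity (2%:R * X ^+ l * (comp n X * comp (fps_powr n (-1)) X)); first by ring.
  by rewrite nX mulr1 -d3 -cn mulrA.
have y1 : (pX * (n * fps_powr (zev (lK l) pX) (-3))) 0%N = 0 by rewrite coef_pXM.
have y2 : (pX ^+ l * fps_powr n (-1)) 0%N = 0 by rewrite coef_pXnM leqn0 (gtn_eqF l0).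
have [X10 X11 _] := XZser_lead (isT : 1%N \in [:: 1; 2; 3; 5; 7; 11; 13; 23]%N).
have T1 : comp (Tser 1) X1s = fps_powr Qser (1 / 2).
  by rewrite -X1s_xser -Z1_zser; apply: comp_expand.
have q0 : fps_powr Qser (1 / 2) 0%N = 1 by exact: fps_powr0.
exists s, n, (fps_powr (zev (lK l) pX) (-3)), (fps_powr um (1 / 2)), (fps_powr up (1 / 2)).
split; first (split; reflexivity).
split; [exact: sE | exact: n0 | rewrite uw; exact: um2 | rewrite pw; exact: up2 | ].
split; [exact: K3 | exact: nn | | | split; [exact: g0 | exact: K0 | exact: um0 | exact: up0]].
(* X_l = q + O(q^2) can be cancelled on the right, so the relation in x is checked at x = X_l(q),
   where it compares Z_l wm(X_l) with Q^(1/2). *)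
- apply: (comp_inj x0 x1); rewrite (compM _ _ x0) TX (compA _ y1 x0) ym T1.
  apply: fps_sqr_inj; [by rewrite fcoef_mul0 z0 fcoef_comp0 fps_powr0 mulr1 | exact: q0 | ].
  rewrite (sq Qser Qser0) exprMn; apply: (mulfI two).
  rewrite -(compX _ 2 x0) uw -d4 mulrCA; congr (_ * _).
  have := congr1 (fun h => comp h X) um2; rewrite (compM 2%:R um x0) comp_nat compB (compM (zev (lb l) pX) s x0) !cz cs.
  exact.
- apply: (comp_inj x0 x1); rewrite (compM _ _ x0) TX (compA _ y2 x0) yp.
  rewrite /dil -(compA _ coef_X1s0 (dil_base0 l0)) T1 -/(dil l _).
  apply: fps_sqr_inj; [by rewrite fcoef_mul0 z0 fcoef_comp0 fps_powr0 mulr1 | by rewrite dil0 q0 | ].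
  rewrite -(dilX l0 _ 2) (sq Qser Qser0) exprMn.
  have ll : 2%:R * l%:R ^+ 2 != 0 :> fps.
    apply: mulf_neq0 two (expf_neq0 2 _).
    by rewrite -(prednK l0); exact: fps_natf_neq0.
  apply: (mulfI ll); rewrite -(compX _ 2 x0) pw -d5 mulrCA; congr (_ * _).
  have := congr1 (fun h => comp h X) up2; rewrite (compM (2%:R * l%:R ^+ 2) up x0) (compM 2%:R (l%:R ^+ 2) x0) (compX l%:R 2 x0) !comp_nat compD (compM (zev (lb l) pX) s x0) !cz cs.
  exact.
Qed.

End FormalTransformation.

(** * The differential equation of the square root of F_1 *)

Section HypergeometricEquation.

(** z, p and x stand for f, D f and D (D f) evaluated at X_1, where z^4 = Q; e1 and e2 are the first
    and second derivatives of this relation. Ramanujan's equations remove the derivatives of P, Q,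
    R, and P then drops out by e1. *)
Lemma hypergeometric_algebra (A : idomainType) (c P Q R X z DP DQ DR Dz p x Dp : A) :
  Q != 0 -> R ^+ 2 = Q ^+ 3 * (1 - c * X) ->
  12%:R * DP = P ^+ 2 - Q -> 3%:R * DQ = P * Q - R -> 2%:R * DR = P * R - Q ^+ 2 ->
  Dz * Q = p * R -> Dp * Q = x * R -> 12%:R * (p * R) = z * (P * Q - R) ->
  12%:R * (Dp * R + p * DR) = Dz * (P * Q - R) + z * (DP * Q + P * DQ - DR) ->
  144%:R * (1 - c * X) * x = c * X * (72%:R * p + 5%:R * z).
Proof.
move=> Q0 hR hP hQ hR' hz hp e1 e2.
have s1 : 144%:R * (x * R ^+ 2) = p * (72%:R * Q ^+ 3 - 60%:R * P * Q * R - 12%:R * R ^+ 2)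
    + Q * z * (5%:R * P ^+ 2 * Q - 10%:R * P * R + 5%:R * Q ^+ 2).
  have e2' := congr1 (fun y => 12%:R * Q * y) e2; rewrite /= in e2'.
  have a1 : 144%:R * (x * R ^+ 2) = 144%:R * R * (Dp * Q) by rewrite hp; ring.
  have a2 : 12%:R * Q * (12%:R * (Dp * R + p * DR)) = 144%:R * R * (Dp * Q) + 72%:R * Q * p * (2%:R * DR) by ring.
  have a3 : 12%:R * Q * (Dz * (P * Q - R) + z * (DP * Q + P * DQ - DR)) =
    12%:R * (Dz * Q) * (P * Q - R) + Q * z * ((12%:R * DP) * Q + 4%:R * P * (3%:R * DQ) - 6%:R * (2%:R * DR)) by ring.
  rewrite a2 a3 hz hP hQ hR' in e2'.
  rewrite a1; move: e2' => /(canRL (addrK _)) ->; ring.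
apply: (mulfI (expf_neq0 3 Q0)).
transitivity (144%:R * (x * (Q ^+ 3 * (1 - c * X)))); first by ring.
rewrite -hR s1.
apply: (lincomb2 (n := 1) (c1 := - (5%:R * P * Q - 5%:R * R)) (c2 := - (72%:R * p + 5%:R * z)) (oner_neq0 _) e1 hR).
by ring.
Qed.

Lemma D_comp_X1s f : D (comp f X1s) * Qser = comp (D f) X1s * Rser.
Proof.
have d := D_comp f coef_X1s0; have e := D_X1s.
move: d e X1s_neq0; move: X1s Qser Rser (comp f X1s) (comp (D f) X1s) (D X1s) (D (comp f X1s)).
move=> x q r a b d c h1 h2 x0; apply: (mulfI x0).
transitivity (c * x * q); first by ring.
by rewrite h1 -mulrA [d * q]mulrC h2; ring.
Qed.

Lemma comp_linL (k c : nat) f :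
  comp (k%:R * (1 - c%:R * pX) * f) X1s = k%:R * (1 - c%:R * X1s) * comp f X1s.
Proof.
have x0 := coef_X1s0.
by rewrite (compM _ f x0) (compM _ _ x0) compB comp1 (compM _ pX x0) !comp_nat comp_pX.
Qed.

Lemma comp_linR (c m n : nat) f g :
  comp (c%:R * pX * (m%:R * f + n%:R * g)) X1s = c%:R * X1s * (m%:R * comp f X1s + n%:R * comp g X1s).
Proof.
have x0 := coef_X1s0.
rewrite (compM _ (_ + _) x0) (compM _ pX x0) compD (compM _ f x0) (compM _ g x0).
by rewrite !comp_nat comp_pX.
Qed.

(** This is the equation of 2F1(1/12, 5/12; 1; 1728 x), and the series is its solution because
    f(X_1) = Q^(1/4). *)
Lemma sqrt_T1_equation (f : fps) : f 0%N = 1 -> f ^+ 2 = Tser 1 ->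
  144%:R * (1 - 1728%:R * pX) * D (D f) = 1728%:R * pX * (72%:R * D f + 5%:R * f).
Proof.
move=> f0 fT; apply: (comp_inj coef_X1s0 coef_X1s1).
have [X10 X11 _] := XZser_lead (isT : 1%N \in [:: 1; 2; 3; 5; 7; 11; 13; 23]%N).
have T1 : comp (Tser 1) X1s = fps_powr Qser (1 / 2).
  by rewrite -X1s_xser -Z1_zser; apply: comp_expand.
have z4 : comp f X1s ^+ 4 = Qser.
  have -> : comp f X1s ^+ 4 = (comp f X1s ^+ 2) ^+ 2 by rewrite -exprM.
  have half : 1 / 2 * 2%:R = 1%:R :> rat by [].
  by rewrite -(compX f 2 coef_X1s0) fT T1 (fps_powrX (1 / 2) 2 Qser0) half (fps_powr_nat 1 Qser0) expr1.
have h1 := D_comp_X1s f; have h2 := D_comp_X1s (D f).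
apply: (etrans (comp_linL 144 1728 (D (D f)))); apply/esym.
apply: (etrans (comp_linR 1728 72 5 (D f) f)); apply/esym.
have Q0 := Qser_neq0; have R2 := X1s_discriminant.
have z0 : comp f X1s != 0 by apply: fps_unit_neq0; rewrite fcoef_comp0.
have e1 : 12%:R * (comp (D f) X1s * Rser) = comp f X1s * (Pser * Qser - Rser).
  rewrite -h1; have dz := congr1 D z4; rewrite (DX _ 3) in dz.
  have q3 := D_Qser; move: z4 dz q3 z0; move: (comp f X1s) (D (comp f X1s)) => z dz z4 dz4 q3 z0.
  apply: (mulfI (expf_neq0 3 z0)).
  transitivity (3%:R * Qser * (4%:R * z ^+ 3 * dz)); first by ring.
  rewrite dz4; transitivity (3%:R * D Qser * Qser); first by ring.
  by rewrite q3 -[X in _ * X = _]z4; ring.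
have e2 := congr1 D e1.
rewrite (D_natM 12) (DM (comp (D f) X1s)) (DM (comp f X1s)) in e2.
have dB : D (Pser * Qser - Rser) = D Pser * Qser + Pser * D Qser - D Rser.
  by rewrite raddfB /= DM.
rewrite dB in e2.
exact: (hypergeometric_algebra Q0 R2 D_Pser D_Qser D_Rser h1 h2 e1 e2).
Qed.

End HypergeometricEquation.

(** * Bounds on coefficients *)

Section Growth.

Definition growth (C M : nat) f := forall n, `|f n| <= (C * M ^ n)%:R.
Definition geometric_growth f := exists C M, growth C M f.

Lemma growthW C M C' M' f : (C <= C')%N -> (M <= M')%N -> growth C M f -> growth C' M' f.
Proof.
move=> hC hM h n; apply: le_trans (h n) _; rewrite ler_nat leq_mul //.
by case: n => // n; rewrite leq_exp2r.
Qed.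

Lemma growthM C C' M f g : growth C M f -> growth C' M g -> growth (C * C') (2 * M) (f * g).
Proof.
move=> hf hg n; rewrite fcoef_mul; apply: le_trans (ler_norm_sum _ _ _) _.
apply: (@le_trans _ _ (\sum_(i < n.+1) (C * C' * M ^ n)%:R)).
  apply: ler_sum => i _; rewrite normrM.
  have -> : (C * C' * M ^ n = C * M ^ i * (C' * M ^ (n - i)))%N.
    by rewrite mulnACA -expnD subnKC // -ltnS.
  by rewrite natrM ler_pM.
rewrite -natr_sum ler_nat sum_nat_const card_ord expnMn mulnCA leq_mul //.
by rewrite leq_mul // ltn_expl.
Qed.

Lemma geoM f g : geometric_growth f -> geometric_growth g -> geometric_growth (f * g).
Proof.
move=> [C [M h]] [C' [M' h']]; exists (C * C')%N, (2 * (M + M'))%N.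
by apply: growthM; [apply: growthW h | apply: growthW h']; rewrite ?leq_addr ?leq_addl.
Qed.

Lemma geoD f g : geometric_growth f -> geometric_growth g -> geometric_growth (f + g).
Proof.
move=> [C [M h]] [C' [M' h']]; exists (C + C')%N, (M + M')%N => n.
rewrite fcoefD; apply: le_trans (ler_normD _ _) _; rewrite mulnDl natrD lerD //.
  by apply: (growthW _ _ h); rewrite ?leq_addr.
by apply: (growthW _ _ h'); rewrite ?leq_addl.
Qed.

Lemma geo_const c : geometric_growth (fps_const c).
Proof.
exists (Num.bound `|c|), 1%N => n; rewrite exp1n muln1 fcoef_const.
case: eqP => _; last by rewrite normr0.
by apply: ltW; apply: archi_boundP.
Qed.

Lemma geo1 : geometric_growth 1.
Proof. by have := geo_const 1; rewrite rmorph1. Qed.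

Lemma geo_pX : geometric_growth pX.
Proof.
exists 1%N, 1%N => n; rewrite exp1n -[pX]expr1 coef_pXn.
by case: eqP => _; rewrite ?normr1 ?normr0.
Qed.

Lemma geoX f k : geometric_growth f -> geometric_growth (f ^+ k).
Proof. by move=> h; elim: k => [|k IH]; [exact: geo1 | rewrite exprS; apply: geoM]. Qed.

Lemma geo_nat k : geometric_growth k%:R.
Proof. by have := geo_const k%:R; rewrite rmorph_nat. Qed.

Lemma geoB f g : geometric_growth f -> geometric_growth g -> geometric_growth (f - g).
Proof.
move=> hf hg; apply: geoD hf _; rewrite -mulN1r; apply: geoM hg.
by have := geo_const (-1); rewrite rmorphN1.
Qed.

Lemma geo_zev s f : geometric_growth f -> geometric_growth (zev s f).
Proof.
move=> hf; elim: s => [|c s IH] /=; first exact: (geo_nat 0).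
by apply: geoD; [rewrite zval_fps; exact: geo_const | apply: geoM].
Qed.

(** For f = O(q) the constant C is absorbed into M. This normalisation keeps the bounds for the
    powers f^k free of C^k. *)
Lemma growth_base f : f 0%N = 0 -> geometric_growth f -> exists M, growth 1 M f.
Proof.
move=> f0 [C [M h]]; exists (C * M)%N => -[|n]; first by rewrite f0 normr0.
apply: le_trans (h n.+1) _; rewrite ler_nat mul1n expnMn leq_mul //.
by case: C {h} => // C; rewrite -[X in (X <= _)%N]expn1 leq_pexp2l.
Qed.

Lemma sum_bin_col n k : (\sum_(j < n) 'C(j, k) = 'C(n, k.+1))%N.
Proof. by elim: n => [|n IH]; rewrite ?big_ord0 // big_ord_recr IH binS. Qed.

(** The coefficient is a sum over compositions of n into k positive parts, and their number is at
    most the binomial coefficient. *)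
Lemma growth_exp M f k n : f 0%N = 0 -> growth 1 M f ->
  `|(f ^+ k) n| <= ('C(n, k) * M ^ n)%:R.
Proof.
move=> f0 h; elim: k n => [|k IH] n.
  by rewrite expr0 fcoef1 bin0 mul1n; case: eqP => [->|_]; rewrite ?normr1 ?normr0.
rewrite exprS fcoef_mul big_ord_recl f0 mul0r add0r.
apply: le_trans (ler_norm_sum _ _ _) _.
apply: (@le_trans _ _ (\sum_(i < n) ('C(n - i.+1, k) * M ^ n)%:R)).
  apply: ler_sum => i _; rewrite normrM lift0.
  have -> : ('C(n - i.+1, k) * M ^ n = (1 * M ^ i.+1) * ('C(n - i.+1, k) * M ^ (n - i.+1)))%N.
    by rewrite mul1n mulnCA -expnD subnKC.
  by rewrite natrM ler_pM.
rewrite -natr_sum ler_nat -big_distrl /= leq_mul2r -sum_bin_col.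
rewrite [X in (_ <= X)%N](reindex_inj rev_ord_inj) /=.
by rewrite leqnn orbT.
Qed.

Definition psum f g N : fps := \sum_(i < N) fps_const (f i) * g ^+ i.

Lemma sum_bin_pow L n N : (\sum_(i < N) L ^ i * 'C(n, i) <= (1 + L) ^ n)%N.
Proof.
elim: n N => [|n IH] [|N]; rewrite ?big_ord0 //.
  by rewrite big_ord_recl big1 // => i _; rewrite bin0n muln0.
rewrite big_ord_recl /= bin0 muln1.
have -> : (\sum_(i < N) L ^ bump 0 i * 'C(n.+1, bump 0 i) =
   \sum_(i < N) L ^ i.+1 * 'C(n, i.+1) + L * \sum_(i < N) L ^ i * 'C(n, i))%N.
  rewrite big_distrr -big_split /=; apply: eq_bigr => i _.
  by rewrite /bump /= add1n binS expnS mulnDr mulnA.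
have h1 := IH N.+1; have h2 := IH N; rewrite big_ord_recl /= bin0 muln1 in h1.
have h3 : (L * \sum_(i < N) L ^ i * 'C(n, i) <= L * (1 + L) ^ n)%N by rewrite leq_mul2l h2 orbT.
rewrite expnS mulnDl mul1n addnA; apply: leq_add h3.
by apply: leq_trans h1; rewrite leq_add2l; apply: leq_sum => i _; rewrite /bump /= add1n.
Qed.

(** The bound does not depend on N, so it applies to the composite as well as to its partial sums,
    which [evals_comp] exploits. *)
Lemma psum_growth C L M f g N : growth C L f -> g 0%N = 0 -> growth 1 M g ->
  growth C (M * (1 + L)) (psum f g N).
Proof.
move=> hf g0 hg n; rewrite /psum fcoef_sum; apply: le_trans (ler_norm_sum _ _ _) _.
apply: (@le_trans _ _ (\sum_(i < N) (C * M ^ n * (L ^ i * 'C(n, i)))%:R)).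
  apply: ler_sum => i _; rewrite fcoef_constM normrM.
  have -> : (C * M ^ n * (L ^ i * 'C(n, i)) = C * L ^ i * ('C(n, i) * M ^ n))%N by rewrite mulnACA [('C(_, _) * _)%N]mulnC.
  by rewrite natrM ler_pM // growth_exp.
rewrite -natr_sum ler_nat -big_distrr /= expnMn mulnA leq_mul2l.
by rewrite sum_bin_pow orbT.
Qed.

Lemma comp_psum f g N n : g 0%N = 0 -> (n < N)%N -> comp f g n = psum f g N n.
Proof.
move=> g0 nN; rewrite (comp_wide f g0 nN) /psum fcoef_sum.
by apply: eq_bigr => i _; rewrite fcoef_constM.
Qed.

Lemma comp_growth C L M f g : growth C L f -> g 0%N = 0 -> growth 1 M g ->
  growth C (M * (1 + L)) (comp f g).
Proof. by move=> hf g0 hg n; rewrite (comp_psum f g0 (ltnSn n)); apply: psum_growth. Qed.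

Lemma geo_comp f g : g 0%N = 0 -> geometric_growth f -> geometric_growth g ->
  geometric_growth (comp f g).
Proof.
move=> g0 [C [L hf]] /(growth_base g0)[M hg]; exists C, (M * (1 + L))%N.
exact: comp_growth.
Qed.

(** For |r| <= 1 each factor (r - i)/(i + 1) has absolute value at most 1. *)
Lemma binser_growth r : `|r| <= 1 -> growth 1 1 (binser r).
Proof.
move=> r1 n; rewrite exp1n mul1n; elim: n => [|n IH].
  by rewrite /binser /gbinomial big_ord0 normr1.
rewrite /binser /gbinomial big_ord_recr /= normrM -[X in _ <= X]mulr1 ler_pM //.
rewrite normrM normfV normr_nat ler_pdivrMr ?ltr0n // mul1r.
apply: le_trans (ler_normB _ _) _; rewrite normr_nat -natr1 addrC lerD2l //.
Qed.

Lemma geo_powr u r : u 0%N = 1 -> `|r| <= 1 -> geometric_growth u ->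
  geometric_growth (fps_powr u r).
Proof.
move=> u0 r1 hu; rewrite fps_powrE; apply: geo_comp.
- by rewrite fcoefB u0 fcoef1 subrr.
- by exists 1%N, 1%N; apply: binser_growth.
- exact: geoB hu geo1.
Qed.

(** The equation is the recursion k (n+1)^2 f_{n+1} = c (k n^2 + m n + p) f_n, and the conditions on
    m and p give k n^2 + m n + p <= k (n+1)^2. *)
Lemma hypergeometric_growth (c k m p : nat) f : `|f 0%N| <= 1 ->
  (0 < k)%N -> (m <= 2 * k)%N -> (p <= k)%N ->
  k%:R * (1 - c%:R * pX) * D (D f) = c%:R * pX * (m%:R * D f + p%:R * f) ->
  growth 1 c f.
Proof.
move=> f0 k0 mk pk eqf; elim=> [|n IH]; first by rewrite expn0.
have := congr1 (fun g : fps => g n.+1) eqf; rewrite /=.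
have -> : k%:R * (1 - c%:R * pX) * D (D f) = k%:R * (D (D f)) - k%:R * (c%:R * (pX * D (D f))).
  by move: (D (D f)) (c%:R : fps) (k%:R : fps) => a b d; ring.
rewrite -[c%:R * pX * _]mulrA !(fcoefB, fcoef_natM, coef_pXM, fcoefD) !/(D _ _).
set a := f n.+1; set b := f n => e.
have {}e : (k * n.+1 ^ 2)%:R * a = (c * (k * n ^ 2 + m * n + p))%:R * b.
  rewrite !(natrM, natrD, natrX); move: e.
  move: (k%:R : rat) (c%:R : rat) (m%:R : rat) (p%:R : rat) (n.+1%:R : rat) (n%:R : rat) a b.
  move=> k' c' m' p' n1 n' a b e; apply/eqP; rewrite -subr_eq0.
  by move/eqP: e; rewrite -subr_eq0 => /eqP e; apply/eqP; rewrite -[RHS]e; ring.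
have n2 : (0 : rat) < (k * n.+1 ^ 2)%:R by rewrite ltr0n muln_gt0 k0 expn_gt0.
rewrite -(ler_pM2l n2) -[X in X * `|a|]normr_nat -normrM e normrM normr_nat.
apply: (@le_trans _ _ ((c * (k * n.+1 ^ 2))%:R * `|b|)).
  by rewrite ler_wpM2r // ler_nat leq_mul2l; apply/orP; right; nia.
rewrite mulnC natrM -mulrA; apply: ler_wpM2l; first exact: ler0n.
rewrite mul1n expnS natrM; apply: ler_wpM2l; first exact: ler0n.
by move: IH; rewrite mul1n.
Qed.

Lemma Tser1_0 : Tser 1 0%N = 1.
Proof.
have [X10 X11 _] := XZser_lead (isT : 1%N \in [:: 1; 2; 3; 5; 7; 11; 13; 23]%N).
have T1 : comp (Tser 1) X1s = fps_powr Qser (1 / 2).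
  by rewrite -X1s_xser -Z1_zser; apply: comp_expand.
by rewrite -(fcoef_comp0 (Tser 1) X1s) T1 fps_powr0.
Qed.

Lemma geo_Tser1 : geometric_growth (Tser 1).
Proof.
have half : 1 / 2 * 2%:R = 1%:R :> rat by [].
have fT : fps_powr (Tser 1) (1 / 2) ^+ 2 = Tser 1.
  by rewrite (fps_powrX (1 / 2) 2 Tser1_0) half (fps_powr_nat 1 Tser1_0) expr1.
rewrite -fT; apply: geoX; exists 1%N, 1728%N.
have f0 : `|fps_powr (Tser 1) (1 / 2) 0%N| <= 1 by rewrite fps_powr0 normr1.
exact: (@hypergeometric_growth 1728 144 72 5 _ f0 isT isT isT (sqrt_T1_equation (fps_powr0 _ _) fT)).
Qed.

End Growth.

(** * Values of power series at small complex arguments *)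

Section Evaluation.
Variable R : realType.
Implicit Types a w x y z : R[i].

Definition ps f x (N : nat) : R[i] := \sum_(0 <= n < N) ratr (f n) * x ^+ n.
(** The value a comes with an explicit geometric error bound for every partial sum. Sums, products
    and composites of values are then handled by finite estimates, and the limit is taken once at
    the end. *)
Definition evals D f x a := forall N, `|a - ps f x N| <= D%:R * 2^-1 ^+ N.

Lemma normc_Re_le z : (`|complex.Re z|)%:C%C <= `|z|. Proof. exact: normc_ge_Re. Qed.
Lemma normc_Im_le z : (`|complex.Im z|)%:C%C <= `|z|.
Proof. by rewrite normc_def lecR -sqrtr_sqr ler_wsqrtr // lerDr sqr_ge0. Qed.

Lemma normc_le_ReIm z : `|z| <= (`|complex.Re z| + `|complex.Im z|)%:C%C.
Proof.
rewrite normc_def lecR -(ger0_norm (addr_ge0 (normr_ge0 _) (normr_ge0 _))) -sqrtr_sqr.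
rewrite ler_wsqrtr // sqrrD -!normrX !(ger0_norm (sqr_ge0 _)) lerD2r lerDl.
by rewrite mulrn_wge0 // mulr_ge0.
Qed.

Lemma real_series (a : nat -> R) (C : nat) : (forall n, `|a n| <= C%:R * 2^-1 ^+ n) ->
  exists s : R, forall N, `|s - \sum_(0 <= k < N) a k| <= (2 * C)%:R * 2^-1 ^+ N.
Proof.
move=> ha; have h2 : `|2^-1 : R| < 1 by rewrite ger0_norm ?invr_ge0 // invf_lt1 ?ltr1n.
have cv : cvgn (series a).
  apply: normed_cvg; apply: (@series_le_cvg _ _ (geometric C%:R 2^-1)).
  - by move=> n; exact: normr_ge0.
  - by move=> n; apply: mulr_ge0; rewrite ?exprn_ge0 ?invr_ge0.
  - exact: ha.
  - exact: is_cvg_geometric_series.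
exists (limn (series a)) => N.
(* The bound is kept in telescoping form so that the induction on m closes. *)
have bd m : `|series a (N + m)%N - series a N| <= (2 * C)%:R * 2^-1 ^+ N - (2 * C)%:R * 2^-1 ^+ (N + m).
  elim: m => [|m IH]; first by rewrite addn0 !subrr normr0.
  rewrite addnS /series /= big_nat_recr //= addrAC.
  apply: le_trans (ler_normD _ _) _; apply: le_trans (lerD IH (ha _)) _.
  rewrite exprS natrM; have : 0 <= (2^-1 : R) ^+ (N + m) by rewrite exprn_ge0 ?invr_ge0.
  by move: (_ ^+ (N + m)) (_ ^+ N) (C%:R) => p q c p0; lra.
have bd' m : (N <= m)%N -> `|series a m - series a N| <= (2 * C)%:R * 2^-1 ^+ N.
  move=> Nm; rewrite -(subnKC Nm); apply: le_trans (bd _) _.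
  by rewrite lerBlDr lerDl mulr_ge0 ?exprn_ge0 ?invr_ge0.
rewrite ler_distl -/(series a N); apply/andP; split.
- apply: limr_ge => //; exists N => // m /= /bd'.
  by rewrite ler_distl => /andP[].
- apply: limr_le => //; exists N => // m /= /bd'.
  by rewrite ler_distl => /andP[].
Qed.

Lemma Re_sum (u : nat -> R[i]) N : complex.Re (\sum_(0 <= k < N) u k) = \sum_(0 <= k < N) complex.Re (u k).
Proof.
elim: N => [|N IH]; first by rewrite !big_geq.
by rewrite !big_nat_recr //= -IH; case: (\sum_(0 <= k < N) u k) => a b; case: (u N).
Qed.
Lemma Im_sum (u : nat -> R[i]) N : complex.Im (\sum_(0 <= k < N) u k) = \sum_(0 <= k < N) complex.Im (u k).
Proof.
elim: N => [|N IH]; first by rewrite !big_geq.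
by rewrite !big_nat_recr //= -IH; case: (\sum_(0 <= k < N) u k) => a b; case: (u N).
Qed.

Lemma half_real n : (2^-1 ^+ n : R[i]) = (2^-1 ^+ n)%:C%C.
Proof. by rewrite rmorphXn fmorphV rmorph_nat. Qed.

Lemma complex_series (u : nat -> R[i]) (C : nat) : (forall n, `|u n| <= C%:R * 2^-1 ^+ n) ->
  exists s : R[i], forall N, `|s - \sum_(0 <= k < N) u k| <= (4 * C)%:R * 2^-1 ^+ N.
Proof.
move=> hu.
have cE n (c : nat) : (c%:R * 2^-1 ^+ n : R[i]) = (c%:R * 2^-1 ^+ n)%:C%C.
  by rewrite rmorphM rmorph_nat half_real.
have [a ha] : exists s : R, forall N, `|s - \sum_(0 <= k < N) complex.Re (u k)| <= (2 * C)%:R * 2^-1 ^+ N.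
  apply: real_series => n; rewrite -lecR -cE; apply: le_trans (hu n); exact: normc_Re_le.
have [b hb] : exists s : R, forall N, `|s - \sum_(0 <= k < N) complex.Im (u k)| <= (2 * C)%:R * 2^-1 ^+ N.
  apply: real_series => n; rewrite -lecR -cE; apply: le_trans (hu n); exact: normc_Im_le.
exists (a +i* b)%C => N; apply: le_trans (normc_le_ReIm _) _.
have -> : complex.Re ((a +i* b)%C - \sum_(0 <= k < N) u k) = a - \sum_(0 <= k < N) complex.Re (u k).
  by rewrite -Re_sum; case: (\sum_(0 <= k < N) u k).
have -> : complex.Im ((a +i* b)%C - \sum_(0 <= k < N) u k) = b - \sum_(0 <= k < N) complex.Im (u k).
  by rewrite -Im_sum; case: (\sum_(0 <= k < N) u k).
rewrite cE lecR; apply: le_trans (lerD (ha N) (hb N)) _.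
by rewrite -mulrDl -natrD; rewrite (_ : 2 * C + 2 * C = 4 * C)%N //; lia.
Qed.

Lemma pow_small (e : R[i]) (c : nat) : 0 < e ->
  exists N, forall n, (N <= n)%N -> c%:R * 2^-1 ^+ n <= e.
Proof.
case: e => r s; rewrite ltcE /= => /andP[/eqP -> r0].
exists (Num.truncn (c%:R / r)).+1 => n hn.
rewrite half_real -(rmorph_nat (real_complex R)) -rmorphM /= lecR.
rewrite exprVn ler_pdivrMr ?exprn_gt0 // mulrC -ler_pdivrMr //.
apply: (@le_trans _ _ n%:R).
  by apply: le_trans (ltW (truncnS_gt _)) _; rewrite ler_nat.
by rewrite -natrX ler_nat ltnW // ltn_expl.
Qed.

Lemma evals_unique D1 D2 f x a w : evals D1 f x a -> evals D2 f x w -> a = w.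
Proof.
move=> hv hw; apply/eqP; rewrite -subr_eq0 -normr_le0; apply/negPn/negP => h.
have e0 : 0 < `|a - w| / 2.
  by rewrite divr_gt0 // normr_gt0; apply: contra h => /eqP ->; rewrite normr0.
have [N hN] := pow_small (D1 + D2) e0.
have : `|a - w| <= `|a - w| / 2.
  apply: le_trans _ (hN N (leqnn N)).
  have -> : a - w = (a - ps f x N) - (w - ps f x N) by rewrite opprB addrA subrK.
  by apply: le_trans (ler_normB _ _) _; rewrite natrD mulrDl lerD.
rewrite ler_pdivlMr // mulr_natr mulr2n gerDl => h'; by rewrite h' in h.
Qed.

Lemma evals_cvg D f x a : evals D f x a -> ps f x n @[n --> \oo] --> a.
Proof.
move=> hv; apply/cvgrPdist_le => e e0; have [N hN] := pow_small D e0.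
by exists N => // n /= /hN; apply: le_trans.
Qed.

Lemma ratr_le (q : rat) (n : nat) : `|q| <= n%:R -> `|ratr q : R[i]| <= n%:R.
Proof. by move=> h; rewrite -ratr_norm -(ratr_nat _ n) ler_rat. Qed.

Lemma term_bound C M f x n : growth C M f -> `|x| * (4 * M)%:R <= 1 ->
  `|ratr (f n) * x ^+ n| <= C%:R * 4^-1 ^+ n.
Proof.
move=> hf hx; rewrite normrM normrX.
apply: (@le_trans _ _ ((C * M ^ n)%:R * `|x| ^+ n)).
  by rewrite ler_wpM2r ?exprn_ge0 // ratr_le.
rewrite natrM -mulrA ler_wpM2l // natrX -exprMn lerXn2r ?nnegrE ?mulr_ge0 ?invr_ge0 //.
by rewrite -[4^-1]mul1r ler_pdivlMr // mulrAC -natrM mulrC [(M * 4)%N]mulnC.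
Qed.

Lemma half_quarter n : (4^-1 : R[i]) ^+ n <= 2^-1 ^+ n.
Proof.
by rewrite lerXn2r ?nnegrE ?invr_ge0 // lef_pV2 ?posrE // ler_nat.
Qed.

Lemma evals_exists C M f x : growth C M f -> `|x| * (4 * M)%:R <= 1 ->
  exists a, evals (4 * C) f x a.
Proof.
move=> hf hx; apply: complex_series => n.
by apply: le_trans (term_bound n hf hx) _; rewrite ler_wpM2l // half_quarter.
Qed.

Lemma evalsD D1 D2 f g x a w : evals D1 f x a -> evals D2 g x w -> evals (D1 + D2) (f + g) x (a + w).
Proof.
move=> hv hw N; have -> : ps (f + g) x N = ps f x N + ps g x N.
  by rewrite /ps -big_split /=; apply: eq_bigr => i _; rewrite fcoefD rmorphD mulrDl.
by rewrite opprD addrACA; apply: le_trans (ler_normD _ _) _; rewrite natrD mulrDl lerD.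
Qed.

Lemma ps_mul f g x N : ps (f * g) x N = \sum_(0 <= i < N) ratr (f i) * x ^+ i * ps g x (N - i).
Proof.
elim: N => [|N IH]; first by rewrite /ps !big_geq.
rewrite {1}/ps big_nat_recr //= -/(ps (f * g) x N) IH.
have -> : \sum_(0 <= i < N.+1) ratr (f i) * x ^+ i * ps g x (N.+1 - i) =
  \sum_(0 <= i < N.+1) (ratr (f i) * x ^+ i * ps g x (N - i) + ratr (f i) * ratr (g (N - i)%N) * x ^+ N).
  apply: eq_big_nat => i /= iN; rewrite subSn // {1}/ps big_nat_recr //= -/(ps g x _) mulrDr.
  by congr (_ + _); rewrite mulrACA -exprD subnKC.
have p0 : ps g x 0 = 0 by rewrite /ps big_geq.
rewrite big_split /=; congr (_ + _); first by rewrite [in RHS]big_nat_recr //= subnn p0 mulr0 addr0.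
rewrite fcoef_mul rmorph_sum /= mulr_suml big_mkord.
by apply: eq_bigr => i _; rewrite rmorphM.
Qed.

Lemma sum_half N : \sum_(0 <= i < N) (2^-1 : R[i]) ^+ i <= 2.
Proof.
have -> : \sum_(0 <= i < N) (2^-1 : R[i]) ^+ i = 2 - 2 * 2^-1 ^+ N.
  elim: N => [|N IH]; first by rewrite big_geq // expr0 mulr1 subrr.
  by rewrite big_nat_recr //= IH exprS; field.
by rewrite gerBl mulr_ge0 ?exprn_ge0 ?invr_ge0.
Qed.

Lemma evals0 D f x a : evals D f x a -> `|a| <= D%:R.
Proof. by move/(_ 0%N); rewrite /ps big_geq // subr0 expr0 mulr1. Qed.

(** The error for the product is (a - S_N(f)) w plus the sum of f_i x^i (w - S_{N-i}(g)). The margin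
    4 in the condition on x makes the terms of f decay like 4^-i, so the second part stays below a
    constant times 2^-N instead of acquiring a factor N. *)
Lemma evalsM C M D1 D2 f g x a w : growth C M f -> `|x| * (4 * M)%:R <= 1 ->
  evals D1 f x a -> evals D2 g x w -> evals (D1 * D2 + 2 * (C * D2)) (f * g) x (a * w).
Proof.
move=> hf hx hv hw N; rewrite ps_mul.
have -> : a * w - \sum_(0 <= i < N) ratr (f i) * x ^+ i * ps g x (N - i) =
  (a - ps f x N) * w + \sum_(0 <= i < N) ratr (f i) * x ^+ i * (w - ps g x (N - i)).
  have -> : \sum_(0 <= i < N) ratr (f i) * x ^+ i * (w - ps g x (N - i)) =
     ps f x N * w - \sum_(0 <= i < N) ratr (f i) * x ^+ i * ps g x (N - i).
    by rewrite /ps mulr_suml -sumrB; apply: eq_bigr => i _; rewrite mulrBr.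
  by rewrite mulrBl addrA subrK.
apply: le_trans (ler_normD _ _) _; rewrite natrD [X in _ <= X]mulrDl; apply: lerD.
  rewrite normrM natrM mulrAC; apply: ler_pM => //; exact: evals0 hw.
apply: le_trans (ler_norm_sum _ _ _) _.
apply: (@le_trans _ _ (\sum_(0 <= i < N) (C * D2)%:R * 2^-1 ^+ N * 2^-1 ^+ i)).
  rewrite big_nat [X in _ <= X]big_nat; apply: ler_sum => i /= iN; rewrite normrM.
  apply: le_trans (ler_pM (normr_ge0 _) (normr_ge0 _) (term_bound i hf hx) (hw _)) _.
  rewrite natrM mulrACA -!mulrA; do 2!rewrite ler_wpM2l //.
  have q : (4^-1 : R[i]) = 2^-1 * 2^-1 by field.
  have e : (2^-1 : R[i]) ^+ i * 2^-1 ^+ (N - i) = 2^-1 ^+ N by rewrite -exprD subnKC // ltnW.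
  by rewrite q exprMn -mulrA e mulrC.
rewrite -mulr_sumr mulrAC (natrM _ 2) [2%:R * _]mulrC; apply: ler_wpM2r; first by rewrite exprn_ge0 ?invr_ge0.
by apply: ler_wpM2l => //; exact: sum_half.
Qed.

(** Write f = 1 + x h and bound the value of h. The estimate supplies both O-terms of the theorem
    and the closeness to 1 that selects the square roots. *)
Lemma evals_unit C M f x : growth C M f -> f 0%N = 1 -> `|x| * (4 * M.+1)%:R <= 1 ->
  exists a, (exists D, evals D f x a) /\ `|a - 1| <= (4 * (C * M))%:R * `|x|.
Proof.
move=> hf f0 hx; pose h := fps_shift f.
have hh : growth (C * M) M h by move=> n; rewrite -mulnA -expnS; exact: hf.
have x1 : `|x| <= 1.
  apply: le_trans hx; rewrite -[X in X <= _]mulr1 ler_wpM2l // ler1n; lia.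
have hx' : `|x| * (4 * M)%:R <= 1.
  by apply: le_trans hx; rewrite ler_wpM2l // ler_nat leq_mul.
have [a hv] := evals_exists hh hx'; have v4 := evals0 hv.
set K := (4 * (C * M))%N in hv v4.
exists (1 + x * a); split; last by rewrite addrAC subrr add0r normrM mulrC ler_wpM2r.
have psS N : ps f x N.+1 = 1 + x * ps h x N.
  rewrite /ps big_nat_recl //= f0 rmorph1 expr0 mulr1 mulr_sumr; congr (_ + _).
  by apply: eq_bigr => i _; rewrite exprS mulrCA.
exists (1 + 2 * K)%N => -[|N].
  rewrite /ps big_geq // subr0 expr0 mulr1; apply: le_trans (ler_normD _ _) _.
  rewrite normr1 natrD lerD2l normrM natrM; apply: ler_pM => //.
  by apply: le_trans x1 _; rewrite ler1n.
rewrite psS opprD addrACA subrr add0r -mulrBr normrM.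
apply: le_trans (ler_pM (normr_ge0 _) (normr_ge0 _) x1 (hv N)) _.
rewrite mul1r exprS natrD natrM mulrA; apply: ler_wpM2r; first by rewrite exprn_ge0 ?invr_ge0.
rewrite mulrDl mul1r mulrAC divff // mul1r lerDr invr_ge0 //.
Qed.

Lemma evals_const c x : exists D, evals D (fps_const c) x (ratr c).
Proof.
exists (Num.bound `|c|) => -[|N].
  rewrite /ps big_geq // subr0 expr0 mulr1; apply: ratr_le; exact/ltW/archi_boundP.
rewrite /ps big_nat_recl //= big1 => [|i _]; last by rewrite fcoef_const /= rmorph0 mul0r.
by rewrite fcoef_const /= expr0 mulr1 addr0 subrr normr0 mulr_ge0 ?exprn_ge0 ?invr_ge0.
Qed.

Lemma evals_pX x : `|x| <= 1 -> evals 2 pX x x.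
Proof.
have c n : pX n = (n == 1%N)%:R by rewrite -[pX]expr1 coef_pXn.
move=> x1 [|[|N]].
- rewrite /ps big_geq // subr0 expr0 mulr1; apply: le_trans x1 _; by rewrite ler1n.
- rewrite /ps big_nat1 c rmorph0 mul0r subr0 expr1 divff //.
rewrite /ps 2?big_nat_recl //= big1 => [|i _]; last by rewrite c rmorph0 mul0r.
by rewrite !c rmorph0 rmorph1 mul0r add0r mul1r addr0 expr1 subrr normr0 mulr_ge0 ?exprn_ge0 ?invr_ge0.
Qed.

End Evaluation.

(** * Values of composites, and principal square roots *)

Section Substitution.
Variable R : realType.
Implicit Types a w x y z : R[i].

Lemma ps_fps_const (c : rat) f x N : ps (fps_const c * f) x N = ratr c * ps f x N.
Proof.
rewrite /ps mulr_sumr; apply: eq_bigr => i _.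
by rewrite fcoef_constM rmorphM mulrA.
Qed.

Lemma evals_zero x : evals 0 (0 : fps) x 0.
Proof.
by move=> N; rewrite /ps big1 ?subrr ?normr0 ?mul0r // => i _; rewrite fcoef0 rmorph0 mul0r.
Qed.

Lemma evalsZ D (c : rat) f x a : evals D f x a ->
  exists D', evals D' (fps_const c * f) x (ratr c * a).
Proof.
move=> h; exists (Num.bound `|c| * D)%N => N.
rewrite ps_fps_const -mulrBr normrM natrM -mulrA; apply: ler_pM => //.
by apply: ratr_le; exact/ltW/archi_boundP.
Qed.

Lemma evalsB D1 D2 f g x a w : evals D1 f x a -> evals D2 g x w ->
  exists D, evals D (f - g) x (a - w).
Proof.
move=> h1 h2; have [D h] := evalsZ (-1) h2.
exists (D1 + D)%N; have := evalsD h1 h.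
by rewrite !rmorphN !rmorph1 !mulN1r.
Qed.

Lemma evals_exp C M f x a k : growth C M f -> `|x| * (4 * M)%:R <= 1 ->
  (exists D, evals D f x a) -> exists D, evals D (f ^+ k) x (a ^+ k).
Proof.
move=> hf hx [D h]; elim: k => [|k [D' IH]].
  by have := evals_const 1 x; rewrite !rmorph1.
by exists (D * D' + 2 * (C * D'))%N; rewrite !exprS; apply: (evalsM hf hx h IH).
Qed.

Lemma evals_psum C M f g x y N : growth C M g -> `|x| * (4 * M)%:R <= 1 ->
  (exists D, evals D g x y) -> exists D, evals D (psum f g N) x (ps f y N).
Proof.
move=> hg hx hy; elim: N => [|N [D IH]].
  have -> : ps f y 0 = 0 by rewrite /ps big_geq.
  by exists 0%N; rewrite /psum big_ord0; exact: evals_zero.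
have [D1 h1] := evals_exp N hg hx hy; have [D2 h2] := evalsZ (f N) h1.
exists (D + D2)%N; rewrite /psum big_ord_recr /= /ps big_nat_recr //=.
exact: evalsD IH h2.
Qed.

(* The coefficients of the difference between the composite and its N-th partial
   sum vanish below N and are bounded independently of N. *)
Lemma evals_comp C L M f g x y : growth C L f -> g 0%N = 0 -> growth 1 M g ->
  `|x| * (4 * (M * (1 + L)))%:R <= 1 -> (exists D, evals D g x y) ->
  exists a, (exists D, evals D (comp f g) x a) /\ (exists D, evals D f y a).
Proof.
move=> hf g0 hg hx hy; have hc := comp_growth hf g0 hg.
have hxM : `|x| * (4 * M)%:R <= 1.
  by apply: le_trans hx; rewrite ler_wpM2l // ler_nat leq_mul // leq_pmulr.
have [a ha] := evals_exists hc hx.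
exists a; split; first by exists (4 * C)%N.
exists (4 * (2 * C))%N => N.
have [D1 h1] := evals_psum f N hg hxM hy; have [D2 h2] := evalsB ha h1.
have hd : growth (2 * C) (M * (1 + L)) (comp f g - psum f g N).
  move=> n; rewrite fcoefB; apply: le_trans (ler_normB _ _) _.
  rewrite -mulnA mul2n -addnn natrD; apply: lerD; first exact: hc.
  exact: psum_growth.
have [b hb] := evals_exists hd hx.
have -> : a - ps f y N = b by apply: evals_unique h2 hb.
have := hb N; rewrite [ps _ x N]big1_seq ?subr0 // => n; rewrite mem_index_iota => /andP[_ nN].
by rewrite fcoefB (comp_psum f g0 nN) subrr rmorph0 mul0r.
Qed.

(** Neighbourhoods of 0 are indexed by a natural number, so that finitely many smallness conditions
    are met together by adding their indices. *)
Definition small (M : nat) x := `|x| * M%:R <= 1.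

Lemma smallW M M' x : (M <= M')%N -> small M' x -> small M x.
Proof. by move=> h; apply: le_trans; rewrite ler_wpM2l // ler_nat. Qed.

Lemma near_small M (P : R[i] -> Prop) : (forall x, small M x -> P x) -> \forall x \near (0 : R[i]), P x.
Proof.
move=> h; apply/nbhs_normP; exists (M.+1%:R^-1); first by rewrite /= invr_gt0 ltr0n.
move=> x /=; rewrite sub0r normrN => hx; apply: h; rewrite /small.
apply: (@le_trans _ _ (M.+1%:R^-1 * M.+1%:R)); last by rewrite mulVf // pnatr_eq0.
by apply: ler_pM => //; [exact: ltW | rewrite ler_nat].
Qed.

Definition value f x a := exists D, evals D f x a.

Lemma value_unique f x a w : value f x a -> value f x w -> a = w.
Proof. by move=> [D h] [D' h']; apply: evals_unique h h'. Qed.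

Lemma valueM f g : geometric_growth f -> exists M, forall x a w, small M x ->
  value f x a -> value g x w -> value (f * g) x (a * w).
Proof.
move=> [C [M hf]]; exists (4 * M)%N => x a w hx [D1 h1] [D2 h2].
by exists (D1 * D2 + 2 * (C * D2))%N; apply: (evalsM hf hx h1 h2).
Qed.

Lemma value_unit f : geometric_growth f -> f 0%N = 1 -> exists B M, forall x, small M x ->
  exists2 a, value f x a & `|a - 1| <= B%:R * `|x|.
Proof.
move=> [C [M hf]] f0; exists (4 * (C * M))%N, (4 * M.+1)%N => x hx.
by have [a [h1 h2]] := evals_unit hf f0 hx; exists a.
Qed.

Lemma value_exists f : geometric_growth f -> exists M, forall x, small M x ->
  exists a, value f x a.
Proof.
move=> [C [M hf]]; exists (4 * M)%N => x hx; have [a h] := evals_exists hf hx.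
by exists a, (4 * C)%N.
Qed.

Lemma value_comp f g : geometric_growth f -> geometric_growth g -> g 0%N = 0 ->
  exists M, forall x y, small M x -> value g x y ->
  exists2 a, value (comp f g) x a & value f y a.
Proof.
move=> [C [L hf]] hg g0; have [M hM] := growth_base g0 hg.
exists (4 * (M * (1 + L)))%N => x y hx hy.
by have [a [h1 h2]] := evals_comp hf g0 hM hx hy; exists a.
Qed.

Lemma value_zev (s : seq BinInt.Z) x : small 1 x -> value (zev s pX) x (zev s x).
Proof.
move=> hx; have x1 : `|x| <= 1 by move: hx; rewrite /small mulr1.
have psM f N : ps (pX * f) x N.+1 = x * ps f x N.
  rewrite /ps big_nat_recl //= coef_pXM rmorph0 mul0r add0r mulr_sumr.
  by apply: eq_bigr => i _; rewrite coef_pXM exprS mulrCA.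
elim: s => [|c s [D IH]] /=.
  by exists 0%N; exact: evals_zero.
have [D1 h1] := evals_const (zval c) x.
have h2 : evals (2 * D) (pX * zev s pX) x (x * zev s x).
  move=> [|N].
    rewrite /ps big_geq // subr0 expr0 mulr1 normrM -[X in _ <= X]mul1r natrM mulrCA mul1r.
    by apply: ler_pM => //; [apply: le_trans x1 _; rewrite ler1n | exact: evals0 IH].
  rewrite psM -mulrBr normrM; apply: le_trans (ler_pM (normr_ge0 _) (normr_ge0 _) x1 (IH N)) _.
  by rewrite mul1r exprS natrM mulrACA divff // mul1r.
exists (D1 + 2 * D)%N; rewrite zval_fps.
have -> : zval c = ratr (zval c) :> R[i] by rewrite /zval ratr_int.
exact: evalsD h1 h2.
Qed.

Lemma valueD f g x a w : value f x a -> value g x w -> value (f + g) x (a + w).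
Proof. by move=> [D h] [D' h']; exists (D + D')%N; apply: evalsD. Qed.
Lemma valueB f g x a w : value f x a -> value g x w -> value (f - g) x (a - w).
Proof. by move=> [D h] [D' h']; apply: evalsB h h'. Qed.

Lemma Re_gt0 z : `|z - 1| < 1 -> 0 < complex.Re z.
Proof.
move=> z1; have := le_lt_trans (normc_Re_le (z - 1)) z1; rewrite ltcR.
by case: z {z1} => p q /=; rewrite ltr_norml => /andP[h _]; lra.
Qed.

(** The principal root has nonnegative real part, hence is the root in the right half plane. *)
Lemma sqrtc_Re z : 0 < complex.Re z -> sqrtc (z ^+ 2) = z.
Proof.
move=> Rez; have Res : 0 <= complex.Re (sqrtc (z ^+ 2)).
  by case: (z ^+ 2) => p q /=; exact: sqrtr_ge0.
have /eqP : sqrtc (z ^+ 2) ^+ 2 = z ^+ 2 by rewrite sqr_sqrtc.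
rewrite eqf_sqr => /orP[/eqP //|/eqP e]; move: Res; rewrite e.
by case: z Rez {e} => p q /= Rez; rewrite oppr_ge0 leNgt Rez.
Qed.

Lemma sqrtc_eq z w : z ^+ 2 = w -> `|z - 1| < 1 -> sqrtc w = z.
Proof. by move=> <- /Re_gt0; exact: sqrtc_Re. Qed.

Lemma sqrtc_nat_mul (k : nat) z : (0 < k)%N -> `|z - 1| < 1 -> sqrtc ((k%:R * z) ^+ 2) = k%:R * z.
Proof.
move=> k0 z1; have Rez : 0 < complex.Re z by exact: Re_gt0.
have Re2 : 0 < complex.Re (k%:R * z).
  rewrite -(rmorph_nat (real_complex R)); case: z Rez {z1} => p q /= Rez.
  by rewrite mul0r subr0 mulr_gt0 // ltr0n.
exact: sqrtc_Re Re2.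
Qed.

Lemma peval_zpoly (s : seq BinInt.Z) x : peval (zpoly s) x = zev s x.
Proof. by rewrite /peval horner_zpoly. Qed.

End Substitution.

(** * From formal identities to functions near 0 *)

Section Germs.
Variable R : realType.
Implicit Types (x y : R[i]) (F G : R[i] -> R[i]).

Definition germ f F := exists M, forall x, small M x -> value f x (F x).

Lemma germ_exists f : geometric_growth f -> exists F, germ f F.
Proof.
move=> gf; have [M h] := value_exists R gf; exists (fun x => xget 0 [set a | value f x a]), M => x /h [a ha].
by have := xgetI (0 : R[i]) (P := [set a | value f x a]) ha.
Qed.

Lemma germ_unit f : geometric_growth f -> f 0%N = 1 -> exists2 F, germ f F &
  exists B M, forall x, small M x -> `|F x - 1| <= B%:R * `|x|.
Proof.
move=> gf f0; have [F [M1 h1]] := germ_exists gf; exists F; first by exists M1.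
have [B [M h]] := value_unit R gf f0; exists B, (M + M1)%N => x hx.
have [a ha le] := h x (smallW (leq_addr _ _) hx).
by rewrite (value_unique (h1 x (smallW (leq_addl _ _) hx)) ha).
Qed.

Lemma germ_unique f F G : germ f F -> germ f G -> exists M, forall x, small M x -> F x = G x.
Proof.
move=> [M h] [M' h']; exists (M + M')%N => x hx.
exact: value_unique (h x (smallW (leq_addr _ _) hx)) (h' x (smallW (leq_addl _ _) hx)).
Qed.

Lemma germM f g F G : geometric_growth f -> germ f F -> germ g G -> germ (f * g) (fun x => F x * G x).
Proof.
move=> /(@valueM R f g)[M0 h0] [M h] [M' h']; exists (M0 + (M + M'))%N => x hx.
apply: h0; first exact: smallW (leq_addr _ _) hx.
- by apply/h/(smallW _ hx); lia.
- by apply/h'/(smallW _ hx); lia.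
Qed.

Lemma germD f g F G : germ f F -> germ g G -> germ (f + g) (fun x => F x + G x).
Proof.
move=> [M h] [M' h']; exists (M + M')%N => x hx.
by apply: valueD; [apply: h (smallW (leq_addr _ _) hx) | apply: h' (smallW (leq_addl _ _) hx)].
Qed.

Lemma germB f g F G : germ f F -> germ g G -> germ (f - g) (fun x => F x - G x).
Proof.
move=> [M h] [M' h']; exists (M + M')%N => x hx.
by apply: valueB; [apply: h (smallW (leq_addr _ _) hx) | apply: h' (smallW (leq_addl _ _) hx)].
Qed.

Lemma germZ c f F : germ f F -> germ (fps_const c * f) (fun x => ratr c * F x).
Proof. by move=> [M h]; exists M => x /h [D hD]; apply: evalsZ hD. Qed.

Lemma germ_zev (s : seq BinInt.Z) : germ (zev s pX) (fun x => zev s x).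
Proof. by exists 1%N => x hx; apply: value_zev. Qed.

Lemma germ_Xn k : germ (pX ^+ k) (fun x => x ^+ k).
Proof.
have [M h] := germ_zev (zXn k); exists M => x /h.
by rewrite !zev_Xn.
Qed.

Lemma germ_pX : germ pX (fun x => x).
Proof. by exists 1%N => x hx; exists 2%N; apply: evals_pX; move: hx; rewrite /small mulr1. Qed.

Lemma small_half B x : small (2 * B) x -> B%:R * `|x| < 1.
Proof.
rewrite /small natrM mulrCA [`|x| * _]mulrC => h.
apply: (@le_lt_trans _ _ 2^-1); last by rewrite invf_lt1 // ltr1n.
by rewrite -[2^-1]mulr1 ler_pdivlMl.
Qed.

Lemma value_cvg f x (a : R[i]) : value f x a -> ps f x n @[n --> \oo] --> a.
Proof. by move=> [D h]; apply: evals_cvg h. Qed.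

Lemma F_value l x (a : R[i]) : value (Tser l) x a -> cvgn (Fpart l x) /\ F l x = a.
Proof.
move=> /value_cvg h; have h' : Fpart l x @ \oo --> a by exact: h.
split; first by apply/cvg_ex; exists a.
exact: (cvg_lim (@norm_hausdorff _ _) h').
Qed.

Lemma cancel_scaled (c z t : R[i]) : c != 0 -> z != 0 -> t = c / (c * z) * (t * z).
Proof. by move=> c0 z0; rewrite invfM (mulrA c) divff // mul1r mulrCA mulVf // mulr1. Qed.

Lemma ratr_half (q : rat) : 2%:R * q = 1 -> ratr q = 2^-1 :> R[i].
Proof.
move=> e; have h : ratr (2%:R * q) = ratr 2%:R * ratr q :> R[i] by exact: rmorphM.
rewrite e rmorph1 ratr_nat in h.
have two : (2%:R : R[i]) != 0 by rewrite pnatr_eq0.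
by apply: (mulfI two); rewrite divff // -h.
Qed.

Lemma peval_a l x : l \in levels -> zev (la l) x = 2%:R * peval (pol_a l) x.
Proof. by move=> hl; rewrite -peval_zpoly -(pol_aE hl) /peval map_polyZ hornerZ /= ratr_nat. Qed.

Lemma peval_b l x : l \in levels -> zev (lb l) x = 2%:R * peval (pol_b l) x.
Proof. by move=> hl; rewrite -peval_zpoly -(pol_bE hl) /peval map_polyZ hornerZ /= ratr_nat. Qed.

Lemma local_transformation l : l \in levels -> exists B M : nat, forall x : R[i], small M x ->
  [/\ `|yplus l x - x ^+ l| <= B%:R * `|x ^+ l.+1|, `|yminus l x - x| <= B%:R * `|x ^+ 2| &
   exists t : R[i], [/\ value (Tser l) x t,
     exists2 a, value (Tser 1) (yplus l x) a & t = l%:R / sqrtc (ab_plus l x) * a &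
     exists2 a, value (Tser 1) (yminus l x) a & t = 1 / sqrtc (ab_minus l x) * a]].
Proof.
move=> hl; have l0 : (0 < l)%N by move: l hl; apply: levelsP.
have [s [n [ki [wm [wp [[sD nD kD mD pD] [s2 n0 m2 p2 [K3 nn T1 T2 [g0 K0 um0 up0]]]]]]]]] :=
  formal_transformation hl.
have gz t : geometric_growth (zev t pX) := geo_zev t geo_pX.
have h1 : `|1 / 2 : rat| <= 1 by [].
have hm1 : `|-1 : rat| <= 1 by [].
have hm2 : `|- (1 / 2) : rat| <= 1 by [].
have gs : geometric_growth s by rewrite sD; apply: geo_powr g0 h1 (gz _).
have gn : geometric_growth n.
  by rewrite nD; apply: geoM (geo_const _) (geoD (gz _) (geoM (gz _) gs)).
have gk : geometric_growth ki.
  have -> : ki = fps_powr (zev (lK l) pX) (-1) ^+ 3.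
    by rewrite kD fps_powrX // mulN1r.
  exact: geoX (geo_powr K0 hm1 (gz _)).
have gni : geometric_growth (fps_powr n (-1)) := geo_powr n0 hm1 gn.
have gum : geometric_growth (fps_const (1 / 2) * (zev (la l) pX - zev (lb l) pX * s)).
  exact: geoM (geo_const _) (geoB (gz _) (geoM (gz _) gs)).
have gup : geometric_growth (fps_const (1 / (2%:R * l%:R ^+ 2)) * (zev (la l) pX + zev (lb l) pX * s)).
  exact: geoM (geo_const _) (geoD (gz _) (geoM (gz _) gs)).
have gwm : geometric_growth wm by rewrite mD; exact: geo_powr um0 h1 gum.
have gwp : geometric_growth wp by rewrite pD; exact: geo_powr up0 h1 gup.
pose ym : fps := pX * (n * ki); pose yp : fps := pX ^+ l * fps_powr n (-1).
have ym0 : ym 0%N = 0 by rewrite /ym coef_pXM.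
have yp0 : yp 0%N = 0 by rewrite /yp coef_pXnM leqn0 gtn_eqF.
have gym : geometric_growth ym := geoM geo_pX (geoM gn gk).
have gyp : geometric_growth yp := geoM (geoX l geo_pX) gni.
have wm0 : wm 0%N = 1 by rewrite mD fps_powr0.
have wp0 : wp 0%N = 1 by rewrite pD fps_powr0.
have gT : geometric_growth (Tser l).
  have -> : Tser l = comp (Tser 1) ym * fps_powr wm (-1).
    by rewrite /ym -T1 -mulrA [wm * _]mulrC fps_powrN1 // mulr1.
  exact: geoM (geo_comp ym0 geo_Tser1 gym) (geo_powr wm0 hm1 gwm).
have s0 : s 0%N = 1 by rewrite sD fps_powr0.
have k0 : ki 0%N = 1 by rewrite kD fps_powr0.
have ni0 : fps_powr n (-1) 0%N = 1 by exact: fps_powr0.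
have nk0 : (n * ki) 0%N = 1 by rewrite fcoef_mul0 n0 k0 mulr1.
have [S hS [Bs [Ms bS]]] := germ_unit gs s0.
have [Nf hN _] := germ_unit gn n0.
have [Kf hK _] := germ_unit gk k0.
have [I hI [Bi [Mi bI]]] := germ_unit gni ni0.
have [Q hQ [Bq [Mq bQ]]] := germ_unit (geoM gn gk) nk0.
have [Wm hWm [Bm [Mm bWm]]] := germ_unit gwm wm0.
have [Wp hWp [Bp [Mp bWp]]] := germ_unit gwp wp0.
have [T hT] := germ_exists gT.
have [M1 E1] : exists M, forall x, small M x -> S x * S x = zev (lg l) x.
  by apply: germ_unique (germM gs hS hS) _; rewrite -expr2 s2; exact: germ_zev.
have [M2 E2] : exists M, forall x, small M x -> Nf x = ratr (1 / 2) * (zev (lc l) x + zev (ld l) x * S x).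
  apply: germ_unique hN _; rewrite nD; apply: germZ.
  exact: germD (germ_zev _) (germM (gz _) (germ_zev _) hS).
have g1 : germ 1 (fun x => 1) := germ_Xn 0.
have [M3 E3] : exists M, forall x, small M x -> zev (zexp (lK l) 3) x * Kf x = 1.
  apply: germ_unique (germM (gz _) (germ_zev (zexp (lK l) 3)) hK) _.
  by rewrite zev_exp K3.
have [M4 E4] : exists M, forall x, small M x -> Nf x * I x = 1.
  by apply: germ_unique (germM gn hN hI) _; rewrite nn.
have [M5 E5] : exists M, forall x, small M x -> ratr 2%:R * (Wm x * Wm x) = zev (la l) x - zev (lb l) x * S x.
  apply: germ_unique (germZ 2%:R (germM gwm hWm hWm)) _; rewrite rmorph_nat -expr2 m2.
  exact: germB (germ_zev _) (germM (gz _) (germ_zev _) hS).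
have [M6 E6] : exists M, forall x, small M x ->
    ratr (2%:R * l%:R ^+ 2) * (Wp x * Wp x) = zev (la l) x + zev (lb l) x * S x.
  apply: germ_unique (germZ (2%:R * l%:R ^+ 2) (germM gwp hWp hWp)) _.
  rewrite rmorphM rmorphXn !rmorph_nat -expr2 p2.
  exact: germD (germ_zev _) (germM (gz _) (germ_zev _) hS).
have [M7 E7] := germ_unique hQ (germM gn hN hK).
have [M8 hym] : germ ym (fun x => x * Q x) := germM geo_pX germ_pX hQ.
have [M9 hyp] : germ yp (fun x => x ^+ l * I x) := germM (geoX l geo_pX) (germ_Xn l) hI.
have [M10 Cm] := value_comp R geo_Tser1 gym ym0.
have [M11 Cp] := value_comp R geo_Tser1 gyp yp0.
have [M12 hTm] := germM gT hT hWm.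
have [M13 hTp] := germM gT hT hWp.
have [M14 hT'] := hT.
(* The sum of all indices dominates each of them. The summands 2 Bs, 2 Bm, 2 Bp keep S, Wm and Wp
   within distance 1 of 1, hence in the right half plane, where they are principal roots. *)
exists (Bi + Bq)%N, (Ms + Mi + Mq + Mm + Mp + M1 + M2 + M3 + M4 + M5 + M6 + M7 + M8 + M9 + M10
  + M11 + M12 + M13 + M14 + 2 * Bs + 2 * Bm + 2 * Bp)%N => x hx.
have sm M' : (M' <= Ms + Mi + Mq + Mm + Mp + M1 + M2 + M3 + M4 + M5 + M6 + M7 + M8 + M9 + M10
  + M11 + M12 + M13 + M14 + 2 * Bs + 2 * Bm + 2 * Bp)%N -> small M' x by move=> h; apply: smallW h hx.
have {E1}E1 : S x * S x = zev (lg l) x by apply/E1/sm; clear; lia.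
have {E2}E2 : Nf x = ratr (1 / 2) * (zev (lc l) x + zev (ld l) x * S x) by apply/E2/sm; clear; lia.
have {E3}E3 : zev (zexp (lK l) 3) x * Kf x = 1 by apply/E3/sm; clear; lia.
have {E4}E4 : Nf x * I x = 1 by apply/E4/sm; clear; lia.
have {E5}E5 : ratr 2%:R * (Wm x * Wm x) = zev (la l) x - zev (lb l) x * S x by apply/E5/sm; clear; lia.
have {E6}E6 : ratr (2%:R * l%:R ^+ 2) * (Wp x * Wp x) = zev (la l) x + zev (lb l) x * S x by apply/E6/sm; clear; lia.
have {E7}E7 : Q x = Nf x * Kf x by apply/E7/sm; clear; lia.
have {bS}bS : `|S x - 1| < 1 by apply: le_lt_trans (bS x (sm _ _)) (small_half (sm _ _)); clear; lia.
have {bWm}bWm : `|Wm x - 1| < 1 by apply: le_lt_trans (bWm x (sm _ _)) (small_half (sm _ _)); clear; lia.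
have {bWp}bWp : `|Wp x - 1| < 1 by apply: le_lt_trans (bWp x (sm _ _)) (small_half (sm _ _)); clear; lia.
have {bI}bI : `|I x - 1| <= Bi%:R * `|x| by apply/bI/sm; clear; lia.
have {bQ}bQ : `|Q x - 1| <= Bq%:R * `|x| by apply/bQ/sm; clear; lia.
have sg : sqrt_g l x = S x.
  by apply: sqrtc_eq bS; rewrite expr2 E1 (pol_gE hl) peval_zpoly.
have two : (2%:R : R[i]) != 0 by rewrite pnatr_eq0.
have lR : (l%:R : R[i]) != 0 by rewrite pnatr_eq0 -lt0n.
have pa := peval_a x hl; have pb := peval_b x hl.
rewrite ratr_nat pa pb in E5; have r6 : ratr (2%:R * l%:R ^+ 2) = 2%:R * l%:R ^+ 2 :> R[i].
  by rewrite -natrX -natrM ratr_nat natrM natrX.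
rewrite r6 pa pb in E6.
have {}E5 : Wm x ^+ 2 = ab_minus l x.
  apply: (mulfI two); rewrite expr2 E5 /ab_minus sg.
  by move: (peval (pol_a l) x) (peval (pol_b l) x) => a b; ring.
have {}E6 : (l%:R * Wp x) ^+ 2 = ab_plus l x.
  apply: (mulfI two); rewrite exprMn expr2 [Wp x ^+ 2]expr2 mulrA -expr2 E6 /ab_plus sg.
  by move: (peval (pol_a l) x) (peval (pol_b l) x) => a b; ring.
have {}E2 : 2%:R * Nf x = zev (lc l) x + zev (ld l) x * S x.
  have r2 : ratr (1 / 2) = 2^-1 :> R[i] by exact: ratr_half.
  by rewrite E2 r2 mulrA divff ?mul1r.
rewrite zev_exp in E3.
have I0 : I x != 0 by apply/eqP => e; move: E4; rewrite e mulr0 => /eqP; rewrite eq_sym oner_eq0.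
have N0 : Nf x != 0 by apply/eqP => e; move: E4; rewrite e mul0r => /eqP; rewrite eq_sym oner_eq0.
have yp_eq : yplus l x = x ^+ l * I x.
  rewrite /yplus sg (pol_cE hl) (pol_dE hl) !peval_zpoly -E2.
  apply: (canLR (mulfK _)); first by rewrite mulf_neq0.
  by transitivity (2%:R * x ^+ l * (Nf x * I x)); [rewrite E4 mulr1 | ring].
have ym_eq : yminus l x = x * Q x.
  rewrite /yminus sg (pol_cE hl) (pol_dE hl) !peval_zpoly E7.
  (* At x = 0 the numerator of y^- vanishes, so the quotient is 0 although its denominator is 0 as
     well. *)
  have [->|x0] := eqVneq x 0; first by rewrite expr0n gtn_eqF // mulr0 !mul0r.
  have cd := cd_zev x hl.
  have e : (zev (lc l) x - zev (ld l) x * S x) * (2%:R * Nf x) = 4%:R * x ^+ l.-1 * zev (lK l) x ^+ 3.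
    by rewrite E2 -cd -E1; ring.
  have K0' : zev (lK l) x ^+ 3 != 0.
    by apply/eqP => e'; move: E3; rewrite e' mul0r => /eqP; rewrite eq_sym oner_eq0.
  have c0 : zev (lc l) x - zev (ld l) x * S x != 0.
    apply/eqP => e'; move: e; rewrite e' mul0r => /esym/eqP; apply/negP.
    by apply: mulf_neq0 K0'; apply: mulf_neq0 (expf_neq0 _ x0); rewrite pnatr_eq0.
  apply: (canLR (mulfK c0)); apply: (mulfI two).
  transitivity (x * Kf x * ((zev (lc l) x - zev (ld l) x * S x) * (2%:R * Nf x))); last by ring.
  rewrite e; transitivity (4%:R * (x * x ^+ l.-1) * (zev (lK l) x ^+ 3 * Kf x)); last by ring.
  by rewrite E3 -exprS prednK //; ring.
have sqm : sqrtc (ab_minus l x) = Wm x := sqrtc_eq E5 bWm.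
have Wm0 : Wm x != 0.
  by apply/eqP => e; move: bWm; rewrite e sub0r normrN normr1 ltxx.
have Wp0 : Wp x != 0.
  by apply/eqP => e; move: bWp; rewrite e sub0r normrN normr1 ltxx.
have sqp : sqrtc (ab_plus l x) = l%:R * Wp x.
  by rewrite -E6; apply: sqrtc_nat_mul.
split.
- rewrite yp_eq -[X in _ - X]mulr1 -mulrBr exprSr !normrM mulrCA.
  apply: ler_wpM2l => //; apply: le_trans bI _.
  by rewrite ler_wpM2r // ler_nat leq_addr.
- rewrite ym_eq -[X in _ - X]mulr1 -mulrBr expr2 !normrM mulrCA.
  apply: ler_wpM2l => //; apply: le_trans bQ _.
  by rewrite ler_wpM2r // ler_nat leq_addl.
exists (T x); split; first by apply/hT'/sm; clear; lia.
- have vy : value yp x (yplus l x) by rewrite yp_eq; apply/hyp/sm; clear; lia.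
  have s11 : small M11 x by apply: sm; clear; lia.
  have [a ca va] := Cp x _ s11 vy; exists a => //.
  have tv : value (Tser l * wp) x (T x * Wp x) by apply/hTp/sm; clear; lia.
  rewrite T2 in tv; rewrite sqp -(value_unique tv ca); exact: cancel_scaled lR Wp0.
- have vy : value ym x (yminus l x) by rewrite ym_eq; apply/hym/sm; clear; lia.
  have s10 : small M10 x by apply: sm; clear; lia.
  have [a ca va] := Cm x _ s10 vy; exists a => //.
  have tv : value (Tser l * wm) x (T x * Wm x) by apply/hTm/sm; clear; lia.
  by rewrite T1 in tv; rewrite sqm -(value_unique tv ca) div1r mulrCA mulVf // mulr1.
Qed.

End Germs.

(** * The polynomial identity and the theorem *)

Lemma fraction_identity l : l \in levels ->
  (pol_c l ^+ 2 - pol_d l ^+ 2 * pol_g l)%:F / (4 * 'X^(l - 1))%:F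
     = ((pol_a l ^+ 2 - pol_b l ^+ 2 * pol_g l)%:F / (l%:R ^+ 2)%:F) ^+ 3
  /\ ((pol_a l ^+ 2 - pol_b l ^+ 2 * pol_g l)%:F / (l%:R ^+ 2)%:F) ^+ 3
     = (pol_K l)%:F ^+ 3 :> {fraction {poly rat}}.
Proof.
move=> hl; have l0 : (0 < l)%N by move: l hl; apply: levelsP.
have c4 : (4%:R : {poly rat}) != 0 by rewrite -polyC_natr polyC_eq0 pnatr_eq0.
have cl : (l%:R ^+ 2 : {poly rat}) != 0.
  by rewrite -natrX -polyC_natr polyC_eq0 pnatr_eq0 -lt0n expn_gt0 l0.
have cd : pol_c l ^+ 2 - pol_d l ^+ 2 * pol_g l = 4%:R * 'X^(l - 1) * pol_K l ^+ 3.
  by rewrite pol_cE // pol_dE // pol_gE // pol_KE // !zpolyE subn1; exact: cd_zev.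
have ab : pol_a l ^+ 2 - pol_b l ^+ 2 * pol_g l = l%:R ^+ 2 * pol_K l.
  apply: (mulfI c4); rewrite mulrA pol_KE // pol_gE // !zpolyE -(ab_zev 'X hl) -!zpolyE -pol_aE // -pol_bE //.
  have z (p : {poly rat}) : 2%:R *: p = 2%:R * p by rewrite scaler_nat mulr_natl.
  by rewrite !z; move: (pol_a l) (pol_b l) (zpoly (lg l)) => a b g; ring.
have -> : (pol_c l ^+ 2 - pol_d l ^+ 2 * pol_g l)%:F / (4 * 'X^(l - 1))%:F = (pol_K l)%:F ^+ 3.
  rewrite cd tofracM mulrAC divff ?mul1r ?tofracXn //.
  by rewrite tofrac_eq0 mulf_neq0 // -size_poly_eq0 size_polyXn.
have -> : (pol_a l ^+ 2 - pol_b l ^+ 2 * pol_g l)%:F / (l%:R ^+ 2)%:F = (pol_K l)%:F.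
  by rewrite ab tofracM mulrAC divff ?mul1r // tofrac_eq0.
by [].
Qed.

Theorem theorem7p1 (R : realType) (l : nat)
    (hl : l \in [:: 2; 3; 5; 7; 11; 13; 23]%N) :
  [/\ (fun x : R[i] => yplus l x - x ^+ l) =O_ (0 : R[i])
        (fun x : R[i] => x ^+ l.+1),
      (fun x : R[i] => yminus l x - x) =O_ (0 : R[i])
        (fun x : R[i] => x ^+ 2),
      \forall x \near (0 : R[i]),
        [/\ cvgn (Fpart l x), cvgn (Fpart 1 (yplus l x)),
            cvgn (Fpart 1 (yminus l x)),
            F l x = l%:R / sqrtc (ab_plus l x) * F 1 (yplus l x) &
            F l x = 1 / sqrtc (ab_minus l x) * F 1 (yminus l x)] &
      ((pol_c l ^+ 2 - pol_d l ^+ 2 * pol_g l)%:F / (4 * 'X^(l - 1))%:F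
         = ((pol_a l ^+ 2 - pol_b l ^+ 2 * pol_g l)%:F / (l%:R ^+ 2)%:F) ^+ 3
       /\ ((pol_a l ^+ 2 - pol_b l ^+ 2 * pol_g l)%:F / (l%:R ^+ 2)%:F) ^+ 3
         = (pol_K l)%:F ^+ 3 :> {fraction {poly rat}})].
Proof.
have [B [M h]] := local_transformation R hl.
have B0 : (0 : R[i]) < B.+1%:R by rewrite ltr0n.
have BB : (B%:R : R[i]) <= B.+1%:R by rewrite ler_nat.
split; last exact: fraction_identity.
- apply/eqO_exP; exists B.+1%:R => //; apply: (near_small (M := M)) => x /h[+ _ _].
  by move/le_trans; apply; rewrite ler_wpM2r.
- apply/eqO_exP; exists B.+1%:R => //; apply: (near_small (M := M)) => x /h[_ + _].
  by move/le_trans; apply; rewrite ler_wpM2r.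
- apply: (near_small (M := M)) => x /h[_ _ [t [/F_value[c1 ->] [a /F_value[c2 ->] e1] [b /F_value[c3 ->] e2]]]].
  by split.
Qed.
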